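(* Let $0<s<1/2$ and let $\{t_n\}_{n=1}^\infty$ be a decreasing sequence of real numbers with $\lim_{n\to\infty}t_n=0$ such that the sequence $\{t_n-t_{n+1}\}_{n=1}^\infty$ is also decreasing. Then the following four statements are equivalent. (a) The sequence $\{t_n\}$ belongs to $\ell^{\rho(s),\infty}(\mathbb{N})$, where $\rho(s)=\frac{2s}{1-2s}$. (b) There is a constant $C_1$ such that for all $f\in H^s(\mathbb{R})$ we have $$\Big\|\sup_{n\in\mathbb{N}}|S^1f(\cdot,t_n)|\Big\|_{L^2(\mathbb{R})}\le C_1\|f\|_{H^s}.$$ (c) There is a constant $C_2$ such that for all $f\in H^s(\mathbb{R})$, for all (measurable) sets $B\subset\mathbb{R}$ of diameter at most $1$, and for all $\alpha>0$, $$\mathrm{meas}\big(\{x\in B:\sup_{n\in\mathbb{N}}|S^1f(x,t_n)|>\alpha\}\big)\le C_2\,\alpha^{-2}\|f\|_{H^s}^2.$$ (d) For every $f\in H^s(\mathbb{R})$ we have $\lim_{n\to\infty}S^1f(x,t_n)=f(x)$ for almost every $x\in\mathbb{R}$.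
   Context: ''Decreasing'' means nonincreasing. $\mathrm{meas}$ is Lebesgue measure on $\mathbb{R}$. The Fourier transform is $\widehat f(\xi)=\int_{\mathbb{R}}f(x)e^{-ix\xi}\,dx$. The Sobolev space $H^s=H^s(\mathbb{R})$ consists of all distributions $f$ with $\|f\|_{H^s}:=\big(\int(1+|\xi|^2)^s|\widehat f(\xi)|^2\,d\xi\big)^{1/2}<\infty$. Define $$S^1f(x,t)=\int_{\mathbb{R}}e^{i(x\xi+t|\xi|)}\widehat f(\xi)\,\frac{d\xi}{2\pi}$$ for Schwartz functions $f$; for fixed $t$ the operator $f\mapsto S^1f(\cdot,t)$ extends to all $f\in H^s$ (as the Fourier multiplier operator with multiplier $e^{it|\xi|}$). For $0<r<\infty$, $\{t_n\}\in\ell^{r,\infty}(\mathbb{N})$ means $\sup_{b>0}b^r\,\#\{n\in\mathbb{N}:|t_n|>b\}<\infty$. *)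

(* Defs.v *)
From HB Require Import structures.
From mathcomp Require Import all_boot all_order all_algebra.
From mathcomp Require Import complex.
From mathcomp Require Import all_classical all_reals all_analysis.

Set Implicit Arguments.
Unset Strict Implicit.
Unset Printing Implicit Defensive.

Import Order.TTheory GRing.Theory Num.Theory.
Import numFieldNormedType.Exports.

Local Open Scope classical_set_scope.
Local Open Scope ring_scope.

Definition cexpi (R : realType) (a : R) : R[i] := (cos a +i* sin a)%C.

Definition cintegral (R : realType) (D : set R) (F : R -> R[i]) : R[i] :=
  (Rintegral lebesgue_measure D (fun x => complex.Re (F x)) +i*
   Rintegral lebesgue_measure D (fun x => complex.Im (F x)))%C.

Definition L2norm_sq (R : realType) (f : R -> R[i]) : \bar R :=
  (\int[lebesgue_measure]_x (Normc.normc (f x) ^+ 2)%:E)%E.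

Definition L2 (R : realType) : set (R -> R[i]) := [set f |
  [/\ measurable_fun setT (fun x => complex.Re (f x)),
      measurable_fun setT (fun x => complex.Im (f x)) &
      (L2norm_sq f < +oo)%E]].

(* The limit in L2 of the integrals over [-N, N] as N tends to infinity: an
   improper integral of the kernel [k x y] in [y], with convergence in mean
   with respect to [x]. It is only determined up to null sets; [xget] picks a
   representative (and 0 if there is no limit). *)
Definition L2integral (R : realType) (k : R -> R -> R[i]) : R -> R[i] :=
  xget (fun=> 0) [set g | L2 g /\
    L2norm_sq (fun x => cintegral `[- N%:R, N%:R] (k x) - g x)
      @[N --> \oo] --> 0%E].

(* By Plancherel's theorem the L2-limit exists for every [f] in L2, and it
   agrees a.e. with the absolutely convergent integral when [f] is also
   integrable. *)
Definition fourier (R : realType) (f : R -> R[i]) : R -> R[i] :=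
  L2integral (fun xi x => f x * cexpi (- (x * xi))).

Definition Hnorm (R : realType) (s : R) (f : R -> R[i]) : \bar R :=
  ((\int[lebesgue_measure]_xi
      ((1 + `|xi| ^+ 2) `^ s * Normc.normc (fourier f xi) ^+ 2)%:E) `^ 2^-1)%E.

(* For [0 <= s] the distributions with finite [Hnorm] are functions in L2. *)
Definition Hs (R : realType) (s : R) : set (R -> R[i]) :=
  [set f | L2 f /\ (Hnorm s f < +oo)%E].

(* The multiplier operator: multiplication of the Fourier transform by
   [exp (i t |xi|)], followed by the inverse Fourier transform on L2. For
   Schwartz [f] the integral converges absolutely. *)
Definition S1 (R : realType) (f : R -> R[i]) (t : R) : R -> R[i] :=
  L2integral (fun x xi =>
    cexpi (x * xi + t * `|xi|) * fourier f xi / ((2 * pi)%:C)%C).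

Definition maximalS1 (R : realType) (t : nat -> R) (f : R -> R[i]) (x : R)
    : \bar R :=
  ereal_sup (range (fun n => (Normc.normc (S1 f (t n) x))%:E)).

Definition weak_ell (R : realType) (r : R) (t : nat -> R) : Prop :=
  (ereal_sup [set (b `^ r)%:E * counting [set n | (b < `|t n|)%R]
     | b in [set b : R | (0 < b)%R]] < +oo)%E.

(* Main.v *)
(* (a) => (b). Put e_n = (n+1)^(-1/(2s)); the weak-type hypothesis gives
   0 <= t_n <= D e_n^(1-2s). Damping the multiplier of S^1 f(., t_n) by
   exp(-e_n |xi|) leaves remainders whose squared L2 norms are summable in n,
   because sum_n (1 - exp(-e_n |xi|))^2 <= 4 |xi|^(2s). The damped part is a sum of
   functions V(x) = \int h(xi) cas((x + tau) xi) exp(-e |xi|) dxi with |tau| <= D e^(1-2s);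
   choosing n as a function of x, one bounds V in L2 by duality, expanding
   (1 + |xi|^2)^(-s) in the functions exp(-2^(-k) |xi|), which produces quadratic
   forms in Poisson kernels of variable width.

   (b) => (c) is Chebyshev's inequality and (c) => (d) the approximation of f by
   band-limited functions.

   (d) => (a). Let d = t_N - t_(N+1). By convexity of t the intervals [-t_n, -t_n + d[
   with n < N are disjoint, so O(1/(N d)) translates of their union E cover half of
   [0, 1]. Let A be the union of the intervals of length d at the same translation
   points. The squared H^s norm of its indicator is O(1/(N d^(2s))), and x + t_n is in A
   for some n < N whenever x is in one of the translates of E. If N d^(2s) were
   unbounded, a maximum F of multiples of such indicators would be in H^s; as
   Re S^1 F(x, t) = (F(x + t) + F(x - t)) / 2, S^1 F(x, t_n) would be unbounded in n on a
   set of positive measure. Hence N (t_N - t_(N+1))^(2s) = O(1), and summing over dyadic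
   blocks gives t_N = O(N^(-(1-2s)/(2s))). *)

Require Import Defs.
From HB Require Import structures.
From mathcomp Require Import all_boot all_order all_algebra.
From mathcomp Require Import complex.
From mathcomp Require Import all_classical all_reals all_analysis.
From mathcomp Require Import measurable_realfun ring lra.

Set Implicit Arguments.
Unset Strict Implicit.
Unset Printing Implicit Defensive.

Import Order.TTheory GRing.Theory Num.Theory.
Import numFieldNormedType.Exports.

Local Open Scope classical_set_scope.
Local Open Scope ring_scope.

(** * Square-integrable real functions *)

(** Both exponents come from one balance. With e_n = (n+1)^(-1/(2s)) one has (e_n |xi|)^(2s) =
    |xi|^(2s) / (n+1), which makes the remainders square-summable, while e_n^(1-2s) =
    (n+1)^(-1/rho(s)) is the decay of t_n that (a) provides. On the damped side a translation by r
    costs the sum over k of 4^(-sk) r / (2^(-k) + e), of order r e^(2s-1): bounded in e when r =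
    O(e^(1-2s)). Exponential damping, rather than a sharp cut-off, makes all kernels positive
    Poisson kernels, and an unknown shift is absorbed by a wider kernel. In (d) => (a), joining
    indicators by maxima instead of sums keeps energies additive without cross terms, so that one
    explicit F does the work of a uniform boundedness principle. Since [fourier] and [S1] are fixed
    only up to null sets, facts are stated for the relations [is_hart] and [is_ft] (L2 convergence
    of truncated integrals) and transferred to the chosen representatives. The L2 theory is built on
    the real Hartley kernel, so that Fubini, positivity and adjointness concern real functions
    only. *)

Ltac mfun := repeat first
  [ assumption
  | match goal with
    | h : measurable_fun [set: _] ?f |- measurable_fun _ (fun x => ?f _) => apply: (measurableT_comp h)
    end
  | exact: measurable_fst | exact: measurable_snd | exact: measurable_cst | exact: measurable_id
  | apply: measurable_funX | apply: measurable_funD | apply: measurable_funB | apply: measurable_funN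
  | match goal with
    | |- measurable_fun _ (fun x => cos _) => apply: (measurableT_comp (continuous_measurable_fun (@continuous_cos _)))
    | |- measurable_fun _ (fun x => sin _) => apply: (measurableT_comp (continuous_measurable_fun (@continuous_sin _)))
    | |- measurable_fun _ (fun x => expR _) => apply: (measurableT_comp (@measurable_expR _))
    | |- measurable_fun _ (fun x => `| _ |) => apply: (measurableT_comp (@normr_measurable _ _))
    | |- measurable_fun _ (fun x => powR _ _) => apply: (measurableT_comp (@measurable_powR _ _))
    end
  | apply: measurable_funM
  | exact: (continuous_measurable_fun (@continuous_cos _)) | exact: (continuous_measurable_fun (@continuous_sin _))
  | exact: measurable_expR | exact: normr_measurable ].

Section lebesgue_filter.
Context {R : realType}.

Lemma ae_filter_lebesgue : Filter (almost_everywhere (@lebesgue_measure R)).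
Proof. exact: (@ae_filter_ringOfSetsType _ (measurableTypeR R)). Qed.

End lebesgue_filter.

#[global] Hint Extern 0 (Filter (almost_everywhere (@lebesgue_measure _))) =>
  (exact: ae_filter_lebesgue) : typeclass_instances.
#[global] Hint Extern 0 (Filter (nbhs (almost_everywhere (@lebesgue_measure _)))) =>
  (exact: ae_filter_lebesgue) : typeclass_instances.

Section basics.
Context {R : realType}.
Notation mu := (@lebesgue_measure R).
Notation mf := (measurable_fun setT).
Implicit Types f g h : R -> R.

Definition L1 f := mu.-integrable setT (EFin \o f).

Lemma emf f : mf f -> measurable_fun setT (fun x => (f x)%:E).
Proof. by move=> /measurable_EFinP. Qed.

Lemma le_int f g : mf f -> mf g -> (forall x, 0 <= f x) ->
  (forall x, f x <= g x) -> (\int[mu]_x (f x)%:E <= \int[mu]_x (g x)%:E)%E.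
Proof.
move=> mf_ mg f0 fg; apply: ge0_le_integral => //=; try exact: emf.
- by move=> x _; rewrite lee_fin.
- by move=> x _; rewrite lee_fin.
Qed.

Lemma intD f g : mf f -> mf g -> (forall x, 0 <= f x) -> (forall x, 0 <= g x) ->
  (\int[mu]_x (f x + g x)%:E = \int[mu]_x (f x)%:E + \int[mu]_x (g x)%:E)%E.
Proof.
move=> mf_ mg f0 g0; rewrite -ge0_integralD//=; try exact: emf.
- by move=> x _; rewrite lee_fin.
- by move=> x _; rewrite lee_fin.
Qed.

Lemma intZ (k : R) f : mf f -> (forall x, 0 <= f x) -> 0 <= k ->
  (\int[mu]_x (k * f x)%:E = k%:E * \int[mu]_x (f x)%:E)%E.
Proof.
move=> mf_ f0 k0; rewrite -ge0_integralZl//=; first exact: emf.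
by move=> x _; rewrite lee_fin.
Qed.

Lemma int_ge0 f : (forall x, 0 <= f x) -> (0 <= \int[mu]_x (f x)%:E)%E.
Proof. by move=> f0; apply: integral_ge0 => x _; rewrite lee_fin. Qed.

Lemma eq_int_ae f g : mf f -> mf g -> {ae mu, forall x, f x = g x} ->
  (\int[mu]_x (f x)%:E = \int[mu]_x (g x)%:E)%E.
Proof.
move=> mf_ mg fg; apply: ae_eq_integral => //=; try exact: emf.
by apply: filterS fg => x -> _.
Qed.

Lemma L1_mf f : L1 f -> mf f.
Proof. by move=> /measurable_int /measurable_EFinP. Qed.

Lemma L1P f : L1 f <-> mf f /\ (\int[mu]_x `|f x|%:E < +oo)%E.
Proof.
split=> [|[m1 m2]].
  by move=> /integrableP[/measurable_EFinP m1 m2]; split => //; move: m2; under eq_integral do rewrite /= .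
by apply/integrableP; split => //=; exact: emf.
Qed.

Lemma le_L1 f g : mf f -> L1 g -> (forall x, `|f x| <= g x) -> L1 f.
Proof.
move=> mf_ ig fg; apply: le_integrable ig => //=; first exact: emf.
by move=> x _; rewrite lee_fin (le_trans (fg x)) ?ler_norm.
Qed.

Lemma L1D f g : L1 f -> L1 g -> L1 (fun x => f x + g x).
Proof. by move=> h1 h2; have := integrableD measurableT h1 h2. Qed.

Lemma L1B f g : L1 f -> L1 g -> L1 (fun x => f x - g x).
Proof. by move=> h1 h2; have := integrableB measurableT h1 h2. Qed.

Lemma L1Z k f : L1 f -> L1 (fun x => k * f x).
Proof. by move=> h1; have := integrableZl measurableT k h1. Qed.

Lemma L1_norm f : L1 f -> L1 (fun x => `|f x|).
Proof. by move=> h1; have := integrable_abse h1. Qed.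

Lemma L1_bdd f g (k : R) : L1 f -> mf g -> (forall x, `|g x| <= k) -> L1 (fun x => f x * g x).
Proof.
move=> h1 mg gk; have k0 : 0 <= k by apply: le_trans (gk 0).
apply: (@le_L1 _ (fun x => k * `|f x|)).
- by have := L1_mf h1 => ?; mfun.
- by apply: L1Z; exact: L1_norm.
- by move=> x; rewrite normrM mulrC ler_wpM2r.
Qed.

Lemma L1_int f : L1 f -> (\int[mu]_x (f x)%:E)%E = (\int[mu]_x f x)%:E.
Proof. by move=> h; rewrite fineK//; apply: integrable_fin_num. Qed.

Lemma RintC f (k : R) : L1 f -> \int[mu]_x (f x * k) = (\int[mu]_x f x) * k.
Proof. by move=> h; rewrite RintegralZr. Qed.

Lemma eq_Rint_ae f g : mf f -> mf g -> {ae mu, forall x, f x = g x} ->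
  \int[mu]_x f x = \int[mu]_x g x.
Proof. by move=> m1 m2 h; congr fine; exact: eq_int_ae. Qed.

Definition n2 f : \bar R := (\int[mu]_x ((f x) ^+ 2)%:E)%E.
Definition L2r f := mf f /\ (n2 f < +oo)%E.

Lemma n2_ge0 f : (0 <= n2 f)%E.
Proof. by apply: int_ge0 => x; rewrite sqr_ge0. Qed.

Lemma le_n2 f g : mf f -> mf g -> (forall x, `|f x| <= `|g x|) -> (n2 f <= n2 g)%E.
Proof.
move=> m1 m2 fg; apply: le_int; [by mfun|by mfun| |].
- by move=> x; rewrite sqr_ge0.
- by move=> x; rewrite -[leLHS]real_normK ?num_real// -[leRHS]real_normK ?num_real// lerXn2r ?nnegrE.
Qed.

Lemma eq_n2_ae f g : mf f -> mf g -> {ae mu, forall x, f x = g x} -> n2 f = n2 g.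
Proof.
by move=> m1 m2 fg; apply: eq_int_ae; [by mfun|by mfun|];apply: filterS fg => x ->.
Qed.

Lemma n2Z k f : mf f -> n2 (fun x => k * f x) = ((k ^+ 2)%:E * n2 f)%E.
Proof.
move=> m1; rewrite /n2 -intZ ?sqr_ge0//; [|by mfun|by move=> x; rewrite sqr_ge0].
by under eq_integral do rewrite exprMn.
Qed.

(** Young's inequality 2fg <= d f^2 + d^-1 g^2. A small [d] lets a bound pass to an L2 limit without
    losing a constant factor ([n2_le_approx]); [d = 1] gives the crude [n2D]. *)
Lemma n2D_delta (d : R) f g : 0 < d -> mf f -> mf g ->
  (n2 (fun x => f x + g x)%R <= (1 + d)%:E * n2 f + (1 + d^-1)%:E * n2 g)%E.
Proof.
move=> d0 m1 m2; have di : 0 < d^-1 by rewrite invr_gt0.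
have d1 : 0 <= 1 + d by lra.
have d2 : 0 <= 1 + d^-1 by lra.
rewrite /n2 -!intZ//; try (by mfun); try (by move=> x; rewrite sqr_ge0).
rewrite -intD//; try (by mfun); try (by move=> x; rewrite mulr_ge0 ?sqr_ge0//).
apply: le_int; try (by mfun); first by move=> x; rewrite sqr_ge0.
move=> x; have : 0 <= d * (f x - d^-1 * g x) ^+ 2 by rewrite mulr_ge0 ?sqr_ge0 ?ltW.
have dd : d * d^-1 = 1 by rewrite divff ?gt_eqF.
have -> : d * (f x - d^-1 * g x) ^+ 2 = d * f x ^+ 2 - 2 * (d * d^-1) * f x * g x + (d * d^-1) * d^-1 * g x ^+ 2 by ring.
rewrite dd; nra.
Qed.

Lemma n2D f g : mf f -> mf g -> (n2 (fun x => f x + g x)%R <= 2%:E * n2 f + 2%:E * n2 g)%E.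
Proof.
move=> m1 m2; have := @n2D_delta 1 f g ltr01 m1 m2.
by rewrite invr1 -[(1+1)%R]/2%:R.
Qed.

Lemma n2N f : n2 (fun x => - f x) = n2 f.
Proof. by rewrite /n2; under eq_integral do rewrite sqrrN. Qed.

Lemma n2B f g : mf f -> mf g -> (n2 (fun x => f x - g x)%R <= 2%:E * n2 f + 2%:E * n2 g)%E.
Proof. by move=> m1 m2; rewrite -(n2N g); apply: n2D => //; mfun. Qed.

Lemma n2BC f g : n2 (fun x => f x - g x) = n2 (fun x => g x - f x).
Proof. by rewrite -n2N; congr n2; apply/funext => x; rewrite opprB. Qed.

Lemma L2rD f g : L2r f -> L2r g -> L2r (fun x => f x + g x).
Proof.
move=> [m1 h1] [m2 h2]; split; first by mfun.
apply: le_lt_trans (n2D m1 m2) _.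
by rewrite lte_add_pinfty// lte_mul_pinfty.
Qed.

Lemma L2rZ k f : L2r f -> L2r (fun x => k * f x).
Proof.
move=> [m1 h1]; split; first by mfun.
by rewrite n2Z// lte_mul_pinfty ?lee_fin ?sqr_ge0.
Qed.

Lemma L2rB f g : L2r f -> L2r g -> L2r (fun x => f x - g x).
Proof.
move=> h1 h2; have := L2rD h1 (L2rZ (-1) h2).
by under eq_fun do rewrite mulN1r.
Qed.

Lemma le_L2r f g : mf f -> L2r g -> (forall x, `|f x| <= `|g x|) -> L2r f.
Proof. by move=> m1 [m2 h2] fg; split => //; apply: le_lt_trans h2; exact: le_n2. Qed.

Lemma L2r_sq f : L2r f -> L1 (fun x => f x ^+ 2).
Proof.
move=> [m1 h]; apply/L1P; split; first by mfun.
by under eq_integral do rewrite ger0_norm ?sqr_ge0//.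
Qed.

Lemma L2rM f g : L2r f -> L2r g -> L1 (fun x => f x * g x).
Proof.
move=> h1 h2; apply: (@le_L1 _ (fun x => f x ^+ 2 + g x ^+ 2)).
- by case: h1 h2 => m1 _ [m2 _]; mfun.
- by apply: L1D; exact: L2r_sq.
- move=> x; rewrite ler_norml; apply/andP; split; nra.
Qed.

Lemma n2_fin f : L2r f -> n2 f = (\int[mu]_x (f x ^+ 2))%:E.
Proof. by move=> h; rewrite -L1_int//; exact: L2r_sq. Qed.

Lemma n2_eq0 f : mf f -> n2 f = 0%E -> {ae mu, forall x, f x = 0}.
Proof.
move=> m1 h.
have : ae_eq mu setT (fun x => (f x ^+ 2)%:E) (cst 0%E).
  apply/ae_eq_integral_abs => //; first by apply: emf; mfun.
  by rewrite -h; apply: eq_integral => x _; rewrite gee0_abs// lee_fin sqr_ge0.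
by apply: filterS => x /(_ I) /= [] /eqP; rewrite sqrf_eq0 => /eqP.
Qed.

Lemma n2_le_approx (c : R) g : mf g -> 
  (forall e : R, 0 < e -> exists f, [/\ mf f, (n2 f <= c%:E)%E & (n2 (fun x => f x - g x)%R <= e%:E)%E]) ->
  (n2 g <= c%:E)%E.
Proof.
move=> mg H; apply/lee_addgt0Pr => e e0.
have c0 : 0 <= c by have [f [_ + _]] := H _ ltr01; rewrite -lee_fin; apply: le_trans; exact: n2_ge0.
(* As d <= 1, the loss (1 + d) c + (1 + d^-1) d^2 - c = d c + d^2 + d is at most d (c + 2) <= e. *)
pose d := Num.min 1 (e / (c + 2)); have d0 : 0 < d by rewrite lt_min ltr01 divr_gt0//; lra.
have [f [m1 h1 h2]] := H (d ^+ 2) (exprn_gt0 _ d0).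
have -> : n2 g = n2 (fun x => f x + (g x - f x)) by congr n2; apply/funext => x; ring.
rewrite n2BC in h2.
apply: le_trans (n2D_delta d0 m1 _) _; first by mfun.
have d1 : d <= 1 by rewrite ge_min lexx.
have d2 : d * (c + 2) <= e by rewrite -ler_pdivlMr ?ge_min ?lexx ?orbT//; lra.
apply: (@le_trans _ _ ((1 + d)%:E * c%:E + (1 + d^-1)%:E * (d ^+ 2)%:E)%E).
  by apply: leeD; apply: lee_wpmul2l => //; rewrite lee_fin; have := invr_gt0 d; lra.
rewrite -!EFinM -!EFinD lee_fin.
have -> : (1 + d^-1) * d ^+ 2 = d ^+ 2 + d * (d / d) by ring.
rewrite divff ?gt_eqF//; nra.
Qed.

End basics.

(** * Fatou's lemma and completeness of L2 *)

Section complete.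
Context {R : realType}.
Notation mu := (@lebesgue_measure R).
Notation mf := (measurable_fun setT).
Implicit Types f g h : R -> R.

Lemma n2_fatou f (F : nat -> R -> R) : mf f -> (forall n, mf (F n)) ->
  {ae mu, forall x, F n x @[n --> \oo] --> f x} ->
  (n2 f <= limn_einf (fun n => n2 (F n)))%E.
Proof.
move=> m1 m2 FF.
apply: (@le_trans _ _ (\int[mu]_x limn_einf (fun n => ((F n x) ^+ 2)%:E))%E); last first.
  apply: (@fatou _ _ _ mu setT measurableT (fun n x => ((F n x) ^+ 2)%:E)).
    by move=> n; apply: emf; have := m2 n => ?; mfun.
  by move=> n x _; rewrite lee_fin sqr_ge0.
have mE : measurable_fun setT (fun x => limn_einf (fun n => ((F n x) ^+ 2)%:E)).
  rewrite (_ : (fun x => _) = (fun x => - limn_esup (fun n => - ((F n x) ^+ 2)%:E))%E); last first.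
    apply/funext => x; rewrite -limn_einfN; congr limn_einf; apply/funext => n /=.
    by rewrite opprK.
  apply: measurableT_comp => //; apply: (@measurable_fun_limn_esup _ _ _ setT (fun n x => (- ((F n x) ^+ 2)%:E)%E)) => n.
  by apply: measurableT_comp => //; apply: emf; have := m2 n => ?; mfun.
apply: ae_ge0_le_integral => //.
- by move=> x _; rewrite lee_fin sqr_ge0.
- by apply: emf; mfun.
- move=> x _; rewrite limn_einf_lim; apply: lime_ge; first exact: is_cvg_einfs.
  by apply: nearW => n; apply: le_ereal_inf_tmp => _ [k _ <-]; rewrite lee_fin sqr_ge0.
- apply: filterS FF => x Fx _.
  have : (((F n x) ^+ 2)%:E @[n --> \oo] --> (f x ^+ 2)%:E).
    by apply: cvg_EFin; [exact: nearW|apply: (cvgM Fx Fx)].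
  by move=> /cvg_limn_einf_sup[-> _].
Qed.

Lemma n2_fatou_le f (F : nat -> R -> R) (c : \bar R) : mf f -> (forall n, mf (F n)) ->
  {ae mu, forall x, F n x @[n --> \oo] --> f x} ->
  (\forall n \near \oo, n2 (F n) <= c)%E ->
  (n2 f <= c)%E.
Proof.
move=> m1 m2 h [N _ hN]; apply: (le_trans (n2_fatou m1 m2 h)).
rewrite limn_einf_lim; apply: lime_le; first exact: is_cvg_einfs.
near=> n; apply: (@le_trans _ _ (n2 (F (maxn n N)))); last by apply: hN; rewrite /= leq_maxr.
by apply: ereal_inf_lbound; exists (maxn n N) => //=; rewrite leq_maxl.
Unshelve. all: by end_near. Qed.

Lemma cvg_geo_bound (u : nat -> R) (K : R) : 
  (forall k, `|u k.+1 - u k| <= K * 2 ^- k) -> cvgn u.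
Proof.
move=> h.
have K0 : 0 <= K by apply: le_trans (normr_ge0 _) _; last by have := h 0%N; rewrite expr0 invr1 mulr1; exact.
have : cvgn (series (telescope u)).
  apply: normed_cvg; apply: (@series_le_cvg _ _ (geometric K (2^-1))) => //.
  - by move=> n /=; exact: normr_ge0.
  - by move=> n; rewrite /= mulr_ge0 ?exprn_ge0 ?invr_ge0.
  - by move=> n; rewrite /= exprVn; exact: h.
  - by apply: is_cvg_geometric_series; rewrite ger0_norm//; lra.
rewrite telescopeK => /cvg_ex[l hl]; apply/cvg_ex; exists (l + u 0%N).
apply: cvg_trans (cvgD hl (cvg_cst (u 0%N))).
by apply: near_eq_cvg; apply: nearW => n /=; rewrite subrK.
Qed.

(** Riesz-Fischer: a rapidly convergent subsequence converges almost everywhere, and Fatou's lemma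
    turns the pointwise limit into an L2 limit of the whole sequence. *)
Lemma L2_complete (F : nat -> R -> R) : (forall n, mf (F n)) ->
  (forall e : R, 0 < e -> exists N : nat, forall n m, (N <= n)%N -> (N <= m)%N ->
     (n2 (fun x => F n x - F m x)%R <= e%:E)%E) ->
  exists g, mf g /\ n2 (fun x => F n x - g x) @[n --> \oo] --> 0%E.
Proof.
move=> mF CF.
have /choice[N hN] : forall k : nat, exists N : nat, forall n m, (N <= n)%N -> (N <= m)%N ->
     (n2 (fun x => F n x - F m x)%R <= (8 ^- k)%:E)%E.
  by move=> k; apply: CF; rewrite invr_gt0 exprn_gt0.
(* [M] dominates [N] and is increasing by construction, whatever the chosen values [N k]. *)
pose M k := (\sum_(i < k.+1) (N i).+1)%N.
have NM k : (N k <= M k)%N by rewrite /M big_ord_recr /= (leq_trans (leqnSn _))// leq_addl.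
have MS k : (M k <= M k.+1)%N by rewrite /M [in leqRHS]big_ord_recr /= leq_addr.
have Mge k j : (k <= j)%N -> (N k <= M j)%N.
  move=> /subnKC <-; elim: (j - k)%N => [|i ih]; first by rewrite addn0.
  by rewrite addnS (leq_trans ih).
have kM k : (k <= M k)%N by rewrite /M (@leq_trans (\sum_(i < k.+1) 1)%N) ?leq_sum// sum1_card card_ord leqnSn.
pose G k := F (M k).
have mG k : mf (G k) by exact: mF.
(* The weight 4^k against differences of squared norm at most 8^-k leaves a convergent series. Where
   its sum S is finite, the increments of [G] are at most sqrt(S) 2^-k. *)
pose D k x := (4 ^+ k * (G k.+1 x - G k x) ^+ 2)%:E.
have D0 k x : (0 <= D k x)%E by rewrite lee_fin mulr_ge0 ?sqr_ge0 ?exprn_ge0.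
have mD k : measurable_fun setT (D k) by apply: emf; have := mG k => ?; have := mG k.+1 => ?; mfun.
have intDk : (\int[mu]_x (\sum_(0 <= k <oo) D k x) < +oo)%E.
  rewrite integral_nneseries//.
  apply: (@le_lt_trans _ _ (\sum_(0 <= k <oo) ((2^-1) ^+ k)%:E)%E); last first.
    rewrite (_ : (\sum_(0 <= k <oo) _)%E = (1 / (1 - 2^-1) : R)%:E) ?ltry//.
    apply/cvg_lim => //.
    rewrite (_ : (fun n => _) = (EFin \o series (geometric 1 (2^-1 : R)))); last first.
      by apply/funext => n /=; rewrite sumEFin; congr EFin; apply: eq_bigr => i _; rewrite /= mul1r.
    apply: cvg_EFin; first exact: nearW.
    by apply: cvg_geometric_series; rewrite ger0_norm//; lra.
  apply: lee_nneseries => k _; first by move=> _; apply: integral_ge0.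
  rewrite intZ ?exprn_ge0//; last 2 first.
  - by have := mG k => ?; have := mG k.+1 => ?; mfun.
  - by move=> x; rewrite sqr_ge0.
  apply: (@le_trans _ _ ((4 ^+ k)%:E * (8 ^- k)%:E)%E).
    apply: lee_wpmul2l; first by rewrite lee_fin exprn_ge0.
    by apply: hN; exact: Mge.
  rewrite -EFinM lee_fin -exprVn -exprMn.
  by rewrite (_ : 4 * 8^-1 = 2^-1 :> R)//; lra.
have aeS : {ae mu, forall x, (\sum_(0 <= k <oo) D k x)%E \is a fin_num}.
  have : mu.-integrable setT (fun x => \sum_(0 <= k <oo) D k x)%E.
    apply/integrableP; split.
    by apply: (@ge0_emeasurable_sum _ _ _ setT D xpredT) => // k _; exact: mD.
    under eq_integral do rewrite gee0_abs ?nneseries_ge0//.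
    by [].
  by move=> /(integrable_ae measurableT); apply: filterS => x; exact.
have aeC : {ae mu, forall x, cvgn (G ^~ x)}.
  apply: filterS aeS => x Sx.
  pose S := fine (\sum_(0 <= k <oo) D k x)%E.
  have DS k : 4 ^+ k * (G k.+1 x - G k x) ^+ 2 <= S.
    rewrite -lee_fin fineK//; apply: (@le_trans _ _ (\sum_(0 <= i < k.+1) D i x)%E).
      by rewrite big_nat_recr//= leeDr// sume_ge0.
    by apply: nneseries_lim_ge => *; exact: D0.
  have S0 : 0 <= S by apply: le_trans (DS 0%N); rewrite mulr_ge0 ?sqr_ge0 ?exprn_ge0.
  apply: (@cvg_geo_bound _ (Num.sqrt S)) => k.
  rewrite ler_pdivlMr ?exprn_gt0// -(ler_pXn2r (n := 2))// ?nnegrE ?mulr_ge0 ?sqrtr_ge0 ?exprn_ge0//.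
  rewrite sqr_sqrtr// exprMn real_normK ?num_real// -exprM mulnC exprM mulrC.
  by rewrite (_ : 2 ^+ 2 = 4 :> R)//; lra.
(* The upper limit gives a measurable function on the whole line that agrees with the limit wherever
   there is one. *)
pose g x := fine (limn_esup (fun k => (G k x)%:E)).
have mg : mf g.
  apply: (measurableT_comp (fine_measurable measurableT)).
  by apply: (@measurable_fun_limn_esup _ _ _ setT (fun k x => (G k x)%:E)) => k; exact: emf.
have aeg : {ae mu, forall x, G k x @[k --> \oo] --> g x}.
  apply: filterS aeC => x /cvg_ex[l hl].
  suff -> : g x = l by [].
  have : (G k x)%:E @[k --> \oo] --> l%:E by apply: cvg_EFin; [exact: nearW|].
  by rewrite /g => /cvg_limn_einf_sup[_ ->].
exists g; split => //.
apply/fine_cvgP; split.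
  exists (N 0%N) => // n hn; rewrite ge0_fin_numE ?n2_ge0//.
  apply: (@le_lt_trans _ _ (8 ^- 0)%:E); last exact: ltry.
  apply: (@n2_fatou_le _ (fun k x => F n x - G k x)).
  - by have := mF n => ?; mfun.
  - by move=> k; have := mF n => ?; have := mG k => ?; mfun.
  - by apply: filterS aeg => x Gx; apply: cvgB => //; exact: cvg_cst.
  - by apply: nearW => k; apply: hN => //; apply: Mge.
apply/cvgrPdist_le => e e0.
have [N0 hN0] := CF e e0.
near=> n; rewrite sub0r normrN ger0_norm ?fine_ge0 ?n2_ge0//.
have : (n2 (fun x => F n x - g x)%R <= e%:E)%E.
  apply: (@n2_fatou_le _ (fun k x => F n x - G k x)).
  - by have := mF n => ?; mfun.
  - by move=> k; have := mF n => ?; have := mG k => ?; mfun.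
  - by apply: filterS aeg => x Gx; apply: cvgB => //; exact: cvg_cst.
  - exists N0 => // k /= hk; apply: hN0; last by apply: leq_trans hk (kM k).
    by near: n; exact: nbhs_infty_ge.
by move=> h; rewrite -lee_fin fineK// ge0_fin_numE ?n2_ge0// (le_lt_trans h) ?ltry.
Unshelve. all: by end_near. Qed.

End complete.

(** * Invariance of Lebesgue measure and Poisson kernels *)

Section invariance.
Context {R : realType}.
Notation mu := (@lebesgue_measure R).
Notation mf := (measurable_fun setT).
Implicit Types f g h : R -> R.

Lemma lebesgue_measure_shift (c : R) (A : set R) : measurable A ->
  mu ((fun x => x + c) @^-1` A) = mu A.
Proof.
move=> mA; have mphi : measurable_fun setT ((fun x => x + c) : R -> measurableTypeR R) by mfun.
have -> : mu ((fun x => x + c) @^-1` A) = pushforward mu ((fun x => x + c) : R -> measurableTypeR R) A by [].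
apply/esym/(@lebesgue_measure_unique _ (pushforward mu ((fun x => x + c) : R -> measurableTypeR R))) => //= _ [[a b]] _ <-.
rewrite /pushforward.
have -> : (fun x => x + c) @^-1` `]a, b]%classic = `]a - c, b - c]%classic.
  by apply/seteqP; split => x /=; rewrite !in_itv/= ltrBlDr lerBrDr.
rewrite !lebesgue_measure_itv/= !lte_fin ltrD2r.
by case: ifP => // _; rewrite -!EFinD; congr EFin; ring.
Qed.

Definition leb_preserving (phi : R -> R) := mf phi /\
  forall A, measurable A -> mu (phi @^-1` A) = mu A.

Lemma leb_preserving_opp : leb_preserving -%R.
Proof. by split=> [|A mA]; [exact: oppr_measurable|exact: lebesgue_measureN]. Qed.

Lemma leb_preserving_shift c : leb_preserving (fun x => x + c).
Proof. by split=> [|A mA]; [mfun|exact: lebesgue_measure_shift]. Qed.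

Lemma leb_preserving_reflect c : leb_preserving (fun x => c - x).
Proof.
split=> [|A mA]; first by mfun.
rewrite -(lebesgue_measure_shift c mA) -[RHS](leb_preserving_opp.2); last first.
  by rewrite -[X in measurable X]setTI; apply: (leb_preserving_shift c).1.
by congr (mu _); apply/seteqP; split => x /=; rewrite addrC.
Qed.

Lemma int_leb_preserving phi f : leb_preserving phi -> mf f -> (forall x, 0 <= f x) ->
  (\int[mu]_x (f (phi x))%:E = \int[mu]_x (f x)%:E)%E.
Proof.
move=> [mphi hphi] m1 f0.
have := @ge0_integral_pushforward _ _ (measurableTypeR R) (measurableTypeR R) R phi mphi mu setT (fun x => (f x)%:E) measurableT (emf m1).
rewrite preimage_setT => <-; last by move=> x _; rewrite lee_fin.
by apply: eq_measure_integral => A mA _; exact: hphi.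
Qed.

Lemma L1_leb_preserving phi f : leb_preserving phi -> L1 f -> L1 (fun x => f (phi x)).
Proof.
move=> hp h1; have m1 := L1_mf h1; apply/L1P; split.
  by have := hp.1 => ?; mfun.
rewrite (@int_leb_preserving _ (fun x => `|f x|))//; last by mfun.
by case/L1P : h1.
Qed.

Lemma Rint_leb_preserving phi f : leb_preserving phi -> L1 f ->
  \int[mu]_x f (phi x) = \int[mu]_x f x.
Proof.
move=> hp h1; congr fine; have m1 := L1_mf h1; move: (hp) => [mphi hphi].
have := @integral_pushforward _ _ (measurableTypeR R) (measurableTypeR R) R phi mphi mu setT (fun x => (f x)%:E) (emf m1).
rewrite preimage_setT => <-//; last exact: L1_leb_preserving.
apply: eq_measure_integral => A mA _. exact: hphi.
Qed.

Lemma n2_leb_preserving phi f : leb_preserving phi -> mf f -> n2 (fun x => f (phi x)) = n2 f.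
Proof.
move=> hp m1; apply: (@int_leb_preserving _ (fun x => f x ^+ 2)) => //; first by mfun.
by move=> x; rewrite sqr_ge0.
Qed.

Lemma L2r_leb_preserving phi f : leb_preserving phi -> L2r f -> L2r (fun x => f (phi x)).
Proof.
move=> hp [m1 h]; split; last by rewrite n2_leb_preserving.
by have := hp.1 => ?; mfun.
Qed.

Lemma ae_leb_preserving phi (P : R -> Prop) : leb_preserving phi ->
  {ae mu, forall x, P x} -> {ae mu, forall x, P (phi x)}.
Proof.
move=> hp [A [mA A0 PA]]; exists (phi @^-1` A); split.
- by rewrite -[X in measurable X]setTI; exact: hp.1.
- by rewrite -A0; exact: hp.2.
- by move=> x /= h; apply: PA.
Qed.

Lemma Rint_odd f : L1 f -> (forall x, f (- x) = - f x) -> \int[mu]_x f x = 0.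
Proof.
move=> h1 odd; have := Rint_leb_preserving leb_preserving_opp h1.
under eq_Rintegral do rewrite odd -mulN1r.
by rewrite RintegralZl// mulN1r; lra.
Qed.

End invariance.

(** * The Poisson kernel as transform of the two-sided exponential *)

Section poisson.
Context {R : realType}.
Notation mu := (@lebesgue_measure R).
Notation mf := (measurable_fun setT).

Definition dexp (b x : R) : R := expR (- (b * `|x|)).
(** The Fourier transform of [dexp b], hence of total mass [2 * pi] and not 1. Widths add when the
    exponentials are multiplied. *)
Definition poisson (b u : R) : R := 2 * b / (b ^+ 2 + u ^+ 2).

Lemma dexp_ge0 b x : 0 <= dexp b x. Proof. exact: expR_ge0. Qed.

Lemma dexp_le1 b x : 0 <= b -> dexp b x <= 1.
Proof. by move=> b0; rewrite /dexp -expR0 ler_expR oppr_le0 mulr_ge0. Qed.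

Lemma dexpD b c x : dexp b x * dexp c x = dexp (b + c) x.
Proof. by rewrite /dexp -expRD; congr expR; ring. Qed.

Lemma measurable_dexp b : mf (dexp b).
Proof. by rewrite /dexp; mfun. Qed.

Lemma continuous_dexp b : continuous (dexp b).
Proof.
move=> x; apply: (@continuous_comp _ _ _ (fun x => - (b * `|x|)) expR); last exact: continuous_expR.
by apply: continuousN; apply: continuousM; [exact: cvg_cst|exact: norm_continuous].
Qed.

Lemma poisson_ge0 b u : 0 <= b -> 0 <= poisson b u.
Proof. by move=> b0; rewrite divr_ge0 ?mulr_ge0 ?addr_ge0 ?sqr_ge0. Qed.

Lemma cvg_dexp (b : R) : 0 < b -> expR (- (b * x)) @[x --> +oo] --> (0 : R).
Proof.
move=> b0; apply: (@cvg_comp _ _ _ (fun x => b * x) (fun x => expR (- x))); last exact: cvgr_expR.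
by apply: gt0_cvgMry => //; exact: cvg_id.
Qed.

Lemma int_dexp (b : R) : 0 < b -> (\int[mu]_x (dexp b x)%:E)%E = (2 / b)%:E.
Proof.
move=> b0; rewrite ge0_symfun_integralT; last 3 first.
- exact: dexp_ge0.
- exact: continuous_dexp.
- by move=> x /=; rewrite /dexp normrN.
rewrite (_ : [set x | 0 <= x] = `[0, +oo[%classic); last by rewrite set_itvcy.
have -> : (\int[mu]_(x in `[0%R, +oo[) (dexp b x)%:E = \int[mu]_(x in `[0%R, +oo[) (expR (- (b * x)))%:E)%E.
  by apply: eq_integral => x; rewrite inE/= in_itv/= andbT => x0; rewrite /dexp ger0_norm.
rewrite (@ge0_continuous_FTC2y _ _ (fun x => - b^-1 * expR (- (b * x))) 0 0).
- by rewrite mulr0 oppr0 expR0 mulr1 -EFinB -EFinM; congr EFin; rewrite sub0r opprK.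
- by move=> x _; exact: expR_ge0.
- apply: continuous_subspaceT => x; apply: (@continuous_comp _ _ _ (fun x => - (b * x)) expR); last exact: continuous_expR.
  by apply: continuousN; apply: continuousM; [exact: cvg_cst|exact: cvg_id].
- by rewrite -(mulr0 (- b^-1)); apply: cvgMr; exact: cvg_dexp.
- by move=> x _; exact: ex_derive.
- apply: cvg_at_right_filter.
  have cF : {for 0, continuous (fun x : R => - b^-1 * expR (- (b * x)))}.
    by apply: differentiable_continuous; apply/derivable1_diffP; exact: ex_derive.
  exact: cF.
- move=> x _; rewrite derive1E.
  have h : is_derive x 1 (fun x : R => - b^-1 * expR (- (b * x))) (expR (- (b * x))).
    by apply: is_derive_eq; rewrite /GRing.scale /=; field; rewrite gt_eqF.
  exact: derive_val.
Qed.

Lemma L1_dexp (b : R) : 0 < b -> L1 (dexp b).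
Proof.
move=> b0; apply/L1P; split; first exact: measurable_dexp.
by under eq_integral do rewrite ger0_norm ?dexp_ge0//; rewrite int_dexp// ltry.
Qed.

Lemma L1_cos_dexp (b u : R) : 0 < b -> L1 (fun x => cos (u * x) * dexp b x).
Proof.
move=> b0; apply: le_L1 (L1_dexp b0) _.
  by have := @measurable_dexp b => ?; mfun.
by move=> x; rewrite normrM (ger0_norm (dexp_ge0 _ _)) ler_piMl ?dexp_ge0// ler_norml cos_geN1 cos_le1.
Qed.

Lemma int_cos_dexp (b u : R) : 0 < b -> \int[mu]_x (cos (u * x) * dexp b x) = poisson b u.
Proof.
move=> b0.
(* Adding 1 to the cosine makes the integrand nonnegative, as the fundamental theorem on a half-line
   asks; the integral of the added exponential is [int_dexp]. *)
suff : (\int[mu]_x ((1 + cos (u * x)) * dexp b x)%:E)%E = (2 / b + poisson b u)%:E.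
  rewrite L1_int; last first.
    under eq_fun do rewrite mulrDl mul1r.
    by apply: L1D; [exact: L1_dexp|exact: L1_cos_dexp].
  move=> [].
  have -> : \int[mu]_x ((1 + cos (u * x)) * dexp b x) = \int[mu]_x (dexp b x + cos (u * x) * dexp b x).
    by apply: eq_Rintegral => x _; rewrite mulrDl mul1r.
  rewrite RintegralD//; [|exact: L1_dexp|exact: L1_cos_dexp].
  rewrite {1}/Rintegral int_dexp//= => /addrI ->//.
have cf : continuous (fun x => (1 + cos (u * x)) * dexp b x).
  move=> x; apply: cvgM; last exact: continuous_dexp.
  have c1 : {for x, continuous (fun x => 1 + cos (u * x))}.
    by apply: differentiable_continuous; apply/derivable1_diffP; exact: ex_derive.
  exact: c1.
rewrite ge0_symfun_integralT//; last 2 first.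
- by move=> x; rewrite mulr_ge0 ?dexp_ge0// -lerBlDl sub0r cos_geN1.
- by move=> x /=; rewrite /dexp normrN mulrN cosN.
rewrite (_ : [set x | 0 <= x] = `[0, +oo[%classic); last by rewrite set_itvcy.
pose f x := (1 + cos (u * x)) * expR (- (b * x)).
have -> : (\int[mu]_(x in `[0%R, +oo[) ((1 + cos (u * x)) * dexp b x)%:E = \int[mu]_(x in `[0%R, +oo[) (f x)%:E)%E.
  by apply: eq_integral => x; rewrite inE/= in_itv/= andbT => x0; rewrite /dexp ger0_norm.
have c0 : 0 < b ^+ 2 + u ^+ 2 by rewrite ltr_wpDr ?sqr_ge0 ?exprn_gt0.
pose c := (b ^+ 2 + u ^+ 2)^-1.
have cp : 0 < c by rewrite invr_gt0.
pose F x := (- b^-1 + c * (u * sin (u * x) - b * cos (u * x))) * expR (- (b * x)).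
rewrite (@ge0_continuous_FTC2y _ _ F 0 0).
- rewrite /F !mulr0 oppr0 expR0 mulr1 sin0 cos0 -EFinB -EFinM; congr EFin.
  by rewrite /poisson -/c; ring.
- by move=> x _; rewrite mulr_ge0 ?expR_ge0// -lerBlDl sub0r cos_geN1.
- apply: continuous_subspaceT => x; apply: differentiable_continuous; apply/derivable1_diffP; exact: ex_derive.
- pose K := b^-1 + c * (`|u| + b).
  apply/norm_cvg0P. apply: (@squeeze_cvgr _ _ _ _ (cst 0) (fun x => K * expR (- (b * x)))).
  + apply: nearW => x; rewrite normr_ge0/= normrM (ger0_norm (expR_ge0 _)) ler_wpM2r ?expR_ge0//.
    rewrite (le_trans (ler_normD _ _))// lerD//; first by rewrite normrN ger0_norm// invr_ge0 ltW.
    rewrite normrM (gtr0_norm cp) ler_wpM2l ?(ltW cp)//.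
    rewrite (le_trans (ler_normB _ _))// lerD//.
      by rewrite normrM ler_piMr// ler_norml sin_geN1 sin_le1.
    by rewrite normrM (gtr0_norm b0) ler_piMr ?(ltW b0)// ler_norml cos_geN1 cos_le1.
  + exact: cvg_cst.
  + by rewrite -(mulr0 K); apply: cvgMr; exact: cvg_dexp.
- by move=> x _; exact: ex_derive.
- apply: cvg_at_right_filter.
  have cF : {for 0, continuous F}.
    by apply: differentiable_continuous; apply/derivable1_diffP; exact: ex_derive.
  exact: cF.
- move=> x _; rewrite derive1E.
  have h : is_derive x 1 F (f x).
    apply: is_derive_eq; rewrite /GRing.scale /= /f /c; field.
    by rewrite !gt_eqF.
  exact: derive_val.
Qed.

Lemma derive_atan_div (b z x : R) : 0 < b ->
  is_derive x 1 (fun x => 2 * atan ((x - z) / b)) (poisson b (x - z)).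
Proof.
move=> b0; apply: is_derive_eq; rewrite /GRing.scale /= /poisson; field.
by rewrite (gt_eqF b0) gt_eqF// ltr_wpDr ?sqr_ge0 ?exprn_gt0.
Qed.

Lemma continuous_poisson (b z : R) : 0 < b -> continuous (fun x => poisson b (x - z)).
Proof.
move=> b0 x; apply: differentiable_continuous; apply/derivable1_diffP.
have h : b ^+ 2 + (x - z) ^+ 2 != 0 by rewrite gt_eqF// ltr_wpDr ?sqr_ge0 ?exprn_gt0.
by apply: derivableM => //; apply: derivableV.
Qed.

Lemma measurable_poisson (b : R) : 0 < b -> mf (poisson b).
Proof.
move=> b0; have := @continuous_measurable_fun _ _ (@continuous_poisson b 0 b0).
by under eq_fun do rewrite subr0.
Qed.

Lemma int_poisson (b : R) : 0 < b -> (\int[mu]_x (poisson b x)%:E)%E = (2 * pi)%:E.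
Proof.
move=> b0.
have c0 : continuous (poisson b).
  by have := @continuous_poisson b 0 b0; under eq_fun do rewrite subr0.
have hd (x : R) : is_derive x 1 (fun x => 2 * atan (x / b)) (poisson b x).
  by have := @derive_atan_div b 0 x b0; under eq_fun do rewrite subr0; rewrite subr0.
rewrite ge0_symfun_integralT//; last 2 first.
- by move=> x; apply: poisson_ge0; exact: ltW.
- by move=> x; rewrite /poisson /= sqrrN.
rewrite (_ : [set x | 0 <= x] = `[0, +oo[%classic); last by rewrite set_itvcy.
rewrite (@ge0_continuous_FTC2y _ _ (fun x => 2 * atan (x / b)) 0 pi).
- by rewrite mul0r atan0 mulr0 sube0 -EFinM.
- by move=> x _; apply: poisson_ge0; exact: ltW.
- exact: continuous_subspaceT.
- have -> : pi = 2 * (pi / 2) :> R by field.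
  apply: cvgMr; apply: (@cvg_comp _ _ _ (fun x => x / b) atan); last exact: cvgy_atan.
  by apply: gt0_cvgMly; [rewrite invr_gt0|exact: cvg_id].
- by move=> x _; exact: ex_derive.
- apply: cvg_at_right_filter.
  have cF : {for 0, continuous (fun x : R => 2 * atan (x / b))}.
    by apply: differentiable_continuous; apply/derivable1_diffP; exact: ex_derive.
  exact: cF.
- by move=> x _; rewrite derive1E; exact: derive_val.
Qed.

Lemma int_poisson_itv (b z a c : R) : 0 < b -> a < c ->
  (\int[mu]_(x in `[a, c]) (poisson b (x - z))%:E)%E =
  (2 * atan ((c - z) / b) - 2 * atan ((a - z) / b))%:E.
Proof.
move=> b0 ac.
have hd (x : R) := @derive_atan_div b z x b0.
rewrite (@continuous_FTC2 _ _ (fun x => 2 * atan ((x - z) / b)))//.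
- exact/continuous_subspaceT/continuous_poisson.
- have cF (x : R) : {for x, continuous (fun x : R => 2 * atan ((x - z) / b))}.
    by apply: differentiable_continuous; apply/derivable1_diffP; exact: ex_derive.
  split; [by move=> x _; exact: ex_derive|exact/cvg_at_right_filter/cF|exact/cvg_at_left_filter/cF].
- by move=> x _; rewrite derive1E; exact: derive_val.
Qed.

End poisson.

(** * Measurability and exchange of iterated real integrals *)

Section fubini_real.
Context {R : realType}.
Notation mu := (@lebesgue_measure R).
Notation mf := (measurable_fun setT).

(** Tonelli's theorem applies to the positive and the negative part separately; [fine] puts 0 where
    the difference is infinite. *)
Lemma measurable_Rint2 (F : R * R -> R) : mf F -> mf (fun x => \int[mu]_y F (x, y)).
Proof.
move=> mF; apply: (measurableT_comp (fine_measurable measurableT)).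
rewrite (_ : (fun x => _) = (fun x => (\int[mu]_y (maxe (F (x, y))%:E 0)) - (\int[mu]_y (maxe (- (F (x, y))%:E) 0)))%E); last first.
  by apply/funext => x; rewrite integralE; congr (_ - _)%E; apply: eq_integral => y _; rewrite ?funeposE ?funenegE.
apply: emeasurable_funB.
  apply: (@measurable_fun_fubini_tonelli_F _ _ _ _ _ mu (fun z => maxe (F z)%:E 0)%E) => //.
    by apply: measurable_maxe => //; exact/measurable_EFinP.
  by move=> z; rewrite le_max lexx orbT.
apply: (@measurable_fun_fubini_tonelli_F _ _ _ _ _ mu (fun z => maxe (- (F z)%:E) 0)%E) => //.
  by apply: measurable_maxe => //; apply: measurableT_comp => //; exact/measurable_EFinP.
by move=> z; rewrite le_max lexx orbT.
Qed.

Lemma measurable_tonelli (K : R * R -> R) : mf K -> (forall z, 0 <= K z) ->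
  mf (fun x => \int[mu]_y (K (x, y))%:E)%E.
Proof.
move=> mK K0; apply: (@measurable_fun_fubini_tonelli_F _ _ _ _ _ mu (fun z => (K z)%:E)%E) => //.
exact/measurable_EFinP.
Qed.

Lemma tonelli_swap (K : R * R -> R) : mf K -> (forall z, 0 <= K z) ->
  (\int[mu]_x \int[mu]_y (K (x, y))%:E = \int[mu]_y \int[mu]_x (K (x, y))%:E)%E.
Proof.
move=> mK K0; apply: (@fubini_tonelli _ _ _ _ _ mu mu (fun z => (K z)%:E)); last first.
  by move=> z; rewrite lee_fin.
exact/measurable_EFinP.
Qed.

Lemma Rfubini (F : R * R -> R) (a b : R -> R) : mf F -> L1 a -> L1 b ->
  (forall x y, `|F (x, y)| <= a x * b y) ->
  \int[mu]_x (\int[mu]_y F (x, y)) = \int[mu]_y (\int[mu]_x F (x, y)).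
Proof.
move=> mF ha hb hF.
have [ma mb] := (L1_mf ha, L1_mf hb).
have iF : (mu \x mu)%E.-integrable setT (EFin \o F).
  apply/integrable12ltyP; first exact/measurable_EFinP.
  apply: (@le_lt_trans _ _ (\int[mu]_x (`|a x| * \int[mu]_y `|b y|)%:E)%E).
    apply: ge0_le_integral => //.
    - by move=> x _; apply: integral_ge0.
    - apply: (@measurable_fun_fubini_tonelli_F _ _ _ _ _ mu (fun z => `|(F z)%:E|)%E) => //.
      by apply: measurableT_comp => //; exact/measurable_EFinP.
    - by apply: emf; mfun.
    - move=> x _; rewrite EFinM -(L1_int (L1_norm hb)) -intZ//; last by mfun.
      apply: le_int => //.
      + by apply: (measurableT_comp (@normr_measurable _ _)); apply: (measurableT_comp mF); exact: measurable_pair1.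
      + by mfun.
      + move=> y; rewrite -normrM (le_trans (hF _ _))// ler_norm//.
  have h : L1 (fun x => (\int[mu]_y `|b y|) * `|a x|) by apply: L1Z; exact: L1_norm.
  under eq_integral do rewrite mulrC.
  by rewrite L1_int// ltry.
have := Fubini iF => /(congr1 fine).
rewrite /Rintegral; congr (_ = _); congr fine.
  apply: eq_integral => x _ /=; rewrite fineK//.
  apply: integrable_fin_num => //.
  apply: (@le_L1 _ _ (fun y => a x * b y)) => //; last exact: L1Z.
  by apply: (measurableT_comp mF); exact: measurable_pair1.
apply: eq_integral => y _ /=; rewrite fineK//.
apply: integrable_fin_num => //.
apply: (@le_L1 _ _ (fun x => b y * a x)) => //; last by move=> x; rewrite mulrC.
  by apply: (measurableT_comp mF); exact: measurable_pair2.
exact: L1Z.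
Qed.

End fubini_real.

(** * The Hartley transform *)

Section hartley.
Context {R : realType}.
Notation mu := (@lebesgue_measure R).
Notation mf := (measurable_fun setT).
Implicit Types f g h : R -> R.

Lemma n2_cvg0 (F : nat -> R -> R) g : (forall n, mf (F n)) -> L2r g ->
  (forall n x, `|F n x| <= `|g x|) -> (forall x, F n x @[n --> \oo] --> (0 : R)) ->
  n2 (F n) @[n --> \oo] --> 0%E.
Proof.
move=> mF h2 Fg F0.
have /(_ _ _ _)[//|||||_ _] := @dominated_convergence _ _ _ mu setT measurableT
  (fun n x => (F n x ^+ 2)%:E) (cst 0%E) (fun x => (g x ^+ 2)%:E).
- by move=> n; apply: emf; have := mF n => ?; mfun.
- exact: measurable_cst.
- apply: aeW => x _; apply: cvg_EFin; first exact: nearW.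
  by rewrite -(mulr0 (0 : R)); apply: (cvgM (F0 x) (F0 x)).
- exact: L2r_sq.
- apply: aeW => x n _; rewrite /= lee_fin ger0_norm ?sqr_ge0//.
  by rewrite -[leLHS]real_normK ?num_real// -[leRHS]real_normK ?num_real// lerXn2r ?nnegrE.
- by rewrite integral0.
Qed.

Lemma poisson_le (b u : R) : 0 < b -> poisson b u <= 2 / b.
Proof.
move=> b0; have h : 0 < b ^+ 2 + u ^+ 2 by rewrite ltr_wpDr ?sqr_ge0 ?exprn_gt0.
rewrite /poisson ler_pdivrMr// mulrAC ler_pdivlMr// -mulrA -expr2 ler_wpM2l//.
by rewrite lerDl sqr_ge0.
Qed.

(* Hartley's kernel is real and symmetric, and the transform with kernel
   [cas (x * y)] is its own inverse up to the factor 2 pi. *)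
Definition cas (x : R) : R := cos x + sin x.

Lemma cas_bdd x : `|cas x| <= 2.
Proof.
rewrite (le_trans (ler_normD _ _))// (_ : 2 = 1 + 1 :> R)// lerD// ler_norml.
  by rewrite cos_geN1 cos_le1.
by rewrite sin_geN1 sin_le1.
Qed.

Lemma measurable_cas : mf cas. Proof. by rewrite /cas; mfun. Qed.

Definition hart1 h x := \int[mu]_y (h y * cas (x * y)).

Lemma L1_cas h x : L1 h -> L1 (fun y => h y * cas (x * y)).
Proof.
move=> h1; apply: (L1_bdd (k := 2)) => //; last by move=> y; exact: cas_bdd.
by have := measurable_cas => ?; mfun.
Qed.

Lemma measurable_hart1 h : mf h -> mf (hart1 h).
Proof.
move=> m1; apply: (@measurable_Rint2 _ (fun z => h z.2 * cas (z.1 * z.2))).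
by have := measurable_cas => ?; mfun.
Qed.

Lemma hart1_bdd h x : L1 h -> `|hart1 h x| <= 2 * \int[mu]_y `|h y|.
Proof.
move=> h1; apply: le_trans (le_normr_Rintegral _ (L1_cas x h1)) _ => //.
rewrite -RintegralZl//; last exact: L1_norm.
apply: le_Rintegral => //; [exact/L1_norm/L1_cas|exact/L1Z/L1_norm|].
by move=> y _; rewrite normrM mulrC ler_wpM2r// cas_bdd.
Qed.

Lemma hart1D f g : L1 f -> L1 g -> hart1 (fun x => f x + g x) = (fun x => hart1 f x + hart1 g x).
Proof.
move=> h1 h2; apply/funext => x; rewrite /hart1 -RintegralD//; try exact: L1_cas.
by apply: eq_Rintegral => y _; rewrite mulrDl.
Qed.

Lemma hart1Z k f : L1 f -> hart1 (fun x => k * f x) = (fun x => k * hart1 f x).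
Proof.
move=> h1; apply/funext => x; rewrite /hart1 -RintegralZl//; last exact: L1_cas.
by apply: eq_Rintegral => y _; rewrite mulrA.
Qed.

Lemma hart1B f g : L1 f -> L1 g -> hart1 (fun x => f x - g x) = (fun x => hart1 f x - hart1 g x).
Proof.
move=> h1 h2; have := hart1D h1 (L1Z (-1) h2); rewrite hart1Z//.
by under eq_fun do rewrite mulN1r; move=> ->; apply/funext => x; rewrite mulN1r.
Qed.

Lemma hart1_opp h : L1 h -> hart1 (fun x => h (- x)) = (fun x => hart1 h (- x)).
Proof.
move=> h1; apply/funext => x; rewrite /hart1.
rewrite -(Rint_leb_preserving leb_preserving_opp (L1_cas (- x) h1)).
by apply: eq_Rintegral => y _; rewrite mulrNN.
Qed.

Lemma hart1_adj f g : L1 f -> L1 g ->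
  \int[mu]_x (hart1 f x * g x) = \int[mu]_x (f x * hart1 g x).
Proof.
move=> h1 h2; have [m1 m2] := (L1_mf h1, L1_mf h2).
transitivity (\int[mu]_x \int[mu]_y (f y * cas (x * y) * g x)).
  by apply: eq_Rintegral => x _; rewrite RintegralZr//; exact: L1_cas.
rewrite (@Rfubini _ (fun z => f z.2 * cas (z.1 * z.2) * g z.1) (fun x => 2 * `|g x|) (fun x => `|f x|)).
- apply: eq_Rintegral => y _ /=; rewrite -RintegralZl//; last exact: L1_cas.
  by apply: eq_Rintegral => x _; rewrite [y * x]mulrC; ring.
- by have := measurable_cas => ?; mfun.
- exact/L1Z/L1_norm.
- exact/L1_norm.
- move=> x y /=; rewrite !normrM -mulrA.
  rewrite (_ : _ * (_ * _) = `|cas (x * y)| * (`|g x| * `|f y|)); last by ring.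
  by rewrite -mulrA ler_wpM2r ?mulr_ge0// cas_bdd.
Qed.

Lemma L1_cas_dexp (b y : R) : 0 < b -> L1 (fun x => dexp b x * cas (x * y)).
Proof.
by move=> b0; under eq_fun do rewrite [_ * y]mulrC; apply: L1_cas; exact: L1_dexp.
Qed.

(** cas(xy) cas(xz) = cos((y - z) x) + sin((y + z) x), and the sine term, being odd in x, integrates
    to 0. *)
Lemma hart1_cas_dexp (b y z : R) : 0 < b ->
  hart1 (fun x => dexp b x * cas (x * y)) z = poisson b (y - z).
Proof.
move=> b0; rewrite /hart1.
have ms : L1 (fun x => sin ((y + z) * x) * dexp b x).
  apply: le_L1 (L1_dexp b0) _; first by have := @measurable_dexp _ b => ?; mfun.
  by move=> x; rewrite normrM (ger0_norm (dexp_ge0 _ _)) ler_piMl ?dexp_ge0// ler_norml sin_geN1 sin_le1.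
transitivity (\int[mu]_x (cos ((y - z) * x) * dexp b x + sin ((y + z) * x) * dexp b x)).
  apply: eq_Rintegral => x _; rewrite /cas mulrBl mulrDl cosB sinD [x * y]mulrC; ring.
rewrite RintegralD//; last exact: L1_cos_dexp.
rewrite int_cos_dexp// [X in _ + X]Rint_odd ?addr0//.
by move=> x; rewrite mulrN sinN /dexp normrN mulNr.
Qed.

Lemma hart1_dexp_poisson (b : R) h y : 0 < b -> L1 h ->
  hart1 (fun x => hart1 h x * dexp b x) y = \int[mu]_z (h z * poisson b (y - z)).
Proof.
move=> b0 h1.
transitivity (\int[mu]_x (hart1 h x * (dexp b x * cas (x * y)))).
  by apply: eq_Rintegral => x _; rewrite mulrA [y * x]mulrC.
rewrite hart1_adj//; last exact: L1_cas_dexp.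
by apply: eq_Rintegral => z _; rewrite hart1_cas_dexp.
Qed.

Lemma L1_hart1_dexp (b : R) h : 0 < b -> L1 h -> L1 (fun x => hart1 h x * dexp b x).
Proof.
move=> b0 h1; under eq_fun do rewrite mulrC.
apply: (L1_bdd (L1_dexp b0) (measurable_hart1 (L1_mf h1))) => x; exact: hart1_bdd.
Qed.

(** By symmetry of the kernel the left-hand side is the pairing of h with its convolution by the
    Poisson kernel of width 2b. Schur's test, with h(x) h(z) <= (h(x)^2 + h(z)^2) / 2, then yields
    the mass 2 pi of the kernel as constant. *)
Lemma n2_hart1_dexp_le (b : R) h : 0 < b -> L1 h -> L2r h ->
  (n2 (fun x => hart1 h x * dexp b x)%R <= (2 * pi)%:E * n2 h)%E.
Proof.
move=> b0 h1 h2; have m1 := L1_mf h1.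
have b20 : 0 < b + b by lra.
have mh := measurable_hart1 m1.
have md := @measurable_dexp R.
have mp := @measurable_poisson R (b + b) b20.
have L1q : L1 (fun x => hart1 h x * (hart1 h x * dexp (b + b) x)).
  under eq_fun do rewrite mulrC.
  apply: (L1_bdd (L1_hart1_dexp b20 h1) mh) => x; exact: hart1_bdd.
rewrite /n2; under eq_integral do rewrite exprMn expr2 [dexp _ _ ^+ 2]expr2 dexpD -mulrA.
rewrite L1_int// hart1_adj//; last exact: L1_hart1_dexp.
set G := hart1 _.
have GE y : G y = \int[mu]_z (h z * poisson (b + b) (y - z)) by rewrite /G hart1_dexp_poisson.
have mG : mf G by apply: measurable_hart1; mfun.
have LG : L1 (fun x => h x * G x).
  apply: (@L1_bdd _ _ _ (2 * \int[mu]_y `|hart1 h y * dexp (b + b) y|)) => //.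
  by move=> x; apply: hart1_bdd; exact: L1_hart1_dexp.
rewrite -L1_int//.
apply: (@le_trans _ _ (\int[mu]_x (`|h x| * `|G x|)%:E)%E).
  rewrite !L1_int//; last by under eq_fun do rewrite -normrM; exact: L1_norm.
  rewrite lee_fin; apply: le_Rintegral => //.
    by have := L1_norm LG; under eq_fun do rewrite normrM.
  by move=> x _; rewrite -normrM ler_norm.
have Pi0 : 0 <= 2 * pi :> R by rewrite mulr_ge0// pi_ge0.
have P0 u : 0 <= poisson (b + b) u by apply: poisson_ge0; exact: ltW.
(* The two halves of this majorant are integrated in opposite orders, each contributing pi times the
   squared norm of h. *)
pose K (z : R * R) := 2^-1 * (h z.1 ^+ 2 * poisson (b + b) (z.1 - z.2) + h z.2 ^+ 2 * poisson (b + b) (z.1 - z.2)).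
have mK : mf K by rewrite /K; mfun.
have K0 z : 0 <= K z by rewrite mulr_ge0// addr_ge0// mulr_ge0 ?sqr_ge0.
apply: (@le_trans _ _ (\int[mu]_x \int[mu]_y (K (x, y))%:E)%E).
  apply: ge0_le_integral => //.
  - by apply: emf; mfun.
  - exact: measurable_tonelli.
  - move=> x _.
    have L1x : L1 (fun z => h z * poisson (b + b) (x - z)).
      apply: (@L1_bdd _ _ _ (2 / (b + b))) => //; first by mfun.
      by move=> z; rewrite ger0_norm// poisson_le.
    apply: (@le_trans _ _ (\int[mu]_z (`|h x| * `|h z * poisson (b + b) (x - z)|)%:E)%E).
      rewrite intZ//; last by mfun.
      rewrite L1_int; last exact: L1_norm.
      by rewrite -EFinM lee_fin ler_wpM2l// GE; apply: le_normr_Rintegral.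
    have mKx : mf (fun z => K (x, z)) by apply: (measurableT_comp mK); exact: measurable_pair1.
    apply: le_int => //; first by mfun.
    move=> z; rewrite normrM (ger0_norm (P0 _)) /K /=.
    set p := poisson _ _; have p0 : 0 <= p by exact: P0.
    clearbody p; rewrite (_ : `|h x| * _ = (`|h x| * `|h z|) * p); last exact: mulrA.
    rewrite (_ : 2^-1 * _ = (2^-1 * (h x ^+ 2 + h z ^+ 2)) * p); last by ring.
    rewrite ler_wpM2r//.
    rewrite -(real_normK (num_real (h x))) -(real_normK (num_real (h z))).
    by have : 0 <= (`|h x| - `|h z|) ^+ 2 by [exact: sqr_ge0]; lra.
pose K1 (z : R * R) := 2^-1 * (h z.1 ^+ 2 * poisson (b + b) (z.1 - z.2)).
pose K2 (z : R * R) := 2^-1 * (h z.2 ^+ 2 * poisson (b + b) (z.1 - z.2)).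
have mK1 : mf K1 by rewrite /K1; mfun.
have mK2 : mf K2 by rewrite /K2; mfun.
have K10 z : 0 <= K1 z by rewrite mulr_ge0// mulr_ge0 ?sqr_ge0.
have K20 z : 0 <= K2 z by rewrite mulr_ge0// mulr_ge0 ?sqr_ge0.
have intP x : (\int[mu]_y (poisson (b + b) (x - y))%:E = (2 * pi)%:E)%E.
  by rewrite (int_leb_preserving (leb_preserving_reflect x)) ?int_poisson.
have intP' x : (\int[mu]_y (poisson (b + b) (y - x))%:E = (2 * pi)%:E)%E.
  by rewrite (int_leb_preserving (leb_preserving_shift (- x))) ?int_poisson.
have half (u : R -> R) : mf u -> (forall x, 0 <= u x) -> (\int[mu]_y (u y)%:E = (2 * pi)%:E)%E ->
  forall c, 0 <= c -> (\int[mu]_y (2^-1 * (c * u y))%:E = (pi * c)%:E)%E.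
  move=> mu_ u0 intu c c0; under eq_integral do rewrite mulrA.
  by rewrite intZ ?mulr_ge0// intu -EFinM; congr EFin; field.
have e1 : (\int[mu]_x \int[mu]_y (K1 (x, y))%:E = pi%:E * n2 h)%E.
  rewrite -intZ ?pi_ge0//; [|by mfun|by move=> x; rewrite sqr_ge0].
  apply: eq_integral => x _; rewrite /K1 /= (half (fun y => poisson (b + b) (x - y))) ?sqr_ge0//.
  by mfun.
have e2 : (\int[mu]_x \int[mu]_y (K2 (x, y))%:E = pi%:E * n2 h)%E.
  rewrite (tonelli_swap mK2 K20).
  rewrite -intZ ?pi_ge0//; [|by mfun|by move=> x; rewrite sqr_ge0].
  apply: eq_integral => x _; rewrite /K2 /= (half (fun y => poisson (b + b) (y - x))) ?sqr_ge0//.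
  by mfun.
have -> : ((2 * pi)%:E * n2 h = pi%:E * n2 h + pi%:E * n2 h)%E.
  by rewrite -muleDl ?n2_fin//; congr (_ * _)%E; rewrite -EFinD; congr EFin; ring.
rewrite -{1}e1 -e2 -ge0_integralD//; last 4 first.
- by move=> x _; apply: integral_ge0 => y _; rewrite lee_fin.
- exact: measurable_tonelli.
- by move=> x _; apply: integral_ge0 => y _; rewrite lee_fin.
- exact: measurable_tonelli.
rewrite le_eqVlt; apply/orP; left; apply/eqP; apply: eq_integral => x _.
rewrite -intD//; last 2 first.
- by rewrite /K1 /=; mfun.
- by rewrite /K2 /=; mfun.
by apply: eq_integral => y _; rewrite /K /K1 /K2 mulrDr.
Qed.

(** The damping is removed by letting its rate 1 / (n+1) tend to 0, with Fatou's lemma. *)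
Lemma n2_hart1_le h : L1 h -> L2r h -> (n2 (hart1 h) <= (2 * pi)%:E * n2 h)%E.
Proof.
move=> h1 h2; have mh := measurable_hart1 (L1_mf h1).
apply: (@n2_fatou_le _ _ (fun n x => hart1 h x * dexp n.+1%:R^-1 x)) => //.
- by move=> n; have := @measurable_dexp R n.+1%:R^-1 => ?; mfun.
- apply: aeW => x; rewrite -[X in _ --> X]mulr1; apply: cvgMr.
  have e : dexp 0 x = 1 by rewrite /dexp mul0r oppr0 expR0.
  rewrite -[X in _ --> X]e.
  apply: (@cvg_comp _ _ _ (fun n => n.+1%:R^-1) (fun b => dexp b x)); first exact: cvg_harmonic.
  have cF : {for 0, continuous (fun b => dexp b x)}.
    by apply: differentiable_continuous; apply/derivable1_diffP; exact: ex_derive.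
  exact: cF.
- by apply: nearW => n; apply: n2_hart1_dexp_le.
Qed.

End hartley.

(** * L2 convergence, Cauchy-Schwarz and truncation *)

Section L2_convergence.
Context {R : realType}.
Notation mu := (@lebesgue_measure R).
Notation mf := (measurable_fun setT).
Implicit Types f g h : R -> R.

Lemma mf_sub f g : mf f -> mf g -> mf (fun x => f x - g x).
Proof. by move=> m1 m2; mfun. Qed.

Definition conv2 (F : nat -> R -> R) f := n2 (fun x => F n x - f x) @[n --> \oo] --> 0%E.

Lemma conv2P F f : conv2 F f <->
  forall e : R, 0 < e -> \forall n \near \oo, (n2 (fun x => F n x - f x)%R <= e%:E)%E.
Proof.
split=> [/fine_cvgP[h1 h2] e e0|h].
  have /cvgrPdist_le/(_ e e0) := h2.
  apply: filterS2 h1 => n h1.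
  rewrite sub0r normrN ger0_norm ?fine_ge0 ?n2_ge0// => h3.
  by rewrite -[leLHS]fineK.
apply/fine_cvgP; split.
  apply: filterS (h 1 ltr01) => n hn.
  by rewrite ge0_fin_numE ?n2_ge0// (le_lt_trans hn) ?ltry.
apply/cvgrPdist_le => e e0; apply: filterS (h e e0) => n hn.
rewrite sub0r normrN ger0_norm ?fine_ge0 ?n2_ge0// -lee_fin fineK//.
by rewrite ge0_fin_numE ?n2_ge0// (le_lt_trans hn) ?ltry.
Qed.

Lemma conv2_uniq F f g : (forall n, mf (F n)) -> mf f -> mf g ->
  conv2 F f -> conv2 F g -> {ae mu, forall x, f x = g x}.
Proof.
move=> mF m1 m2 /conv2P h1 /conv2P h2.
have : n2 (fun x => f x - g x) = 0%E.
  apply/eqP; rewrite eq_le n2_ge0 andbT; apply/lee_addgt0Pr => e e0; rewrite add0e.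
  have e4 : 0 < e / 4 by rewrite divr_gt0.
  have [n [n1 n2']] := filter_ex (filterI (h1 _ e4) (h2 _ e4)).
  have -> : n2 (fun x => f x - g x) = n2 (fun x => (F n x - g x) - (F n x - f x)).
    by congr n2; apply/funext => x; ring.
  apply: le_trans (n2B (mf_sub (mF n) m2) (mf_sub (mF n) m1)) _.
  apply: (@le_trans _ _ (2%:E * (e / 4)%:E + 2%:E * (e / 4)%:E)%E).
    by apply: leeD; apply: lee_wpmul2l.
  by rewrite -!EFinM -EFinD lee_fin; lra.
move=> /(n2_eq0 (mf_sub m1 m2)); apply: filterS => x /eqP.
by rewrite subr_eq0 => /eqP.
Qed.

Lemma conv2D F G f g : (forall n, mf (F n)) -> (forall n, mf (G n)) -> mf f -> mf g ->
  conv2 F f -> conv2 G g -> conv2 (fun n x => F n x + G n x) (fun x => f x + g x).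
Proof.
move=> mF mG m1 m2 /conv2P h1 /conv2P h2; apply/conv2P => e e0.
have e4 : 0 < e / 4 by rewrite divr_gt0.
apply: filterS2 (h1 _ e4) (h2 _ e4) => n k1 k2.
have -> : n2 (fun x => F n x + G n x - (f x + g x)) = n2 (fun x => (F n x - f x) + (G n x - g x)).
  by congr n2; apply/funext => x; ring.
apply: le_trans (n2D (mf_sub (mF n) m1) (mf_sub (mG n) m2)) _.
apply: (@le_trans _ _ (2%:E * (e / 4)%:E + 2%:E * (e / 4)%:E)%E).
  by apply: leeD; apply: lee_wpmul2l.
by rewrite -!EFinM -EFinD lee_fin; lra.
Qed.

Lemma conv2Z k F f : (forall n, mf (F n)) -> mf f ->
  conv2 F f -> conv2 (fun n x => k * F n x) (fun x => k * f x).
Proof.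
move=> mF m1 h1; rewrite /conv2.
have -> : (fun n => n2 (fun x => k * F n x - k * f x)) = (fun n => (k ^+ 2)%:E * n2 (fun x => (F n x - f x)%R))%E.
  apply/funext => n; rewrite -n2Z; last exact: mf_sub.
  by congr n2; apply/funext => x; rewrite mulrBr.
by rewrite -(mule0 (k ^+ 2)%:E); apply: cvgeZl.
Qed.

Lemma conv2_ae F f g : (forall n, mf (F n)) -> mf f -> mf g -> {ae mu, forall x, f x = g x} ->
  conv2 F f -> conv2 F g.
Proof.
move=> mF m1 m2 fg; rewrite /conv2; apply: cvg_trans.
apply: near_eq_cvg; apply: nearW => n; apply: eq_n2_ae; try exact: mf_sub.
by apply: filterS fg => x ->.
Qed.

Definition nr f := Num.sqrt (fine (n2 f)).

(** The squared norm of f - t g is a nonnegative quadratic in t, evaluated at its vertex t = B / C.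
    If C = 0 it is affine in t, which forces B = 0. *)
Lemma L2r_cs f g : L2r f -> L2r g -> `|\int[mu]_x (f x * g x)| <= nr f * nr g.
Proof.
move=> h1 h2.
pose A := fine (n2 f); pose B := \int[mu]_x (f x * g x); pose C := fine (n2 g).
have A0 : 0 <= A by apply: fine_ge0; exact: n2_ge0.
have C0 : 0 <= C by apply: fine_ge0; exact: n2_ge0.
have q (t : R) : 0 <= A - t * (2 * B) + t ^+ 2 * C.
  have -> : A - t * (2 * B) + t ^+ 2 * C = \int[mu]_x ((f x - t * g x) ^+ 2).
    rewrite /A /C !n2_fin//= /B.
    transitivity (\int[mu]_x (f x ^+ 2 - (t * (2 * (f x * g x))) + t ^+ 2 * g x ^+ 2)); last first.
      by apply: eq_Rintegral => x _; ring.
    have L1fg := L2rM h1 h2.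
    have l1 : L1 (fun x => t * (2 * (f x * g x))) by apply/L1Z/L1Z.
    have l2 : L1 (fun x => t ^+ 2 * g x ^+ 2) by apply/L1Z/L2r_sq.
    rewrite RintegralD//; last by apply: L1B => //; exact: L2r_sq.
    rewrite RintegralB//; last exact: L2r_sq.
    rewrite RintegralZl//; last exact: L1Z.
    by rewrite !RintegralZl//; exact: L2r_sq.
  by apply: Rintegral_ge0 => x _; rewrite sqr_ge0.
suff : B ^+ 2 <= A * C.
  rewrite /nr -/A -/C -/B -sqrtrM// => BAC.
  by rewrite -sqrtr_sqr ler_wsqrtr.
have [C00|Cn0] := eqVneq C 0.
  rewrite C00 mulr0; have [->|B0] := eqVneq B 0; first by rewrite expr0n.
  have := q ((A + 1) / (2 * B)); rewrite C00 mulr0 addr0.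
  have -> : (A + 1) / (2 * B) * (2 * B) = A + 1 by field.
  lra.
have Cp : 0 < C by rewrite lt_neqAle eq_sym Cn0.
have := q (B / C); have -> : A - B / C * (2 * B) + (B / C) ^+ 2 * C = A - B ^+ 2 / C by field.
by rewrite subr_ge0 ler_pdivrMr.
Qed.

Lemma conv2_nr F f : (forall n, mf (F n)) -> mf f -> conv2 F f -> nr (fun x => F n x - f x) @[n --> \oo] --> (0 : R).
Proof.
move=> mF m1 /fine_cvgP[_ h].
by have := cvg_comp _ _ h (@sqrt_continuous R 0); rewrite sqrtr0.
Qed.

(** FG - fg = (F - f)(G - g) + (F - f) g + f (G - g), and Cauchy-Schwarz makes the integral of each
    term tend to 0. *)
Lemma conv2_Rint F G f g : (forall n, L2r (F n)) -> (forall n, L2r (G n)) -> L2r f -> L2r g ->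
  conv2 F f -> conv2 G g ->
  \int[mu]_x (F n x * G n x) @[n --> \oo] --> \int[mu]_x (f x * g x).
Proof.
move=> lF lG lf lg h1 h2.
have n1 := conv2_nr (fun n => (lF n).1) lf.1 h1.
have n2' := conv2_nr (fun n => (lG n).1) lg.1 h2.
have E n : \int[mu]_x (F n x * G n x) = \int[mu]_x (f x * g x) + \int[mu]_x ((F n x - f x) * (G n x - g x))
   + \int[mu]_x ((F n x - f x) * g x) + \int[mu]_x (f x * (G n x - g x)).
  have d1 := L2rB (lF n) lf; have d2 := L2rB (lG n) lg.
  have e1 := L2rM d1 d2; have e2 := L2rM d1 lg; have e3 := L2rM lf d2; have e0 := L2rM lf lg.
  rewrite -!RintegralD//; try by do ?apply: L1D.
  by apply: eq_Rintegral => x _; ring.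
have Z (u v : nat -> R -> R) : (forall n, L2r (u n)) -> (forall n, L2r (v n)) ->
  nr (u n) * nr (v n) @[n --> \oo] --> (0 : R) -> \int[mu]_x (u n x * v n x) @[n --> \oo] --> (0 : R).
  move=> lu lv h; apply/norm_cvg0P; apply: (squeeze_cvgr _ (cvg_cst 0) h).
  by apply: nearW => n; rewrite normr_ge0 L2r_cs.
have -> : \int[mu]_x (f x * g x) = \int[mu]_x (f x * g x) + 0 + 0 + 0 by rewrite !addr0.
under eq_fun do rewrite E.
apply: cvgD; last first.
  apply: (Z (fun _ => f)) => //; first by move=> n; exact: L2rB.
  by rewrite -(mulr0 (nr f)); apply: cvgM => //; exact: cvg_cst.
apply: cvgD; last first.
  apply: (Z _ (fun _ => g)) => //; first by move=> n; exact: L2rB.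
  by rewrite -(mul0r (nr g)); apply: cvgM => //; exact: cvg_cst.
apply: cvgD; first exact: cvg_cst.
apply: Z; [by move=> n; exact: L2rB|by move=> n; exact: L2rB|].
by rewrite -(mul0r (0 : R)); apply: cvgM.
Qed.

Definition itvN (N : nat) : set R := `[- N%:R, N%:R]%classic.
(** The truncation built into [L2integral]. A truncated L2 function is integrable, so [hart1]
    applies to it. *)
Definition cut (N : nat) h x := h x * \1_(itvN N) x.

Lemma measurable_indic_itv (i : interval R) : mf (\1_[set` i] : R -> R).
Proof. exact: measurable_indic. Qed.

Lemma indic01 (A : set R) x : 0 <= (\1_A x : R) <= 1.
Proof. by rewrite indicE; case: (_ \in _); rewrite ?lexx ?ler01. Qed.

Lemma L2r_indic (A : set R) : measurable A -> (mu A < +oo)%E -> L2r (\1_A : R -> R).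
Proof.
move=> mA Aoo; split; first exact: measurable_indic.
rewrite /n2; under eq_integral do rewrite indicE -natrX.
rewrite (_ : (fun x => _) = (fun x => (\1_A x)%:E)); last first.
  by apply/funext => x; rewrite indicE; case: (_ \in _).
by rewrite integral_indic ?setIT.
Qed.

Lemma itvN_fin (a c : R) : (mu `[a, c]%classic < +oo)%E.
Proof. by rewrite lebesgue_measure_itv /=; case: ifP => _; rewrite ?ltry// -EFinD ltry. Qed.

Lemma norm_cut N h x : `|cut N h x| <= `|h x|.
Proof. by have /andP[a b] := indic01 (itvN N) x; rewrite /cut normrM (ger0_norm a) ler_piMr. Qed.

Lemma measurable_cut N h : mf h -> mf (cut N h).
Proof. by move=> m1; have := @measurable_indic_itv `[- N%:R, N%:R] => ?; rewrite /cut /itvN; mfun. Qed.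

Lemma L2r_cut N h : L2r h -> L2r (cut N h).
Proof. by move=> h2; apply: (le_L2r _ h2); [exact: measurable_cut h2.1|exact: norm_cut]. Qed.

Lemma L1_cut N h : L2r h -> L1 (cut N h).
Proof. move=> h2; apply: L2rM => //; apply: L2r_indic; first exact: measurable_itv.
by apply: itvN_fin. Qed.

Lemma cut_eq h x : \forall N \near \oo, cut N h x = h x.
Proof.
near=> N; rewrite /cut indicE mem_set ?mulr1// /itvN /= in_itv /= -ler_norml.
by near: N; exact: nbhs_infty_ger.
Unshelve. all: by end_near. Qed.

Lemma conv2_cut h : L2r h -> conv2 (fun N => cut N h) h.
Proof.
move=> h2; apply: (@n2_cvg0 _ _ (fun x => 2 * h x)).
- by move=> N; apply: mf_sub; [exact: measurable_cut h2.1|exact: h2.1].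
- exact: L2rZ.
- move=> N x; rewrite (le_trans (ler_normB _ _))// [leRHS]normrM (ger0_norm (ler0n _ 2)).
  by have := norm_cut N h x; lra.
- move=> x; apply: cvg_near_cst; apply: filterS (cut_eq h x) => N ->.
  by rewrite subrr.
Qed.

Lemma cutZ N k h : cut N (fun x => k * h x) = (fun x => k * cut N h x).
Proof. by apply/funext => x; rewrite /cut mulrA. Qed.

Lemma cutD N f g : cut N (fun x => f x + g x) = (fun x => cut N f x + cut N g x).
Proof. by apply/funext => x; rewrite /cut mulrDl. Qed.

Lemma cut_opp N h : cut N (fun x => h (- x)) = (fun x => cut N h (- x)).
Proof.
apply/funext => x; rewrite /cut !indicE; congr (_ * (_ : bool)%:R).
by apply/idP/idP => /set_mem; rewrite /itvN /= in_itv /= => /andP[a b]; apply/mem_set; rewrite /= in_itv /=; apply/andP; split; lra.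
Qed.

End L2_convergence.

(** * The Hartley transform on L2 and its inversion *)

Section hartley_L2.
Context {R : realType}.
Notation mu := (@lebesgue_measure R).
Notation mf := (measurable_fun setT).
Implicit Types f g h : R -> R.

Lemma poissonC (b x y : R) : poisson b (x - y) = poisson b (y - x).
Proof. by rewrite /poisson -[(x - y) ^+ 2]sqrrN opprB. Qed.

(** A relation, because the transform on L2 is determined only almost everywhere. The mode of
    convergence is the one in [L2integral]. *)
Definition is_hart h g := L2r g /\ conv2 (fun N => hart1 (cut N h)) g.

Lemma pi2_ge0 : 0 <= 2 * pi :> R. Proof. by rewrite mulr_ge0// pi_ge0. Qed.

Lemma measurable_hart1_cut h N : mf h -> mf (hart1 (cut N h)).
Proof. by move=> m1; apply: measurable_hart1; exact: measurable_cut. Qed.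

Lemma L2r_hart1 h : L1 h -> L2r h -> L2r (hart1 h).
Proof.
move=> h1 h2; split; first by apply: measurable_hart1; exact: L1_mf.
apply: le_lt_trans (n2_hart1_le h1 h2) _.
by rewrite n2_fin// -EFinM ltry.
Qed.

Lemma hart_cauchy h (e : R) : L2r h -> 0 < e -> exists N : nat, forall n m, (N <= n)%N -> (N <= m)%N ->
  (n2 (fun x => hart1 (cut n h) x - hart1 (cut m h) x)%R <= e%:E)%E.
Proof.
move=> h2 e0.
pose d := e / (8 * (pi + 1)).
have pi0 := pi_ge0 R.
have d0 : 0 < d by rewrite divr_gt0// mulr_gt0//; lra.
have /conv2P/(_ _ d0)[N _ hN] := conv2_cut h2.
exists N => n m Nn Nm.
have -> : (fun x => hart1 (cut n h) x - hart1 (cut m h) x) = hart1 (fun x => cut n h x - cut m h x).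
  by rewrite hart1B//; exact: L1_cut.
apply: le_trans (n2_hart1_le _ _) _.
- by apply: L1B; exact: L1_cut.
- by apply: L2rB; exact: L2r_cut.
apply: (@le_trans _ _ ((2 * pi)%:E * (4 * d)%:E)%E).
  apply: lee_wpmul2l; first by rewrite lee_fin pi2_ge0.
  have -> : n2 (fun x => cut n h x - cut m h x) = n2 (fun x => (cut n h x - h x) - (cut m h x - h x)).
    by congr n2; apply/funext => x; ring.
  apply: le_trans (n2B _ _) _; try by apply: mf_sub; [exact: measurable_cut h2.1|exact: h2.1].
  apply: (@le_trans _ _ (2%:E * d%:E + 2%:E * d%:E)%E).
    by apply: leeD; apply: lee_wpmul2l => //; exact: hN.
  by rewrite -!EFinM -EFinD lee_fin; lra.
rewrite -EFinM lee_fin /d (_ : 2 * pi * _ = e * (pi / (pi + 1))).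
  by rewrite ler_piMr ?(ltW e0)// ler_pdivrMr; lra.
by field; lra.
Qed.

Lemma hart_ex h : L2r h -> exists g, is_hart h g.
Proof.
move=> h2; have mH N : mf (hart1 (cut N h)) by exact: measurable_hart1_cut h2.1.
have [g [mg hg]] := L2_complete mH (fun e e0 => hart_cauchy h2 e0).
exists g; split => //; split => //.
have /conv2P/(_ 1 ltr01)[N _ /(_ N (leqnn _)) hN] := hg.
have [mHN lHN] : L2r (hart1 (cut N h)) by apply: L2r_hart1; [exact: L1_cut|exact: L2r_cut].
have -> : n2 g = n2 (fun x => hart1 (cut N h) x - (hart1 (cut N h) x - g x)).
  by congr n2; apply/funext => x; ring.
apply: le_lt_trans (n2B mHN (mf_sub mHN mg)) _.
by rewrite lte_add_pinfty// lte_mul_pinfty// (le_lt_trans hN)// ltry.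
Qed.

Lemma hart_uniq h g g' : mf h -> is_hart h g -> is_hart h g' -> {ae mu, forall x, g x = g' x}.
Proof.
move=> mh [[m1 _] h1] [[m2 _] h2]; apply: conv2_uniq h1 h2 => // N.
exact: measurable_hart1_cut.
Qed.

Lemma hart_aer h g g' : mf h -> is_hart h g -> mf g' -> {ae mu, forall x, g x = g' x} -> is_hart h g'.
Proof.
move=> mh [[m1 l1] h1] m2 e; split; first by split=> //; rewrite -(eq_n2_ae m1 m2 e).
by apply: conv2_ae e h1 => // N; exact: measurable_hart1_cut.
Qed.

Lemma hart_ael h h' g : mf h -> mf h' -> {ae mu, forall x, h x = h' x} -> is_hart h g -> is_hart h' g.
Proof.
move=> m1 m2 e [l c]; split; first exact: l.
suff <- : (fun N => hart1 (cut N h)) = (fun N => hart1 (cut N h')) by exact: c.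
apply/funext => N; apply/funext => x; apply: eq_Rint_ae.
- by have := measurable_cut N m1 => ?; have := @measurable_cas R => ?; mfun.
- by have := measurable_cut N m2 => ?; have := @measurable_cas R => ?; mfun.
- by apply: filterS e => y; rewrite /cut => ->.
Qed.

Lemma hartD f g f' g' : L2r f -> L2r g -> is_hart f f' -> is_hart g g' ->
  is_hart (fun x => f x + g x) (fun x => f' x + g' x).
Proof.
move=> lf lg [l1 c1] [l2 c2]; split; first exact: L2rD.
have := conv2D (fun N => measurable_hart1_cut N lf.1) (fun N => measurable_hart1_cut N lg.1) l1.1 l2.1 c1 c2.
rewrite (_ : (fun (n : nat) x => _) = (fun N => hart1 (cut N (fun x => f x + g x))))//.
by apply/funext => N; rewrite cutD hart1D//; exact: L1_cut.
Qed.

Lemma hartZ k f f' : L2r f -> is_hart f f' -> is_hart (fun x => k * f x) (fun x => k * f' x).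
Proof.
move=> lf [l1 c1]; split; first exact: L2rZ.
have := conv2Z k (fun N => measurable_hart1_cut N lf.1) l1.1 c1.
rewrite (_ : (fun (n : nat) x => _) = (fun N => hart1 (cut N (fun x => k * f x))))//.
by apply/funext => N; rewrite cutZ hart1Z//; exact: L1_cut.
Qed.

Lemma hartB f g f' g' : L2r f -> L2r g -> is_hart f f' -> is_hart g g' ->
  is_hart (fun x => f x - g x) (fun x => f' x - g' x).
Proof.
move=> lf lg h1 h2; have := hartD lf (L2rZ (-1) lg) h1 (hartZ (-1) lg h2).
by under eq_fun do rewrite mulN1r; under [X in is_hart _ X]eq_fun do rewrite mulN1r.
Qed.

Lemma hart_opp f f' : L2r f -> is_hart f f' -> is_hart (fun x => f (- x)) (fun x => f' (- x)).
Proof.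
move=> lf [l1 c1]; split; first exact: (L2r_leb_preserving leb_preserving_opp).
move: c1; rewrite /conv2; set u := (fun n : nat => _); set v := (fun n : nat => _).
suff -> : u = v by [].
apply/funext => N; rewrite /u /v cut_opp hart1_opp; last exact: L1_cut.
apply/esym/(@n2_leb_preserving _ _ (fun x => hart1 (cut N f) x - f' x)); first exact: leb_preserving_opp.
by apply: mf_sub; [exact: measurable_hart1_cut lf.1|exact: l1.1].
Qed.

Lemma hart_bound h g : L2r h -> is_hart h g -> (n2 g <= (2 * pi)%:E * n2 h)%E.
Proof.
move=> h2 [[mg lg] c]; rewrite (n2_fin h2) -EFinM; apply: n2_le_approx => // e e0.
have /conv2P/(_ _ e0) H := c; have [N hN] := filter_ex H.
exists (hart1 (cut N h)); split => //; first exact: measurable_hart1_cut h2.1.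
apply: le_trans (n2_hart1_le (L1_cut N h2) (L2r_cut N h2)) _.
rewrite [leRHS]EFinM -(n2_fin h2); apply: lee_wpmul2l; first by rewrite lee_fin pi2_ge0.
by apply: le_n2; [exact: measurable_cut h2.1|exact: h2.1|exact: norm_cut].
Qed.

(** The transforms of the truncations converge pointwise by dominated convergence, and Fatou's lemma
    turns the Cauchy bound of [hart_cauchy] into L2 convergence to the same limit. *)
Lemma hart_L1 h : L1 h -> L2r h -> is_hart h (hart1 h).
Proof.
move=> h1 h2; split; first exact: L2r_hart1.
apply/conv2P => e e0; have [N hN] := hart_cauchy h2 e0.
exists N => // n /= Nn; rewrite n2BC.
apply: (@n2_fatou_le _ _ (fun m x => hart1 (cut m h) x - hart1 (cut n h) x)).
- by apply: mf_sub; [by apply: measurable_hart1; exact: L1_mf|exact: measurable_hart1_cut h2.1].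
- by move=> m; apply: mf_sub; exact: measurable_hart1_cut h2.1.
- apply: aeW => x; apply: cvgB; last exact: cvg_cst.
  have mc := @measurable_cas R; have mh := h2.1.
  have ic (m : nat) : L1 (fun y => cut m h y * cas (x * y)) by apply/L1_cas/L1_cut.
  have /(_ _ _ _)[//|||||_ _ H] := @dominated_convergence _ _ _ mu setT measurableT
    (fun m y => (cut m h y * cas (x * y))%:E) (fun y => (h y * cas (x * y))%:E) (fun y => (2 * `|h y|)%:E).
  + by move=> m; apply: emf; exact: L1_mf.
  + by apply: emf; mfun.
  + apply: aeW => y _; apply: cvg_EFin; first exact: nearW.
    apply: cvgMl; apply: cvg_near_cst; apply: filterS (cut_eq h y) => m ->//.
  + exact/L1Z/L1_norm.
  + apply: aeW => y m _; rewrite /= lee_fin normrM mulrC.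
    by apply: ler_pM => //; [exact: cas_bdd|exact: norm_cut].
  apply: fine_cvg; move: H; rewrite -L1_int; last exact: L1_cas.
  by rewrite L1_int//; exact: L1_cas.
- by exists N => // m /= Nm; exact: hN.
Qed.

Lemma hart_adj a b a' b' : L2r a -> L2r b -> is_hart a a' -> is_hart b b' ->
  \int[mu]_x (a' x * b x) = \int[mu]_x (a x * b' x).
Proof.
move=> la lb [la' ca] [lb' cb].
have l1 N : L2r (hart1 (cut N a)) by apply: L2r_hart1; [exact: L1_cut|exact: L2r_cut].
have l2 N : L2r (hart1 (cut N b)) by apply: L2r_hart1; [exact: L1_cut|exact: L2r_cut].
have h1 := conv2_Rint l1 (fun N => L2r_cut N lb) la' lb ca (conv2_cut lb).
have h2 := conv2_Rint (fun N => L2r_cut N la) l2 la lb' (conv2_cut la) cb.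
have E : (fun n => \int[mu]_x (hart1 (cut n a) x * cut n b x)) = (fun n => \int[mu]_x (cut n a x * hart1 (cut n b) x)).
  by apply/funext => n; rewrite hart1_adj//; exact: L1_cut.
rewrite E in h1; rewrite -(cvg_lim (@norm_hausdorff _ _) h1).
exact: (cvg_lim (@norm_hausdorff _ _) h2).
Qed.

Lemma ae_neq (a : R) : {ae mu, forall x, x != a}.
Proof.
exists [set a]; split; [exact: measurable_set1|exact: lebesgue_measure_set1|].
by move=> x /= /negP; rewrite negbK => /eqP.
Qed.

(** Abel summation: after damping by [dexp (b n)] the second transform is a difference of
    arctangents, which tends to 2 pi inside the interval and to 0 outside. The L2 bound identifies
    this limit with [k]; the two endpoints form a null set. *)
Lemma hart_indic (a c : R) k : a < c -> is_hart (hart1 \1_(`[a, c]%classic)) k ->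
  {ae mu, forall x, k x = 2 * pi * \1_(`[a, c]%classic) x}.
Proof.
move=> ac hk; set e : R -> R := \1_(`[a, c]%classic).
have le2 : L2r e by apply: L2r_indic => //; exact: itvN_fin.
have me := le2.1.
have le1 : L1 e by have := L2r_sq le2; rewrite (_ : (fun x => e x ^+ 2) = e)//; apply/funext => x; rewrite /e indicE; case: (_ \in _); rewrite ?expr1n ?expr0n.
set g := hart1 e; have lg : L2r g := L2r_hart1 le1 le2.
have [mg mk] : mf g /\ mf k by split; [exact: lg.1|exact: hk.1.1].
pose b n : R := n.+1%:R^-1.
have b0 n : 0 < b n by rewrite /b invr_gt0.
pose gn n x := g x * dexp (b n) x.
have gn1 n : L1 (gn n) by exact: L1_hart1_dexp.
have gng n x : `|gn n x| <= `|g x| by rewrite normrM (ger0_norm (dexp_ge0 _ _)) ler_piMr// dexp_le1// ltW.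
have gn2 n : L2r (gn n) by apply: le_L2r lg _; [exact: L1_mf|].
have cgn : conv2 gn g.
  apply: (@n2_cvg0 _ _ (fun x => 2 * g x)).
  - by move=> n; apply: mf_sub => //; exact: L1_mf.
  - exact: L2rZ.
  - move=> n x; rewrite (le_trans (ler_normB _ _))// [leRHS]normrM (ger0_norm (ler0n _ 2)).
    by have := gng n x; lra.
  - move=> x; rewrite -(subrr (g x)); apply: cvgB; last exact: cvg_cst.
    rewrite -[X in _ --> X]mulr1; apply: cvgMr.
    have e1 : dexp 0 x = 1 by rewrite /dexp mul0r oppr0 expR0.
    rewrite -[X in _ --> X]e1.
    apply: (@cvg_comp _ _ _ b (fun b => dexp b x)); first exact: cvg_harmonic.
    have cF : {for 0, continuous (fun b => dexp b x)}.
      by apply: differentiable_continuous; apply/derivable1_diffP; exact: ex_derive.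
    exact: cF.
have Hgn n z : hart1 (gn n) z = 2 * atan ((c - z) / b n) - 2 * atan ((a - z) / b n).
  rewrite /gn hart1_dexp_poisson//.
  have := int_poisson_itv z (b0 n) ac; rewrite integral_mkcond => /(congr1 fine) /= <-.
  congr fine; apply: eq_integral => y _; rewrite patchE /e indicE.
  rewrite poissonC; case: ifP => _; rewrite ?mul1r ?mul0r//.
have binf : (b n)^-1 @[n --> \oo] --> +oo.
  rewrite (_ : (fun n => _) = (fun n => n.+1%:R)); last by apply/funext => n; rewrite /b invrK.
  apply/cvgryPge => A; near=> n; rewrite (@le_trans _ _ n%:R)// ?ler_nat//.
  by near: n; exact: nbhs_infty_ger.
have at1 (y : R) : 0 < y -> 2 * atan (y / b n) @[n --> \oo] --> (pi : R).
  move=> y0; have -> : pi = 2 * (pi / 2) :> R by field.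
  apply: cvgMr; have yb : y / b n @[n --> \oo] --> +oo.
    apply: (@cvg_comp _ _ _ (fun n => (b n)^-1) (fun z => y * z) _ _ _ binf).
    by apply: gt0_cvgMry => //; exact: cvg_id.
  by apply: cvg_comp yb _; exact: cvgy_atan.
have at2 (y : R) : y < 0 -> 2 * atan (y / b n) @[n --> \oo] --> (- pi : R).
  move=> y0; have y1 : 0 < - y by lra.
  rewrite (_ : (fun n => _) = (fun n => - (2 * atan (- y / b n)))); first by apply: cvgN; exact: at1.
  by apply/funext => n; rewrite mulNr atanN mulrN opprK.
have ptw z : z != a -> z != c -> hart1 (gn n) z @[n --> \oo] --> 2 * pi * e z.
  move=> za zc; under eq_fun do rewrite Hgn.
  rewrite /e indicE; have [za1|za1] := ltP z a.
    rewrite memNset ?mulr0; last by rewrite /= in_itv/= => /andP[h _]; lra.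
    by rewrite -(subrr pi); apply: cvgB; apply: at1; lra.
  have {za1}za1 : a < z by rewrite lt_neqAle eq_sym za.
  have [zc1|zc1] := ltP z c.
    rewrite mem_set; last by rewrite /= in_itv/= !ltW.
    rewrite mulr1 (_ : 2 * pi = pi - (- pi)); last by ring.
    by apply: cvgB; [apply: at1|apply: at2]; lra.
  have {zc1}zc1 : c < z by rewrite lt_neqAle eq_sym zc.
  rewrite memNset ?mulr0; last by rewrite /= in_itv/= => /andP[_ h]; lra.
  by rewrite -(subrr (- pi)); apply: cvgB; apply: at2; lra.
have mHgn n : mf (hart1 (gn n)) by apply: measurable_hart1; exact: L1_mf.
have mke : mf (fun x => k x - 2 * pi * e x) by mfun.
have : n2 (fun x => k x - 2 * pi * e x) = 0%E.
  apply/eqP; rewrite eq_le n2_ge0 andbT; apply/lee_addgt0Pr => d d0; rewrite add0e.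
  apply: (@n2_fatou_le _ _ (fun n x => k x - hart1 (gn n) x)) => //.
  - by move=> n; exact: mf_sub.
  - apply: filterS2 (ae_neq a) (ae_neq c) => x xa xc.
    by apply: cvgB; [exact: cvg_cst|exact: ptw].
  - have pi0 := pi_ge0 R.
    have d'0 : 0 < d / (2 * pi + 1) by rewrite divr_gt0//; lra.
    have /conv2P/(_ _ d'0) := cgn; apply: filterS => n hn.
    have hh := hartB lg (gn2 n) hk (hart_L1 (gn1 n) (gn2 n)).
    apply: le_trans (hart_bound (L2rB lg (gn2 n)) hh) _.
    apply: (@le_trans _ _ ((2 * pi)%:E * (d / (2 * pi + 1))%:E)%E).
      by apply: lee_wpmul2l; [rewrite lee_fin pi2_ge0|rewrite n2BC].
    rewrite -EFinM lee_fin mulrCA ler_piMr ?(ltW d0)// ler_pdivrMr; lra.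
move=> /(n2_eq0 mke); apply: filterS => x /eqP; rewrite subr_eq0 => /eqP //.
Unshelve. all: by end_near. Qed.

(** The primitive of the truncation of f to each [-m, m] vanishes identically, and Lebesgue's
    differentiation theorem recovers f from it almost everywhere. *)
Lemma ae0_of_itv f : L2r f -> (forall a c, a < c -> \int[mu]_x (f x * \1_(`[a, c]%classic) x) = 0) ->
  {ae mu, forall x, f x = 0}.
Proof.
move=> lf H.
have Ha a c : \int[mu]_x (f x * \1_(`[a, c]%classic) x) = 0.
  have [ac|ca|->] := ltgtP a c; first exact: H.
    rewrite (_ : `[a, c]%classic = set0); last by rewrite set_itv_ge// bnd_simp -ltNge.
    by under eq_Rintegral do rewrite indic0 mulr0; rewrite Rintegral_cst// mul0r.
  rewrite set_itv1 -[RHS](Rintegral_set1 f c) [RHS]Rintegral_mkcond.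
  apply: eq_Rintegral => y _; rewrite patchE indicE.
  by case: ifP; rewrite ?mulr1 ?mulr0.
have Hm (m : nat) : {ae mu, forall x, - m%:R < x < m%:R -> f x = 0}.
  pose fm := f \_ `[- m%:R, m%:R]%classic.
  have mI : measurable (`[- m%:R, m%:R]%classic : set R) by exact: measurable_itv.
  have fmE : fm = (fun x => f x * \1_(`[- m%:R, m%:R]%classic) x).
    by apply/funext => x; rewrite /fm patchE indicE; case: ifP => _; rewrite ?mulr1 ?mulr0.
  have Lm : L1 fm by rewrite fmE; apply: L2rM => //; apply: L2r_indic => //; exact: itvN_fin.
  have loc : locally_integrable setT fm.
    have := @integrable_locally_restrict R f _ mI; apply.
    by apply/integrable_mkcond => //; rewrite restrict_EFin.
  have L1y y : mu.-integrable `]-oo, y] (EFin \o fm).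
    by apply: (integrableS measurableT).
  have := @FTC1Ny R fm L1y loc.
  have F0 : (fun x => \int[mu]_(t in `]-oo, x]) fm t) = cst 0.
    apply/funext => x; rewrite Rintegral_mkcond /=.
    rewrite -(Ha (- m%:R) (Num.min x m%:R)); apply: eq_Rintegral => y _.
    rewrite patchE fmE !indicE !mem_setE !in_itv/= le_min.
    by case: (y <= x); rewrite ?andbT ?andbF ?mulr0.
  rewrite F0; apply: filterS => x [_ hx] /andP[xm1 xm2].
  move: hx; rewrite derive1_cst /fm patchE mem_set ?in_itv/= ?ltW//.
  by rewrite /= in_itv /= !ltW.
have : {ae mu, forall x, forall m : nat, - m%:R < x < m%:R -> f x = 0}.
  exact/ae_foralln.
apply: filterS => x hx; have [m hm] : exists m : nat, `|x| < m%:R.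
  by exists (Num.truncn `|x|).+1; exact: truncnS_gt.
by apply: (hx m); rewrite -ltr_norml.
Qed.

(** Both sides are tested on the indicator [e] of an interval. Two uses of self-adjointness move
    both transforms onto [e], where [hart_indic] computes them. *)
Lemma hart_inv h g : L2r h -> is_hart h g -> is_hart g (fun x => 2 * pi * h x).
Proof.
move=> lh hg; have lg := hg.1; have [k hk] := hart_ex lg.
apply: (hart_aer lg.1 hk); first by have := lh.1 => ?; mfun.
have lk := hk.1.
have L := L2rB lk (L2rZ (2 * pi) lh).
suff : {ae mu, forall x, k x - 2 * pi * h x = 0}.
  by apply: filterS => x /eqP; rewrite subr_eq0 => /eqP.
apply: (ae0_of_itv L) => a c ac; set e : R -> R := \1_(`[a, c]%classic).
have le2 : L2r e by apply: L2r_indic => //; exact: itvN_fin.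
have le1 : L1 e by have := L2r_sq le2; rewrite (_ : (fun x => e x ^+ 2) = e)//; apply/funext => x; rewrite /e indicE; case: (_ \in _); rewrite ?expr1n ?expr0n.
have he := hart_L1 le1 le2; have lhe := he.1.
have [k' hk'] := hart_ex lhe.
have ek' := hart_indic ac hk'.
have E1 := hart_adj lg le2 hk he.
have E2 := hart_adj lh lhe hg hk'.
have E3 : \int[mu]_x (h x * k' x) = \int[mu]_x (2 * pi * (h x * e x)).
  apply: eq_Rint_ae.
  - by have := lh.1 => ?; have := hk'.1.1 => ?; mfun.
  - by have := lh.1 => ?; have := le2.1 => ?; mfun.
  - by apply: filterS ek' => x ->; rewrite -/e; ring.
transitivity (\int[mu]_x (k x * e x - 2 * pi * (h x * e x))).
  by apply: eq_Rintegral => x _; ring.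
have l1 := L2rM lk le2; have l2 := L2rM lh le2.
rewrite RintegralB//; last exact: L1Z.
by rewrite E1 E2 E3 subrr.
Qed.

End hartley_L2.

(** * The Fourier transform and S1 on L2 *)

Section complex_L2.
Context {R : realType}.
Notation mu := (@lebesgue_measure R).
Notation mf := (measurable_fun setT).
Implicit Types f psi : R -> R[i].

Definition re f x := complex.Re (f x).
Definition im f x := complex.Im (f x).

Lemma normc_sq (z : R[i]) : Normc.normc z ^+ 2 = complex.Re z ^+ 2 + complex.Im z ^+ 2.
Proof. by case: z => a b /=; rewrite sqr_sqrtr// addr_ge0 ?sqr_ge0. Qed.

Lemma L2P f : L2 f <-> L2r (re f) /\ L2r (im f).
Proof.
have E : mf (re f) -> mf (im f) -> L2norm_sq f = (n2 (re f) + n2 (im f))%E.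
  move=> m1 m2; rewrite /L2norm_sq; under eq_integral do rewrite normc_sq.
  by rewrite intD//; [mfun|mfun|move=> x; exact: sqr_ge0|move=> x; exact: sqr_ge0].
split=> [[m1 m2]|[[m1 l1] [m2 l2]]].
  rewrite E// => h; split; split => //; apply: le_lt_trans h.
    by rewrite leeDl// n2_ge0.
  by rewrite leeDr// n2_ge0.
by split => //; rewrite E// lte_add_pinfty.
Qed.

Lemma L2norm_sqE f : mf (re f) -> mf (im f) -> L2norm_sq f = (n2 (re f) + n2 (im f))%E.
Proof.
move=> m1 m2; rewrite /L2norm_sq; under eq_integral do rewrite normc_sq.
by rewrite intD//; [mfun|mfun|move=> x; exact: sqr_ge0|move=> x; exact: sqr_ge0].
Qed.

Lemma complex_eqP (z w : R[i]) : z = w <-> complex.Re z = complex.Re w /\ complex.Im z = complex.Im w.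
Proof. by case: z w => a b [c d] /=; split=> [[-> ->]|[-> ->]]. Qed.

Lemma reD (z w : R[i]) : complex.Re (z + w) = complex.Re z + complex.Re w.
Proof. by case: z w => a b [c d]. Qed.
Lemma imD (z w : R[i]) : complex.Im (z + w) = complex.Im z + complex.Im w.
Proof. by case: z w => a b [c d]. Qed.
Lemma reB (z w : R[i]) : complex.Re (z - w) = complex.Re z - complex.Re w.
Proof. by case: z w => a b [c d]. Qed.
Lemma imB (z w : R[i]) : complex.Im (z - w) = complex.Im z - complex.Im w.
Proof. by case: z w => a b [c d]. Qed.
Lemma reM (z w : R[i]) : complex.Re (z * w) = complex.Re z * complex.Re w - complex.Im z * complex.Im w.
Proof. by case: z w => a b [c d]. Qed.
Lemma imM (z w : R[i]) : complex.Im (z * w) = complex.Re z * complex.Im w + complex.Im z * complex.Re w.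
Proof. by case: z w => a b [c d] /=. Qed.

Lemma cexpiD (a b : R) : cexpi (a + b) = cexpi a * cexpi b.
Proof. by apply/complex_eqP; rewrite reM imM /= cosD sinD; split => //; ring. Qed.

(** The kernel has the sign of the inverse transform and carries no factor 1 / (2 pi), which suits
    [S1]. The transform [fourier] has the opposite sign, hence the reflection in [fourier_spec]. *)
Definition ftN psi (N : nat) x := cintegral `[- N%:R, N%:R] (fun y => psi y * cexpi (x * y)).

Definition is_ft psi (g : R -> R[i]) := L2 g /\ L2norm_sq (fun x => ftN psi N x - g x) @[N --> \oo] --> 0%E.

Definition ev (h : R -> R) x := (h x + h (- x)) / 2.
Definition od (h : R -> R) x := (h x - h (- x)) / 2.

(** The even part of a Hartley transform is the cosine transform, the odd part the sine transform.
    If [hp] and [hq] belong to the real and the imaginary part of a function, this is its Fourier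
    transform. *)
Definition ftr hp hq : R -> R[i] := fun x => ((ev hp x - od hq x) +i* (ev hq x + od hp x))%C.

Lemma L2r_comp_opp (h : R -> R) : L2r h -> L2r (fun x => h (- x)).
Proof. exact: (L2r_leb_preserving leb_preserving_opp). Qed.

Lemma L2r_ev h : L2r h -> L2r (ev h).
Proof.
move=> lh; have := L2rZ 2^-1 (L2rD lh (L2r_comp_opp lh)).
by under eq_fun do rewrite mulrC.
Qed.

Lemma L2r_od h : L2r h -> L2r (od h).
Proof.
move=> lh; have := L2rZ 2^-1 (L2rB lh (L2r_comp_opp lh)).
by under eq_fun do rewrite mulrC.
Qed.

Lemma hart_ev h g : L2r h -> is_hart h g -> is_hart (ev h) (ev g).
Proof.
move=> lh hg; have := hartZ 2^-1 (L2rD lh (L2r_comp_opp lh)) (hartD lh (L2r_comp_opp lh) hg (hart_opp lh hg)).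
by under eq_fun do rewrite mulrC; under [X in is_hart _ X]eq_fun do rewrite mulrC.
Qed.

Lemma hart_od h g : L2r h -> is_hart h g -> is_hart (od h) (od g).
Proof.
move=> lh hg; have := hartZ 2^-1 (L2rB lh (L2r_comp_opp lh)) (hartB lh (L2r_comp_opp lh) hg (hart_opp lh hg)).
by under eq_fun do rewrite mulrC; under [X in is_hart _ X]eq_fun do rewrite mulrC.
Qed.

Lemma L1_cos (h : R -> R) x : L1 h -> L1 (fun y => h y * cos (x * y)).
Proof.
move=> h1; apply: (L1_bdd (k := 1)) => //; first by mfun.
by move=> y; rewrite ler_norml cos_geN1 cos_le1.
Qed.

Lemma L1_sin (h : R -> R) x : L1 h -> L1 (fun y => h y * sin (x * y)).
Proof.
move=> h1; apply: (L1_bdd (k := 1)) => //; first by mfun.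
by move=> y; rewrite ler_norml sin_geN1 sin_le1.
Qed.

Lemma Rint_cos h x : L1 h -> \int[mu]_y (h y * cos (x * y)) = ev (hart1 h) x.
Proof.
move=> h1; rewrite /ev /hart1 -RintegralD//; try exact: L1_cas.
rewrite -RintegralZr//; last by apply: L1D; exact: L1_cas.
by apply: eq_Rintegral => y _; rewrite /cas mulNr cosN sinN; field.
Qed.

Lemma Rint_sin h x : L1 h -> \int[mu]_y (h y * sin (x * y)) = od (hart1 h) x.
Proof.
move=> h1; rewrite /od /hart1 -RintegralB//; try exact: L1_cas.
rewrite -RintegralZr//; last by apply: L1B; exact: L1_cas.
by apply: eq_Rintegral => y _; rewrite /cas mulNr cosN sinN; field.
Qed.

Lemma Rint_cut (F : R -> R) N : \int[mu]_(y in `[- N%:R, N%:R]) F y = \int[mu]_y (cut N F y).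
Proof.
rewrite Rintegral_mkcond; apply: eq_Rintegral => y _; rewrite patchE /cut /itvN indicE.
by case: ifP => _; rewrite ?mulr1 ?mulr0.
Qed.

Lemma ft_L1E psi x : L1 (re psi) -> L1 (im psi) ->
  cintegral setT (fun y => psi y * cexpi (x * y)) = ftr (hart1 (re psi)) (hart1 (im psi)) x.
Proof.
move=> l1 l2; rewrite /cintegral /ftr; congr (_ +i* _)%C.
  rewrite -Rint_cos// -Rint_sin// -RintegralB//; [|exact: L1_cos|exact: L1_sin].
  by apply: eq_Rintegral => y _; rewrite reM.
rewrite -Rint_cos// -Rint_sin// -RintegralD//; [|exact: L1_cos|exact: L1_sin].
by apply: eq_Rintegral => y _; rewrite imM addrC.
Qed.

Lemma ftN_E psi N x : L2 psi -> ftN psi N x = ftr (hart1 (cut N (re psi))) (hart1 (cut N (im psi))) x.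
Proof.
move=> /L2P[l1 l2]; rewrite /ftr -!Rint_cos -?Rint_sin; try exact: L1_cut.
rewrite /ftN /cintegral !Rint_cut; congr (_ +i* _)%C.
  rewrite -RintegralB//; [|by apply: L1_cos; exact: L1_cut|by apply: L1_sin; exact: L1_cut].
  by apply: eq_Rintegral => y _; rewrite /cut reM; rewrite /re /im /=; ring.
rewrite -RintegralD//; [|by apply: L1_cos; exact: L1_cut|by apply: L1_sin; exact: L1_cut].
by apply: eq_Rintegral => y _; rewrite /cut imM; rewrite /re /im /=; ring.
Qed.

Lemma measurable_ev h : mf h -> mf (ev h).
Proof. by move=> m1; have := @oppr_measurable R setT => ?; rewrite /ev; mfun. Qed.

Lemma measurable_od h : mf h -> mf (od h).
Proof. by move=> m1; have := @oppr_measurable R setT => ?; rewrite /od; mfun. Qed.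

Lemma L2_ftr hp hq : L2r hp -> L2r hq -> L2 (ftr hp hq).
Proof.
move=> l1 l2; apply/L2P; split.
  exact: (L2rB (L2r_ev l1) (L2r_od l2)).
exact: (L2rD (L2r_ev l2) (L2r_od l1)).
Qed.

Lemma conv2_opp (F : nat -> R -> R) h : (forall n, mf (F n)) -> mf h ->
  conv2 F h -> conv2 (fun n x => F n (- x)) (fun x => h (- x)).
Proof.
move=> mF mh /conv2P H; apply/conv2P => e e0; apply: filterS (H e e0) => n.
apply: le_trans; rewrite (@n2_leb_preserving _ _ (fun x => F n x - h x))//; first exact: leb_preserving_opp.
exact: mf_sub.
Qed.

Lemma conv2_ev (F : nat -> R -> R) h : (forall n, mf (F n)) -> mf h ->
  conv2 F h -> conv2 (fun n => ev (F n)) (ev h).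
Proof.
move=> mF mh c.
have mo := @oppr_measurable R setT.
have mFo n : mf (fun x : R => F n (- x)) by have := mF n => ?; mfun.
have mho : mf (fun x : R => h (- x)) by mfun.
have e (u : R -> R) : ev u = (fun x => 2^-1 * (u x + u (- x))) by apply/funext => x; rewrite /ev mulrC.
rewrite e (_ : (fun n => ev (F n)) = (fun n x => 2^-1 * (F n x + F n (- x)))); last by apply/funext => n; exact: e.
apply: conv2Z; [by move=> n; have := mF n => ?; have := mFo n => ?; mfun|by mfun|].
exact: (conv2D mF mFo mh mho c (conv2_opp mF mh c)).
Qed.

Lemma conv2_od (F : nat -> R -> R) h : (forall n, mf (F n)) -> mf h ->
  conv2 F h -> conv2 (fun n => od (F n)) (od h).
Proof.
move=> mF mh c.
have mo := @oppr_measurable R setT.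
have mFo n : mf (fun x : R => - 1 * F n (- x)) by have := mF n => ?; mfun.
have mho : mf (fun x : R => - 1 * h (- x)) by mfun.
have c' : conv2 (fun n x => - 1 * F n (- x)) (fun x => -1 * h (- x)).
  by apply: conv2Z; [move=> n; have := mF n => ?; mfun|mfun|exact: conv2_opp].
have e (u : R -> R) : od u = (fun x => 2^-1 * (u x + -1 * u (- x))) by apply/funext => x; rewrite /od mulrC mulN1r.
rewrite e (_ : (fun n => od (F n)) = (fun n x => 2^-1 * (F n x + -1 * F n (- x)))); last by apply/funext => n; exact: e.
apply: conv2Z; [by move=> n; have := mF n => ?; have := mFo n => ?; mfun|by mfun|].
exact: (conv2D mF mFo mh mho c c').
Qed.

Lemma L2norm_sq_cvgP (F : nat -> R -> R[i]) (g : R -> R[i]) : (forall n, mf (re (F n))) -> (forall n, mf (im (F n))) ->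
  mf (re g) -> mf (im g) ->
  L2norm_sq (fun x => F N x - g x) @[N --> \oo] --> 0%E <->
  conv2 (fun n => re (F n)) (re g) /\ conv2 (fun n => im (F n)) (im g).
Proof.
move=> m1 m2 m3 m4.
have E n : L2norm_sq (fun x => F n x - g x) = (n2 (fun x => re (F n) x - re g x)%R + n2 (fun x => im (F n) x - im g x)%R)%E.
  have e1 : re (fun x => F n x - g x) = (fun x => re (F n) x - re g x) by apply/funext => x; exact: reB.
  have e2 : im (fun x => F n x - g x) = (fun x => im (F n) x - im g x) by apply/funext => x; exact: imB.
  by have := @L2norm_sqE (fun x => F n x - g x); rewrite e1 e2 => ->//; exact: mf_sub.
under eq_fun do rewrite E.
split=> [h|[h1 h2]].
  split.
    apply: (squeeze_cvge _ (cvg_cst 0%E) h); apply: nearW => n.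
    by rewrite n2_ge0 /= leeDl// n2_ge0.
  apply: (squeeze_cvge _ (cvg_cst 0%E) h); apply: nearW => n.
  by rewrite n2_ge0 /= leeDr// n2_ge0.
by rewrite -(adde0 0%E); apply: cvgeD.
Qed.

Lemma ft_hart psi hp hq : L2 psi -> is_hart (re psi) hp -> is_hart (im psi) hq ->
  is_ft psi (ftr hp hq).
Proof.
move=> lpsi [lp cp] [lq cq]; have [l1 l2] := L2P psi; have {l1 l2}[l1 l2] := l1 lpsi.
have lg := L2_ftr lp lq; split => //.
have mp N : mf (hart1 (cut N (re psi))) by exact: measurable_hart1_cut l1.1.
have mq N : mf (hart1 (cut N (im psi))) by exact: measurable_hart1_cut l2.1.
have E : ftN psi = (fun N => ftr (hart1 (cut N (re psi))) (hart1 (cut N (im psi)))).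
  by apply/funext => N; apply/funext => x; exact: ftN_E.
rewrite E.
have me := measurable_ev; have mo := measurable_od.
have mN1 (c : R) (h : R -> R) : mf h -> mf (fun x => c * h x) by move=> ?; mfun.
apply/L2norm_sq_cvgP.
- by move=> N; exact: (mf_sub (me _ (mp N)) (mo _ (mq N))).
- by move=> N; exact: (measurable_funD (me _ (mq N)) (mo _ (mp N))).
- exact: (mf_sub (me _ lp.1) (mo _ lq.1)).
- exact: (measurable_funD (me _ lq.1) (mo _ lp.1)).
split.
  have := conv2D (fun N => me _ (mp N)) (fun N => mN1 (-1) _ (mo _ (mq N))) (me _ lp.1) (mN1 (-1) _ (mo _ lq.1))
   (conv2_ev mp lp.1 cp) (conv2Z (-1) (fun N => mo _ (mq N)) (mo _ lq.1) (conv2_od mq lq.1 cq)).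
  under eq_fun => n do under eq_fun do rewrite mulN1r.
  by under [X in conv2 _ X]eq_fun do rewrite mulN1r.
exact: (conv2D (fun N => me _ (mq N)) (fun N => mo _ (mp N)) (me _ lq.1) (mo _ lp.1)
   (conv2_ev mq lq.1 cq) (conv2_od mp lp.1 cp)).
Qed.

End complex_L2.

(** * Linearity, inversion and bounds for the Fourier transform on L2 *)

Section fourier_L2.
Context {R : realType}.
Notation mu := (@lebesgue_measure R).
Notation mf := (measurable_fun setT).
Implicit Types f g psi : R -> R[i].

Lemma L2_re psi : L2 psi -> L2r (re psi). Proof. by move=> /L2P[]. Qed.
Lemma L2_im psi : L2 psi -> L2r (im psi). Proof. by move=> /L2P[]. Qed.

Lemma measurable_ftN psi N : L2 psi -> mf (re (ftN psi N)) /\ mf (im (ftN psi N)).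
Proof.
move=> l; have [l1 l2] := (L2_re l, L2_im l).
have -> : ftN psi N = ftr (hart1 (cut N (re psi))) (hart1 (cut N (im psi))).
  by apply/funext => x; exact: ftN_E.
have mp : mf (hart1 (cut N (re psi))) by exact: measurable_hart1_cut l1.1.
have mq : mf (hart1 (cut N (im psi))) by exact: measurable_hart1_cut l2.1.
split.
  exact: (mf_sub (measurable_ev mp) (measurable_od mq)).
exact: (measurable_funD (measurable_ev mq) (measurable_od mp)).
Qed.

Lemma ft_cvgP psi g : L2 psi -> is_ft psi g <->
  [/\ L2 g, conv2 (fun N => re (ftN psi N)) (re g) & conv2 (fun N => im (ftN psi N)) (im g)].
Proof.
move=> l; split=> [[lg /L2norm_sq_cvgP[]]|[lg h1 h2]].
- by move=> n; exact: (measurable_ftN n l).1.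
- by move=> n; exact: (measurable_ftN n l).2.
- exact: (L2_re lg).1.
- exact: (L2_im lg).1.
- by move=> h1 h2; split.
- split => //; apply/L2norm_sq_cvgP => //.
  + by move=> n; exact: (measurable_ftN n l).1.
  + by move=> n; exact: (measurable_ftN n l).2.
  + exact: (L2_re lg).1.
  + exact: (L2_im lg).1.
Qed.

Lemma ft_uniq psi g g' : L2 psi -> is_ft psi g -> is_ft psi g' -> {ae mu, forall x, g x = g' x}.
Proof.
move=> l /(ft_cvgP _ l)[lg h1 h2] /(ft_cvgP _ l)[lg' h1' h2'].
have m1 n := (measurable_ftN n l).1; have m2 n := (measurable_ftN n l).2.
apply: filterS2 (conv2_uniq m1 (L2_re lg).1 (L2_re lg').1 h1 h1') (conv2_uniq m2 (L2_im lg).1 (L2_im lg').1 h2 h2').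
by move=> x e1 e2; apply/complex_eqP.
Qed.

Lemma ae_re g g' : {ae mu, forall x, g x = g' x} -> {ae mu, forall x, re g x = re g' x}.
Proof. by apply: filterS => x; rewrite /re => ->. Qed.

Lemma ae_im g g' : {ae mu, forall x, g x = g' x} -> {ae mu, forall x, im g x = im g' x}.
Proof. by apply: filterS => x; rewrite /im => ->. Qed.

Lemma L2_ae g g' : L2 g -> mf (re g') -> mf (im g') -> {ae mu, forall x, g x = g' x} -> L2 g'.
Proof.
move=> lg m1 m2 e; have [[n1 l1] [n2' l2]] := (L2_re lg, L2_im lg).
apply/L2P; split; split => //.
  by rewrite -(eq_n2_ae n1 m1 (ae_re e)).
by rewrite -(eq_n2_ae n2' m2 (ae_im e)).
Qed.

Lemma ft_aer psi g g' : L2 psi -> is_ft psi g -> mf (re g') -> mf (im g') ->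
  {ae mu, forall x, g x = g' x} -> is_ft psi g'.
Proof.
move=> l /(ft_cvgP _ l)[lg h1 h2] m1 m2 e; apply/(ft_cvgP _ l); split.
- exact: L2_ae e.
- by apply: conv2_ae (ae_re e) h1 => //; [move=> n; exact: (measurable_ftN n l).1|exact: (L2_re lg).1].
- by apply: conv2_ae (ae_im e) h2 => //; [move=> n; exact: (measurable_ftN n l).2|exact: (L2_im lg).1].
Qed.

(** Every L2 transform is thereby reduced to the Hartley transforms of the real and imaginary parts,
    from which linearity, reflection and inversion are inherited. *)
Lemma ft_form psi g : L2 psi -> is_ft psi g ->
  exists hp hq, [/\ is_hart (re psi) hp, is_hart (im psi) hq & {ae mu, forall x, g x = ftr hp hq x}].
Proof.
move=> l hg; have [hp h1] := hart_ex (L2_re l); have [hq h2] := hart_ex (L2_im l).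
exists hp, hq; split => //; exact: (ft_uniq l hg (ft_hart l h1 h2)).
Qed.

Lemma ft_ex psi : L2 psi -> exists g, is_ft psi g.
Proof.
move=> l; have [hp h1] := hart_ex (L2_re l); have [hq h2] := hart_ex (L2_im l).
by exists (ftr hp hq); exact: ft_hart.
Qed.

Lemma ft_of_form psi g hp hq : L2 psi -> mf (re g) -> mf (im g) -> is_hart (re psi) hp -> is_hart (im psi) hq ->
  {ae mu, forall x, g x = ftr hp hq x} -> is_ft psi g.
Proof.
move=> l m1 m2 h1 h2 e; apply: (ft_aer l (ft_hart l h1 h2)) => //.
by apply: filterS e => x ->.
Qed.

Lemma ft_ael psi psi' g : L2 psi -> L2 psi' -> {ae mu, forall x, psi x = psi' x} -> is_ft psi g -> is_ft psi' g.
Proof.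
move=> l l' e hg; have [hp [hq [h1 h2 eg]]] := ft_form l hg.
have lg := hg.1; apply: (ft_of_form l' (L2_re lg).1 (L2_im lg).1 _ _ eg).
  exact: (hart_ael (L2_re l).1 (L2_re l').1 (ae_re e) h1).
exact: (hart_ael (L2_im l).1 (L2_im l').1 (ae_im e) h2).
Qed.

Lemma L2D f g : L2 f -> L2 g -> L2 (fun x => f x + g x).
Proof.
move=> lf lg; apply/L2P; split.
  have -> : re (fun x => f x + g x) = (fun x => re f x + re g x) by apply/funext => x; exact: reD.
  by apply: L2rD; exact: L2_re.
have -> : im (fun x => f x + g x) = (fun x => im f x + im g x) by apply/funext => x; exact: imD.
by apply: L2rD; exact: L2_im.
Qed.

Lemma reZ (c : R) (z : R[i]) : complex.Re (c%:C%C * z) = c * complex.Re z.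
Proof. by case: z => a b /=; rewrite mul0r subr0. Qed.
Lemma imZ (c : R) (z : R[i]) : complex.Im (c%:C%C * z) = c * complex.Im z.
Proof. by case: z => a b /=; rewrite mul0r addr0. Qed.

Lemma L2Z (c : R) f : L2 f -> L2 (fun x => c%:C%C * f x).
Proof.
move=> lf; apply/L2P; split.
  have -> : re (fun x => c%:C%C * f x) = (fun x => c * re f x) by apply/funext => x; exact: reZ.
  by apply: L2rZ; exact: L2_re.
have -> : im (fun x => c%:C%C * f x) = (fun x => c * im f x) by apply/funext => x; exact: imZ.
by apply: L2rZ; exact: L2_im.
Qed.

Lemma ftD f g f' g' : L2 f -> L2 g -> is_ft f f' -> is_ft g g' -> is_ft (fun x => f x + g x) (fun x => f' x + g' x).
Proof.
move=> lf lg hf hg; have [hp [hq [h1 h2 e1]]] := ft_form lf hf; have [kp [kq [k1 k2 e2]]] := ft_form lg hg.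
have l := L2D hf.1 hg.1.
apply: (@ft_of_form _ _ (fun x => hp x + kp x) (fun x => hq x + kq x) (L2D lf lg) (L2_re l).1 (L2_im l).1).
- have -> : re (fun x => f x + g x) = (fun x => re f x + re g x) by apply/funext => x; exact: reD.
  by apply: hartD => //; exact: L2_re.
- have -> : im (fun x => f x + g x) = (fun x => im f x + im g x) by apply/funext => x; exact: imD.
  by apply: hartD => //; exact: L2_im.
- by apply: filterS2 e1 e2 => x -> ->; apply/complex_eqP; rewrite reD imD /= /ev /od; split; field.
Qed.

Lemma ftZ (c : R) f f' : L2 f -> is_ft f f' -> is_ft (fun x => c%:C%C * f x) (fun x => c%:C%C * f' x).
Proof.
move=> lf hf; have [hp [hq [h1 h2 e1]]] := ft_form lf hf.
have l := L2Z c hf.1.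
apply: (@ft_of_form _ _ (fun x => c * hp x) (fun x => c * hq x) (L2Z c lf) (L2_re l).1 (L2_im l).1).
- have -> : re (fun x => c%:C%C * f x) = (fun x => c * re f x) by apply/funext => x; exact: reZ.
  by apply: hartZ => //; exact: L2_re.
- have -> : im (fun x => c%:C%C * f x) = (fun x => c * im f x) by apply/funext => x; exact: imZ.
  by apply: hartZ => //; exact: L2_im.
- by apply: filterS e1 => x ->; apply/complex_eqP; rewrite reZ imZ /= /ev /od; split; field.
Qed.

Lemma subC (z w : R[i]) : z - w = z + (-1)%:C%C * w.
Proof. by apply/complex_eqP; rewrite reB imB reD imD reZ imZ !mulN1r. Qed.

Lemma L2B f g : L2 f -> L2 g -> L2 (fun x => f x - g x).
Proof.
move=> lf lg; have := L2D lf (L2Z (-1) lg).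
by rewrite (_ : (fun x => f x - g x) = (fun x => f x + (-1)%:C%C * g x))//; apply/funext => x; exact: subC.
Qed.

Lemma ftB f g f' g' : L2 f -> L2 g -> is_ft f f' -> is_ft g g' -> is_ft (fun x => f x - g x) (fun x => f' x - g' x).
Proof.
move=> lf lg hf hg; have := ftD lf (L2Z (-1) lg) hf (ftZ (-1) lg hg).
rewrite (_ : (fun x => f x - g x) = (fun x => f x + (-1)%:C%C * g x)); last by apply/funext => x; exact: subC.
by rewrite (_ : (fun x => f' x - g' x) = (fun x => f' x + (-1)%:C%C * g' x))//; apply/funext => x; exact: subC.
Qed.

Lemma L2_opp f : L2 f -> L2 (fun x => f (- x)).
Proof.
by move=> lf; apply/L2P; split; [apply: (L2r_comp_opp (L2_re lf))|apply: (L2r_comp_opp (L2_im lf))].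
Qed.

Lemma ft_opp f f' : L2 f -> is_ft f f' -> is_ft (fun x => f (- x)) (fun x => f' (- x)).
Proof.
move=> lf hf; have [hp [hq [h1 h2 e1]]] := ft_form lf hf.
have l := L2_opp hf.1.
apply: (@ft_of_form _ _ (fun x => hp (- x)) (fun x => hq (- x)) (L2_opp lf) (L2_re l).1 (L2_im l).1).
- by apply: (hart_opp (L2_re lf)).
- by apply: (hart_opp (L2_im lf)).
- have := ae_leb_preserving leb_preserving_opp e1.
  by apply: filterS => x ->; apply/complex_eqP; rewrite /= /ev /od; split; rewrite opprK; field.
Qed.

Lemma n2_ev (h : R -> R) : mf h -> (n2 (ev h) <= n2 h)%E.
Proof.
move=> m1; have mo := @oppr_measurable R setT.
have m2 : mf (fun x : R => h (- x)) by apply: (measurableT_comp m1).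
have -> : ev h = (fun x => 2^-1 * (h x + h (- x))) by apply/funext => x; rewrite /ev mulrC.
rewrite n2Z; last by mfun.
apply: (@le_trans _ _ ((2^-1 ^+ 2)%:E * (2%:E * n2 h + 2%:E * n2 h))%E).
  apply: lee_wpmul2l; first by rewrite lee_fin sqr_ge0.
  by have := n2D m1 m2; rewrite (@n2_leb_preserving _ _ h leb_preserving_opp m1).
have := n2_ge0 h; case: (n2 h) => [r| |] //= r0.
  by rewrite -?EFinM -?EFinD -?EFinM lee_fin; lra.
by rewrite leey.
Qed.

Lemma n2_od (h : R -> R) : mf h -> (n2 (od h) <= n2 h)%E.
Proof.
move=> m1; have mo := @oppr_measurable R setT.
have m2 : mf (fun x : R => h (- x)) by apply: (measurableT_comp m1).
have -> : od h = (fun x => 2^-1 * (h x - h (- x))) by apply/funext => x; rewrite /od mulrC.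
rewrite n2Z; last by mfun.
apply: (@le_trans _ _ ((2^-1 ^+ 2)%:E * (2%:E * n2 h + 2%:E * n2 h))%E).
  apply: lee_wpmul2l; first by rewrite lee_fin sqr_ge0.
  by have := n2B m1 m2; rewrite (@n2_leb_preserving _ _ h leb_preserving_opp m1).
have := n2_ge0 h; case: (n2 h) => [r| |] //= r0.
  by rewrite -?EFinM -?EFinD -?EFinM lee_fin; lra.
by rewrite leey.
Qed.

(** Plancherel's constant is 2 pi; recombining even and odd parts with (a + b)^2 <= 2 a^2 + 2 b^2
    costs a factor 4. As 8 pi <= (2 pi)^2, this is still good enough for the constant 1 in
    [ft_lower]. *)
Lemma ft_bound psi g : L2 psi -> is_ft psi g -> (L2norm_sq g <= (8 * pi)%:E * L2norm_sq psi)%E.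
Proof.
move=> l hg; have [hp [hq [h1 h2 e]]] := ft_form l hg.
have lF := L2_ftr h1.1 h2.1; have lg := hg.1.
have [lp lq] := (h1.1, h2.1).
have b1 := hart_bound (L2_re l) h1; have b2 := hart_bound (L2_im l) h2.
rewrite L2norm_sqE; [|exact: (L2_re lg).1|exact: (L2_im lg).1].
rewrite (eq_n2_ae (L2_re lg).1 (L2_re lF).1 (ae_re e)) (eq_n2_ae (L2_im lg).1 (L2_im lF).1 (ae_im e)).
rewrite L2norm_sqE; [|exact: (L2_re l).1|exact: (L2_im l).1].
have c1 := n2B (measurable_ev lp.1) (measurable_od lq.1).
have c2 := n2D (measurable_ev lq.1) (measurable_od lp.1).
have d1 := n2_ev lp.1; have d2 := n2_od lp.1; have d3 := n2_ev lq.1; have d4 := n2_od lq.1.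
have [c1' c2'] : (n2 (re (ftr hp hq)) <= 2%:E * n2 (ev hp) + 2%:E * n2 (od hq))%E /\
  (n2 (im (ftr hp hq)) <= 2%:E * n2 (ev hq) + 2%:E * n2 (od hp))%E by [].
have [x1 x2 x3 x4] : [/\ L2r (ev hp), L2r (ev hq), L2r (od hp) & L2r (od hq)].
  by split; [exact: L2r_ev|exact: L2r_ev|exact: L2r_od|exact: L2r_od].
have fin (h : R -> R) : L2r h -> exists r, n2 h = r%:E by move=> hh; eexists; exact: n2_fin hh.
have [r1 E1] := fin _ (L2_re l); have [r2 E2] := fin _ (L2_im l); have [r3 E3] := fin _ lp; have [r4 E4] := fin _ lq.
have [r5 E5] := fin _ (L2_re lF); have [r6 E6] := fin _ (L2_im lF).
have [r7 E7] := fin _ x1; have [r8 E8] := fin _ x2; have [r9 E9] := fin _ x3; have [r0 E0] := fin _ x4.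
move: c1' c2' d1 d2 d3 d4 b1 b2; rewrite E1 E2 E3 E4 E5 E6 E7 E8 E9 E0.
rewrite -?EFinM -?EFinD -?EFinM !lee_fin; lra.
Qed.

(** Even and odd parts are transformed back separately by [hart_inv]. Using the same sign in the
    kernel both times leaves a reflection. *)
Lemma ft_inv psi g : L2 psi -> is_ft psi g -> is_ft g (fun x => (2 * pi)%:C%C * psi (- x)).
Proof.
move=> l hg; have [hp [hq [h1 h2 e]]] := ft_form l hg.
have [lp lq] := (h1.1, h2.1); have [l1 l2] := (L2_re l, L2_im l).
have i1 := hart_inv l1 h1; have i2 := hart_inv l2 h2.
have lF := L2_ftr lp lq.
have l' := L2Z (2 * pi) (L2_opp l).
suff H : is_ft (ftr hp hq) (fun x => (2 * pi)%:C%C * psi (- x)).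
  by apply: (ft_ael lF hg.1 _ H); apply: filterS e => x ->.
apply: (ft_of_form lF (L2_re l').1 (L2_im l').1 (hartB (L2r_ev lp) (L2r_od lq) (hart_ev lp i1) (hart_od lq i2))
  (hartD (L2r_ev lq) (L2r_od lp) (hart_ev lq i2) (hart_od lp i1))).
by apply: aeW => x; apply/complex_eqP; rewrite reZ imZ /= /ev /od /re /im opprK; split; field.
Qed.

Lemma ft_L1 psi : L1 (re psi) -> L1 (im psi) -> L2 psi ->
  is_ft psi (fun x => cintegral setT (fun y => psi y * cexpi (x * y))).
Proof.
move=> h1 h2 l; have := ft_hart l (hart_L1 h1 (L2_re l)) (hart_L1 h2 (L2_im l)).
by congr is_ft; apply/funext => x; rewrite ft_L1E.
Qed.

Lemma L2_0 : L2 (fun=> 0 : R[i]).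
Proof.
have l0 : L2r (fun=> 0 : R).
  split; first exact: measurable_cst.
  by rewrite /n2 (eq_integral (cst 0%E)) ?integral0 ?ltry// => x _; rewrite expr0n.
by apply/L2P.
Qed.

Lemma L2_L2integral (k : R -> R -> R[i]) : L2 (L2integral k).
Proof. by rewrite /L2integral; case: xgetP => [g _ []//|_]; exact: L2_0. Qed.

(** As soon as one L2 limit exists, [xget] selects a limit and not its default 0. *)
Lemma L2integral_cvg (k : R -> R -> R[i]) g : L2 g ->
  L2norm_sq (fun x => cintegral `[- N%:R, N%:R] (k x) - g x) @[N --> \oo] --> 0%E ->
  L2norm_sq (fun x => cintegral `[- N%:R, N%:R] (k x) - L2integral k x) @[N --> \oo] --> 0%E.
Proof.
move=> lg cg.
have := @xgetPex _ (fun=> 0) [set g | L2 g /\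
    L2norm_sq (fun x => cintegral `[- N%:R, N%:R] (k x) - g x)
      @[N --> \oo] --> 0%E]; case; first by exists g.
by move=> _; apply.
Qed.

Lemma L2_fourier f : L2 (fourier f). Proof. exact: L2_L2integral. Qed.

Lemma L2norm_sq_opp f : mf (re f) -> mf (im f) -> L2norm_sq (fun x => f (- x)) = L2norm_sq f.
Proof.
move=> m1 m2; have mo := @oppr_measurable R setT.
have e1 := @n2_leb_preserving _ _ (re f) leb_preserving_opp m1.
have e2 := @n2_leb_preserving _ _ (im f) leb_preserving_opp m2.
rewrite !L2norm_sqE//; first by congr (_ + _)%E.
  by apply: (measurableT_comp m1).
by apply: (measurableT_comp m2).
Qed.

Lemma fourier_spec f : L2 f -> is_ft f (fun x => fourier f (- x)).
Proof.
move=> lf; have [g hg] := ft_ex lf.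
pose k (xi x : R) := f x * cexpi (- (x * xi)).
have key (h : R -> R[i]) N : L2 h -> L2norm_sq (fun x => cintegral `[- N%:R, N%:R] (k x) - h x) =
    L2norm_sq (fun x => ftN f N x - h (- x)).
  move=> lh; have lh' := L2_opp lh.
  have [m1 m2] := measurable_ftN N lf.
  rewrite -[RHS]L2norm_sq_opp.
  - congr L2norm_sq; apply/funext => x; rewrite opprK; congr (_ - _); congr cintegral.
    by apply/funext => y; rewrite /k mulNr [y * x]mulrC.
  - have -> : re (fun x => ftN f N x - h (- x)) = (fun x => re (ftN f N) x - re (fun x => h (- x)) x) by apply/funext => x; exact: reB.
    exact: mf_sub m1 (L2_re lh').1.
  - have -> : im (fun x => ftN f N x - h (- x)) = (fun x => im (ftN f N) x - im (fun x => h (- x)) x) by apply/funext => x; exact: imB.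
    exact: mf_sub m2 (L2_im lh').1.
have lgo := L2_opp hg.1.
have c : L2norm_sq (fun x => cintegral `[- N%:R, N%:R] (k x) - g (- x)) @[N --> \oo] --> 0%E.
  rewrite (_ : (fun N => _) = (fun N => L2norm_sq (fun x => ftN f N x - g x))); first exact: hg.2.
  by apply/funext => N; rewrite (key (fun x => g (- x)))//; congr L2norm_sq; apply/funext => x; rewrite opprK.
have lF := L2_fourier f.
have c' := L2integral_cvg lgo c.
split; first exact: (L2_opp lF).
rewrite (_ : (fun N => _) = (fun N => L2norm_sq (fun x => cintegral `[- N%:R, N%:R] (k x) - L2integral k x))); first exact: c'.
by apply/funext => N; rewrite (key (fourier f)).
Qed.

Definition S1mult f t xi : R[i] := ((2 * pi)^-1)%:C%C * (cexpi (t * `|xi|) * fourier f xi).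

Lemma mf_mul_cexp (u : R -> R) f : mf u -> mf (re f) -> mf (im f) ->
  mf (re (fun x => cexpi (u x) * f x)) /\ mf (im (fun x => cexpi (u x) * f x)).
Proof.
move=> m0 m1 m2; split.
  have -> : re (fun x => cexpi (u x) * f x) = (fun x => cos (u x) * re f x - sin (u x) * im f x) by apply/funext => x; exact: reM.
  by mfun.
have -> : im (fun x => cexpi (u x) * f x) = (fun x => cos (u x) * im f x + sin (u x) * re f x) by apply/funext => x; exact: imM.
by mfun.
Qed.

Lemma normc_cexp (a : R) (z : R[i]) : Normc.normc (cexpi a * z) ^+ 2 = Normc.normc z ^+ 2.
Proof.
rewrite !normc_sq reM imM /=; have := cos2Dsin2 a.
set c := cos a; set s := sin a; move=> h.
transitivity ((c ^+ 2 + s ^+ 2) * (complex.Re z ^+ 2 + complex.Im z ^+ 2)); first by ring.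
by rewrite h mul1r.
Qed.

Lemma L2_mul_cexp (u : R -> R) f : mf u -> L2 f -> L2 (fun x => cexpi (u x) * f x).
Proof.
move=> m0 lf; have [m1 m2] := mf_mul_cexp m0 (L2_re lf).1 (L2_im lf).1.
split => //; case: lf => _ _; rewrite /L2norm_sq.
by under [X in _ -> (X < _)%E]eq_integral do rewrite normc_cexp.
Qed.

Lemma L2_S1mult f t : L2 (S1mult f t).
Proof. by apply: L2Z; apply: L2_mul_cexp; [mfun|exact: L2_fourier]. Qed.

(** [fourier f] lies in L2 for every [f], the default value 0 included, so the multiplied function
    always has an L2 transform and the choice in [S1] is always a genuine limit. *)
Lemma S1_spec f t : is_ft (S1mult f t) (S1 f t).
Proof.
have [g hg] := ft_ex (L2_S1mult f t).
have pi0 := pi_gt0 R.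
pose k (x xi : R) := cexpi (x * xi + t * `|xi|) * fourier f xi / ((2 * pi)%:C)%C.
have E x y : k x y = S1mult f t y * cexpi (x * y).
  rewrite /k cexpiD /S1mult.
  have -> : (((2 * pi)^-1)%:C)%C = ((2 * pi)%:C)%C^-1 :> R[i] by rewrite fmorphV.
  by move: ((2 * pi)%:C)%C^-1 => q; ring.
have key (h : R -> R[i]) : (fun N : nat => L2norm_sq (fun x => cintegral `[- N%:R, N%:R] (k x) - h x)) =
    (fun N => L2norm_sq (fun x => ftN (S1mult f t) N x - h x)).
  apply/funext => N; congr L2norm_sq; apply/funext => x; congr (_ - _); congr cintegral.
  by apply/funext => y; exact: E.
have c := hg.2; rewrite -key in c.
have c' := L2integral_cvg hg.1 c.
split; first exact: L2_L2integral.
have e : S1 f t = L2integral k by [].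
by rewrite e -(key (L2integral k)).
Qed.

End fourier_L2.

(** * From strong to weak estimates to convergence *)

Section sobolev.
Context {R : realType}.
Notation mu := (@lebesgue_measure R).
Notation mf := (measurable_fun setT).
Implicit Types (f phi : R -> R[i]) (s : R) (t : nat -> R).

Definition wt s (xi : R) : R := (1 + `|xi| ^+ 2) `^ s.
Definition W s phi : \bar R := (\int[mu]_xi (wt s xi * Normc.normc (phi xi) ^+ 2)%:E)%E.

Lemma wt_ge1 s xi : 0 <= s -> 1 <= wt s xi.
Proof.
move=> s0; rewrite /wt -[leLHS](powRr0 (1 + `|xi| ^+ 2)); apply: ler_powR => //.
by rewrite lerDl sqr_ge0.
Qed.

Lemma wt_ge0 s xi : 0 <= wt s xi. Proof. exact: powR_ge0. Qed.

Lemma measurable_wt s : mf (wt s).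
Proof. by rewrite /wt; mfun. Qed.

Lemma measurable_normc_sq f : mf (re f) -> mf (im f) -> mf (fun x => Normc.normc (f x) ^+ 2).
Proof.
move=> m1 m2; under eq_fun do rewrite normc_sq.
exact: (measurable_funD (measurable_funX 2 m1) (measurable_funX 2 m2)).
Qed.

Lemma normc_ge0 (z : R[i]) : 0 <= Normc.normc z.
Proof. by case: z => a b; exact: sqrtr_ge0. Qed.

Lemma measurable_normc f : mf (re f) -> mf (im f) -> mf (fun x => Normc.normc (f x)).
Proof.
move=> m1 m2; have -> : (fun x => Normc.normc (f x)) = (fun x => Num.sqrt (Normc.normc (f x) ^+ 2)).
  by apply/funext => x; rewrite sqrtr_sqr ger0_norm ?normc_ge0.
apply: (measurableT_comp (continuous_measurable_fun (@sqrt_continuous R))).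
exact: measurable_normc_sq.
Qed.

Lemma sqrte_sq (x : \bar R) : (0 <= x)%E -> ((x `^ 2^-1) ^+ 2 = x)%E.
Proof. by move=> x0; rewrite poweR12_sqrt// sqr_sqrte. Qed.

Lemma W_ge0 s phi : (0 <= W s phi)%E.
Proof. by apply: int_ge0 => x; rewrite mulr_ge0 ?wt_ge0 ?sqr_ge0. Qed.

Lemma Hnorm_sq s f : (Hnorm s f ^+ 2 = W s (fourier f))%E.
Proof. by rewrite /Hnorm sqrte_sq// W_ge0. Qed.

Lemma Hnorm_ge0 s f : (0 <= Hnorm s f)%E.
Proof. exact: poweR_ge0. Qed.

Lemma W_lty s f : (Hnorm s f < +oo)%E -> (W s (fourier f) < +oo)%E.
Proof.
rewrite -Hnorm_sq; have := Hnorm_ge0 s f; case: (Hnorm s f) => [r| |]//= _ _.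
by rewrite -EFinM ltry.
Qed.

Lemma lty_Hnorm s f : (W s (fourier f) < +oo)%E -> (Hnorm s f < +oo)%E.
Proof.
rewrite -Hnorm_sq; have := Hnorm_ge0 s f; case: (Hnorm s f) => [r _ _| |//]; first exact: ltry.
by move=> _; rewrite expe2 mulyy.
Qed.

Lemma Lnorm2_sq (g : R -> \bar R) : (forall x, 0 <= g x)%E -> ('N[mu]_2[g] ^+ 2 = \int[mu]_x (g x) ^+ 2)%E.
Proof.
move=> g0; rewrite unlock.
have I0 : (0 <= \int[mu]_x (g x) ^+ 2)%E by apply: integral_ge0 => x _; rewrite expe_ge0.
transitivity (((\int[mu]_x (g x) ^+ 2) `^ 2^-1) ^+ 2)%E; last exact: sqrte_sq.
congr ((_ `^ _) ^+ 2)%E; apply: eq_integral => x _; rewrite gee0_abs//.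
have := g0 x; case: (g x) => [r| |]// r0.
  by rewrite expe2 poweR_EFin -EFinM; congr EFin; rewrite -expr2; exact: (powR_mulrn 2).
by rewrite poweRyr// expe2 mulyy.
Qed.

Lemma measurable_S1 f (a : R) : mf (re (S1 f a)) /\ mf (im (S1 f a)).
Proof. by have [/L2P[[m1 _] [m2 _]] _] := S1_spec f a. Qed.

Lemma maximalS1_ge0 t f x : (0 <= maximalS1 t f x)%E.
Proof.
apply: (@le_trans _ _ (Normc.normc (S1 f (t 0%N) x))%:E); first by rewrite lee_fin normc_ge0.
by apply: ereal_sup_ubound; exists 0%N.
Qed.

Lemma measurable_maximalS1 t f : mf (maximalS1 t f).
Proof.
have -> : maximalS1 t f = (fun x => esups (fun n => (Normc.normc (S1 f (t n) x))%:E) 0%N).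
  apply/funext => x; congr ereal_sup; apply/seteqP; split => y.
    by move=> [n _ <-]; exists n.
  by move=> [n _ <-]; exists n.
apply: (@measurable_fun_esups _ _ _ setT (fun n x => (Normc.normc (S1 f (t n) x))%:E)) => n.
by apply: emf; have [m1 m2] := measurable_S1 f (t n); exact: measurable_normc.
Qed.

Lemma markov2 (g : R -> \bar R) (alpha : R) : mf g -> (forall x, 0 <= g x)%E -> 0 < alpha ->
  (mu [set x | alpha%:E < g x] <= (alpha ^- 2)%:E * \int[mu]_x (g x) ^+ 2)%E.
Proof.
move=> mg g0 a0; set A := [set x | _].
have mA : measurable A by rewrite -[A]setTI; exact: emeasurable_fun_o_infty.
have a2 : 0 < alpha ^+ 2 by rewrite exprn_gt0.
rewrite -lee_pdivrMl ?invr_gt0// invrK.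
apply: (@le_trans _ _ (\int[mu]_(x in A) (alpha ^+ 2)%:E)%E); first by rewrite integral_cst.
apply: (@le_trans _ _ (\int[mu]_(x in A) (g x) ^+ 2)%E).
  apply: ge0_le_integral => //.
  - by move=> x _; rewrite lee_fin ltW.
  - under eq_fun do rewrite expe2; apply: measurable_funTS; exact: emeasurable_funM.
  - move=> x Ax; rewrite -[X in (X <= _)%E]/(alpha%:E ^+ 2)%E lee_sqr ?lee_fin ?(ltW a0)//; exact: ltW Ax.
apply: (@ge0_subset_integral _ _ _ mu A setT) => //.
- by under eq_fun do rewrite expe2; exact: emeasurable_funM.
- by move=> x _; rewrite expe_ge0.
Qed.

Lemma strong_weak s t (C1 : R) :
  (forall f, Hs s f -> ('N[mu]_2[maximalS1 t f] <= C1%:E * Hnorm s f)%E) ->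
  exists C2 : R, forall f, Hs s f ->
         forall B : set R, measurable B ->
         (forall x y, B x -> B y -> `|x - y| <= 1) ->
         forall alpha : R, 0 < alpha ->
         (lebesgue_measure [set x | B x /\ (alpha%:E < maximalS1 t f x)%E]
            <= (C2 * alpha ^- 2)%:E * Hnorm s f ^+ 2)%E.
Proof.
move=> H; exists (C1 ^+ 2) => f hf B mB _ alpha a0.
have mm := measurable_maximalS1 t f.
have mA : measurable [set x | (alpha%:E < maximalS1 t f x)%E].
  by rewrite -[X in measurable X]setTI; exact: emeasurable_fun_o_infty.
apply: (@le_trans _ _ (mu [set x | (alpha%:E < maximalS1 t f x)%E])).
  apply: le_measure; rewrite ?inE//; last by move=> x [].
  exact: measurableI.
apply: le_trans (markov2 mm (maximalS1_ge0 t f) a0) _.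
rewrite -Lnorm2_sq; last exact: maximalS1_ge0.
rewrite [(C1 ^+ 2 * _)%R]mulrC EFinM -muleA; apply: lee_wpmul2l.
  by rewrite lee_fin invr_ge0 exprn_ge0 ?ltW.
have N0 : (0 <= 'N[mu]_2[maximalS1 t f])%E by exact: Lnorm_ge0.
have h := H f hf.
have h0 := le_trans N0 h.
have -> : ((C1 ^+ 2)%:E * Hnorm s f ^+ 2 = (C1%:E * Hnorm s f) ^+ 2)%E.
  by rewrite !expe2 expr2 EFinM muleACA.
by rewrite lee_sqr.
Qed.

Lemma Rint_dominated (F : nat -> R -> R) (G g : R -> R) : (forall n, mf (F n)) -> mf G -> L1 g ->
  (forall n x, `|F n x| <= g x) -> (forall x, F n x @[n --> \oo] --> G x) ->
  \int[mu]_x F n x @[n --> \oo] --> \int[mu]_x G x.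
Proof.
move=> mF mG lg Fg FG.
have lF n : L1 (F n) by apply: le_L1 lg _.
have /(_ _ _ _)[//|||||iG _ H] := @dominated_convergence _ _ _ mu setT measurableT
    (fun n y => (F n y)%:E) (fun y => (G y)%:E) (fun y => (g y)%:E).
- by move=> n; exact: emf.
- exact: emf.
- by apply: aeW => y _; apply: cvg_EFin; [exact: nearW|exact: FG].
- exact: lg.
- by apply: aeW => y n _; rewrite /= lee_fin; exact: Fg.
by apply: fine_cvg; move: H; rewrite (L1_int iG).
Qed.

Definition cutC m phi : R -> R[i] := fun x => ((cut m (re phi) x) +i* (cut m (im phi) x))%C.

Lemma L2_cutC m phi : L2 phi -> L2 (cutC m phi).
Proof. by move=> /L2P[l1 l2]; apply/L2P; split; exact: L2r_cut. Qed.

Definition mult1 (a : R) phi xi : R[i] := ((2 * pi)^-1)%:C%C * (cexpi (a * `|xi|) * phi xi).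
(** For integrable frequency data [phi] this is the wave at time [a] as an absolutely convergent
    integral. It has a definite value at every x, which gives access to pointwise limits in [a]. *)
Definition U (a : R) phi x : R[i] := cintegral setT (fun y => mult1 a phi y * cexpi (x * y)).

Lemma L2_mult1 a phi : L2 phi -> L2 (mult1 a phi).
Proof. by move=> l; apply: L2Z; apply: L2_mul_cexp => //; mfun. Qed.

Lemma L1_mul_cexp (u : R -> R) phi : mf u -> L1 (re phi) -> L1 (im phi) ->
  L1 (re (fun x => cexpi (u x) * phi x)) /\ L1 (im (fun x => cexpi (u x) * phi x)).
Proof.
move=> m0 l1 l2; have [m1 m2] := (L1_mf l1, L1_mf l2).
have cc : forall x, `|cos (u x)| <= 1 by move=> x; rewrite ler_norml cos_geN1 cos_le1.
have ss : forall x, `|sin (u x)| <= 1 by move=> x; rewrite ler_norml sin_geN1 sin_le1.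
have mc : mf (fun x => cos (u x)) by mfun.
have ms : mf (fun x => sin (u x)) by mfun.
split.
  have -> : re (fun x => cexpi (u x) * phi x) = (fun x => re phi x * cos (u x) - im phi x * sin (u x)).
    by apply/funext => x; rewrite /re reM /= -/(re phi x); rewrite mulrC [sin _ * _]mulrC.
  by apply: L1B; [exact: L1_bdd l1 mc cc|exact: L1_bdd l2 ms ss].
have -> : im (fun x => cexpi (u x) * phi x) = (fun x => im phi x * cos (u x) + re phi x * sin (u x)).
  by apply/funext => x; rewrite /im imM /= -/(im phi x); rewrite mulrC [sin _ * _]mulrC.
by apply: L1D; [exact: L1_bdd l2 mc cc|exact: L1_bdd l1 ms ss].
Qed.

Lemma L1_mult1 a phi : L1 (re phi) -> L1 (im phi) -> L1 (re (mult1 a phi)) /\ L1 (im (mult1 a phi)).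
Proof.
move=> l1 l2; have m0 : mf (fun xi : R => a * `|xi|) by mfun.
have [h1 h2] := L1_mul_cexp m0 l1 l2.
split.
  have -> : re (mult1 a phi) = (fun x => (2 * pi)^-1 * re (fun xi => cexpi (a * `|xi|) * phi xi) x) by apply/funext => x; exact: reZ.
  exact: L1Z.
have -> : im (mult1 a phi) = (fun x => (2 * pi)^-1 * im (fun xi => cexpi (a * `|xi|) * phi xi) x) by apply/funext => x; exact: imZ.
exact: L1Z.
Qed.

Lemma ft_U a phi : L1 (re phi) -> L1 (im phi) -> L2 phi -> is_ft (mult1 a phi) (U a phi).
Proof.
move=> l1 l2 l; have [h1 h2] := L1_mult1 a l1 l2.
exact: ft_L1 h1 h2 (L2_mult1 a l).
Qed.

Lemma U_re a phi x : complex.Re (U a phi x) =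
  \int[mu]_y ((2 * pi)^-1 * (cos (x * y + a * `|y|) * re phi y - sin (x * y + a * `|y|) * im phi y)).
Proof.
apply: eq_Rintegral => y _; rewrite /mult1 -mulrA reZ [_ * cexpi _]mulrC mulrA -cexpiD reM //.
Qed.

Lemma U_im a phi x : complex.Im (U a phi x) =
  \int[mu]_y ((2 * pi)^-1 * (cos (x * y + a * `|y|) * im phi y + sin (x * y + a * `|y|) * re phi y)).
Proof.
apply: eq_Rintegral => y _; rewrite /mult1 -mulrA imZ [_ * cexpi _]mulrC mulrA -cexpiD imM //.
Qed.

Lemma U_cvg t phi x : L1 (re phi) -> L1 (im phi) -> t n @[n --> \oo] --> (0 : R) ->
  complex.Re (U (t n) phi x) @[n --> \oo] --> complex.Re (U 0 phi x) /\
  complex.Im (U (t n) phi x) @[n --> \oo] --> complex.Im (U 0 phi x).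
Proof.
move=> l1 l2 t0; have [m1 m2] := (L1_mf l1, L1_mf l2).
have pi0 : 0 <= (2 * pi)^-1 :> R by rewrite invr_ge0 pi2_ge0.
have lg : L1 (fun y => (2 * pi)^-1 * (`|re phi y| + `|im phi y|)).
  by apply: L1Z; apply: L1D; exact: L1_norm.
have arg y : x * y + t n * `|y| @[n --> \oo] --> x * y + 0 * `|y|.
  by apply: cvgD; [exact: cvg_cst|apply: cvgM => //; exact: cvg_cst].
have ct y : cos (x * y + t n * `|y|) @[n --> \oo] --> cos (x * y + 0 * `|y|).
  by apply: (cvg_comp _ _ (arg y)); exact: continuous_cos.
have st y : sin (x * y + t n * `|y|) @[n --> \oo] --> sin (x * y + 0 * `|y|).
  by apply: (cvg_comp _ _ (arg y)); exact: continuous_sin.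
have bd (a b c d : R) : `|a| <= 1 -> `|b| <= 1 -> `|a * c + b * d| <= `|c| + `|d|.
  move=> a1 b1; rewrite (le_trans (ler_normD _ _))// !normrM lerD// ler_piMl//.
have c1 (z : R) : `|cos z| <= 1 by rewrite ler_norml cos_geN1 cos_le1.
have s1 (z : R) : `|sin z| <= 1 by rewrite ler_norml sin_geN1 sin_le1.
split; [rewrite U_re; under eq_fun do rewrite U_re|rewrite U_im; under eq_fun do rewrite U_im].
  apply: (Rint_dominated _ _ lg) => [n||n y|y].
  - by mfun.
  - by mfun.
  - rewrite normrM (ger0_norm pi0) ler_wpM2l// -mulNr; apply: bd; rewrite ?normrN//.
  - by apply: cvgMr; apply: cvgB; apply: cvgMl.
apply: (Rint_dominated _ _ lg) => [n||n y|y].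
- by mfun.
- by mfun.
- by rewrite normrM (ger0_norm pi0) ler_wpM2l// [leRHS]addrC; apply: bd.
- by apply: cvgMr; apply: cvgD; apply: cvgMl.
Qed.

End sobolev.

(** * Frequency truncation and almost everywhere convergence *)

Section weak_to_convergence.
Context {R : realType}.
Notation mu := (@lebesgue_measure R).
Notation mf := (measurable_fun setT).
Implicit Types (f phi : R -> R[i]) (s : R) (t : nat -> R).

Definition tailC m phi : R -> R[i] := fun x => phi x - cutC m phi x.

Lemma ft_Ucut (a : R) m phi : L2 phi -> is_ft (mult1 a (cutC m phi)) (U a (cutC m phi)).
Proof.
move=> l; apply: ft_U; [exact: (L1_cut m (L2_re l))|exact: (L1_cut m (L2_im l))|exact: L2_cutC].
Qed.

(** At time 0, [U] is the inverse Fourier transform, so this keeps the frequencies of [f] in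
    [-m, m]. *)
Definition low m f : R -> R[i] := U 0 (cutC m (fourier f)).

Lemma L2_low m f : L2 (low m f).
Proof.
have l := L2_fourier f; have lc := L2_cutC m l.
by have [] := ft_Ucut 0 m l.
Qed.

Lemma mult1_0 phi : mult1 0 phi = (fun xi => ((2 * pi)^-1)%:C%C * phi xi).
Proof.
apply/funext => xi; rewrite /mult1 mul0r; congr (_ * _).
by rewrite /cexpi cos0 sin0 mul1r.
Qed.

Lemma twopiK (z : R[i]) : (2 * pi)%:C%C * (((2 * pi)^-1)%:C%C * z) = z.
Proof.
apply/complex_eqP; rewrite !reZ !imZ !mulrA divff ?mul1r//.
by rewrite mulf_neq0// gt_eqF// pi_gt0.
Qed.

Lemma fourier_low m f : {ae mu, forall xi, fourier (low m f) xi = cutC m (fourier f) xi}.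
Proof.
have l := L2_fourier f; have lc := L2_cutC m l.
have h := ft_Ucut 0 m l.
have h1 := ft_inv (L2_mult1 0 lc) h.
have h2 := fourier_spec (L2_low m f).
have := ae_leb_preserving leb_preserving_opp (ft_uniq (L2_low m f) h2 h1).
apply: filterS => x; rewrite opprK => ->.
by rewrite mult1_0 twopiK.
Qed.

Definition high m f : R -> R[i] := fun x => f x - low m f x.

Lemma L2_high m f : L2 f -> L2 (high m f).
Proof. by move=> lf; apply: L2B => //; exact: L2_low. Qed.

Lemma L2_tailC m phi : L2 phi -> L2 (tailC m phi).
Proof. by move=> l; apply: L2B => //; exact: L2_cutC. Qed.

Lemma fourier_high m f : L2 f -> {ae mu, forall xi, fourier (high m f) xi = tailC m (fourier f) xi}.
Proof.
move=> lf; have lh := L2_high m lf; have ll := L2_low m f.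
have h1 := ftB lf ll (fourier_spec lf) (fourier_spec ll).
have h2 := fourier_spec lh.
have e := ae_leb_preserving leb_preserving_opp (ft_uniq lh h2 h1).
by apply: filterS2 e (fourier_low m f) => x; rewrite opprK /tailC => -> ->.
Qed.

Lemma S1_high m f (a : R) : L2 f ->
  {ae mu, forall x, S1 (high m f) a x = S1 f a x - U a (cutC m (fourier f)) x}.
Proof.
move=> lf; have l := L2_fourier f; have lc := L2_cutC m l.
have h := ft_Ucut a m l.
have h1 := ftB (L2_S1mult f a) (L2_mult1 a lc) (S1_spec f a) h.
apply: (ft_uniq (L2_S1mult (high m f) a) (S1_spec (high m f) a)).
apply: (ft_ael _ (L2_S1mult (high m f) a) _ h1).
  exact: (L2B (L2_S1mult f a) (L2_mult1 a lc)).
apply: filterS (fourier_high m lf) => x; rewrite /S1mult /mult1 => ->.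
by rewrite /tailC -mulrBr -mulrBr.
Qed.

Lemma normc_sq_tailC m phi x : Normc.normc (tailC m phi x) ^+ 2 = Normc.normc (phi x) ^+ 2 * (1 - \1_(itvN m) x).
Proof.
rewrite !normc_sq reB imB /cutC /cut /= -/(re phi x) -/(im phi x) indicE.
by case: (_ \in _); rewrite ?mulr1 ?mulr0 ?subrr ?subr0 ?mulr0 ?mulr1 ?expr0n ?addr0//=.
Qed.

Lemma W_tail s phi : L2 phi -> (W s phi < +oo)%E -> W s (tailC m phi) @[m --> \oo] --> 0%E.
Proof.
move=> l h; have [[m1 _] [m2 _]] := (L2_re l, L2_im l).
have mW : mf (fun x => wt s x * Normc.normc (phi x) ^+ 2).
  have := @measurable_wt R s => ?; have := measurable_normc_sq m1 m2 => ?.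
  exact: measurable_funM.
have mI m := @measurable_indic_itv R `[- m%:R, m%:R].
have W0 x : 0 <= wt s x * Normc.normc (phi x) ^+ 2 by rewrite mulr_ge0 ?wt_ge0 ?sqr_ge0.
have /(_ _ _ _)[//|||||_ _ H] := @dominated_convergence _ _ _ mu setT measurableT
    (fun m x => (wt s x * Normc.normc (phi x) ^+ 2 * (1 - \1_(itvN m) x))%:E) (cst 0%E)
    (fun x => (wt s x * Normc.normc (phi x) ^+ 2)%:E).
- by move=> m; apply: emf; have := mI m => ?; rewrite /itvN; apply: measurable_funM => //; mfun.
- exact: measurable_cst.
- apply: aeW => x _; apply: cvg_EFin; first exact: nearW.
  apply: cvg_near_cst; have [k hk] : exists k : nat, `|x| <= k%:R.
    by exists (Num.truncn `|x|).+1; apply/ltW; exact: truncnS_gt.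
  exists k => // n /= kn; rewrite indicE mem_set ?subrr ?mulr0//.
  by rewrite /itvN /= in_itv /= -ler_norml (le_trans hk)// ler_nat.
- by apply/L1P; split => //; under eq_integral do rewrite ger0_norm//.
- apply: aeW => x m _; rewrite /= lee_fin.
  have /andP[i0 i1] := indic01 (itvN m) x.
  rewrite normrM (ger0_norm (W0 x)); apply: ler_piMr => //.
  by rewrite ler_norml; apply/andP; split; lra.
move: H; rewrite integral0; apply: cvg_trans; apply: near_eq_cvg; apply: nearW => m.
rewrite /W /=; apply: eq_integral => x _.
by rewrite normc_sq_tailC -mulrA.
Qed.

Lemma W_ae s f phi : mf (re f) -> mf (im f) -> mf (re phi) -> mf (im phi) ->
  {ae mu, forall xi, f xi = phi xi} -> W s f = W s phi.
Proof.
move=> m1 m2 m3 m4 e; have mw := @measurable_wt R s.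
apply: eq_int_ae.
- by apply: measurable_funM => //; exact: measurable_normc_sq.
- by apply: measurable_funM => //; exact: measurable_normc_sq.
- by apply: filterS e => x ->.
Qed.

Lemma L2norm_le_W s phi : 0 <= s -> mf (re phi) -> mf (im phi) -> (L2norm_sq phi <= W s phi)%E.
Proof.
move=> s0 m1 m2; have mw := @measurable_wt R s; have mn := measurable_normc_sq m1 m2.
apply: le_int => //; first exact: measurable_funM.
  by move=> x; rewrite sqr_ge0.
by move=> x; rewrite ler_peMl ?sqr_ge0 ?wt_ge1.
Qed.

Lemma L2norm_high m f s : 0 <= s -> L2 f -> (L2norm_sq (high m f) <= 4%:E * W s (tailC m (fourier f)))%E.
Proof.
move=> s0 lf; have lh := L2_high m lf.
have h1 := fourier_spec lh; have h2 := ft_inv lh h1.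
have lF := L2_fourier (high m f).
have b := ft_bound (L2_opp lF) h2.
have [[n1 _] [n2' _]] := (L2_re lh, L2_im lh).
have [[k1 _] [k2 _]] := (L2_re lF, L2_im lF).
have lt := L2_tailC m (L2_fourier f).
rewrite L2norm_sq_opp// in b.
have e : L2norm_sq (fun x => (2 * pi)%:C%C * high m f (- x)) = (((2 * pi) ^+ 2)%:E * L2norm_sq (high m f))%E.
  have lo := L2_opp lh.
  have -> : L2norm_sq (high m f) = L2norm_sq (fun x => high m f (- x)) by rewrite L2norm_sq_opp.
  rewrite /L2norm_sq -intZ ?sqr_ge0//; last 2 first.
  - exact: (measurable_normc_sq (L2_re lo).1 (L2_im lo).1).
  - by move=> x; rewrite sqr_ge0.
  apply: eq_integral => x _; rewrite !normc_sq reZ imZ; congr EFin; ring.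
rewrite e in b.
have b2 : (L2norm_sq (fourier (high m f)) <= W s (tailC m (fourier f)))%E.
  apply: (@le_trans _ _ (W s (fourier (high m f)))); first exact: L2norm_le_W.
  by rewrite (W_ae s k1 k2 (L2_re lt).1 (L2_im lt).1 (fourier_high m lf)).
have pi2 := pi_ge2 R.
have p0 : 0 < (2 * pi) ^+ 2 :> R by rewrite exprn_gt0// mulr_gt0//; lra.
rewrite -(@lee_pmul2l _ ((2 * pi) ^+ 2)%:E)//.
apply: (le_trans b).
apply: (@le_trans _ _ ((8 * pi)%:E * W s (tailC m (fourier f)))%E).
  by apply: lee_wpmul2l => //; rewrite lee_fin; lra.
rewrite muleA -EFinM; apply: lee_wpmul2r; first exact: W_ge0.
by rewrite lee_fin; nra.
Qed.

Lemma negligible_small (A : nat -> set R) : (forall m, measurable (A m)) ->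
  (forall e : R, 0 < e -> exists m, (mu (A m) <= e%:E)%E) ->
  mu.-negligible (\bigcap_m A m).
Proof.
move=> mA h; have mI : measurable (\bigcap_m A m) by exact: bigcapT_measurable.
apply/negligibleP => //; apply/eqP; rewrite eq_le measure_ge0 andbT.
apply/lee_addgt0Pr => e e0; rewrite add0e; have [m hm] := h e e0.
apply: le_trans hm; apply: le_measure; rewrite ?inE//; first exact: mA.
by move=> x; exact.
Qed.

Lemma normc_tri (z w : R[i]) : Normc.normc (z + w) <= Normc.normc z + Normc.normc w.
Proof. exact: (@le_normcD R z w). Qed.

Lemma U_cvgC t phi x : L1 (re phi) -> L1 (im phi) -> t n @[n --> \oo] --> (0 : R) ->
  Normc.normc (U (t n) phi x - U 0 phi x) @[n --> \oo] --> (0 : R).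
Proof.
move=> l1 l2 t0; have [h1 h2] := U_cvg x l1 l2 t0.
pose d1 n := complex.Re (U (t n) phi x) - complex.Re (U 0 phi x).
pose d2 n := complex.Im (U (t n) phi x) - complex.Im (U 0 phi x).
have -> : (fun n => Normc.normc (U (t n) phi x - U 0 phi x)) = (fun n => Num.sqrt (d1 n * d1 n + d2 n * d2 n)).
  by apply/funext => n; rewrite /d1 /d2 -reB -imB -!expr2 -normc_sq sqrtr_sqr ger0_norm// normc_ge0.
have c1 : d1 n @[n --> \oo] --> (0 : R) by apply/subr_cvg0.
have c2 : d2 n @[n --> \oo] --> (0 : R) by apply/subr_cvg0.
have c3 : d1 n * d1 n + d2 n * d2 n @[n --> \oo] --> (0 * 0 + 0 * 0 : R) by apply: cvgD; apply: cvgM.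
rewrite mul0r addr0 in c3.
by have := cvg_comp _ _ c3 (@sqrt_continuous R 0); rewrite sqrtr0.
Qed.

(** Off [X m] and [Y m] the error splits into S^1 of the high part, the difference of the
    band-limited part at times t_n and 0, and minus the high part; each is at most e for large n.
    The measure of the two exceptional sets tends to 0 with the energy of the tail, so almost every
    point escapes them for some m. *)
Lemma weak_local_conv s t (C2 : R) f (B : set R) (e : R) : 0 <= s -> t n @[n --> \oo] --> (0 : R) ->
  Hs s f -> measurable B ->
  (forall g, Hs s g -> forall alpha : R, 0 < alpha ->
    (mu [set x | B x /\ (alpha%:E < maximalS1 t g x)%E] <= (C2 * alpha ^- 2)%:E * Hnorm s g ^+ 2)%E) ->
  0 < e ->
  {ae mu, forall x, B x -> \forall n \near \oo, Normc.normc (S1 f (t n) x - f x) <= 3 * e}.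
Proof.
move=> s0 t0 [lf hW] mB H e0; set phi := fourier f.
have lphi : L2 phi := L2_fourier f.
have Wphi := W_lty hW.
have lh m : L2 (high m f) := L2_high m lf.
have Wh m : W s (fourier (high m f)) = W s (tailC m phi).
  have lF := L2_fourier (high m f); have lt := L2_tailC m lphi.
  by apply: W_ae; [exact: (L2_re lF).1|exact: (L2_im lF).1|exact: (L2_re lt).1|exact: (L2_im lt).1|exact: fourier_high].
have hWt := W_tail lphi Wphi.
have Wfin m : (W s (tailC m phi) < +oo)%E.
  apply: le_lt_trans Wphi; have lt := L2_tailC m lphi.
  have mw := @measurable_wt R s.
  apply: le_int.
  - by apply: measurable_funM => //; exact: (measurable_normc_sq (L2_re lt).1 (L2_im lt).1).
  - by apply: measurable_funM => //; exact: (measurable_normc_sq (L2_re lphi).1 (L2_im lphi).1).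
  - by move=> x; rewrite mulr_ge0 ?wt_ge0 ?sqr_ge0.
  - move=> x; apply: ler_wpM2l; first exact: wt_ge0.
    rewrite normc_sq_tailC; apply: ler_piMr; first exact: sqr_ge0.
    by have /andP[i0 i1] := indic01 (itvN m) x; lra.
have hs m : Hs s (high m f) by split; [exact: lh|apply: lty_Hnorm; rewrite Wh; exact: Wfin].
pose X m := [set x | B x /\ (e%:E < maximalS1 t (high m f) x)%E].
pose Y m := [set x | (e%:E < (Normc.normc (high m f x))%:E)%E].
have mY m : mf (fun x => (Normc.normc (high m f x))%:E).
  by apply: emf; apply: measurable_normc; [exact: (L2_re (lh m)).1|exact: (L2_im (lh m)).1].
have mX m : measurable (X m).
  apply: measurableI => //; rewrite -[X in measurable X]setTI; apply: emeasurable_fun_o_infty => //.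
  exact: measurable_maximalS1.
have mYm m : measurable (Y m) by rewrite -[X in measurable X]setTI; exact: emeasurable_fun_o_infty.
have small : forall d : R, 0 < d -> exists m, (mu (X m `|` Y m) <= d%:E)%E.
  move=> d d0.
  (* The weak-type constant at height e, plus Chebyshev's inequality for the high part itself with
     the factor 4 of [L2norm_high]; the final 1 makes [K] positive. *)
  pose K := `|C2| * e ^- 2 + e ^- 2 * 4 + 1.
  have e2 : 0 < e ^- 2 by rewrite invr_gt0 exprn_gt0.
  have K0 : 0 < K by rewrite /K ltr_pwDr// addr_ge0// mulr_ge0// ltW.
  have [m hm] : exists m, (W s (tailC m phi) <= (d / K)%:E)%E.
    have /fine_cvgP[_ /cvgrPdist_le/(_ (d / K))] := hWt.
    have dK : 0 < d / K by rewrite divr_gt0.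
    move=> /(_ dK) hh; have [m hm] := filter_ex hh; exists m.
    move: hm; rewrite /= sub0r normrN ger0_norm ?fine_ge0 ?W_ge0// -lee_fin fineK//.
    by rewrite ge0_fin_numE ?W_ge0.
  exists m.
  apply: (@le_trans _ _ (mu (X m) + mu (Y m))%E).
    by apply: (@measureU2 _ _ _ mu); [exact: mX|exact: mYm].
  have [w hw] : exists w : R, W s (tailC m phi) = w%:E.
    by exists (fine (W s (tailC m phi))); rewrite fineK// ge0_fin_numE ?W_ge0.
  have w0 : 0 <= w by rewrite -lee_fin -hw W_ge0.
  apply: (@le_trans _ _ ((`|C2| * e ^- 2 * w)%:E + (e ^- 2 * 4 * w)%:E)%E).
    apply: leeD.
      apply: le_trans (H _ (hs m) e e0) _; rewrite Hnorm_sq Wh hw -EFinM lee_fin.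
      by rewrite ler_wpM2r// ler_wpM2r ?(ltW e2)// ler_norm.
    have := markov2 (mY m) _ e0; move=> /(_ _)/le_trans; apply.
      by move=> x; rewrite lee_fin normc_ge0.
    rewrite -mulrA EFinM; apply: lee_wpmul2l; first by rewrite lee_fin ltW.
    apply: le_trans (L2norm_high m s0 lf) _.
    by rewrite hw -EFinM.
  rewrite -EFinD lee_fin -mulrDl.
  move: hm; rewrite hw lee_fin ler_pdivlMr// => hm; apply: le_trans hm.
  by rewrite mulrC ler_wpM2l// /K lerDl.
have neg := negligible_small (fun m => measurableU _ _ (mX m) (mYm m)) small.
have aeS : {ae mu, forall x, forall m n, S1 (high m f) (t n) x = S1 f (t n) x - U (t n) (cutC m phi) x}.
  by apply: ae_foralln => m; apply: ae_foralln => n; exact: S1_high.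
have aeN : {ae mu, forall x, ~ (\bigcap_m (X m `|` Y m)) x}.
  by apply: negligibleS neg => x /= /contrapT.
apply: filterS2 aeS aeN => x hS hN Bx.
have [m hm] : exists m, ~ (X m `|` Y m) x.
  by apply: contrapT => h; apply: hN => m _; apply: contrapT => hh; apply: h; exists m.
have hX : (maximalS1 t (high m f) x <= e%:E)%E by rewrite leNgt; apply/negP => h; apply: hm; left.
have hY : Normc.normc (high m f x) <= e by rewrite leNgt; apply/negP => h; apply: hm; right; rewrite /Y /= lte_fin.
have := @U_cvgC t (cutC m phi) x (L1_cut m (L2_re lphi)) (L1_cut m (L2_im lphi)) t0.
move=> /cvgrPdist_le/(_ e e0); apply: filterS => n.
rewrite sub0r normrN ger0_norm ?normc_ge0// => hU.
have -> : S1 f (t n) x - f x = S1 (high m f) (t n) x + ((U (t n) (cutC m phi) x - U 0 (cutC m phi) x) + - high m f x).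
  by rewrite hS /high /low -/phi; ring.
apply: le_trans (normc_tri _ _) _.
have h1 : Normc.normc (S1 (high m f) (t n) x) <= e.
  by rewrite -lee_fin; apply: le_trans hX; apply: ereal_sup_ubound; exists n.
have h2 := normc_tri (U (t n) (cutC m phi) x - U 0 (cutC m phi) x) (- high m f x).
have h3 : Normc.normc (- high m f x) = Normc.normc (high m f x) by exact: normcN.
rewrite h3 in h2; lra.
Qed.

Lemma weak_conv s t (C2 : R) : 0 <= s -> t n @[n --> \oo] --> (0 : R) ->
  (forall f, Hs s f ->
         forall B : set R, measurable B ->
         (forall x y, B x -> B y -> `|x - y| <= 1) ->
         forall alpha : R, 0 < alpha ->
         (lebesgue_measure [set x | B x /\ (alpha%:E < maximalS1 t f x)%E]
            <= (C2 * alpha ^- 2)%:E * Hnorm s f ^+ 2)%E) ->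
  forall f, Hs s f -> {ae lebesgue_measure, forall x : R,
            Normc.normc (S1 f (t n) x - f x) @[n --> \oo] --> (0 : R)}.
Proof.
move=> s0 t0 H f hf.
(* Unit intervals starting at all integers, written as differences of natural numbers so that the
   null sets are indexed by [nat]. *)
pose B (a b : nat) : set R := `[a%:R - b%:R, a%:R - b%:R + 1]%classic.
have : {ae mu, forall x, forall k a b : nat, B a b x -> \forall n \near \oo, Normc.normc (S1 f (t n) x - f x) <= 3 * (k.+1%:R^-1)}.
  apply: ae_foralln => k; apply: ae_foralln => a; apply: ae_foralln => b.
  apply: (@weak_local_conv s t C2 f (B a b) _ s0 t0 hf) => //; first exact: measurable_itv.
  move=> g hg alpha a0; apply: H => //; first exact: measurable_itv.
  move=> x y; rewrite /B /= !in_itv /= => /andP[x1 x2] /andP[y1 y2].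
    by rewrite ler_norml; apply/andP; split; lra.
apply: filterS => x hx.
have [a [b hab]] : exists a b : nat, B a b x.
  have [z0|z0] := leP 0 (Num.floor x).
    exists `|Num.floor x|%N, 0%N; rewrite /B /= in_itv /= subr0.
    rewrite natr_absz ger0_norm//; have := floor_itv x; rewrite intrD => /andP[h1 h2].
    by apply/andP; split => //; exact: ltW.
  exists 0%N, `|Num.floor x|%N; rewrite /B /= in_itv /= sub0r.
  rewrite natr_absz ltr0_norm// mulrNz opprK; have := floor_itv x; rewrite intrD => /andP[h1 h2].
  by apply/andP; split => //; exact: ltW.
apply/cvgrPdist_le => e e0.
near \oo => k.
apply: filterS (hx k a b hab) => n hn; rewrite sub0r normrN ger0_norm ?normc_ge0// (le_trans hn)//.
rewrite -ler_pdivlMl// -[leRHS]invrK lef_pV2 ?posrE ?invr_gt0 ?mulr_gt0//.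
by near: k; apply: filterS (nbhs_infty_ger (3^-1 * e)^-1) => k hk; rewrite (le_trans hk)// ler_nat.
Unshelve. all: by end_near. Qed.

End weak_to_convergence.

(** * Functions of small Sobolev norm *)

Section dyadic.
Context {R : realType}.

Definition minsum_cst (th : R) : R :=
  let q := 2 `^ th in 2 * (q - 1)^-1 + (1 - q / 2)^-1.

Lemma two_powR_bounds (th : R) : 0 < th -> th < 1 -> 1 < 2 `^ th /\ 2 `^ th < 2 :> R.
Proof.
move=> h0 h1.
have gt1 (u : R) : 0 < u -> 1 < 2 `^ u :> R.
  move=> u0; apply: (@le_lt_trans _ _ (1 `^ u)); first by rewrite powR1.
  apply: gt0_ltr_powR => //.
  - by rewrite nnegrE.
  - by rewrite nnegrE.
  - by rewrite ltr1n.
split.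
  exact: gt1.
have e : 2 `^ th * 2 `^ (1 - th) = 2 :> R.
  by rewrite -powRD ?pnatr_eq0 ?implybT// subrKC powRr1.
rewrite -[ltRHS]e ltr_pMr ?powR_gt0// gt1//; lra.
Qed.

(** The terms grow like (2^th)^k d until 2^-k drops to d and decay like (2^th / 2)^k from there, so
    the sum has the order of its peak d^(1 - th). It serves with th = 2s for the energy of
    indicators and with th = 1 - 2s for the cost of translations. *)
Lemma minsum_fin (th : R) (n : nat) (d : R) : 0 < th -> th < 1 -> 0 < d ->
  \sum_(0 <= k < n) (2 `^ th) ^+ k * Num.min d (2 ^- k) <= minsum_cst th * d `^ (1 - th).
Proof.
move=> t0 t1; have [q1 q2] := two_powR_bounds t0 t1; rewrite /minsum_cst /=.
set q : R := 2 `^ th; rewrite -/q in q1 q2.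
set B := (q - 1)^-1; set D := (1 - q / 2)^-1; set C := 2 * B + D.
have B0 : 0 < B by rewrite invr_gt0; lra.
have D0 : 0 < D by rewrite invr_gt0; lra.
have qB : (q - 1) * B = 1 by rewrite divff// subr_eq0 gt_eqF.
have geo (m : nat) (e : R) : \sum_(0 <= k < m) q ^+ k * Num.min e (2 ^- k) <= D.
  apply: (@le_trans _ _ (\sum_(0 <= k < m) (q / 2) ^+ k)).
    apply: ler_sum => k _; rewrite exprMn exprVn ler_wpM2l ?exprn_ge0//; first by lra.
    by rewrite ge_min lexx orbT.
  have := @geometric_le_lim R m 1 (q / 2) ler01 _ _; rewrite div1r => /(_ _ _)/le_trans.
  rewrite /series /= => h; apply: (le_trans _ (h _ _ _ (lexx _))).
  - by apply: ler_sum => k _; rewrite mul1r.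
  - by lra.
  - by rewrite ger0_norm; lra.
have pe : 0 < 1 - th by lra.
have pw1 (e : R) : 0 < e -> e <= 2 -> e / 2 <= e `^ (1 - th).
  move=> e0 e2; have -> : e `^ (1 - th) = e / e `^ th.
    by rewrite powRB ?gt_eqF// powRr1// ltW.
  rewrite ler_pM2l// lef_pV2 ?posrE ?powR_gt0//.
  apply: (@le_trans _ _ q); last exact: ltW.
  by apply: ge0_ler_powR => //; rewrite ?nnegrE ltW.
(* Induction on n through the scaling e -> 2e. The term - B e makes the claim reproduce itself: the
   first summand e is paid for by q B = 1 + B. Beyond e = 1 the scaling would leave the range, and
   the geometric bound [geo] takes over. *)
have main : forall n (e : R), 0 < e -> e <= 2 -> \sum_(0 <= k < n) q ^+ k * Num.min e (2 ^- k) <= C * e `^ (1 - th) - B * e.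
  elim=> [|m ih] e e0 e2.
    by rewrite big_nil /C; have := pw1 e e0 e2; nra.
  have [e1|e1] := leP e 1; last first.
    apply: (le_trans (geo _ _)).
    have : 1 <= e `^ (1 - th).
      by rewrite -[leLHS](powRr0 e); apply: ler_powR; apply: ltW.
    have := pw1 e e0 e2; rewrite /C; nra.
  rewrite big_nat_recl//= expr0 mul1r expr0 invr1 min_l//.
  have -> : \sum_(0 <= i < m) q ^+ i.+1 * Num.min e (2 ^- i.+1) = (q / 2) * \sum_(0 <= i < m) q ^+ i * Num.min (2 * e) (2 ^- i).
    rewrite big_distrr /=; apply: eq_bigr => i _.
    rewrite !exprS invfM; have -> : Num.min e (2^-1 * 2 ^- i) = 2^-1 * Num.min (2 * e) (2 ^- i).
      by rewrite minr_pMr ?invr_ge0// mulKf.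
    by ring.
  have : 2 * e <= 2 by lra.
  move=> /(ih (2 * e) (mulr_gt0 (ltr0Sn R 1) e0)).
  have -> : (2 * e) `^ (1 - th) = 2 / q * e `^ (1 - th).
    by rewrite powRM ?(ltW e0)// powRB ?pnatr_eq0 ?implybT// powRr1.
  set p := e `^ (1 - th) => h.
  have q0 : 0 < q by lra.
  have : q / 2 * (\sum_(0 <= i < m) q ^+ i * Num.min (2 * e) (2 ^- i)) <= q / 2 * (C * (2 / q * p) - B * (2 * e)).
    by rewrite ler_pM2l// divr_gt0.
  have -> : q / 2 * (C * (2 / q * p) - B * (2 * e)) = C * p - q * B * e.
    by field; rewrite gt_eqF.
  have : q * B = 1 + B by rewrite -[in LHS](subrK 1 q) mulrDl qB mul1r.
  move=> -> h2; lra.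
move=> d0; have [d2|d2] := leP d 2.
  by apply: (le_trans (main n d d0 d2)); rewrite lerBlDr lerDl mulr_ge0 ?ltW.
apply: (le_trans (geo _ _)).
have : 1 <= d `^ (1 - th) by rewrite -[leLHS](powRr0 d); apply: ler_powR; lra.
rewrite /C; nra.
Qed.

Lemma minsum_cst_ge0 (th : R) : 0 < th -> th < 1 -> 0 <= minsum_cst th.
Proof.
move=> t0 t1; have [q1 q2] := two_powR_bounds t0 t1; rewrite /minsum_cst /=.
by rewrite addr_ge0// ?mulr_ge0// ?invr_ge0; lra.
Qed.

Lemma dyadic_between (x : R) : 1 <= x -> exists k : nat, 2 ^+ k <= x /\ x < 2 ^+ k.+1.
Proof.
move=> x1; have [m hm] : exists m : nat, x < 2 ^+ m.
  exists (Num.truncn x).+1; apply: (lt_le_trans (truncnS_gt x)).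
  by rewrite -natrX ler_nat ltnW// ltn_expl.
have ex : exists m : nat, x < 2 ^+ m by exists m.
case: (ex_minnP ex) => -[|k] hk hmin.
  by move: hk; rewrite expr0; lra.
exists k; split => //; rewrite leNgt; apply/negP => /hmin; rewrite ltnn //.
Qed.

End dyadic.

(** * Sobolev norms through differences, and d'Alembert's formula *)

Section fourier_tools.
Context {R : realType}.
Notation mu := (@lebesgue_measure R).
Notation mf := (measurable_fun setT).
Implicit Types (f phi psi g : R -> R[i]) (s : R).

Lemma L2_leb_preserving f (p : R -> R) : leb_preserving p -> L2 f -> L2 (fun x => f (p x)).
Proof.
by move=> hp lf; apply/L2P; split; [apply: (L2r_leb_preserving hp (L2_re lf))|apply: (L2r_leb_preserving hp (L2_im lf))].
Qed.

Lemma L2norm_sq_leb f (p : R -> R) : leb_preserving p -> mf (re f) -> mf (im f) -> L2norm_sq (fun x => f (p x)) = L2norm_sq f.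
Proof.
move=> hp m1 m2; apply: (@int_leb_preserving _ _ (fun x => Normc.normc (f x) ^+ 2)) => //.
  exact: measurable_normc_sq.
by move=> x; rewrite sqr_ge0.
Qed.

Lemma ft_shift psi g (h : R) : L2 psi -> is_ft psi g ->
  is_ft (fun xi => cexpi (h * xi) * psi xi) (fun x => g (x + h)).
Proof.
move=> l [lg c]; split; first exact: (L2_leb_preserving (leb_preserving_shift h) lg).
suff E N : L2norm_sq (fun x => ftN (fun xi => cexpi (h * xi) * psi xi) N x - g (x + h)) = L2norm_sq (fun x => ftN psi N x - g x).
  have -> : (fun N => L2norm_sq (fun x => ftN (fun xi => cexpi (h * xi) * psi xi) N x - g (x + h))) = (fun N => L2norm_sq (fun x => ftN psi N x - g x)).
    by apply/funext => N; exact: E.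
  exact: c.
have [m1 m2] := measurable_ftN N l.
rewrite -[RHS](L2norm_sq_leb (leb_preserving_shift h)); last 2 first.
- have -> : re (fun x => ftN psi N x - g x) = (fun x => re (ftN psi N) x - re g x) by apply/funext => x; exact: reB.
  exact: mf_sub m1 (L2_re lg).1.
- have -> : im (fun x => ftN psi N x - g x) = (fun x => im (ftN psi N) x - im g x) by apply/funext => x; exact: imB.
  exact: mf_sub m2 (L2_im lg).1.
congr L2norm_sq; apply/funext => x; congr (_ - _); rewrite /ftN; congr cintegral.
by apply/funext => y; rewrite mulrDl cexpiD; ring.
Qed.

Lemma L2norm_sqZ (c : R) f : mf (re f) -> mf (im f) ->
  L2norm_sq (fun x => c%:C%C * f x) = ((c ^+ 2)%:E * L2norm_sq f)%E.
Proof.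
move=> m1 m2; rewrite /L2norm_sq -intZ ?sqr_ge0//; last 2 first.
- exact: measurable_normc_sq.
- by move=> x; rewrite sqr_ge0.
by apply: eq_integral => x _; rewrite !normc_sq reZ imZ; congr EFin; ring.
Qed.

(** This is [ft_bound] for the inverse transform, with 8 pi <= (2 pi)^2. *)
Lemma ft_lower psi g : L2 psi -> is_ft psi g -> (L2norm_sq psi <= L2norm_sq g)%E.
Proof.
move=> l h; have b := ft_bound h.1 (ft_inv l h); have lo := L2_opp l.
rewrite L2norm_sqZ ?L2norm_sq_opp in b; [|exact: (L2_re l).1|exact: (L2_im l).1|exact: (L2_re lo).1|exact: (L2_im lo).1].
have pi2 := pi_ge2 R.
have p0 : 0 < (2 * pi) ^+ 2 :> R by rewrite exprn_gt0// mulr_gt0//; lra.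
rewrite -(@lee_pmul2l _ ((2 * pi) ^+ 2)%:E)//; apply: (le_trans b).
apply: lee_wpmul2r; last by rewrite lee_fin; nra.
by apply: integral_ge0 => x _; rewrite lee_fin sqr_ge0.
Qed.

Lemma ft_fourier_inv f : L2 f -> is_ft (fun xi => ((2 * pi)^-1)%:C%C * fourier f xi) f.
Proof.
move=> lf; have lF := L2_fourier f.
have h := ft_inv lf (fourier_spec lf).
have := ft_opp (L2_opp lF) h.
rewrite (_ : (fun x => fourier f (- - x)) = fourier f); last by apply/funext => x; rewrite opprK.
move=> /(ftZ (2 * pi)^-1 lF); congr is_ft; apply/funext => x.
rewrite opprK mulrCA twopiK //.
Qed.

Lemma normc_cexp1 (a : R) (z : R[i]) : Normc.normc (cexpi a * z - z) ^+ 2 = (2 - 2 * cos a) * Normc.normc z ^+ 2.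
Proof.
rewrite !normc_sq reB imB reM imM /=; have := cos2Dsin2 a.
set c := cos a; set v := sin a; move=> h.
transitivity (((c ^+ 2 + v ^+ 2) + 1 - 2 * c) * (complex.Re z ^+ 2 + complex.Im z ^+ 2)); first by ring.
by rewrite h; ring.
Qed.

(** On the frequency side the difference is multiplication by exp(i h xi) - 1, whose squared modulus
    is 2 - 2 cos(h xi). *)
Lemma diff_bound f (h : R) : L2 f ->
  (\int[mu]_xi ((2 - 2 * cos (h * xi)) * Normc.normc (fourier f xi) ^+ 2)%:E <=
   ((2 * pi) ^+ 2)%:E * L2norm_sq (fun x => f (x + h) - f x)%R)%E.
Proof.
move=> lf; have lF := L2_fourier f; have lF' := L2Z (2 * pi)^-1 lF.
set psi := fun xi => ((2 * pi)^-1)%:C%C * fourier f xi; rewrite -/psi in lF'.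
have i1 := ft_fourier_inv lf; rewrite -/psi in i1.
have i2 := ft_shift h lF' i1.
have le : L2 (fun xi => cexpi (h * xi) * psi xi) by apply: L2_mul_cexp => //; mfun.
have i3 := ftB le lF' i2 i1.
have b := ft_lower (L2B le lF') i3.
have pi0 := pi_gt0 R.
have p0 : (2 * pi) ^+ 2 != 0 :> R by rewrite gt_eqF// exprn_gt0// mulr_gt0.
apply: (@le_trans _ _ (((2 * pi) ^+ 2)%:E * L2norm_sq (fun xi => cexpi (h * xi) * psi xi - psi xi)%R)%E); last first.
  by apply: lee_wpmul2l => //; rewrite lee_fin sqr_ge0.
rewrite /L2norm_sq -intZ ?sqr_ge0//; last 2 first.
- have lB := L2B le lF'; exact: (measurable_normc_sq (L2_re lB).1 (L2_im lB).1).
- by move=> x; rewrite sqr_ge0.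
rewrite le_eqVlt; apply/orP; left; apply/eqP; apply: eq_integral => x _; congr EFin.
rewrite normc_cexp1 /psi !normc_sq reZ imZ; move: pi0; move=> pi0.
have : 2 * pi * (2 * pi)^-1 = 1 :> R by rewrite divff// gt_eqF// mulr_gt0.
set p : R := pi; set c := cos _; move: (complex.Re _) (complex.Im _) => a1 a2; set iv := (2 * p)^-1 => piv.
transitivity ((2 * p * iv) ^+ 2 * ((2 - 2 * c) * (a1 ^+ 2 + a2 ^+ 2))); last by ring.
by rewrite piv; ring.
Qed.

Definition W_cst s : R := 2 `^ s + 8 `^ s / (2 - 2 * cos 1).

Lemma W_cst_ge0 s : 0 <= W_cst s.
Proof.
have := cos_le1 (1 : R) => h.
by rewrite /W_cst addr_ge0 ?powR_ge0// divr_ge0 ?powR_ge0//; lra.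
Qed.

(** If 2^k <= |xi| < 2^(k+1), the angle 2^-k |xi| lies in [1, 2), where the cosine is at most cos 1,
    and 1 + |xi|^2 is at most 8 times 4^k. The term 2^s of [W_cst] covers |xi| < 1. *)
Lemma wt_le s (xi : R) : 0 < s -> exists k : nat, wt s xi <= W_cst s * (1 + (4 `^ s) ^+ k * (2 - 2 * cos (2 ^- k * xi))).
Proof.
move=> s0.
have pi2 := pi_ge2 R.
have c1 : cos 1 < 1 :> R.
  by rewrite -[ltRHS]cos0 ltr_cos// ?in_itv/=; lra.
have W0 : 0 <= 8 `^ s / (2 - 2 * cos 1) :> R by rewrite divr_ge0 ?powR_ge0//; lra.
have p2 : 0 <= 2 `^ s :> R by exact: powR_ge0.
have [x1|x1] := leP 1 `|xi|; last first.
  exists 0%N; rewrite expr0 mul1r.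
  have h0 : 0 <= 2 - 2 * cos (2 ^- 0 * xi) by have := cos_le1 (2 ^- 0 * xi); lra.
  apply: (@le_trans _ _ (2 `^ s)).
    apply: ge0_ler_powR; rewrite ?nnegrE ?addr_ge0 ?sqr_ge0//; first exact: ltW.
    by have := normr_ge0 xi; nra.
  rewrite /W_cst; nra.
have [k [k1 k2]] := dyadic_between x1; exists k.
have e2 : 0 < 2 ^+ k :> R by rewrite exprn_gt0.
have th1 : 1 <= 2 ^- k * `|xi| by rewrite mulrC ler_pdivlMr// mul1r.
have th2 : 2 ^- k * `|xi| < 2 by rewrite mulrC ltr_pdivrMr// -exprS.
have hc : 2 - 2 * cos 1 <= 2 - 2 * cos (2 ^- k * xi).
  have -> : cos (2 ^- k * xi) = cos (2 ^- k * `|xi|).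
    by have [x0|x0] := leP 0 xi; rewrite ?(ger0_norm x0)// (ltr0_norm x0) mulrN cosN.
  have : cos (2 ^- k * `|xi|) <= cos 1.
    rewrite leNgt; apply/negP; rewrite ltr_cos// ?in_itv/=; last 2 first.
    - by apply/andP; split; lra.
    - by apply/andP; split; lra.
    by lra.
  lra.
have hw : wt s xi <= 8 `^ s * (4 `^ s) ^+ k.
  rewrite -powR_mulrn ?powR_ge0// -powRrM [s * _]mulrC powRrM powR_mulrn// -powRM ?exprn_ge0//.
  apply: ge0_ler_powR; rewrite ?nnegrE ?addr_ge0 ?sqr_ge0 ?mulr_ge0 ?exprn_ge0//; first exact: ltW.
  have a1 : `|xi| ^+ 2 <= (2 ^+ k.+1) ^+ 2 by rewrite lerXn2r ?nnegrE ?exprn_ge0// ltW.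
  have e4 : (2 ^+ k.+1) ^+ 2 = 4 * 4 ^+ k :> R by rewrite -exprM mulnC exprM exprS; congr (_ * _ ^+ _); ring.
  have a2 : 1 <= 4 ^+ k :> R by rewrite exprn_ege1//; lra.
  rewrite e4 in a1; move: a1 a2; set y := _ ^+ 2; set z := 4 ^+ k; lra.
apply: (le_trans hw).
have q0 : 0 <= (4 `^ s) ^+ k :> R by rewrite exprn_ge0// powR_ge0.
have c0 : 0 < 2 - 2 * cos 1 :> R by lra.
apply: (@le_trans _ _ (8 `^ s / (2 - 2 * cos 1) * ((4 `^ s) ^+ k * (2 - 2 * cos (2 ^- k * xi))))).
  rewrite -mulrA ler_wpM2l ?powR_ge0// mulrCA ler_peMr// mulrC ler_pdivlMr// mul1r//.
have h3 : 0 <= (4 `^ s) ^+ k * (2 - 2 * cos (2 ^- k * xi)) by rewrite mulr_ge0//; lra.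
rewrite /W_cst; nra.
Qed.

(** A Besov-type bound for the H^s norm by L2 differences at the scales 2^-k. For indicators these
    differences are governed by lengths of intervals, so that no Fourier transform has to be
    computed. *)
Lemma W_le_diff s f : 0 < s -> L2 f ->
  (W s (fourier f) <= (W_cst s)%:E * (L2norm_sq (fourier f) +
    \sum_(0 <= k <oo) (((4 `^ s) ^+ k)%:E * (((2 * pi) ^+ 2)%:E * L2norm_sq (fun x => f (x + 2 ^- k) - f x)%R))))%E.
Proof.
move=> s0 lf; have lF := L2_fourier f.
have mn := measurable_normc_sq (L2_re lF).1 (L2_im lF).1.
have Wc0 := W_cst_ge0 s.
set n := fun xi => Normc.normc (fourier f xi) ^+ 2; rewrite -/n in mn.
have n0 xi : 0 <= n xi by rewrite sqr_ge0.
pose u k xi : R := (4 `^ s) ^+ k * ((2 - 2 * cos (2 ^- k * xi)) * n xi).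
have c0 (a : R) : 0 <= 2 - 2 * cos a by have := cos_le1 a; rewrite subr_ge0; lra.
have u0 k xi : 0 <= u k xi by rewrite mulr_ge0 ?exprn_ge0 ?powR_ge0// mulr_ge0.
have mu_ k : mf (u k) by rewrite /u; mfun.
have mS : mf (fun xi => \sum_(0 <= k <oo) (u k xi)%:E)%E.
  apply: (@ge0_emeasurable_sum _ _ _ setT (fun k xi => (u k xi)%:E) xpredT) => //.
  - by move=> k x _ _; rewrite lee_fin.
  - by move=> k _; exact: emf.
apply: (@le_trans _ _ (\int[mu]_xi ((W_cst s)%:E * ((n xi)%:E + \sum_(0 <= k <oo) (u k xi)%:E)))%E).
  apply: ge0_le_integral => //.
  - by move=> xi _; rewrite lee_fin mulr_ge0 ?wt_ge0 ?sqr_ge0.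
  - by apply: emf; apply: measurable_funM => //; exact: measurable_wt.
  - by apply: measurable_funeM; apply: emeasurable_funD => //; exact: emf.
  - move=> xi _; have [k hk] := wt_le xi s0.
    apply: (@le_trans _ _ ((W_cst s)%:E * ((n xi)%:E + (u k xi)%:E))%E).
      have -> : ((W_cst s)%:E * ((n xi)%:E + (u k xi)%:E))%E = (W_cst s * (n xi + u k xi))%:E by [].
      have -> : n xi + u k xi = (1 + (4 `^ s) ^+ k * (2 - 2 * cos (2 ^- k * xi))) * n xi by rewrite /u; ring.
      by rewrite lee_fin; apply: le_trans (ler_wpM2r (n0 xi) hk) _; rewrite -mulrA.
    apply: lee_wpmul2l; first by rewrite lee_fin.
    apply: leeD2l; apply: (@le_trans _ _ (\sum_(0 <= i < k.+1) (u i xi)%:E)%E).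
      by rewrite big_nat_recr//= leeDr// sume_ge0// => i _; rewrite lee_fin.
    by apply: nneseries_lim_ge => i _ _; rewrite lee_fin.
rewrite ge0_integralZl//; last 2 first.
- by apply: emeasurable_funD => //; exact: emf.
- by move=> xi _; rewrite adde_ge0// ?lee_fin// nneseries_ge0// => k _ _; rewrite lee_fin.
apply: lee_wpmul2l; first by rewrite lee_fin.
rewrite ge0_integralD//; last 3 first.
- by move=> xi _; rewrite lee_fin.
- exact: emf.
- by move=> xi _; rewrite nneseries_ge0// => k _ _; rewrite lee_fin.
apply: leeD2l; rewrite integral_nneseries//; last 2 first.
- by move=> k; exact: emf.
- by move=> k xi _; rewrite lee_fin.
apply: lee_nneseries => k _; first by move=> _; apply: integral_ge0 => xi _; rewrite lee_fin.
rewrite /u intZ ?exprn_ge0 ?powR_ge0//; last 2 first.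
- by mfun.
- by move=> xi; rewrite mulr_ge0.
apply: lee_wpmul2l; first by rewrite lee_fin exprn_ge0// powR_ge0.
exact: diff_bound.
Qed.

Definition realC (F : R -> R) : R -> R[i] := fun x => (F x)%:C%C.

Lemma L2_realC F : L2r F -> L2 (realC F).
Proof.
by move=> l; apply/L2P; split=> //; have := L2_im L2_0.
Qed.

Lemma hart0 : is_hart (fun=> 0 : R) (fun=> 0 : R).
Proof.
have l0 : L2r (fun=> 0 : R) by have := L2_im L2_0.
have [g hg] := hart_ex l0.
have e1 : (fun x : R => 0 * (fun=> 0) x) = (fun=> 0 : R) by apply/funext => x; rewrite mul0r.
have e2 : (fun x : R => 0 * g x) = (fun=> 0 : R) by apply/funext => x; rewrite mul0r.
have := hartZ 0 l0 hg; rewrite e2.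
by have -> : (fun x : R => 0 * 0) = (fun=> 0 : R) by exact: e1.
Qed.

Lemma fourier_real_parity (F : R -> R) : L2r F ->
  {ae mu, forall x, re (fourier (realC F)) (- x) = re (fourier (realC F)) x /\
                    im (fourier (realC F)) (- x) = - im (fourier (realC F)) x}.
Proof.
move=> lF; have lf := L2_realC lF; have [H hH] := hart_ex lF.
have h := ft_hart lf hH hart0.
have e1 := ft_uniq lf (fourier_spec lf) h.
have e2 := ae_leb_preserving leb_preserving_opp e1.
apply: filterS2 e1 e2 => x; rewrite opprK /re /im => -> ->.
by rewrite /= /ev /od opprK; split; field.
Qed.

Lemma hart_odd (h g : R -> R) : L2r h -> is_hart h g -> {ae mu, forall x, h (- x) = - h x} -> {ae mu, forall x, ev g x = 0}.
Proof.
move=> lh hg e; have lo := L2r_comp_opp lh; have ln := L2rZ (-1) lh.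
have h1 := hart_opp lh hg; have h2 := hartZ (-1) lh hg.
have h3 : is_hart (fun x => h (- x)) (fun x => -1 * g x).
  by apply: (hart_ael ln.1 lo.1 _ h2); apply: filterS e => x ->; rewrite mulN1r.
by apply: filterS (hart_uniq lo.1 h1 h3) => x; rewrite /ev => ->; field.
Qed.

Lemma hart_even (h g : R -> R) : L2r h -> is_hart h g -> {ae mu, forall x, h (- x) = h x} -> {ae mu, forall x, od g x = 0}.
Proof.
move=> lh hg e; have lo := L2r_comp_opp lh.
have h1 := hart_opp lh hg.
have h3 : is_hart (fun x => h (- x)) g.
  by apply: (hart_ael lh.1 lo.1 _ hg); apply: filterS e => x ->.
by apply: filterS (hart_uniq lo.1 h1 h3) => x; rewrite /od => ->; field.
Qed.

(** exp(i t |xi|) - cos(t xi) = i sin(t |xi|), and the Fourier transform of a real function has even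
    real and odd imaginary part. What remains after subtracting the two translates therefore has odd
    real and even imaginary part, and its transform is purely imaginary. *)
Lemma Re_S1_real (F : R -> R) (t : R) : L2r F ->
  {ae mu, forall x, complex.Re (S1 (realC F) t x) = (F (x + t) + F (x - t)) / 2}.
Proof.
move=> lF; set f := realC F; have lf : L2 f := L2_realC lF.
have lf' := L2_fourier f; have lf2 := L2Z (2 * pi)^-1 lf'.
set psi := fun xi => ((2 * pi)^-1)%:C%C * fourier f xi; rewrite -/psi in lf2.
have i0 : is_ft psi f := ft_fourier_inv lf.
have l1 : L2 (fun xi => cexpi (t * xi) * psi xi) by apply: L2_mul_cexp => //; mfun.
have l2 : L2 (fun xi => cexpi (- t * xi) * psi xi) by apply: L2_mul_cexp => //; mfun.
have i1 := ftZ 2^-1 (L2D l1 l2) (ftD l1 l2 (ft_shift t lf2 i0) (ft_shift (- t) lf2 i0)).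
have l3 := L2Z 2^-1 (L2D l1 l2).
have i2 := ftB (L2_S1mult f t) l3 (S1_spec f t) i1.
have l4 := L2B (L2_S1mult f t) l3.
set rho := (fun xi => S1mult f t xi - _) in i2 l4.
have [hp [hq [h1 h2 e]]] := ft_form l4 i2.
have rhoE xi : rho xi = (0 +i* ((2 * pi)^-1 * sin (t * `|xi|)))%C * fourier f xi.
  rewrite /rho /S1mult /psi; apply/complex_eqP.
  have C : cos (t * `|xi|) = cos (t * xi).
    by have [x0|x0] := leP 0 xi; rewrite ?(ger0_norm x0)// (ltr0_norm x0) mulrN cosN.
  have Sn : sin (- t * xi) = - sin (t * xi) by rewrite mulNr sinN.
  have Cn : cos (- t * xi) = cos (t * xi) by rewrite mulNr cosN.
  rewrite !(reB,imB,reZ,imZ,reD,imD,reM,imM) /= C Sn Cn.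
  by set iv : R := (2 * pi)^-1; split; field.
have par := fourier_real_parity lF; rewrite -/f in par.
have o1 : {ae mu, forall x, re rho (- x) = - re rho x}.
  apply: filterS par => x [e1 e2]; rewrite /re !rhoE !reM /= normrN; move: e1 e2; rewrite /re /im => e1 e2.
  by rewrite e2; ring.
have o2 : {ae mu, forall x, im rho (- x) = im rho x}.
  apply: filterS par => x [e1 e2]; rewrite /im !rhoE !imM /= normrN; move: e1 e2; rewrite /re /im => e1 e2.
  by rewrite e1; ring.
have z1 := hart_odd (L2_re l4) h1 o1; have z2 := hart_even (L2_im l4) h2 o2.
have z : {ae mu, forall x, ev hp x = 0 /\ od hq x = 0} by apply: filterS2 z1 z2.
apply: filterS2 e z => x ex [y1 y2].
have : complex.Re (S1 f t x - (2^-1)%:C%C * (f (x + t) + f (x + - t))) = 0 by rewrite ex /= y1 y2 subr0.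
by rewrite reB reZ reD /f /realC /= => /eqP; rewrite subr_eq0 => /eqP ->; rewrite mulrC.
Qed.

End fourier_tools.

(** * Covering half of the unit interval by translates of a comb *)

Section covering.
Context {R : realType}.
Notation mu := (@lebesgue_measure R).
Notation mf := (measurable_fun setT).

Lemma le_mu (A B : set R) : measurable A -> measurable B -> A `<=` B -> (mu A <= mu B)%E.
Proof. by move=> mA mB AB; apply: le_measure; rewrite ?inE. Qed.

(** The set E of the overview: [x - y] lies in it exactly when x + t_n lies in [y, y + d[ for some n
    < N. *)
Definition comb (t : nat -> R) (d : R) (N : nat) : set R :=
  [set z | exists2 n, (n < N)%N & 0 <= z + t n < d].

Lemma combS t d N : comb t d N.+1 = comb t d N `|` `[- t N, - t N + d[%classic.
Proof.
apply/seteqP; split => z.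
  move=> [n]; rewrite ltnS leq_eqVlt => /orP[/eqP ->|nN] /andP[h1 h2]; last by left; exists n => //; apply/andP.
  by right; rewrite /= in_itv /=; apply/andP; split; lra.
move=> [[n nN h]|]; first by exists n => //; exact: ltnW.
by rewrite /= in_itv /= => /andP[h1 h2]; exists N => //; apply/andP; split; lra.
Qed.

Lemma measurable_comb t d N : measurable (comb t d N).
Proof.
elim: N => [|N ih]; last by rewrite combS; apply: measurableU => //; exact: measurable_itv.
by rewrite (_ : comb t d 0 = set0)//; apply/seteqP; split => z // [].
Qed.

Lemma mu_comb t d N : 0 <= d -> nonincreasing_seq t -> (forall n, (n < N)%N -> d <= t n - t n.+1) ->
  mu (comb t d N) = (N%:R * d)%:E.
Proof.
move=> d0 ht; elim: N => [|N ih] h.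
  by rewrite (_ : comb t d 0 = set0) ?measure0 ?mul0r//; apply/seteqP; split => z // [].
pose I : set R := `[- t N, - t N + d[%classic.
have mU : mu (comb t d N `|` I) = (mu (comb t d N) + mu I)%E.
  apply: measureU; [exact: measurable_comb|exact: measurable_itv|].
  apply/seteqP; split => z //= -[[n nN /andP[h1 h2]]]; rewrite /I /= in_itv /= => /andP[h3 h4].
  have := h n (ltnW nN); have := ht _ _ nN; lra.
rewrite combS mU /I; rewrite ih; last by move=> n nN; apply: h; exact: ltnW.
  rewrite lebesgue_measure_itv /= lte_fin; case: ifPn => hd.
    by rewrite -!EFinD; congr EFin; rewrite -natr1; ring.
  rewrite adde0; congr EFin; have -> : d = 0 by move: hd; rewrite -leNgt => hd; lra.
  by rewrite !mulr0.
Qed.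

(** The right end - t_n + d of each tooth stays at or below - t_(n+1) <= 0. *)
Lemma comb_sub t d N : nonincreasing_seq t -> (forall n, 0 <= t n) -> (forall n, (n < N)%N -> d <= t n - t n.+1) ->
  forall z, comb t d N z -> - t 0%N <= z <= 0.
Proof.
move=> ht t0 h z [n nN /andP[h1 h2]].
have := ht _ _ (leq0n n); have := t0 n.+1; have := h n nN => *.
by apply/andP; split; lra.
Qed.

Lemma int_indic (A : set R) : measurable A -> (\int[mu]_x (\1_A x)%:E)%E = mu A.
Proof. by move=> mA; rewrite integral_indic// setIT. Qed.

(** By Tonelli the measure of the part of Z inside E + y, integrated over y in [0, 1 + T], equals
    mu(E) mu(Z), so some y attains at least the average proportion m / (1 + T). Only half of it is
    claimed, which makes the failure of every y contradictory. *)
Lemma cover_step (E Z : set R) (T m : R) : measurable E -> measurable Z -> 0 <= T -> 0 < m ->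
  (forall z, E z -> - T <= z <= 0) -> (forall z, Z z -> 0 <= z <= 1) -> mu E = m%:E ->
  exists y, (mu [set x | Z x /\ ~ E (x - y)%R] <= (1 - m / (2 * (1 + T)))%:E * mu Z)%E.
Proof.
move=> mE mZ T0 m0 ET Z1 hE; set p := m / (2 * (1 + T)).
have Zf : (mu Z <= 1%:E)%E.
  have -> : 1%:E = mu `[0, 1]%classic by rewrite lebesgue_measure_itv /= lte_fin ltr01 -EFinD subr0.
  by apply: le_mu => //.
have Zn : mu Z \is a fin_num by rewrite ge0_fin_numE ?measure_ge0//; apply: le_lt_trans Zf _; rewrite ltry.
set z := fine (mu Z); have zE : mu Z = z%:E by rewrite fineK.
have z0 : 0 <= z by rewrite fine_ge0 ?measure_ge0.
have p0 : 0 < p by rewrite divr_gt0// mulr_gt0//; lra.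
pose Ey (y : R) : set R := (fun x => x - y) @^-1` E.
have mEy (y : R) : measurable (Ey y).
  by rewrite -[X in measurable X]setTI; apply: (leb_preserving_shift (- y)).1.
apply: contrapT => H.
have H1 y : (mu (Z `&` Ey y) <= (p * z)%:E)%E.
  have hU : Z = (Z `&` Ey y) `|` [set x | Z x /\ ~ Ey y x].
    apply/seteqP; split => x; last by move=> [[]|[]].
    by move=> Zx; have [Ex|nEx] := pselect (E (x - y)); [left|right].
  have m2 : measurable [set x | Z x /\ ~ Ey y x].
    by apply: measurableI => //; apply: (measurableC (mEy y)).
  have m1 := measurableI _ _ mZ (mEy y).
  have hm : mu Z = (mu (Z `&` Ey y) + mu [set x | Z x /\ ~ Ey y x])%E.
    rewrite {1}hU measureU//; apply/seteqP; split => x // -[[_ h1] [_ h2]]; exact: h2.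
  have : ((1 - p)%:E * mu Z < mu [set x | Z x /\ ~ Ey y x])%E.
    by rewrite ltNge; apply/negP => h; apply: H; exists y.
  move: hm; rewrite zE.
  have : (0 <= mu (Z `&` Ey y))%E by exact: measure_ge0.
  have : (0 <= mu [set x | Z x /\ ~ Ey y x])%E by exact: measure_ge0.
  case: (mu (Z `&` _)) => [a| |]; case: (mu [set x | _]) => [b| |] //=.
  rewrite -EFinD !lee_fin => b0 a0 [zab]; rewrite -EFinM lte_fin; nra.
have z1 : 0 < z.
  rewrite lt_neqAle z0 andbT; apply/eqP => e; apply: H; exists 0.
  rewrite zE -e -EFinM mulr0; apply: (@le_trans _ _ (mu Z)); last by rewrite zE -e.
  apply: le_mu => //; last by move=> x [].
  by apply: measurableI => //; apply: (measurableC (mEy 0)).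
pose K (w : R * R) : R := \1_Z w.1 * \1_E (w.1 - w.2).
have mK : mf K.
  have mZf : mf (\1_Z : R -> R) by exact: measurable_indic.
  have mEf : mf (\1_E : R -> R) by exact: measurable_indic.
  apply: measurable_funM; first exact: (measurableT_comp mZf measurable_fst).
  by apply: (measurableT_comp mEf); apply: measurable_funB; [exact: measurable_fst|exact: measurable_snd].
have K0 w : 0 <= K w by rewrite mulr_ge0//; have /andP[] := indic01.
have S := tonelli_swap mK K0.
have e1 : (\int[mu]_x \int[mu]_y (K (x, y))%:E = (m * z)%:E)%E.
  transitivity (\int[mu]_x (m * \1_Z x)%:E)%E.
    apply: eq_integral => x _; rewrite /K /=.
    have i1 : mf (\1_E : R -> R) by exact: measurable_indic.
    have i2 : mf (fun y : R => \1_E (x - y) : R) by apply: (measurableT_comp i1 (leb_preserving_reflect x).1).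
    have i3 (y : R) : 0 <= \1_E y :> R by have /andP[] := @indic01 R E y.
    have i4 : 0 <= \1_Z x :> R by have /andP[] := @indic01 R Z x.
    rewrite (intZ i2 (fun y => i3 (x - y)) i4).
    rewrite (int_leb_preserving (leb_preserving_reflect x) i1 i3).
    by rewrite int_indic// hE -EFinM mulrC.
  have i1 : mf (\1_Z : R -> R) by exact: measurable_indic.
  have i3 (y : R) : 0 <= \1_Z y :> R by have /andP[] := @indic01 R Z y.
  by rewrite (intZ i1 i3 (ltW m0)) int_indic// zE.
have e2 : (\int[mu]_y \int[mu]_x (K (x, y))%:E <= (p * z * (1 + T))%:E)%E.
  apply: (@le_trans _ _ (\int[mu]_y (p * z * \1_(`[0, 1 + T]%classic) y)%:E)%E).
    apply: ge0_le_integral; first exact: measurableT.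
    - by move=> y _; apply: integral_ge0 => x _; rewrite lee_fin.
    - have m2 : mf (fun w : R * R => K (w.2, w.1)) by apply: (measurableT_comp mK); exact: measurable_swap.
      exact: (measurable_tonelli m2).
    - by apply: emf; have := @measurable_indic_itv R `[0, 1 + T] => ?; mfun.
    - move=> y _.
      have -> : (\int[mu]_x (K (x, y))%:E = mu (Z `&` Ey y))%E.
        rewrite -int_indic; last exact: measurableI.
        apply: eq_integral => x _; rewrite indicI /K /= ; congr EFin.
      have [y1|y1] := boolP (y \in `[0, 1 + T]); first by rewrite indicE mem_set// mulr1; exact: H1.
      have ze : Z `&` Ey y = set0.
        apply/seteqP; split => x // -[/Z1 /andP[x0 x1] /ET /andP[h1 h2]].
        move/negP: y1; apply; rewrite in_itv /=; apply/andP; split; lra.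
      have /andP[i0 _] := @indic01 R `[0, 1 + T]%classic y.
      by rewrite ze measure0 lee_fin; exact: mulr_ge0 (mulr_ge0 (ltW p0) z0) i0.
  have i3 (y : R) : 0 <= \1_(`[0, 1 + T]%classic) y :> R by have /andP[] := @indic01 R `[0, 1 + T]%classic y.
  have pz : 0 <= p * z by rewrite mulr_ge0 ?ltW.
  rewrite (intZ (measurable_indic_itv `[0, 1 + T]) i3 pz).
  rewrite int_indic; last exact: measurable_itv.
  rewrite lebesgue_measure_itv /= lte_fin; have -> : 0 < 1 + T by lra.
  by rewrite -EFinD subr0.
move: e2; rewrite -S e1 lee_fin.
have -> : p * z * (1 + T) = m * z / 2 by rewrite /p; field; rewrite gt_eqF//; lra.
have : 0 < m * z by exact: mulr_gt0.
lra.
Qed.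

Definition uncovered (E : set R) (ys : seq R) : set R :=
  [set x | 0 <= x <= 1 /\ forall y, y \in ys -> ~ E (x - y)].

Lemma measurable_uncovered E ys : measurable E -> measurable (uncovered E ys).
Proof.
move=> mE; elim: ys => [|y ys ih].
  rewrite (_ : uncovered _ _ = `[0, 1]%classic); first exact: measurable_itv.
  by apply/seteqP; split => [x [x1 _]|x]; rewrite /uncovered /= in_itv.
rewrite (_ : uncovered E (y :: ys) = uncovered E ys `&` ~` ((fun x => x - y) @^-1` E)).
  apply: measurableI => //; apply: measurableC.
  by rewrite -[X in measurable X]setTI; apply: (leb_preserving_shift (- y)).1.
apply/seteqP; split => x.
  move=> [x1 h]; split; last by apply: h; rewrite in_cons eqxx.
  by split => // w wy; apply: h; rewrite in_cons wy orbT.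
move=> [[x1 h] h2]; split => // w; rewrite in_cons => /orP[/eqP -> //|]; exact: h.
Qed.

(** Greedy iteration of [cover_step]: each new translate leaves at most the fraction 1 - p of what
    was still uncovered. *)
Lemma cover_iter (E : set R) (T m : R) (M : nat) : measurable E -> 0 <= T -> 0 < m -> m <= T ->
  (forall z, E z -> - T <= z <= 0) -> mu E = m%:E ->
  exists ys, size ys = M /\ (mu (uncovered E ys) <= ((1 - m / (2 * (1 + T))) ^+ M)%:E)%E.
Proof.
move=> mE T0 m0 mT ET hE; set p := m / (2 * (1 + T)).
have p1 : p <= 1 by rewrite ler_pdivrMr ?mulr_gt0//; lra.
elim: M => [|M [ys [hs h]]].
  exists [::]; split => //; rewrite expr0.
  have -> : 1%:E = mu `[0, 1]%classic by rewrite lebesgue_measure_itv /= lte_fin ltr01 -EFinD subr0.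
  apply: le_mu; [exact: measurable_uncovered|exact: measurable_itv|].
  by move=> x [] x1 _; rewrite /= in_itv.
have [y hy] := cover_step mE (measurable_uncovered ys mE) T0 m0 ET (fun z (h : uncovered E ys z) => h.1) hE.
exists (y :: ys); split; first by rewrite /= hs.
have -> : uncovered E (y :: ys) = [set x | uncovered E ys x /\ ~ E (x - y)].
  apply/seteqP; split => x.
    move=> [x1 g]; split; last by apply: g; rewrite in_cons eqxx.
    by split => // w wy; apply: g; rewrite in_cons wy orbT.
  move=> [[x1 g] g2]; split => // w; rewrite in_cons => /orP[/eqP -> //|]; exact: g.
apply: (le_trans hy); rewrite exprS EFinM; apply: lee_wpmul2l => //.
by rewrite lee_fin -/p; lra.
Qed.

(** (1 - p)^M (1 + p)^M <= 1, while (1 + p)^M >= 1 + M p >= 2. *)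
Lemma bernoulli_half (p : R) (M : nat) : 0 <= p -> p <= 1 -> 1 <= M%:R * p -> (1 - p) ^+ M <= 1 / 2.
Proof.
move=> p0 p1 hM.
have h1 : 1 + M%:R * p <= (1 + p) ^+ M.
  elim: M {hM} => [|M ih]; first by rewrite mul0r addr0 expr0.
  rewrite exprS; apply: (@le_trans _ _ ((1 + p) * (1 + M%:R * p))); last by rewrite ler_wpM2l//; lra.
  rewrite -natr1; have := ler0n R M; nra.
have h2 : (1 - p) ^+ M * (1 + p) ^+ M <= 1.
  by rewrite -exprMn exprn_ile1//; nra.
have h3 : 0 <= (1 - p) ^+ M by rewrite exprn_ge0//; lra.
nra.
Qed.

Lemma cover_half (E : set R) (T m : R) : measurable E -> 0 <= T -> 0 < m -> m <= T ->
  (forall z, E z -> - T <= z <= 0) -> mu E = m%:E ->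
  exists ys, (size ys)%:R * m <= 4 * (1 + T) /\ (mu (uncovered E ys) <= (1 / 2)%:E)%E.
Proof.
move=> mE T0 m0 mT ET hE; set p := m / (2 * (1 + T)).
have T2 : 0 < 2 * (1 + T) by lra.
have p1 : p <= 1 by rewrite ler_pdivrMr//; lra.
have p0 : 0 < p by rewrite divr_gt0.
(* The least natural number above 1 / p: M p >= 1 is what [bernoulli_half] asks, and M p <= 1 + p <=
   2 limits the number of translates. *)
pose M := (Num.truncn p^-1).+1.
have [ys [hs hm]] := cover_iter M mE T0 m0 mT ET hE; exists ys.
have M1 : p^-1 < M%:R := truncnS_gt p^-1.
have M2 : M%:R <= p^-1 + 1.
  rewrite /M -natr1 lerD2r; rewrite -truncn_ge_nat// ?invr_ge0 ltW//.
have pp : p^-1 * p = 1 by rewrite mulVf// gt_eqF.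
split.
  have -> : m = 2 * (1 + T) * p by rewrite /p mulrCA divff ?mulr1// gt_eqF.
  rewrite hs; have : M%:R * p <= 2 by nra.
  nra.
apply: (le_trans hm); rewrite lee_fin; apply: bernoulli_half => //; first exact: ltW.
rewrite -/p; have : p^-1 * p <= M%:R * p by rewrite ler_pM2r// ltW.
by rewrite pp.
Qed.

End covering.

(** * Maxima of indicators and their Sobolev energy *)

Section step_functions.
Context {R : realType}.
Notation mu := (@lebesgue_measure R).
Notation mf := (measurable_fun setT).
Implicit Types (d y h x : R).

(** Two maxima differ by at most the largest of the differences of their entries, so no cross terms
    arise. Energies of overlapping indicators thus add up when these are joined by a maximum, which
    would fail for sums. *)
Lemma sq_max_diff (I : Type) (r : seq I) (a b : I -> R) :
  (\big[Num.max/0]_(i <- r) a i - \big[Num.max/0]_(i <- r) b i) ^+ 2 <= \sum_(i <- r) (a i - b i) ^+ 2.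
Proof.
elim: r => [|i r ih]; first by rewrite !big_nil subrr expr0n.
rewrite !big_cons; apply: le_trans (lerD (lexx _) ih).
set A := \big[_/_]_(j <- r) a j; set B := \big[_/_]_(j <- r) b j.
have [h1|h1] := leP (a i) A; have [h2|h2] := leP (b i) B.
- by rewrite lerDr sqr_ge0.
- have [h3|h3] := leP A (b i).
    have := mulr_ge0 (_ : 0 <= A - a i) (_ : 0 <= 2 * b i - A - a i); have := sqr_ge0 (A - B); nra.
  have := mulr_ge0 (_ : 0 <= b i - B) (_ : 0 <= 2 * A - B - b i); have := sqr_ge0 (a i - b i); nra.
- have [h3|h3] := leP B (a i).
    have := mulr_ge0 (_ : 0 <= B - b i) (_ : 0 <= 2 * a i - B - b i); have := sqr_ge0 (A - B); nra.
  have := mulr_ge0 (_ : 0 <= a i - A) (_ : 0 <= 2 * B - A - a i); have := sqr_ge0 (a i - b i); nra.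
- by rewrite lerDl sqr_ge0.
Qed.

Lemma twice_lt1 (s : R) : 0 < s -> s < 1 / 2 -> 0 < 2 * s /\ 2 * s < 1.
Proof. by move=> s0 s1; split; lra. Qed.

Definition bump d y x : R := \1_(`[y, y + d[%classic) x.

Lemma bump01 d y x : bump d y x = 0 \/ bump d y x = 1.
Proof. by rewrite /bump indicE; case: (_ \in _); [right|left]. Qed.

Lemma measurable_bump d y : mf (bump d y).
Proof. exact: measurable_indic_itv. Qed.

Lemma bumpE d y x : bump d y x = if (y <= x < y + d) then 1 else 0.
Proof.
rewrite /bump indicE; case: ifPn => [h|/negP h].
  by rewrite mem_set//= in_itv.
by rewrite memNset//= in_itv.
Qed.

Lemma n2_bump d y : 0 <= d -> n2 (bump d y) = d%:E.
Proof.
move=> d0; transitivity (\int[mu]_x (bump d y x)%:E)%E.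
  by apply: eq_integral => x _; case: (bump01 d y x) => ->; rewrite ?expr0n ?expr1n.
rewrite int_indic; last exact: measurable_itv.
rewrite lebesgue_measure_itv /= lte_fin; case: ifPn => hd; first by rewrite -EFinD; congr EFin; ring.
by congr EFin; move: hd; rewrite -leNgt; lra.
Qed.

(** For h < d the two indicators differ only on two intervals of length h, at the two ends; for d <=
    h both squared norms equal d and [n2B] gives 4 d. *)
Lemma n2_bump_diff d y h : 0 <= d -> 0 <= h ->
  (n2 (fun x => bump d y (x + h) - bump d y x)%R <= (4 * Num.min d h)%:E)%E.
Proof.
move=> d0 h0; have mb := measurable_bump.
have mbh : mf (fun x => bump d y (x + h)) by apply: (measurableT_comp (mb d y) (leb_preserving_shift h).1).
have [dh|hd] := leP d h.
  apply: le_trans (n2B mbh (mb d y)) _.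
  rewrite (n2_leb_preserving (leb_preserving_shift h) (mb d y)) n2_bump//.
  by rewrite -!EFinM -EFinD lee_fin; lra.
apply: (@le_trans _ _ (\int[mu]_x (bump h (y - h) x ^+ 2 + bump h (y + d - h) x ^+ 2)%:E)%E).
  apply: le_int.
  - by mfun.
  - by have := mb h (y - h) => ?; have := mb h (y + d - h) => ?; mfun.
  - by move=> x; rewrite sqr_ge0.
  - move=> x; rewrite !bumpE.
    by do 4 (case: ifPn; rewrite ?negb_and -?ltNge -?leNgt); rewrite ?expr0n ?expr1n ?subrr ?subr0 ?sub0r ?sqrrN ?expr0n ?expr1n /=; lra.
rewrite intD; last 4 first.
- by have := mb h (y - h) => ?; mfun.
- by have := mb h (y + d - h) => ?; mfun.
- by move=> x; rewrite sqr_ge0.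
- by move=> x; rewrite sqr_ge0.
have n1 := n2_bump (y - h) h0; have n2' := n2_bump (y + d - h) h0.
by rewrite /n2 in n1 n2'; rewrite n1 n2' -EFinD lee_fin; lra.
Qed.

Definition steps d (ys : seq R) x : R := \big[Num.max/0]_(y <- ys) bump d y x.

Lemma measurable_bigmax (I : Type) (r : seq I) (f : I -> R -> R) : (forall i, mf (f i)) ->
  mf (fun x => \big[Num.max/0]_(i <- r) f i x).
Proof.
move=> mF; elim: r => [|i r ih].
  by under eq_fun do rewrite big_nil; exact: measurable_cst.
by under eq_fun do rewrite big_cons; exact: measurable_maxr.
Qed.

Lemma bigmax_ge0 (I : Type) (r : seq I) (f : I -> R) : 0 <= \big[Num.max/0]_(i <- r) f i.
Proof. by elim: r => [|i r ih]; rewrite ?big_nil// big_cons le_max ih orbT. Qed.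

Lemma le_bigmax_seq0 (I : eqType) (r : seq I) (f : I -> R) i : i \in r -> f i <= \big[Num.max/0]_(i <- r) f i.
Proof.
elim: r => // j r ih; rewrite in_cons big_cons le_max => /orP[/eqP ->|/ih ->]; last by rewrite orbT.
by rewrite lexx.
Qed.

Lemma int_sum (I : Type) (r : seq I) (f : I -> R -> R) : (forall i, mf (f i)) -> (forall i x, 0 <= f i x) ->
  (\int[mu]_x (\sum_(i <- r) f i x)%:E = \sum_(i <- r) \int[mu]_x (f i x)%:E)%E.
Proof.
move=> m0 f0; elim: r => [|i r ih].
  by rewrite big_nil; under eq_integral do rewrite big_nil; rewrite integral0.
rewrite big_cons -ih -intD//.
- by apply: eq_integral => x _; rewrite big_cons.
- exact: measurable_sum.
- by move=> x; exact: sumr_ge0.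
Qed.

Lemma n2_sq_max (I : Type) (r : seq I) (a b : I -> R -> R) : (forall i, mf (a i)) -> (forall i, mf (b i)) ->
  (n2 (fun x => \big[Num.max/0]_(i <- r) a i x - \big[Num.max/0]_(i <- r) b i x)%R <=
   \sum_(i <- r) n2 (fun x => a i x - b i x)%R)%E.
Proof.
move=> m1 m2; have m3 i : mf (fun x => (a i x - b i x) ^+ 2) by have := m1 i => ?; have := m2 i => ?; mfun.
rewrite /n2 -int_sum//; last by move=> i x; rewrite sqr_ge0.
apply: le_int.
- have := measurable_bigmax r m1 => ?; have := measurable_bigmax r m2 => ?; mfun.
- exact: measurable_sum.
- by move=> x; rewrite sqr_ge0.
- by move=> x; exact: sq_max_diff.
Qed.

Lemma measurable_steps d ys : mf (steps d ys).
Proof. by apply: measurable_bigmax => y; exact: measurable_bump. Qed.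

Lemma sum_cst_le (r : seq R) (u : R -> \bar R) (c : R) : (forall i, u i <= c%:E)%E ->
  (\sum_(i <- r) u i <= ((size r)%:R * c)%:E)%E.
Proof.
move=> h; elim: r => [|i r ih]; first by rewrite big_nil mul0r.
rewrite big_cons /= -natr1 mulrDl mul1r addrC EFinD; exact: leeD.
Qed.

Lemma n2_steps d ys : 0 <= d -> (n2 (steps d ys) <= ((size ys)%:R * d)%:E)%E.
Proof.
move=> d0; have m0 (i : R) : mf (fun _ : R => 0 : R) by exact: measurable_cst.
have := n2_sq_max ys (measurable_bump d) m0.
have -> : (fun x => \big[Num.max/0]_(i <- ys) bump d i x - \big[Num.max/0]_(i <- ys) (0 : R)) = steps d ys.
  apply/funext => x; rewrite [X in _ - X](_ : _ = 0) ?subr0//.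
  by elim: ys => [|i r ih]; rewrite ?big_nil// big_cons ih maxxx.
move=> /le_trans; apply; apply: sum_cst_le => y.
have -> : (fun x => bump d y x - 0) = bump d y by apply/funext => x; rewrite subr0.
by rewrite n2_bump.
Qed.

Lemma n2_steps_diff d ys h : 0 <= d -> 0 <= h ->
  (n2 (fun x => steps d ys (x + h) - steps d ys x)%R <= ((size ys)%:R * (4 * Num.min d h))%:E)%E.
Proof.
move=> d0 h0; have mbh y : mf (fun x => bump d y (x + h)) by apply: (measurableT_comp (measurable_bump d y) (leb_preserving_shift h).1).
apply: le_trans (n2_sq_max ys mbh (measurable_bump d)) _.
by apply: sum_cst_le => y; exact: n2_bump_diff.
Qed.

Lemma steps_ge1 d ys y x : y \in ys -> y <= x < y + d -> 1 <= steps d ys x.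
Proof.
move=> yin hx; apply: le_trans (le_bigmax_seq0 (fun y => bump d y x) yin).
by rewrite bumpE hx.
Qed.

Lemma steps_ge0 d ys x : 0 <= steps d ys x. Proof. exact: bigmax_ge0. Qed.

(* Layer j has height 2^j on a set of energy of order 16^-j, so that the maximum
   of all layers has energy of order \sum_j 4^j 16^-j. *)
Definition tower (d : nat -> R) (ys : nat -> seq R) (J : nat) x : R :=
  \big[Num.max/0]_(j <- iota 0 J) (2 ^+ j * steps (d j) (ys j) x).

Section tower.
Variables (d : nat -> R) (ys : nat -> seq R) (B s : R).
Hypotheses (s0 : 0 < s) (s1 : s < 1 / 2) (d0 : forall j, 0 < d j) (B0 : 0 <= B).
(** The number of intervals times their length bounds the squared L2 norm of layer j; the number
    times length^(1 - 2s) governs its squared H^s energy. The rate 16^-j outweighs the squared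
    height 4^j. *)
Hypothesis hB1 : forall j, (size (ys j))%:R * d j <= B / 16 ^+ j.
Hypothesis hB2 : forall j, (size (ys j))%:R * (d j) `^ (1 - 2 * s) <= B / 16 ^+ j.

Lemma measurable_tower J : mf (tower d ys J).
Proof. by apply: measurable_bigmax => j; have := measurable_steps (d j) (ys j) => ?; mfun. Qed.

Lemma tower_ge J j x : (j < J)%N -> 2 ^+ j * steps (d j) (ys j) x <= tower d ys J x.
Proof.
move=> jJ; apply: (@le_bigmax_seq0 _ (iota 0 J) (fun j => 2 ^+ j * steps (d j) (ys j) x)).
by rewrite mem_iota.
Qed.

Lemma tower_ge0 J x : 0 <= tower d ys J x. Proof. exact: bigmax_ge0. Qed.

Lemma tower_split J K x : tower d ys (J + K) x =
  Num.max (tower d ys J x) (\big[Num.max/0]_(j <- iota J K) (2 ^+ j * steps (d j) (ys j) x)).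
Proof.
rewrite /tower iotaD add0n; elim: (iota 0 J) => [|i r ih] /=.
  by rewrite big_nil max_r// bigmax_ge0.
by rewrite !big_cons ih maxA.
Qed.

Lemma tower_mono J K x : (J <= K)%N -> tower d ys J x <= tower d ys K x.
Proof. by move=> /subnKC <-; rewrite tower_split le_max lexx. Qed.

Lemma sum4 J K : \sum_(j <- iota J K) (4 ^+ j * (B / 16 ^+ j)) <= 2 * B * 4 ^- J.
Proof.
elim: K J => [|K ih] J /=.
  by rewrite big_nil !mulr_ge0// ?invr_ge0 ?exprn_ge0.
rewrite big_cons; apply: (le_trans (lerD (lexx _) (ih J.+1))).
have -> : 4 ^+ J * (B / 16 ^+ J) = B * 4 ^- J.
  rewrite (_ : 16 = 4 * 4 :> R); last by ring.
  by rewrite exprMn; field; rewrite expf_neq0.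
rewrite exprS invfM; have : 0 <= B * 4 ^- J by rewrite mulr_ge0 ?invr_ge0 ?exprn_ge0.
by move: (B * 4 ^- J) (4 ^- J) => a b; set c := 2 * B * (4^-1 * b); rewrite /c; lra.
Qed.

Lemma sum4_lim (e : R) : 0 < e -> exists J : nat, forall m, (J <= m)%N -> 2 * B * 4 ^- m <= e.
Proof.
move=> e0; exists (Num.truncn (2 * B / e)).+1 => m Jm.
rewrite ler_pdivrMr ?exprn_gt0// -ler_pdivrMl// [leLHS]mulrC.
apply: (le_trans (ltW (truncnS_gt _))).
apply: (@le_trans _ _ m%:R); first by rewrite ler_nat.
by rewrite -natrX ler_nat ltnW// ltn_expl.
Qed.

(** The increment of the tower is dominated by the maximum over the new layers alone, whose energies
    add. *)
Lemma n2_tower_diffJ J K : (J <= K)%N ->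
  (n2 (fun x => tower d ys K x - tower d ys J x)%R <= (2 * B * 4 ^- J)%:E)%E.
Proof.
move=> /subnKC <-; set L := (K - J)%N.
have ms j : mf (fun x => 2 ^+ j * steps (d j) (ys j) x) by have := measurable_steps (d j) (ys j) => ?; mfun.
have m0 (i : nat) : mf (fun _ : R => 0 : R) by exact: measurable_cst.
pose G x := \big[Num.max/0]_(j <- iota J L) (2 ^+ j * steps (d j) (ys j) x).
have mG : mf G by exact: measurable_bigmax.
have h1 : (n2 (fun x => tower d ys (J + L) x - tower d ys J x)%R <= n2 G)%E.
  apply: le_n2 => //.
    by have := measurable_tower J => ?; have := measurable_tower (J + L)%N => ?; mfun.
  move=> x; have h := tower_ge0 J x; have g : 0 <= G x := bigmax_ge0 _ _.
  rewrite tower_split -/(G x) (ger0_norm g).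
  by have [h2|h2] := leP (tower d ys J x) (G x); rewrite ?subrr ?normr0// ger0_norm; lra.
apply: (le_trans h1).
have -> : n2 G = n2 (fun x => G x - \big[Num.max/0]_(j <- iota J L) (0 : R)).
  congr n2; apply/funext => x; rewrite [X in _ - X](_ : _ = 0) ?subr0//.
  by elim: (iota J L) => [|i r ih]; rewrite ?big_nil// big_cons ih maxxx.
apply: (le_trans (n2_sq_max (iota J L) ms m0)).
apply: (@le_trans _ _ (\sum_(j <- iota J L) (4 ^+ j * (B / 16 ^+ j)))%:E); last by rewrite lee_fin sum4.
rewrite -sumEFin; apply: lee_sum => j _.
have -> : (fun x => 2 ^+ j * steps (d j) (ys j) x - 0) = (fun x => 2 ^+ j * steps (d j) (ys j) x) by apply/funext => x; rewrite subr0.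
rewrite n2Z; last exact: measurable_steps.
rewrite -exprM mulnC exprM (_ : 2 ^+ 2 = 4 :> R); last by ring.
rewrite EFinM; apply: lee_wpmul2l; first by rewrite lee_fin exprn_ge0.
by apply: (le_trans (n2_steps (ys j) (ltW (d0 j)))); rewrite lee_fin.
Qed.

Lemma n2_tower_shift J h : 0 <= h ->
  (n2 (fun x => tower d ys J (x + h) - tower d ys J x)%R <=
   (\sum_(j <- iota 0 J) (4 ^+ j * ((size (ys j))%:R * (4 * Num.min (d j) h))))%:E)%E.
Proof.
move=> h0.
have ms j : mf (fun x => 2 ^+ j * steps (d j) (ys j) x) by have := measurable_steps (d j) (ys j) => ?; mfun.
have msh j : mf (fun x => 2 ^+ j * steps (d j) (ys j) (x + h)).
  by apply: (measurableT_comp (ms j) (leb_preserving_shift h).1).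
apply: (le_trans (n2_sq_max (iota 0 J) msh ms)).
rewrite -sumEFin; apply: lee_sum => j _.
have -> : (fun x => 2 ^+ j * steps (d j) (ys j) (x + h) - 2 ^+ j * steps (d j) (ys j) x) =
          (fun x => 2 ^+ j * (steps (d j) (ys j) (x + h) - steps (d j) (ys j) x)) by apply/funext => x; rewrite mulrBr.
rewrite n2Z; last first.
  have := measurable_steps (d j) (ys j) => mj.
  have := measurableT_comp mj (leb_preserving_shift h).1 => mj2.
  exact: mf_sub.
rewrite -exprM mulnC exprM (_ : 2 ^+ 2 = 4 :> R); last by ring.
rewrite EFinM; apply: lee_wpmul2l; first by rewrite lee_fin exprn_ge0.
exact: n2_steps_diff (ltW (d0 j)) h0.
Qed.

(** Summing over the scales first, [minsum_fin] with th = 2s turns min(d, 2^-k) into d^(1 - 2s), the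
    quantity in [hB2]; the layers are then summed geometrically. The 8 is the 4 of [n2_bump_diff]
    times the 2 of [sum4]. *)
Lemma tower_energy J n :
  \sum_(0 <= k < n) (2 `^ (2 * s)) ^+ k * (\sum_(j <- iota 0 J) (4 ^+ j * ((size (ys j))%:R * (4 * Num.min (d j) (2 ^- k))))) <=
  8 * minsum_cst (2 * s) * B.
Proof.
have [t0 t1] := twice_lt1 s0 s1.
have C0 := minsum_cst_ge0 t0 t1.
under eq_bigr do rewrite big_distrr /=.
rewrite exchange_big /=.
apply: (@le_trans _ _ (\sum_(j <- iota 0 J) 4 * minsum_cst (2 * s) * (4 ^+ j * (B / 16 ^+ j)))); last first.
  rewrite -big_distrr /=; have := sum4 0 J; rewrite expr0 invr1 mulr1 => h.
  have : 4 * minsum_cst (2 * s) * (\sum_(j <- iota 0 J) 4 ^+ j * (B / 16 ^+ j)) <= 4 * minsum_cst (2 * s) * (2 * B).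
    by apply: ler_wpM2l => //; rewrite mulr_ge0.
  lra.
apply: ler_sum => j _.
have -> : \sum_(0 <= k < n) (2 `^ (2 * s)) ^+ k * (4 ^+ j * ((size (ys j))%:R * (4 * Num.min (d j) (2 ^- k)))) =
  4 * (4 ^+ j * (size (ys j))%:R) * \sum_(0 <= k < n) (2 `^ (2 * s)) ^+ k * Num.min (d j) (2 ^- k).
  by rewrite big_distrr /=; apply: eq_bigr => k _; ring.
have c1 : 0 <= 4 * (4 ^+ j * (size (ys j))%:R) :> R by rewrite !mulr_ge0// exprn_ge0.
apply: (le_trans (ler_wpM2l c1 (minsum_fin n t0 t1 (d0 j)))).
have -> : 4 * (4 ^+ j * (size (ys j))%:R) * (minsum_cst (2 * s) * d j `^ (1 - 2 * s)) =
  4 * minsum_cst (2 * s) * (4 ^+ j * ((size (ys j))%:R * d j `^ (1 - 2 * s))) by ring.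
by apply: ler_wpM2l; [rewrite mulr_ge0|apply: ler_wpM2l; [rewrite exprn_ge0|exact: hB2]].
Qed.

(** F is the L2 limit of the increasing towers. Its difference series is bounded through partial
    sums: for a fixed number n of scales, a tower close enough to F transfers the uniform bound
    [tower_energy]. *)
Lemma bad_function : exists F : R -> R, [/\ L2r F, (W s (fourier (realC F)) < +oo)%E &
  {ae mu, forall x, forall j, 2 ^+ j * steps (d j) (ys j) x <= F x}].
Proof.
have mT := measurable_tower.
have [F [mF cF]] : exists g, mf g /\ conv2 (tower d ys) g.
  apply: L2_complete => // e e0; have [J hJ] := sum4_lim e0; exists J => n m Jn Jm.
  have [nm|mn] := leqP n m.
    rewrite n2BC; apply: (le_trans (n2_tower_diffJ nm)).
    by rewrite lee_fin hJ.
  by apply: (le_trans (n2_tower_diffJ (ltnW mn))); rewrite lee_fin hJ.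
move/conv2P in cF.
have n2T J : (n2 (tower d ys J) <= (2 * B)%:E)%E.
  have := n2_tower_diffJ (leq0n J); rewrite expr0 invr1 mulr1.
  by have -> : (fun x => tower d ys J x - tower d ys 0 x) = tower d ys J by apply/funext => x; rewrite /tower /= big_nil subr0.
have near (e : R) : 0 < e -> exists J0, forall J, (J0 <= J)%N -> (n2 (fun x => tower d ys J x - F x)%R <= e%:E)%E.
  by move=> /cF [J0 _ hJ]; exists J0 => J hJ0; exact: hJ.
have lF : L2r F.
  split => //; apply: (@le_lt_trans _ _ (2 * B)%:E); last by rewrite ltry.
  apply: n2_le_approx => // e /near[J hJ]; exists (tower d ys J); split => //.
  exact: hJ.
exists F; split => //.
- have lf := L2_realC lF.
  apply: (le_lt_trans (W_le_diff s0 lf)).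
  apply: lte_mul_pinfty => //; first by rewrite lee_fin W_cst_ge0.
  apply: lte_add_pinfty; first by case: (L2_fourier (realC F)).
  set P : R := (2 * pi) ^+ 2.
  pose E0 : R := P * (2 * (8 * minsum_cst (2 * s) * B) + 1).
  apply: (@le_lt_trans _ _ E0%:E); last by rewrite ltry.
  have P0 : 0 < P by rewrite exprn_gt0// mulr_gt0// pi_gt0.
  have q0 k : 0 <= (4 `^ s) ^+ k :> R by rewrite exprn_ge0// powR_ge0.
  have nn h : L2norm_sq (fun x => realC F (x + h) - realC F x) = n2 (fun x => F (x + h) - F x).
    apply: eq_integral => x _; congr EFin; rewrite normc_sq reB imB /realC /=; ring.
  apply: lime_le.
    apply: is_cvg_nneseries => k _ _; apply: mule_ge0; first by rewrite lee_fin.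
    by apply: mule_ge0; [rewrite lee_fin ltW|rewrite nn; exact: n2_ge0].
  apply: nearW => n.
  (* The total weight of the first n scales. The tower is chosen after n, with squared distance to F
     at most 1 / (8 (Q + 1)), so that the weighted errors add up to at most 1, apart from the factor
     [P]. *)
  pose Q : R := \sum_(0 <= k < n) (4 `^ s) ^+ k.
  have Q0 : 0 <= Q by apply: sumr_ge0.
  have e0 : 0 < (8 * (Q + 1))^-1 by rewrite invr_gt0; lra.
  have [J hJ] := near _ e0; set e := (8 * (Q + 1))^-1 in e0 hJ.
  pose u k := \sum_(j <- iota 0 J) (4 ^+ j * ((size (ys j))%:R * (4 * Num.min (d j) (2 ^- k)))).
  (* The difference of F is that of the tower minus that of the error tower - F. Each gets a factor
     2 from [n2B], and the second has squared norm at most 4 e by translation invariance. *)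
  have hn k : (n2 (fun x => F (x + 2 ^- k) - F x)%R <= (2 * u k + 8 * e)%:E)%E.
    have h0 : 0 <= 2 ^- k :> R by rewrite invr_ge0 exprn_ge0.
    set h := 2 ^- k.
    have mFh : mf (fun x => F (x + h)) by exact: (measurableT_comp mF (leb_preserving_shift h).1).
    have mTh : mf (fun x => tower d ys J (x + h)) by exact: (measurableT_comp (mT J) (leb_preserving_shift h).1).
    have mG : mf (fun x => tower d ys J x - F x) by exact: mf_sub.
    have mGh : mf (fun x => tower d ys J (x + h) - F (x + h)) by exact: mf_sub.
    have mD : mf (fun x => tower d ys J (x + h) - tower d ys J x) by exact: mf_sub.
    have mE : mf (fun x => (tower d ys J (x + h) - F (x + h)) - (tower d ys J x - F x)) by exact: mf_sub.
    have -> : (fun x => F (x + h) - F x) = (fun x => (tower d ys J (x + h) - tower d ys J x) - ((tower d ys J (x + h) - F (x + h)) - (tower d ys J x - F x))).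
      by apply/funext => x; ring.
    apply: (le_trans (n2B mD mE)).
    have -> : (2 * u k + 8 * e)%:E = ((2 * u k)%:E + (8 * e)%:E)%E by [].
    apply: leeD.
      by rewrite EFinM; apply: lee_wpmul2l; [rewrite lee_fin|exact: n2_tower_shift].
    have a1 := hJ J (leqnn J).
    have a2 := n2B mGh mG.
    rewrite (n2_leb_preserving (leb_preserving_shift h) mG) in a2.
    have a3 : (n2 (fun x => ((tower d ys J (x + h) - F (x + h)) - (tower d ys J x - F x)))%R <= (4 * e)%:E)%E.
      apply: (le_trans a2); have : (2%:E * n2 (fun x => (tower d ys J x - F x))%R <= 2%:E * e%:E)%E.
        by apply: lee_wpmul2l => //; rewrite lee_fin.
      move=> a4; apply: (le_trans (leeD a4 a4)); rewrite -EFinM -EFinD lee_fin; lra.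
    apply: (@le_trans _ _ (2%:E * (4 * e)%:E)%E); first by apply: lee_wpmul2l => //; rewrite lee_fin.
    by rewrite -EFinM lee_fin; lra.
  apply: (@le_trans _ _ (\sum_(0 <= k < n) ((4 `^ s) ^+ k * (P * (2 * u k + 8 * e)))%:E)%E).
    apply: lee_sum => k _.
    have -> : ((4 `^ s) ^+ k * (P * (2 * u k + 8 * e)))%:E = (((4 `^ s) ^+ k)%:E * (P%:E * (2 * u k + 8 * e)%:E))%E by [].
    apply: lee_wpmul2l; first by rewrite lee_fin.
    by apply: lee_wpmul2l; [rewrite lee_fin ltW|rewrite nn].
  rewrite sumEFin lee_fin.
  have -> : \sum_(0 <= k < n) (4 `^ s) ^+ k * (P * (2 * u k + 8 * e)) =
    P * (2 * (\sum_(0 <= k < n) (4 `^ s) ^+ k * u k) + (8 * e) * Q).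
    rewrite mulrDr mulrCA [RHS]addrC /Q !big_distrr /= -big_split /=; apply: eq_bigr => k _; ring.
  rewrite /E0 ler_pM2l//; apply: lerD.
    rewrite ler_pM2l//; have := tower_energy J n.
    by have -> : 2 `^ (2 * s) = 4 `^ s :> R by rewrite powRrM; congr (_ `^ _); rewrite powR_mulrn//; ring.
  have -> : 8 * e * Q = Q / (Q + 1) by rewrite /e invfM; field; lra.
  by rewrite ler_pdivrMr; lra.
- apply: ae_foralln => j.
  (* As the towers increase, tower j+1 minus F is at most tower K minus F for all later K, which
     tends to 0 in L2. So the positive part has norm 0. *)
  have mP : mf (fun x => Num.max (tower d ys j.+1 x - F x) 0).
    by apply: measurable_maxr; [exact: mf_sub|exact: measurable_cst].
  have z : n2 (fun x => Num.max (tower d ys j.+1 x - F x) 0) = 0%E.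
    apply/eqP; rewrite eq_le n2_ge0 andbT; apply/lee_addgt0Pr => e e0; rewrite add0e.
    have [J hJ] := near e e0; pose K := maxn J j.+1.
    apply: le_trans (hJ K (leq_maxl _ _)); apply: le_n2 => //; first exact: mf_sub.
    move=> x; have h := tower_mono x (leq_maxr J j.+1).
    have [h1|h1] := leP (tower d ys j.+1 x - F x) 0; first by rewrite normr0.
    rewrite gtr0_norm//; apply: le_trans (ler_norm _); rewrite /K; lra.
  have := n2_eq0 mP z; apply: filterS => x hx.
  have h1 := @tower_ge j.+1 j x (ltnSn j).
  have : tower d ys j.+1 x - F x <= 0 by rewrite -hx le_max lexx.
  lra.
Qed.

End tower.

End step_functions.

(** * Decay rates *)

Section rates.
Context {R : realType}.
Notation mu := (@lebesgue_measure R).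
Notation mf := (measurable_fun setT).
Implicit Types (s : R) (t : nat -> R).

Lemma nonincreasing_cvg0_ge0 t : nonincreasing_seq t -> t n @[n --> \oo] --> (0 : R) -> forall n, 0 <= t n.
Proof.
move=> ht t0 n; have := nonincreasing_cvgn_ge ht (cvgP _ t0) n.
by rewrite (cvg_lim _ t0).
Qed.

(** The contradiction is one of measure. Convergence bounds Re S^1 F(x, t_n) in n for almost every
    x, which forces almost every x in [0, 1] to be uncovered at all late levels j; yet the uncovered
    part has measure at most 1/2 at each level. *)
Lemma gap_growth s t : 0 < s -> s < 1 / 2 -> nonincreasing_seq t -> t n @[n --> \oo] --> (0 : R) ->
  nonincreasing_seq (fun n => t n - t n.+1) ->
  (forall f : R -> R[i], Hs s f ->
     {ae mu, forall x, Normc.normc (S1 f (t n) x - f x) @[n --> \oo] --> (0 : R)}) ->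
  exists K : R, forall N, N%:R * (t N - t N.+1) `^ (2 * s) <= K.
Proof.
move=> s0 s1 ht t0 hdt H; have tp := nonincreasing_cvg0_ge0 ht t0.
have [ts0 ts1] := twice_lt1 s0 s1.
apply: contrapT => hK.
have hK' : forall K : R, exists N, K < N%:R * (t N - t N.+1) `^ (2 * s).
  move=> K; apply: contrapT => h; apply: hK; exists K => N; rewrite leNgt; apply/negP => h2.
  by apply: h; exists N.
have /choice[N hN] : forall j : nat, exists N, 16 ^+ j < N%:R * (t N - t N.+1) `^ (2 * s) by move=> j; exact: hK'.
pose d j := t (N j) - t (N j).+1.
have p16 (j : nat) : 0 < 16 ^+ j :> R by rewrite exprn_gt0.
have dge j : 0 <= d j by rewrite subr_ge0; exact: ht.
have d0 j : 0 < d j.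
  rewrite lt_neqAle dge andbT; apply/eqP => e; have := hN j; rewrite -/(d j) -e powR0 ?gt_eqF// mulr0.
  by rewrite ltNge ltW.
have N0 j : 0 < (N j)%:R :> R.
  rewrite lt_neqAle ler0n andbT; apply/eqP => e; have := hN j; rewrite -e mul0r.
  by rewrite ltNge ltW.
set T := t 0%N; have T0 : 0 <= T := tp 0%N.
have T1 : 0 < 1 + T by apply: (lt_le_trans ltr01); rewrite lerDl.
have gap j n : (n < N j)%N -> d j <= t n - t n.+1 by move=> nN; apply: hdt; exact: ltnW.
have hE j := mu_comb (dge j) ht (gap j).
have hsub j := comb_sub ht tp (gap j).
have mT j : (N j)%:R * d j <= T.
  rewrite -lee_fin -hE; apply: (@le_trans _ _ (mu `[- T, 0]%classic)).
    apply: le_mu; [exact: measurable_comb|exact: measurable_itv|].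
    by move=> z /hsub; rewrite /= in_itv.
  rewrite lebesgue_measure_itv /= lte_fin; case: ifPn => _; last by rewrite lee_fin.
  by rewrite -EFinD lee_fin sub0r opprK.
have /choice[ys hys] : forall j, exists ys : seq R, (size ys)%:R * ((N j)%:R * d j) <= 4 * (1 + T) /\
    (mu (uncovered (comb t (d j) (N j)) ys) <= (1 / 2)%:E)%E.
  move=> j; apply: (cover_half (measurable_comb t (d j) (N j)) T0 (mulr_gt0 (N0 j) (d0 j)) (mT j) (hsub j) (hE j)).
(* The second factor 1 + T bounds d_j^(2s), which turns the H^s bound [hb2] into the L2 bound
   [hB1]. *)
pose B := 4 * (1 + T) * (1 + T).
have dT j : d j <= 1 + T.
  have := tp (N j).+1; have := ht _ _ (leq0n (N j)); rewrite -/T /d; lra.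
(* For M translates M N d <= 4 (1 + T), and N d^(2s) > 16^j by the choice of N; the quotient of
   these is the claim. *)
have hb2 j : (size (ys j))%:R * (d j) `^ (1 - 2 * s) <= 4 * (1 + T) / 16 ^+ j.
  rewrite ler_pdivlMr//.
  have [h1 _] := hys j; apply: le_trans h1.
  have hd : d j = d j `^ (1 - 2 * s) * d j `^ (2 * s).
    by rewrite -powRD ?subrK ?powRr1 ?dge//; rewrite (gt_eqF (d0 j)) implybT.
  rewrite -mulrA ler_wpM2l//; rewrite {2}hd mulrCA ler_wpM2l ?powR_ge0//.
  exact: ltW.
have B0 : 0 <= B by rewrite !mulr_ge0// ltW.
have hB2 j : (size (ys j))%:R * (d j) `^ (1 - 2 * s) <= B / 16 ^+ j.
  apply: (le_trans (hb2 j)); rewrite ler_pM2r ?invr_gt0// /B ler_peMr//; last by rewrite lerDl.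
  by rewrite mulr_ge0// ltW.
have hB1 j : (size (ys j))%:R * d j <= B / 16 ^+ j.
  have -> : (size (ys j))%:R * d j = ((size (ys j))%:R * (d j) `^ (1 - 2 * s)) * d j `^ (2 * s).
    by rewrite -mulrA -powRD ?subrK ?powRr1 ?dge//; rewrite (gt_eqF (d0 j)) implybT.
  have h2 : d j `^ (2 * s) <= 1 + T.
    apply: (@le_trans _ _ ((1 + T) `^ (2 * s))).
      by apply: ge0_ler_powR; rewrite ?nnegrE ?(ltW ts0) ?(ltW T1).
    rewrite -[leRHS](powRr1 (ltW T1)); apply: ler_powR; [by rewrite lerDl|exact: ltW].
  have -> : B / 16 ^+ j = (4 * (1 + T) / 16 ^+ j) * (1 + T) by rewrite /B; ring.
  by apply: ler_pM; rewrite ?mulr_ge0 ?powR_ge0.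
have [F [lF WF Fge]] := bad_function s0 s1 d0 B0 hB1 hB2.
have lf := L2_realC lF.
have hf : Hs s (realC F) by split => //; exact: lty_Hnorm.
have a1 := H _ hf.
have a2 : {ae mu, forall x, forall n, complex.Re (S1 (realC F) (t n) x) = (F (x + t n) + F (x - t n)) / 2}.
  by apply: ae_foralln => n; exact: Re_S1_real.
have a3 : {ae mu, forall x, forall n j, 2 ^+ j * steps (d j) (ys j) (x + t n) <= F (x + t n)}.
  by apply: ae_foralln => n; exact: (ae_leb_preserving (leb_preserving_shift (t n)) Fge).
have a4 : {ae mu, forall x, forall n j, 2 ^+ j * steps (d j) (ys j) (x - t n) <= F (x - t n)}.
  by apply: ae_foralln => n; exact: (ae_leb_preserving (leb_preserving_shift (- t n)) Fge).
(* Re S^1 F averages F(x + t_n) and F(x - t_n). Nonnegativity of the second term prevents it from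
   cancelling the first. *)
have a34 : {ae mu, forall x, forall n j, 2 ^+ j * steps (d j) (ys j) (x + t n) <= F (x + t n) /\ 0 <= F (x - t n)}.
  apply: filterS2 a3 a4 => x h3 h4 n j; split => //.
  by apply: le_trans (h4 n 0%N); rewrite mulr_ge0 ?steps_ge0.
have a12 : {ae mu, forall x, exists M : R, forall n, (F (x + t n) + F (x - t n)) / 2 <= M}.
  apply: filterS2 a1 a2 => x h1 h2.
  have [M [_ hM]] := cvg_seq_bounded (cvgP _ h1).
  exists (M + 1 + `|F x|) => n; rewrite -h2.
  have h3 := hM (M + 1) (ltr_pwDr ltr01 (lexx M)) n I.
  rewrite /= ger0_norm ?normc_ge0// in h3.
  have h4 : complex.Re (S1 (realC F) (t n) x) - F x <= Normc.normc (S1 (realC F) (t n) x - realC F x).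
    apply: (@le_trans _ _ `|complex.Re (S1 (realC F) (t n) x - realC F x)|).
      by rewrite reB /realC /= ler_norm.
    rewrite -(@ler_pXn2r _ 2)// ?nnegrE ?normc_ge0// normc_sq real_normK ?num_real// lerDl sqr_ge0//.
  have := ler_norm (F x); lra.
pose Z j := uncovered (comb t (d j) (N j)) (ys j).
have mZ j : measurable (Z j) by apply: measurable_uncovered; exact: measurable_comb.
have conv : {ae mu, forall x, (\1_(Z j) x : R) @[j --> \oo] --> (\1_(`[0, 1]%classic) x : R)}.
  apply: filterS2 a12 a34 => x [M hM] h34.
  have [x1|x1] := boolP (x \in `[0, 1]); last first.
    rewrite [X in _ --> X]indicE memNset; last by apply/negP.
    apply: cvg_near_cst; apply: nearW => j; rewrite indicE memNset// => -[x2 _].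
    by move/negP: x1; apply; rewrite in_itv.
  rewrite [X in _ --> X]indicE mem_set//.
  (* From this level on 2^j > 2 |M|. A covered x would give F(x + t_n) >= 2^j, against F(x + t_n) <=
     2 M. *)
  apply: cvg_near_cst; exists (Num.truncn (2 * `|M|)).+1 => // j /= hj; rewrite indicE mem_set//.
  split; first by move: x1; rewrite in_itv.
  move=> y yin [n nN h]; have [h1 h2] := h34 n j.
  have yst : y <= x + t n < y + d j by move: h => /andP[g1 g2]; apply/andP; split; lra.
  have h3 := steps_ge1 yin yst.
  have h4 : 2 ^+ j <= 2 ^+ j * steps (d j) (ys j) (x + t n) by rewrite ler_peMr// exprn_ge0.
  have h5 : 2 * `|M| < 2 ^+ j.
    apply: (lt_le_trans (truncnS_gt _)); apply: (@le_trans _ _ j%:R); first by rewrite ler_nat.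
    by rewrite -natrX ler_nat ltnW// ltn_expl.
  have := hM n; have := ler_norm M; lra.
have m01 : mf (\1_(`[0, 1]%classic) : R -> R) by exact: measurable_indic_itv.
have mZf j : mf (\1_(Z j) : R -> R) by exact: measurable_indic.
have n2i (A : set R) : measurable A -> n2 (\1_A : R -> R) = mu A.
  move=> mA; rewrite -int_indic//; apply: eq_integral => x _; congr EFin.
  by rewrite indicE; case: (_ \in _); rewrite ?expr1n ?expr0n.
pose I01 : set R := `[0, 1]%classic.
have : (n2 (\1_I01 : R -> R) <= (1 / 2)%:E)%E.
  apply: (n2_fatou_le m01 mZf conv); apply: nearW => j; rewrite n2i//.
  by have [_] := hys j.
rewrite n2i; last exact: measurable_itv.
rewrite lebesgue_measure_itv /= lte_fin ltr01 -EFinD subr0 lee_fin; lra.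
Qed.

(** The reciprocal of rho(s). For a nonnegative nonincreasing sequence, weak l^rho means decay of
    order n^(-kappa). *)
Definition kappa s : R := (1 - 2 * s) / (2 * s).

Lemma kappa_gt0 s : 0 < s -> s < 1 / 2 -> 0 < kappa s.
Proof. by move=> s0 s1; have [h1 h2] := twice_lt1 s0 s1; rewrite divr_gt0//; lra. Qed.

(** The drops over the blocks from 2^m N to 2^(m+1) N form a geometric series of ratio 2^(-k), and
    the remaining term t(2^m N) tends to 0. *)
Lemma doubling_decay t (K k : R) : 0 < k -> t n @[n --> \oo] --> (0 : R) -> 0 <= K ->
  (forall N, (0 < N)%N -> t N - t (2 * N)%N <= K * N%:R `^ (- k)) ->
  forall N, (0 < N)%N -> t N <= K / (1 - 2 `^ (- k)) * N%:R `^ (- k).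
Proof.
move=> k0 t0 K0 H N N0.
have q1 : 1 < 2 `^ k :> R.
  apply: (@le_lt_trans _ _ (1 `^ k)); first by rewrite powR1.
  apply: gt0_ltr_powR => //.
  - by rewrite nnegrE.
  - by rewrite nnegrE.
  - by rewrite ltr1n.
set r : R := 2 `^ (- k).
have r0 : 0 < r by exact: powR_gt0.
have r1 : r < 1 by rewrite /r powRN invf_lt1// (lt_trans ltr01).
set C := (1 - r)^-1; have C0 : 0 < C by rewrite invr_gt0 subr_gt0.
have CE : C * (1 - r) = 1 by rewrite mulVf// subr_eq0 gt_eqF.
have step m : forall M, (0 < M)%N -> t M <= K * C * M%:R `^ (- k) + t (2 ^ m * M)%N.
  elim: m => [|m ih] M M0.
    by rewrite expn0 mul1n lerDr !mulr_ge0 ?powR_ge0// ltW.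
  have h1 := H M M0; have M2 : (0 < 2 * M)%N by rewrite muln_gt0.
  have := ih (2 * M)%N M2; rewrite natrM powRM// -/r mulnA -expnSr => h2.
  have : K * C * (r * M%:R `^ (- k)) = K * C * M%:R `^ (- k) - K * M%:R `^ (- k).
    have -> : K * C * (r * M%:R `^ (- k)) = K * M%:R `^ (- k) * (C - C * (1 - r)) by ring.
    by rewrite CE; ring.
  move=> e; rewrite e in h2; lra.
have lim : (fun m => K * C * N%:R `^ (- k) + t (2 ^ m * N)%N) @ \oo --> K * C * N%:R `^ (- k) + 0.
  apply: cvgD; first exact: cvg_cst.
  apply: (cvg_comp _ _ _ t0) => P [n0 _ hP]; exists n0 => // m /= hm; apply: hP => /=.
  apply: (leq_trans hm); apply: (@leq_trans (2 ^ m)); first by rewrite ltnW// ltn_expl.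
  by rewrite leq_pmulr.
rewrite addr0 in lim; rewrite -(cvg_lim _ lim)//.
apply: limr_ge; first exact: cvgP lim.
by apply: nearW => m; exact: step.
Qed.

(** As the gaps decrease, t_N - t_(2N) <= N (t_N - t_(N+1)) <= N (K / N)^(1/(2s)), and 1 - 1/(2s) =
    - kappa. *)
Lemma gap_growth_decay s t (K : R) : 0 < s -> s < 1 / 2 -> nonincreasing_seq t -> t n @[n --> \oo] --> (0 : R) ->
  nonincreasing_seq (fun n => t n - t n.+1) ->
  (forall N, N%:R * (t N - t N.+1) `^ (2 * s) <= K) ->
  exists D : R, 0 <= D /\ forall N, (0 < N)%N -> t N <= D * N%:R `^ (- kappa s).
Proof.
move=> s0 s1 ht t0 hdt hK; have [ts0 ts1] := twice_lt1 s0 s1.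
have k0 := kappa_gt0 s0 s1.
have K0 : 0 <= K by apply: le_trans (hK 0%N); rewrite mul0r.
pose K1 := K `^ (2 * s)^-1.
have K10 : 0 <= K1 by exact: powR_ge0.
have gap0 n : 0 <= t n - t n.+1 by rewrite subr_ge0 ht.
have block N : (0 < N)%N -> t N - t (2 * N)%N <= K1 * N%:R `^ (- kappa s).
  move=> N0; have n0 : 0 < N%:R :> R by rewrite ltr0n.
  apply: (@le_trans _ _ (N%:R * (t N - t N.+1))).
    have tel m : t N - t (N + m)%N <= m%:R * (t N - t N.+1).
      elim: m => [|m ih]; first by rewrite addn0 subrr mul0r.
      have := hdt _ _ (leq_addr m N); rewrite /= -natr1 mulrDl mul1r addnS; lra.
    by have := tel N; rewrite addnn -mul2n.
  have gE : t N - t N.+1 = ((t N - t N.+1) `^ (2 * s)) `^ (2 * s)^-1.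
    by rewrite -powRrM divff ?gt_eqF// powRr1.
  have h1 : (t N - t N.+1) `^ (2 * s) <= K / N%:R by rewrite ler_pdivlMr// mulrC.
  have h2 : t N - t N.+1 <= (K / N%:R) `^ (2 * s)^-1.
    rewrite {1}gE; apply: ge0_ler_powR; rewrite ?nnegrE ?powR_ge0 ?divr_ge0 ?invr_ge0 ?(ltW ts0)//.
  apply: (le_trans (ler_wpM2l (ltW n0) h2)).
  rewrite powRM ?invr_ge0// mulrCA -/K1 ler_wpM2l//.
  rewrite -powR_inv1// -powRrM -{1}(powRr1 (ltW n0)) -powRD ?(gt_eqF n0) ?implybT//.
  rewrite le_eqVlt; apply/orP; left; apply/eqP; congr (_ `^ _).
  by rewrite /kappa; field; rewrite gt_eqF.
exists (K1 / (1 - 2 `^ (- kappa s))); split; last exact: doubling_decay.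
rewrite divr_ge0// subr_ge0 powRN invf_le1 ?powR_gt0//.
by rewrite -[leLHS](powRr0 2); apply: ler_powR; [rewrite ler1n|exact: ltW].
Qed.

Lemma counting_le (A : set nat) m : A `<=` `I_m -> ((counting A : \bar R) <= m%:R%:E)%E.
Proof.
move=> h; have fA : finite_set A := sub_finite_set h (finite_II m).
rewrite /counting asboolT// lee_fin ler_nat; apply: geq_card_fset_set.
exact: subset_card_le.
Qed.

Lemma counting_ge (A : set nat) m : `I_m `<=` A -> (m%:R%:E <= (counting A : \bar R))%E.
Proof.
move=> h; rewrite /counting; case: ifPn => [/asboolP fA|_]; last exact: leey.
rewrite lee_fin ler_nat; apply: leq_card_fset_set => //; exact: subset_card_le.
Qed.

Lemma decay_weak_ell s t (D : R) : 0 < s -> s < 1 / 2 -> nonincreasing_seq t -> (forall n, 0 <= t n) -> 0 <= D ->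
  (forall N, (0 < N)%N -> t N <= D * N%:R `^ (- kappa s)) -> weak_ell (2 * s / (1 - 2 * s)) t.
Proof.
move=> s0 s1 ht tp D0 hD; have [ts0 ts1] := twice_lt1 s0 s1; have k0 := kappa_gt0 s0 s1.
set r := 2 * s / (1 - 2 * s).
have r0 : 0 < r by rewrite divr_gt0// subr_gt0.
have kr : kappa s * r = 1 by rewrite /kappa /r; field; rewrite !gt_eqF//; lra.
pose S := D `^ r + 2 * (t 0%N) `^ r.
rewrite /weak_ell; apply: (@le_lt_trans _ _ S%:E); last by rewrite ltry.
apply: ge_ereal_sup => _ [b b0 <-].
have b0' : 0 < b := b0.
have S0 : 0 <= S by rewrite addr_ge0 ?mulr_ge0 ?powR_ge0.
have br : 0 <= b `^ r by exact: powR_ge0.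
have [tb|bt] := leP (t 0%N) b.
  have e : [set n | b < `|t n|] `<=` `I_0.
    move=> n /=; rewrite ger0_norm// => h; have := ht _ _ (leq0n n); lra.
  apply: (@le_trans _ _ ((b `^ r)%:E * 0%:R%:E)%E); last by rewrite mule0 lee_fin.
  by apply: lee_wpmul2l; [rewrite lee_fin|exact: counting_le].
(* The index 0, to which the decay bound does not apply, is always counted. The surplus 2 b^r is at
   most 2 (t_0)^r because b < t_0, whence the second term of [S]. *)
pose X := (D / b) `^ r; pose m := (Num.truncn X).+2.
have e : [set n | b < `|t n|] `<=` `I_m.
  move=> [|n] //=; rewrite ger0_norm// => h; rewrite /m !ltnS.
  have h1 := hD n.+1 isT.
  have n0 : 0 < n.+1%:R :> R by rewrite ltr0n.
  have h2 : b * n.+1%:R `^ kappa s <= D.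
    have nk : 0 < n.+1%:R `^ kappa s :> R by exact: powR_gt0.
    rewrite -ler_pdivlMr//; rewrite powRN in h1; exact: le_trans (ltW h) h1.
  have h3 : n.+1%:R <= X.
    have -> : n.+1%:R = (n.+1%:R `^ kappa s) `^ r :> R by rewrite -powRrM kr powRr1// ltW.
    apply: ge0_ler_powR; rewrite ?nnegrE ?powR_ge0 ?(ltW r0)//; first by rewrite divr_ge0// ltW.
    by rewrite ler_pdivlMr// mulrC.
  by rewrite -ltnS; apply: (leq_trans (ltnSn n)); rewrite ltnW// ltnS truncn_ge_nat// powR_ge0.
apply: (@le_trans _ _ ((b `^ r)%:E * m%:R%:E)%E).
  by apply: lee_wpmul2l; [rewrite lee_fin|exact: counting_le].
rewrite -EFinM lee_fin.
have X0 : 0 <= X by exact: powR_ge0.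
have hm : m%:R <= X + 2.
  have : (Num.truncn X)%:R <= X by rewrite truncn_le.
  by rewrite /m -!natr1; lra.
apply: (le_trans (ler_wpM2l br hm)); rewrite mulrDr /S; apply: lerD.
  by rewrite /X -powRM ?divr_ge0 ?(ltW b0')// mulrCA divff ?mulr1// gt_eqF.
rewrite mulrC ler_wpM2l//; apply: ge0_ler_powR; rewrite ?nnegrE ?(ltW r0) ?(ltW b0')//; exact: ltW.
Qed.

Lemma weak_ell_decay s t : 0 < s -> s < 1 / 2 -> nonincreasing_seq t -> (forall n, 0 <= t n) ->
  weak_ell (2 * s / (1 - 2 * s)) t ->
  exists D : R, 0 < D /\ forall n, t n <= D * n.+1%:R `^ (- kappa s).
Proof.
move=> s0 s1 ht tp; have [ts0 ts1] := twice_lt1 s0 s1; have k0 := kappa_gt0 s0 s1.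
set r := 2 * s / (1 - 2 * s).
have r0 : 0 < r by rewrite divr_gt0// subr_gt0.
have kr : r * kappa s = 1 by rewrite /kappa /r; field; rewrite !gt_eqF//; lra.
rewrite /weak_ell; set A := [set _ | b in _] => hA.
pose S := `|fine (ereal_sup A)| + 1.
have S0 : 0 < S by rewrite ltr_pwDr.
have hS b : 0 < b -> ((b `^ r)%:E * counting [set n | (b < `|t n|)%R] <= S%:E)%E.
  move=> b0; apply: (@le_trans _ _ (ereal_sup A)); first by apply: ereal_sup_ubound; exists b.
  case: (ereal_sup A) hA @S S0 => [a| |] // _ S _; last exact: leNye.
  by rewrite lee_fin /S /=; have := ler_norm a; lra.
exists (2 * S `^ kappa s); split; first by rewrite mulr_gt0// powR_gt0.
move=> n; have [tn|tn] := leP (t n) 0.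
  by apply: (le_trans tn); rewrite !mulr_ge0 ?powR_ge0.
(* A level strictly below t_n, so that all n + 1 indices up to n are counted. *)
have b0 : 0 < t n / 2 by rewrite divr_gt0.
have h := hS _ b0.
have hc : (n.+1%:R%:E <= counting [set m | (t n / 2 < `|t m|)%R] :> \bar R)%E.
  apply: counting_ge => m /=; rewrite ltnS => mn; rewrite ger0_norm//.
  have := ht _ _ mn; lra.
have h2 : (t n / 2) `^ r * n.+1%:R <= S.
  rewrite -lee_fin EFinM; apply: le_trans h; apply: lee_wpmul2l => //; rewrite lee_fin powR_ge0//.
have n0 : 0 < n.+1%:R :> R by rewrite ltr0n.
have h3 : (t n / 2) `^ r <= S / n.+1%:R by rewrite ler_pdivlMr.
have h4 : t n / 2 <= (S / n.+1%:R) `^ kappa s.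
  have -> : t n / 2 = ((t n / 2) `^ r) `^ kappa s by rewrite -powRrM kr powRr1// ltW.
  apply: ge0_ler_powR => //; first exact: ltW.
  - by rewrite nnegrE powR_ge0.
  - by rewrite nnegrE divr_ge0// ltW.
rewrite powRM ?invr_ge0 ?(ltW S0)// in h4.
have e : n.+1%:R^-1 `^ kappa s = n.+1%:R `^ (- kappa s) :> R.
  by rewrite -powR_inv1 ?ltW// -powRrM mulN1r.
rewrite e in h4; lra.
Qed.

End rates.

(** * Bilinear forms with Poisson kernels *)

Section bilinear.
Context {R : realType}.
Notation mu := (@lebesgue_measure R).
Notation mf := (measurable_fun setT).
Implicit Types (g h sg rh : R -> R).

(** The adjoint of the operator [lowV] below (see [low_duality]), with evaluation point [sg x] and
    damping rate [rh x] as free functions of x. *)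
Definition gam g sg rh xi : R := \int[mu]_x (g x * (cas (sg x * xi) * dexp (rh x) xi)).

Lemma measurable_gam_ker g sg rh : mf g -> mf sg -> mf rh ->
  mf (fun w : R * R => g w.2 * (cas (sg w.2 * w.1) * dexp (rh w.2) w.1)).
Proof.
move=> m1 m2 m3; have mc := @measurable_cas R.
have f1 : mf (fun w : R * R => w.1) := measurable_fst.
have f2 : mf (fun w : R * R => w.2) := measurable_snd.
have g2 := measurableT_comp m1 f2; have s2 := measurableT_comp m2 f2; have r2 := measurableT_comp m3 f2.
apply: measurable_funM => //; apply: measurable_funM.
  by apply: (measurableT_comp mc); exact: measurable_funM.
rewrite /dexp; apply: measurableT_comp => //; apply: measurableT_comp => //.
by apply: measurable_funM => //; apply: measurableT_comp.
Qed.

Lemma measurable_gam g sg rh : mf g -> mf sg -> mf rh -> mf (gam g sg rh).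
Proof. by move=> m1 m2 m3; apply: measurable_Rint2 (measurable_gam_ker m1 m2 m3). Qed.

Lemma cas_dexp_le (a b xi : R) (c : R) : c <= b -> `|cas a * dexp b xi| <= 2 * dexp c xi.
Proof.
move=> cb; rewrite normrM (ger0_norm (dexp_ge0 _ _)); apply: ler_pM => //; first exact: dexp_ge0.
  exact: cas_bdd.
by rewrite /dexp ler_expR lerN2 ler_wpM2r.
Qed.

Lemma dexp0 (xi : R) : dexp 0 xi = 1.
Proof. by rewrite /dexp mul0r oppr0 expR0. Qed.

Lemma RintZ f (k : R) : L1 f -> \int[mu]_x (k * f x) = k * \int[mu]_x f x.
Proof.
move=> l; rewrite mulrC -RintC//; apply: eq_Rintegral => x _; exact: mulrC.
Qed.

Lemma L1_gam_ker g sg rh (c : R) xi : L1 g -> mf sg -> mf rh -> (forall x, c <= rh x) ->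
  L1 (fun x => g x * (cas (sg x * xi) * dexp (rh x) xi)).
Proof.
move=> lg m2 m3 hc.
have mk : mf (fun x => g x * (cas (sg x * xi) * dexp (rh x) xi)).
  exact: (measurableT_comp (measurable_gam_ker (L1_mf lg) m2 m3) (measurable_pair1 xi)).
apply: (le_L1 mk (L1Z (2 * dexp c xi) (L1_norm lg))) => x.
by rewrite normrM mulrC ler_wpM2r// cas_dexp_le.
Qed.

Lemma gam_le g sg rh (c : R) xi : L1 g -> mf sg -> mf rh -> (forall x, c <= rh x) ->
  `|gam g sg rh xi| <= 2 * (\int[mu]_x `|g x|) * dexp c xi.
Proof.
move=> lg m2 m3 hc; have lG := L1_norm lg.
have lk := L1_gam_ker xi lg m2 m3 hc.
rewrite /gam; apply: le_trans (le_normr_Rintegral measurableT lk) _.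
have -> : 2 * (\int[mu]_x `|g x|) * dexp c xi = \int[mu]_x (2 * dexp c xi * `|g x|).
  by rewrite RintZ//; ring.
apply: le_Rintegral => //; [exact: (L1_norm lk)|exact: (L1Z (2 * dexp c xi) lG)|].
by move=> x _; rewrite normrM mulrC ler_wpM2r// cas_dexp_le.
Qed.

Lemma Rint_cas_cas (a b c d : R) : 0 < a + b ->
  \int[mu]_xi ((cas (c * xi) * dexp a xi) * (cas (d * xi) * dexp b xi)) = poisson (a + b) (c - d).
Proof.
move=> ab0; rewrite -(hart1_cas_dexp c d ab0); apply: eq_Rintegral => xi _.
by rewrite -dexpD [xi * c]mulrC; ring.
Qed.

Lemma normr_mul3_le (a b d A e : R) : `|a| <= A -> `|b| <= e -> `|a * (d * b)| <= A * e * `|d|.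
Proof.
move=> h1 h2; rewrite !normrM [`|d| * _]mulrC mulrA ler_wpM2r//.
exact: ler_pM.
Qed.

Lemma leeD_double (z : R) : (2%:E * z%:E + 2%:E * z%:E <= (4 * z)%:E)%E.
Proof.
have -> : (2%:E * z%:E + 2%:E * z%:E)%E = (2 * z + 2 * z)%:E by [].
by rewrite lee_fin; lra.
Qed.

Lemma mulrCA_rot (a b d : R) : a * (b * d) = b * (d * a).
Proof. by ring. Qed.

Lemma absorb_half (x a b n p : R) : x <= 8^-1 * a + 2 * b -> a <= 4 * x -> b <= 2 * p * n -> x <= 8 * p * n.
Proof. by rewrite -!mulrA; move: (p * n) => q; lra. Qed.

Lemma amgm8 (a b : R) : a * b <= 8^-1 * (a * a) + 2 * (b * b).
Proof. by have := sqr_ge0 (a - 4 * b); lra. Qed.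

Lemma Rint_amgm f h : L1 (fun x => f x * f x) -> L1 (fun x => h x * h x) -> L1 (fun x => f x * h x) ->
  \int[mu]_x (f x * h x) <= 8^-1 * \int[mu]_x (f x * f x) + 2 * \int[mu]_x (h x * h x).
Proof.
move=> lf lh lfh; have l1 := L1Z 8^-1 lf; have l2 := L1Z 2 lh.
rewrite -(RintZ _ lf) -(RintZ _ lh) -RintegralD; [|exact: measurableT|exact: l1|exact: l2].
apply: le_Rintegral; [exact: measurableT|exact: lfh|exact: (L1D l1 l2)|].
by move=> x _; exact: amgm8.
Qed.

(** A TT* identity: the integral in xi of two damped cas functions is a Poisson kernel whose width
    is the sum of the rates. The lower bound [c] on one rate makes both exchanges absolutely
    convergent, so the other rate may vanish, as in [quadratic_form]. *)
Lemma bilinear g1 g2 sg1 sg2 rh1 rh2 (c : R) : L1 g1 -> L1 g2 -> mf sg1 -> mf sg2 -> mf rh1 -> mf rh2 ->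
  0 < c -> (forall x, c <= rh1 x) -> (forall x, 0 <= rh2 x) ->
  \int[mu]_xi (gam g1 sg1 rh1 xi * gam g2 sg2 rh2 xi) =
  \int[mu]_x (g1 x * \int[mu]_y (g2 y * poisson (rh1 x + rh2 y) (sg1 x - sg2 y))).
Proof.
move=> l1 l2 ms1 ms2 mr1 mr2 c0 h1 h2.
have m1 := L1_mf l1; have m2 := L1_mf l2.
have mg2 := measurable_gam m2 ms2 mr2.
set A2 := 2 * \int[mu]_x `|g2 x|.
have b2 xi : `|gam g2 sg2 rh2 xi| <= A2.
  by have := gam_le xi l2 ms2 mr2 h2; rewrite dexp0 mulr1.
have lA1 := L1_norm l1; have lA2 := L1_norm l2.
have ld := L1_dexp c0.
pose k1 x xi := cas (sg1 x * xi) * dexp (rh1 x) xi.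
pose k2 y xi := cas (sg2 y * xi) * dexp (rh2 y) xi.
have bk1 x xi : `|k1 x xi| <= 2 * dexp c xi by exact: cas_dexp_le.
have bk2 y xi : `|k2 y xi| <= 2 by have := cas_dexp_le (sg2 y * xi) xi (h2 y); rewrite dexp0 mulr1.
have mk1 : mf (fun w : R * R => g1 w.2 * k1 w.2 w.1) := measurable_gam_ker m1 ms1 mr1.
have mk2 : mf (fun w : R * R => g2 w.2 * k2 w.2 w.1) := measurable_gam_ker m2 ms2 mr2.
have mk1x x : mf (k1 x).
  rewrite /k1 /dexp; have mc := @measurable_cas R.
  apply: measurable_funM; last by mfun.
  by apply: (measurableT_comp mc); mfun.
have lk1 x : L1 (k1 x) by apply: (le_L1 (mk1x x) (L1Z 2 ld)) => xi; exact: bk1.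
have lw1 xi : L1 (fun x => g1 x * k1 x xi) := L1_gam_ker xi l1 ms1 mr1 h1.
have lw2 xi : L1 (fun y => g2 y * k2 y xi) := L1_gam_ker xi l2 ms2 mr2 h2.
have mF : mf (fun w : R * R => gam g2 sg2 rh2 w.1 * (g1 w.2 * k1 w.2 w.1)).
  by apply: measurable_funM; [exact: (measurableT_comp mg2 measurable_fst)|exact: mk1].
have bF xi x : `|gam g2 sg2 rh2 xi * (g1 x * k1 x xi)| <= A2 * 2 * dexp c xi * `|g1 x|.
  by have h := normr_mul3_le (g1 x) (b2 xi) (bk1 x xi); rewrite (mulrA A2 2) in h; exact: h.
have swap1 := Rfubini mF (L1Z (A2 * 2) ld) lA1 bF.
transitivity (\int[mu]_xi \int[mu]_x (gam g2 sg2 rh2 xi * (g1 x * k1 x xi))).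
  by apply: eq_Rintegral => xi _; rewrite (RintZ _ (lw1 xi)); exact: mulrC.
rewrite swap1; apply: eq_Rintegral => x _ /=.
transitivity (\int[mu]_xi (g1 x * (k1 x xi * gam g2 sg2 rh2 xi))).
  by apply: eq_Rintegral => xi _; exact: mulrCA_rot.
have lkg : L1 (fun xi => k1 x xi * gam g2 sg2 rh2 xi) by exact: (L1_bdd (lk1 x) mg2 b2).
rewrite (RintZ _ lkg); congr (_ * _).
transitivity (\int[mu]_xi \int[mu]_y (k1 x xi * (g2 y * k2 y xi))).
  by apply: eq_Rintegral => xi _; rewrite (RintZ _ (lw2 xi)).
have mH : mf (fun w : R * R => k1 x w.1 * (g2 w.2 * k2 w.2 w.1)).
  by apply: measurable_funM; [exact: (measurableT_comp (mk1x x) measurable_fst)|exact: mk2].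
have bH xi y : `|k1 x xi * (g2 y * k2 y xi)| <= 4 * dexp c xi * `|g2 y|.
  have := normr_mul3_le (g2 y) (bk1 x xi) (bk2 y xi).
  by have -> : 2 * dexp c xi * 2 = 4 * dexp c xi by ring.
rewrite (Rfubini mH (L1Z 4 ld) lA2 bH); apply: eq_Rintegral => y _ /=.
have rr : 0 < rh1 x + rh2 y by apply: (lt_le_trans c0); rewrite -[leLHS]addr0 lerD.
rewrite -(Rint_cas_cas (sg1 x) (sg2 y) rr) -RintZ; last first.
  have mk2y : mf (k2 y).
    rewrite /k2 /dexp; have mc := @measurable_cas R.
    apply: measurable_funM; last by mfun.
    by apply: (measurableT_comp mc); mfun.
  exact: (L1_bdd (lk1 x) mk2y (bk2 y)).
by apply: eq_Rintegral => xi _; rewrite /k1 /k2 mulrCA.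
Qed.

Section positive_kernel.
Variables (g1 g2 : R -> R) (K : R * R -> R) (M : R).
Hypotheses (l1 : L1 g1) (l2 : L1 g2) (mK : mf K) (hK : forall w, 0 <= K w <= M).

Lemma L1_kernel x : L1 (fun y => g2 y * K (x, y)).
Proof.
have mKx : mf (fun y => K (x, y)) by exact: (measurableT_comp mK (measurable_pair1 x)).
apply: (L1_bdd l2 mKx) => y; have /andP[k0 kM] := hK (x, y).
by rewrite ger0_norm//; exact: kM.
Qed.

Lemma L1_kernel2 : L1 (fun x => g1 x * \int[mu]_y (g2 y * K (x, y))).
Proof.
have m2 := L1_mf l2.
have mI : mf (fun x => \int[mu]_y (g2 y * K (x, y))).
  apply: (measurable_Rint2 (F := fun w => g2 w.2 * K w)); apply: measurable_funM => //.
  exact: (measurableT_comp m2 measurable_snd).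
apply: (L1_bdd l1 mI (k := M * \int[mu]_y `|g2 y|)) => x.
apply: le_trans (le_normr_Rintegral measurableT (L1_kernel x)) _.
rewrite -(RintZ _ (L1_norm l2)).
apply: le_Rintegral; [exact: measurableT|exact: (L1_norm (L1_kernel x))|exact: (L1Z M (L1_norm l2))|].
move=> y _; have /andP[k0 kM] := hK (x, y).
by rewrite normrM mulrC (ger0_norm k0) ler_wpM2r.
Qed.

(** Passage to extended integrals, in which kernels can be compared and integrals exchanged by
    positivity alone. *)
Lemma bilinear_pos : (forall x, 0 <= g1 x) -> (forall x, 0 <= g2 x) ->
  (\int[mu]_x \int[mu]_y (g1 x * g2 y * K (x, y))%:E)%E =
  (\int[mu]_x (g1 x * \int[mu]_y (g2 y * K (x, y))))%:E.
Proof.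
move=> p1 p2; rewrite -(L1_int L1_kernel2); apply: eq_integral => x _.
rewrite EFinM -(L1_int (L1_kernel x)) -intZ; [|exact: (L1_mf (L1_kernel x))| |exact: p1].
  by apply: eq_integral => y _; rewrite mulrA.
by move=> y; rewrite mulr_ge0//; have /andP[] := hK (x, y).
Qed.

End positive_kernel.

Lemma bilinear_le g1 g2 (K : R * R -> R) (M : R) : L1 g1 -> L1 g2 -> mf K -> (forall w, 0 <= K w <= M) ->
  ((\int[mu]_x (g1 x * \int[mu]_y (g2 y * K (x, y))))%:E <=
   \int[mu]_x \int[mu]_y (`|g1 x| * `|g2 y| * K (x, y))%:E)%E.
Proof.
move=> l1 l2 mK hK.
rewrite (bilinear_pos (L1_norm l1) (L1_norm l2) mK hK)// lee_fin.
apply: le_Rintegral; [exact: measurableT|exact: (L1_kernel2 l1 l2 mK hK)|exact: (L1_kernel2 (L1_norm l1) (L1_norm l2) mK hK)|].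
move=> x _; apply: le_trans (ler_norm _) _; rewrite normrM ler_wpM2l//.
apply: le_trans (le_normr_Rintegral measurableT (L1_kernel l2 mK hK x)) _.
rewrite le_eqVlt; apply/orP; left; apply/eqP; apply: eq_Rintegral => y _.
by rewrite normrM (ger0_norm (_ : 0 <= K (x, y)))//; have /andP[] := hK (x, y).
Qed.

(** If n <= m, widening m to m + n at most doubles the numerator and increases the denominator. *)
Lemma poisson_add_le (a b u : R) : 0 < a -> 0 < b -> poisson (a + b) u <= 2 * (poisson a u + poisson b u).
Proof.
move=> a0 b0.
have main (m n : R) : 0 < m -> 0 < n -> n <= m -> poisson (m + n) u <= 2 * poisson m u.
  move=> m0 n0 nm; rewrite /poisson ler_pdivrMr; last by rewrite ltr_pwDl ?sqr_ge0// exprn_gt0// addr_gt0.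
  have d0 : 0 < m ^+ 2 + u ^+ 2 by rewrite ltr_pwDl ?sqr_ge0// exprn_gt0.
  have -> : 2 * (2 * m / (m ^+ 2 + u ^+ 2)) * ((m + n) ^+ 2 + u ^+ 2) = (4 * m * ((m + n) ^+ 2 + u ^+ 2)) / (m ^+ 2 + u ^+ 2) by field; rewrite gt_eqF.
  rewrite ler_pdivlMr//.
  have h1 : 2 * (m + n) * (m ^+ 2 + u ^+ 2) <= 4 * m * (m ^+ 2 + u ^+ 2) by rewrite ler_pM2r//; lra.
  apply: (le_trans h1); rewrite ler_pM2l ?mulr_gt0// lerD2r lerXn2r ?nnegrE; lra.
have pa := poisson_ge0 u (ltW a0); have pb := poisson_ge0 u (ltW b0).
have [ab|ba] := leP b a.
  by have := main a b a0 b0 ab; lra.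
by have := main b a b0 a0 (ltW ba); rewrite [b + a]addrC; lra.
Qed.

Lemma measurable_poisson2 (r s : R * R -> R) (c : R) : 0 < c -> (forall w, c <= r w) -> mf r -> mf s ->
  mf (fun w => poisson (r w) (s w)).
Proof.
move=> c0 hc mr ms; have -> : (fun w => poisson (r w) (s w)) = (fun w => 2 * r w * (r w ^+ 2 + s w ^+ 2) `^ (-1)).
  apply/funext => w; rewrite /poisson powR_inv1// addr_ge0// sqr_ge0//.
apply: measurable_funM; first by mfun.
by apply: (measurableT_comp (measurable_powR (-1))); mfun.
Qed.

(* Let a be the left-hand side and Gam := gam g id rh. Then a = <Gam, hart1 g> and
   |Gam|^2 <= 4 a, hence a <= a/2 + 2 |hart1 g|^2. This TT* argument plays the role
   of the L2 bound for the Hardy-Littlewood maximal function. *)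
Lemma quadratic_form g rh (c : R) : L1 g -> L2r g -> (forall x, 0 <= g x) -> mf rh -> 0 < c -> (forall x, c <= rh x) ->
  (\int[mu]_x \int[mu]_y (g x * g y * poisson (rh x) (x - y))%:E <= (8 * pi)%:E * n2 g)%E.
Proof.
move=> lg l2g g0 mr c0 hc; have mg := L1_mf lg.
have r0 x : 0 < rh x := lt_le_trans c0 (hc x).
have m1 : mf (fun w : R * R => w.1) := measurable_fst.
have m2 : mf (fun w : R * R => w.2) := measurable_snd.
have mr1 := measurableT_comp mr m1; have mr2 := measurableT_comp mr m2.
have mg1 := measurableT_comp mg m1; have mg2 := measurableT_comp mg m2.
have md : mf (fun w : R * R => w.1 - w.2) by exact: measurable_funB.
have mK : mf (fun w : R * R => poisson (rh w.1) (w.1 - w.2)).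
  exact: (@measurable_poisson2 (fun w => rh w.1) _ c).
have mK2 : mf (fun w : R * R => poisson (rh w.2) (w.1 - w.2)).
  exact: (@measurable_poisson2 (fun w => rh w.2) _ c).
have mS : mf (fun w : R * R => poisson (rh w.1 + rh w.2) (w.1 - w.2)).
  apply: (@measurable_poisson2 (fun w => rh w.1 + rh w.2) _ c) => //.
    by move=> w; rewrite (le_trans (hc w.1))// lerDl ltW.
  exact: measurable_funD.
have P0 (b u : R) : 0 < b -> 0 <= poisson b u by move=> b0; apply: poisson_ge0; exact: ltW.
have PM (b u : R) : c <= b -> poisson b u <= 2 / c.
  move=> cb; apply: (le_trans (poisson_le u (lt_le_trans c0 cb))).
  by rewrite ler_pM2l// lef_pV2 ?posrE// (lt_le_trans c0).
set a := (\int[mu]_x \int[mu]_y (g x * g y * poisson (rh x) (x - y))%:E)%E.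
have mgK : mf (fun w : R * R => g w.1 * g w.2 * poisson (rh w.1) (w.1 - w.2)).
  by apply: measurable_funM => //; exact: measurable_funM.
have gK0 w : 0 <= g w.1 * g w.2 * poisson (rh w.1) (w.1 - w.2) := mulr_ge0 (mulr_ge0 (g0 _) (g0 _)) (P0 _ _ (r0 _)).
have gn : (fun x => `|g x|) = g by apply/funext => x; rewrite ger0_norm.
set I := \int[mu]_x g x.
have I0 : 0 <= I by apply: Rintegral_ge0.
have hK w : 0 <= poisson (rh w.1) (w.1 - w.2) <= 2 / c by rewrite P0//= PM.
have hS w : 0 <= poisson (rh w.1 + rh w.2) (w.1 - w.2) <= 2 / c.
  by rewrite P0 ?addr_gt0//= PM// (le_trans (hc w.1))// lerDl ltW.
have aE0 := bilinear_pos lg lg mK hK g0 g0; rewrite -/a /= in aE0.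
set al := Rintegral _ _ _ in aE0.
have mid : mf (fun x : R => x) by exact: measurable_id.
pose G := gam g (fun x => x) rh; pose H := gam g (fun x => x) (fun=> 0).
have mG : mf G by exact: measurable_gam.
have HE : H = hart1 g.
  by apply/funext => xi; apply: eq_Rintegral => x _; rewrite dexp0 mulr1 [xi * x]mulrC.
have lgg : L2r (hart1 g) := L2r_hart1 lg l2g.
have z0 x : 0 <= (fun _ : R => 0 : R) x by [].
have eaH : al = \int[mu]_xi (G xi * H xi).
  rewrite (bilinear lg lg mid mid mr (measurable_cst (0:R)) c0 hc z0) /al.
  by apply: eq_Rintegral => x _; under [in RHS]eq_Rintegral do rewrite addr0.
have lG : L1 G.
  apply: (le_L1 mG (L1Z (2 * \int[mu]_x `|g x|) (L1_dexp c0))) => xi; exact: gam_le.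
have bG xi : `|G xi| <= 2 * \int[mu]_x `|g x|.
  apply: le_trans (gam_le xi lg mid mr hc) _; rewrite ler_piMr ?dexp_le1 ?(ltW c0)//.
  by rewrite mulr_ge0// Rintegral_ge0.
have lGG : L1 (fun xi => G xi * G xi) by exact: (L1_bdd lG mG bG).
have lH : L2r H by rewrite HE.
have lHH := L2rM lH lH.
have bH xi : `|H xi| <= 2 * \int[mu]_x `|g x| by rewrite HE; exact: hart1_bdd.
have lGH : L1 (fun xi => G xi * H xi) by exact: (L1_bdd lG lH.1 bH).
have gg : \int[mu]_xi (G xi * G xi) <= 4 * al.
  rewrite (bilinear lg lg mid mid mr mr c0 hc (fun x => ltW (r0 x))).
  rewrite -lee_fin -(bilinear_pos lg lg mS hS g0 g0) /=.
  have mgK2 : mf (fun w : R * R => g w.1 * g w.2 * poisson (rh w.2) (w.1 - w.2)).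
    by apply: measurable_funM => //; exact: measurable_funM.
  have mgS : mf (fun w : R * R => g w.1 * g w.2 * poisson (rh w.1 + rh w.2) (w.1 - w.2)).
    by apply: measurable_funM => //; exact: measurable_funM.
  have gK20 w : 0 <= g w.1 * g w.2 * poisson (rh w.2) (w.1 - w.2) := mulr_ge0 (mulr_ge0 (g0 _) (g0 _)) (P0 _ _ (r0 _)).
  have gS0 w : 0 <= g w.1 * g w.2 * poisson (rh w.1 + rh w.2) (w.1 - w.2).
    by have /andP[h _] := hS w; exact: mulr_ge0 (mulr_ge0 (g0 _) (g0 _)) h.
  have a'E : (\int[mu]_x \int[mu]_y (g x * g y * poisson (rh y) (x - y))%:E)%E = a.
    rewrite (tonelli_swap mgK2 gK20) /a; apply: eq_integral => x _; apply: eq_integral => y _ /=.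
    by rewrite poissonC [g y * g x]mulrC.
  have mgKx x : mf (fun y => g x * g y * poisson (rh x) (x - y)) by exact: (measurableT_comp mgK (measurable_pair1 x)).
  have mgK2x x : mf (fun y => g x * g y * poisson (rh y) (x - y)) by exact: (measurableT_comp mgK2 (measurable_pair1 x)).
  have e1 x : (\int[mu]_y (g x * g y * poisson (rh x + rh y) (x - y))%:E <=
      2%:E * (\int[mu]_y (g x * g y * poisson (rh x) (x - y))%:E) + 2%:E * (\int[mu]_y (g x * g y * poisson (rh y) (x - y))%:E))%E.
    rewrite -(intZ (mgKx x) (fun y => gK0 (x, y)) (ler0n R 2)) -(intZ (mgK2x x) (fun y => gK20 (x, y)) (ler0n R 2)).
    rewrite -intD; [|by apply: measurable_funM; [exact: measurable_cst|exact: mgKx]|by apply: measurable_funM; [exact: measurable_cst|exact: mgK2x]|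
      by move=> y; exact: mulr_ge0 (ler0n R 2) (gK0 (x, y))|by move=> y; exact: mulr_ge0 (ler0n R 2) (gK20 (x, y))].
    apply: le_int.
    - exact: (measurableT_comp mgS (measurable_pair1 x)).
    - by have := mgKx x => ?; have := mgK2x x => ?; mfun.
    - by move=> y; exact: (gS0 (x, y)).
    - move=> y; have h := poisson_add_le (x - y) (r0 x) (r0 y).
      have gg0 : 0 <= g x * g y by rewrite mulr_ge0.
      apply: (le_trans (ler_wpM2l gg0 h)); rewrite le_eqVlt; apply/orP; left; apply/eqP; ring.
  have i0 x : (0 <= \int[mu]_y (g x * g y * poisson (rh x) (x - y))%:E)%E by apply: int_ge0 => y; exact: (gK0 (x, y)).
  have i20 x : (0 <= \int[mu]_y (g x * g y * poisson (rh y) (x - y))%:E)%E by apply: int_ge0 => y; exact: (gK20 (x, y)).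
  have mI := measurable_tonelli mgK gK0.
  have mI2 := measurable_tonelli mgK2 gK20.
  apply: (@le_trans _ _ (\int[mu]_x (2%:E * (\int[mu]_y (g x * g y * poisson (rh x) (x - y))%:E) + 2%:E * (\int[mu]_y (g x * g y * poisson (rh y) (x - y))%:E)))%E).
    apply: ge0_le_integral; first exact: measurableT.
    - by move=> x _; apply: int_ge0 => y; exact: (gS0 (x, y)).
    - exact: (measurable_tonelli mgS gS0).
    - by apply: emeasurable_funD; apply: measurable_funeM.
    - by move=> x _; exact: e1.
  rewrite ge0_integralD; [|exact: measurableT|by move=> x _; rewrite mule_ge0|by apply: measurable_funeM|by move=> x _; rewrite mule_ge0|by apply: measurable_funeM].
  rewrite ge0_integralZl; [|exact: measurableT|exact: mI|by move=> x _; exact: i0|by []].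
  rewrite ge0_integralZl; [|exact: measurableT|exact: mI2|by move=> x _; exact: i20|by []].
  rewrite a'E -/a aE0; exact: leeD_double.
have amgm : al <= 8^-1 * (\int[mu]_xi (G xi * G xi)) + 2 * \int[mu]_xi (H xi * H xi).
  by rewrite eaH; exact: Rint_amgm.
have hh : (\int[mu]_xi (H xi * H xi))%:E = n2 (hart1 g) by rewrite -HE n2_fin.
have := n2_hart1_le lg l2g; rewrite -hh aE0 (n2_fin l2g) -!EFinM !lee_fin => hh2.
exact: absorb_half amgm gg hh2.
Qed.

End bilinear.

(** * The linearised damped operator *)

Section low_frequency.
Context {R : realType}.
Notation mu := (@lebesgue_measure R).
Notation mf := (measurable_fun setT).
Implicit Types (g h tau eps : R -> R) (s D : R).

(** The factor by which the weight |xi|^(-2s) falls when the frequency doubles. By [quart2] it fits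
    [minsum_fin] with th = 1 - 2s. *)
Definition quart s : R := (4 `^ s)^-1.

Lemma quart_bounds s : 0 < s -> 0 < quart s /\ quart s < 1.
Proof.
move=> s0; have q1 : 1 < 4 `^ s :> R.
  apply: (@le_lt_trans _ _ (1 `^ s)); first by rewrite powR1.
  by apply: gt0_ltr_powR; rewrite ?nnegrE// ltr1n.
by rewrite /quart invr_gt0 invf_lt1// (lt_trans ltr01).
Qed.

Lemma quart2 s : 2 `^ (1 - 2 * s) = 2 * quart s.
Proof.
rewrite powRB ?pnatr_eq0 ?implybT// powRr1//; congr (_ / _).
by rewrite powRrM; congr (_ `^ _); rewrite powR_mulrn//; ring.
Qed.

(** If 2^k <= |xi| < 2^(k+1), then 2^-k |xi| < 2, so the factor e^2 compensates the exponential; k =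
    0 serves for |xi| < 1. *)
Lemma wt_inv_le s (xi : R) : 0 < s ->
  exists k : nat, (wt s xi)^-1 <= expR 2 * (quart s ^+ k * dexp (2 ^- k) xi).
Proof.
move=> s0; have w1 := wt_ge1 xi (ltW s0); have w0 : 0 < wt s xi := lt_le_trans ltr01 w1.
have [x1|x1] := leP 1 `|xi|; last first.
  exists 0%N; rewrite expr0 mul1r expr0 invr1 /dexp mul1r -expRD.
  apply: (@le_trans _ _ 1); first by rewrite invf_le1.
  by rewrite -[leLHS]expR0 ler_expR; lra.
have [k [k1 k2]] := dyadic_between x1; exists k.
have e2 : 0 < 2 ^+ k :> R by rewrite exprn_gt0.
have q0 : 0 <= quart s ^+ k by rewrite exprn_ge0// ltW//; case: (quart_bounds s0).
apply: (@le_trans _ _ (quart s ^+ k)).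
  rewrite /quart exprVn lef_pV2 ?posrE ?exprn_gt0 ?powR_gt0//.
  rewrite -powR_mulrn ?powR_ge0// -powRrM [s * _]mulrC powRrM powR_mulrn//.
  apply: ge0_ler_powR; rewrite ?nnegrE ?addr_ge0 ?sqr_ge0 ?exprn_ge0//; first exact: ltW.
  have h : (2 ^+ k) ^+ 2 <= `|xi| ^+ 2 by rewrite lerXn2r ?nnegrE ?(ltW e2).
  rewrite -exprM mulnC exprM (_ : 2 ^+ 2 = 4 :> R) in h; last by ring.
  by apply: (le_trans h); rewrite lerDr.
rewrite mulrCA ler_peMr// /dexp -expRD -[leLHS]expR0 ler_expR subr_ge0.
by rewrite mulrC ler_pdivrMr// -exprS ltW.
Qed.

(** For |u| <= 4r the kernel of width 4r is at least 1 / (4r), so with weight 8r / b0 it dominates 2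
    / b0, an upper bound for the left-hand side. For |u| > 4r the shift is below |u| / 2 and changes
    the kernel only by a constant factor. *)
Lemma poisson_shift (b0 b u v r : R) : 0 < b0 -> b0 <= b -> b <= 2 * b0 -> 0 < r -> `|v| <= 2 * r ->
  poisson b (u + v) <= 8 * poisson b0 u + 8 * r / b0 * poisson (4 * r) u.
Proof.
move=> b00 bb b2 r0 hv; have bp : 0 < b := lt_le_trans b00 bb.
have p1 : 0 <= poisson b0 u by apply: poisson_ge0; exact: ltW.
have r4 : 0 < 4 * r by rewrite mulr_gt0.
have p2 : 0 <= poisson (4 * r) u by apply: poisson_ge0; exact: ltW.
have c0 : 0 <= 8 * r / b0 by rewrite divr_ge0// ?mulr_ge0// ltW.
have [hu|hu] := leP `|u| (4 * r).
  apply: (@le_trans _ _ (8 * r / b0 * poisson (4 * r) u)); last by rewrite lerDr mulr_ge0.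
  apply: (le_trans (poisson_le _ bp)); apply: (@le_trans _ _ (2 / b0)).
    by rewrite ler_pM2l// lef_pV2 ?posrE.
  have u2 : u ^+ 2 <= (4 * r) ^+ 2.
    by rewrite -[leLHS]real_normK ?num_real// lerXn2r ?nnegrE ?(ltW r4).
  have d0 : 0 < (4 * r) ^+ 2 + u ^+ 2 by rewrite ltr_pwDl ?sqr_ge0// exprn_gt0.
  rewrite /poisson -[8 * r / b0]mulrA [r / b0]mulrC !mulrA.
  rewrite ler_pdivlMr// -subr_ge0.
  have -> : 8 / b0 * r * 2 * 4 * r - 2 / b0 * ((4 * r) ^+ 2 + u ^+ 2) = 2 / b0 * ((4 * r) ^+ 2 - u ^+ 2) by ring.
  by rewrite mulr_ge0 ?subr_ge0// divr_ge0// ltW.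
apply: (@le_trans _ _ (8 * poisson b0 u)); last by rewrite lerDl mulr_ge0.
have huv : u ^+ 2 <= 4 * (u + v) ^+ 2.
  have h1 : `|u| <= 2 * `|u + v|.
    have h2 := ler_normB (u + v) v; rewrite addrK in h2; lra.
  rewrite -[leLHS]real_normK ?num_real// -[(u + v) ^+ 2]real_normK ?num_real//.
  have := normr_ge0 u; nra.
have d0 : 0 < b0 ^+ 2 + u ^+ 2 by rewrite ltr_pwDl ?sqr_ge0// exprn_gt0.
have d1 : 0 < b ^+ 2 + (u + v) ^+ 2 by rewrite ltr_pwDl ?sqr_ge0// exprn_gt0.
rewrite /poisson mulrA ler_pdivrMr// mulrAC ler_pdivlMr//.
have h3 : b0 ^+ 2 <= b ^+ 2 by rewrite lerXn2r ?nnegrE ?(ltW b00) ?(ltW bp).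
have h4 : b0 ^+ 2 + u ^+ 2 <= 4 * (b ^+ 2 + (u + v) ^+ 2) by have := sqr_ge0 b; lra.
have hb : 0 <= 2 * b by rewrite mulr_ge0// ltW.
apply: (le_trans (ler_wpM2l hb h4)).
have h5 : 0 <= b ^+ 2 + (u + v) ^+ 2 by exact: ltW.
have : 8 * b * (b ^+ 2 + (u + v) ^+ 2) <= 16 * b0 * (b ^+ 2 + (u + v) ^+ 2) by rewrite ler_wpM2r//; lra.
lra.
Qed.

(** From 1 / (2^-k + e) <= 2^k min(e, 2^-k) / e the sum reduces to [minsum_fin] with th = 1 - 2s,
    which is of order e^(2s). The powers e^(1-2s), e^(2s) and e^-1 cancel: this is where the radius
    e^(1-2s) is critical. *)
Lemma scale_sum s D (e : R) (n : nat) : 0 < s -> s < 1 / 2 -> 0 < D -> 0 < e ->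
  \sum_(0 <= k < n) quart s ^+ k * (8 * (D * e `^ (1 - 2 * s)) / (2 ^- k + e)) <= 8 * D * minsum_cst (1 - 2 * s).
Proof.
move=> s0 s1 D0 e0; have [ts0 ts1] := twice_lt1 s0 s1; have [q0 q1] := quart_bounds s0.
have t0 : 0 < 1 - 2 * s by rewrite subr_gt0.
have t1 : 1 - 2 * s < 1 by rewrite ltrBlDr ltrDl.
set p := e `^ (1 - 2 * s); have p0 : 0 < p by exact: powR_gt0.
apply: (@le_trans _ _ (8 * (D * p) / e * \sum_(0 <= k < n) (2 `^ (1 - 2 * s)) ^+ k * Num.min e (2 ^- k))).
  rewrite big_distrr /=; apply: ler_sum => k _.
  have k0 : 0 < 2 ^- k :> R by rewrite invr_gt0 exprn_gt0.
  rewrite quart2 exprMn.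
  have h : (2 ^- k + e)^-1 <= 2 ^+ k * Num.min e (2 ^- k) / e.
    have [h1|h1] := leP e (2 ^- k).
      rewrite mulrK ?unitfE ?gt_eqF// -[leRHS]invrK lef_pV2 ?posrE ?addr_gt0//.
      by rewrite lerDl ltW.
    by rewrite mulfV ?gt_eqF ?exprn_gt0// mul1r lef_pV2 ?posrE ?addr_gt0// lerDr ltW.
  have c0 : 0 <= quart s ^+ k * (8 * (D * p)) by rewrite !mulr_ge0 ?exprn_ge0// ltW.
  have := ler_wpM2l c0 h; rewrite -!mulrA => h2; apply: (le_trans h2).
  by rewrite le_eqVlt; apply/orP; left; apply/eqP; ring.
have c0 : 0 <= 8 * (D * p) / e by rewrite divr_ge0 ?mulr_ge0// ltW.
apply: (le_trans (ler_wpM2l c0 (minsum_fin n t0 t1 e0))).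
rewrite opprB addrCA subrr addr0.
have -> : 8 * (D * p) / e * (minsum_cst (1 - 2 * s) * e `^ (2 * s)) = 8 * D * minsum_cst (1 - 2 * s) * (p * e `^ (2 * s) / e) by ring.
rewrite /p -powRD ?(gt_eqF e0) ?implybT// subrK powRr1 ?(ltW e0)// divff ?gt_eqF// mulr1//.
Qed.

Lemma geo_sum (q : R) (n : nat) : 0 < q -> q < 1 -> \sum_(0 <= k < n) q ^+ k <= (1 - q)^-1.
Proof.
move=> q0 q1; have h : 0 < 1 - q by rewrite subr_gt0.
rewrite -[leRHS]mul1r ler_pdivlMr//.
have -> : (\sum_(0 <= k < n) q ^+ k) * (1 - q) = 1 - q ^+ n.
  elim: n => [|n ih]; first by rewrite big_nil mul0r expr0 subrr.
  by rewrite big_nat_recr//= mulrDl ih exprSr; ring.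
by rewrite gerDl oppr_le0 exprn_ge0// ltW.
Qed.

Section double_integral.
Implicit Types K : R * R -> R.

Definition dbl K : \bar R := (\int[mu]_x \int[mu]_y (K (x, y))%:E)%E.

Lemma mf_pair1 K x : mf K -> mf (fun y => K (x, y)).
Proof. by move=> mK; exact: (measurableT_comp mK (measurable_pair1 x)). Qed.

Lemma dbl_ge0 K : (forall w, 0 <= K w) -> (0 <= dbl K)%E.
Proof. by move=> K0; apply: integral_ge0 => x _; apply: int_ge0 => y. Qed.

Lemma le_dbl K1 K2 : mf K1 -> mf K2 -> (forall w, 0 <= K1 w) -> (forall w, K1 w <= K2 w) -> (dbl K1 <= dbl K2)%E.
Proof.
move=> m1 m2 p1 h; apply: ge0_le_integral; first exact: measurableT.
- by move=> x _; apply: int_ge0 => y.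
- exact: measurable_tonelli.
- by apply: measurable_tonelli => // w; exact: le_trans (h w).
- by move=> x _; apply: le_int; [exact: mf_pair1|exact: mf_pair1|by move=> y|by move=> y].
Qed.

Lemma dblD K1 K2 : mf K1 -> mf K2 -> (forall w, 0 <= K1 w) -> (forall w, 0 <= K2 w) ->
  dbl (fun w => K1 w + K2 w) = (dbl K1 + dbl K2)%E.
Proof.
move=> m1 m2 p1 p2; rewrite /dbl -ge0_integralD; first last.
- exact: measurable_tonelli.
- by move=> x _; apply: int_ge0 => y.
- exact: measurable_tonelli.
- by move=> x _; apply: int_ge0 => y.
- exact: measurableT.
by apply: eq_integral => x _; apply: intD; [exact: mf_pair1|exact: mf_pair1|by move=> y|by move=> y].
Qed.

Lemma dblZ (k : R) K : mf K -> (forall w, 0 <= K w) -> 0 <= k -> dbl (fun w => k * K w) = (k%:E * dbl K)%E.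
Proof.
move=> m1 p1 k0; rewrite /dbl -ge0_integralZl; first last.
- by rewrite lee_fin.
- by move=> x _; apply: int_ge0 => y.
- exact: measurable_tonelli.
- exact: measurableT.
by apply: eq_integral => x _; apply: intZ; [exact: mf_pair1|by move=> y|].
Qed.

Lemma dbl_sum (I : Type) (r : seq I) (K : I -> R * R -> R) : (forall i, mf (K i)) -> (forall i w, 0 <= K i w) ->
  dbl (fun w => \sum_(i <- r) K i w) = (\sum_(i <- r) dbl (K i))%E.
Proof.
move=> m0 p0; elim: r => [|i r ih].
  rewrite big_nil /dbl; under eq_integral do under eq_integral do rewrite big_nil.
  by under eq_integral do rewrite integral0; rewrite integral0.
rewrite big_cons -ih -dblD; [|exact: m0|exact: measurable_sum|exact: p0|by move=> w; exact: sumr_ge0].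
by congr dbl; apply/funext => w; rewrite big_cons.
Qed.

Lemma dbl_swap K : mf K -> (forall w, 0 <= K w) -> dbl (fun w => K (w.2, w.1)) = dbl K.
Proof. by move=> m1 p1; rewrite /dbl [RHS]tonelli_swap. Qed.

End double_integral.

Lemma L2r_gam g sg rh (c : R) : L1 g -> mf sg -> mf rh -> 0 < c -> (forall x, c <= rh x) -> L2r (gam g sg rh).
Proof.
move=> lg m2 m3 c0 hc; have mG := measurable_gam (L1_mf lg) m2 m3.
set B := 2 * \int[mu]_x `|g x|.
have lG : L1 (gam g sg rh) by apply: (le_L1 mG (L1Z B (L1_dexp c0))) => xi; exact: gam_le.
have B0 : 0 <= B by rewrite mulr_ge0// Rintegral_ge0.
have bG xi : `|gam g sg rh xi| <= B.
  by apply: le_trans (gam_le xi lg m2 m3 hc) _; rewrite ler_piMr ?dexp_le1// ltW.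
split => //; have /L1P[_] := L1_bdd lG mG bG; apply: le_lt_trans.
rewrite le_eqVlt; apply/orP; left; apply/eqP; apply: eq_integral => x _.
by rewrite -expr2 ger0_norm// sqr_ge0.
Qed.

(** * Energy of the adjoint at the dyadic damping scales *)

Section energy.
Variables (s D c : R) (g tau eps : R -> R).
Hypotheses (s0 : 0 < s) (s1 : s < 1 / 2) (D0 : 0 < D) (c0 : 0 < c).
Hypotheses (lg : L1 g) (l2g : L2r g) (mtau : mf tau) (meps : mf eps).
Hypotheses (heps : forall x, c <= eps x) (htau : forall x, `|tau x| <= D * eps x `^ (1 - 2 * s)).

Let sg x := x + tau x.
Let rad x := D * eps x `^ (1 - 2 * s).

Let eps0 x : 0 < eps x. Proof. exact: lt_le_trans c0 (heps x). Qed.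
Let rad0 x : 0 < rad x. Proof. by rewrite mulr_gt0// powR_gt0. Qed.

Let msg : mf sg.
Proof. by apply: measurable_funD => //; exact: measurable_id. Qed.

Let mrad : mf rad.
Proof. by apply: measurable_funM; [exact: measurable_cst|exact: (measurableT_comp (measurable_powR _) meps)]. Qed.

Let radc x : D * c `^ (1 - 2 * s) <= rad x.
Proof.
have [ts0 ts1] := twice_lt1 s0 s1; rewrite ler_wpM2l ?(ltW D0)//.
by apply: ge0_ler_powR; rewrite ?nnegrE ?(ltW c0) ?(ltW (eps0 _)) ?subr_ge0// ltW.
Qed.

Let m1 : mf (fun w : R * R => w.1) := measurable_fst.
Let m2 : mf (fun w : R * R => w.2) := measurable_snd.
Let md : mf (fun w : R * R => w.1 - w.2). Proof. exact: measurable_funB. Qed.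

Let gg (w : R * R) := `|g w.1| * `|g w.2|.

Let gg0 w : 0 <= gg w. Proof. by rewrite mulr_ge0. Qed.

Let mgg : mf gg.
Proof.
by apply: measurable_funM; apply: measurableT_comp => //;
  [exact: (measurableT_comp (L1_mf lg) m1)|exact: (measurableT_comp (L1_mf lg) m2)].
Qed.

(** A near and a far kernel whose widths depend on the first variable only, the form that
    [quadratic_form] can treat. *)
Definition shift_ker (b : R) (w : R * R) : R :=
  8 * poisson (b + eps w.1) (w.1 - w.2) + 8 * rad w.1 / (b + eps w.1) * poisson (4 * rad w.1) (w.1 - w.2).

Lemma shift_ker_ge0 b w : 0 < b -> 0 <= shift_ker b w.
Proof.
move=> b0; have h : 0 <= b + eps w.1 by rewrite addr_ge0// ltW.
rewrite addr_ge0// mulr_ge0//; first exact: poisson_ge0.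
  by rewrite divr_ge0// mulr_ge0// ltW.
by apply: poisson_ge0; rewrite mulr_ge0// ltW.
Qed.

(** If eps y <= eps x, the width b + eps x + eps y is at most twice b + eps x and the displacements
    differ by at most 2 rad x, so [poisson_shift] applies. The symmetric sum covers both orders. *)
Lemma shift_kernel_le b x y : 0 < b ->
  poisson (b + eps x + eps y) (sg x - sg y) <= shift_ker b (x, y) + shift_ker b (y, x).
Proof.
move=> b0.
have main u v : eps v <= eps u -> poisson (b + eps u + eps v) (sg u - sg v) <= shift_ker b (u, v).
  move=> h; have -> : sg u - sg v = (u - v) + (tau u - tau v) by rewrite /sg; ring.
  apply: poisson_shift.
  - by rewrite addr_gt0.
  - by rewrite lerDl ltW.
  - by rewrite mulr_natl mulr2n lerD2l (le_trans h)// lerDr ltW.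
  - exact: rad0.
  - apply: le_trans (ler_normB _ _) _.
    have h1 := htau u; have h2 := htau v.
    have h3 : rad v <= rad u.
      have [ts0 ts1] := twice_lt1 s0 s1; rewrite ler_wpM2l ?(ltW D0)//.
      by apply: ge0_ler_powR; rewrite ?nnegrE ?(ltW (eps0 _)) ?subr_ge0// ltW.
    rewrite -/(rad u) in h1; rewrite -/(rad v) in h2.
    by rewrite mulr_natl mulr2n lerD// (le_trans h2).
have [h|h] := leP (eps y) (eps x).
  by apply: (le_trans (main _ _ h)); rewrite lerDl shift_ker_ge0.
have := main _ _ (ltW h); rewrite addrAC.
rewrite /poisson -[(sg y - sg x) ^+ 2]sqrrN opprB => hh; apply: (le_trans hh).
by rewrite lerDr; exact: shift_ker_ge0.
Qed.

Let mbe b : mf (fun w : R * R => b + eps w.1).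
Proof. by apply: measurable_funD; [exact: measurable_cst|exact: (measurableT_comp meps m1)]. Qed.

Let mrad1 : mf (fun w : R * R => rad w.1). Proof. exact: (measurableT_comp mrad m1). Qed.

Let near_ker b (w : R * R) := poisson (b + eps w.1) (w.1 - w.2).
Let far_ker (w : R * R) := poisson (4 * rad w.1) (w.1 - w.2).
Let far_wt b (w : R * R) := 8 * rad w.1 / (b + eps w.1).

Let be_ge b x : 0 < b -> c <= b + eps x.
Proof. by move=> b0; rewrite (le_trans (heps x))// lerDr ltW. Qed.

Let mnear b : 0 < b -> mf (near_ker b).
Proof. by move=> b0; apply: (@measurable_poisson2 _ (fun w => b + eps w.1) _ c) => // w; exact: be_ge. Qed.

Let rc0 : 0 < 4 * (D * c `^ (1 - 2 * s)).
Proof. by rewrite mulr_gt0// mulr_gt0// powR_gt0. Qed.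

Let mfar : mf far_ker.
Proof.
apply: (@measurable_poisson2 _ (fun w => 4 * rad w.1) _ (4 * (D * c `^ (1 - 2 * s)))) => //.
  by move=> w; rewrite ler_pM2l.
by apply: measurable_funM; [exact: measurable_cst|exact: mrad1].
Qed.

Let mfwt b : 0 < b -> mf (far_wt b).
Proof.
move=> b0; have -> : far_wt b = (fun w => 8 * rad w.1 * (b + eps w.1) `^ (-1)).
  by apply/funext => w; rewrite /far_wt powR_inv1// (le_trans _ (be_ge w.1 b0))// ltW.
apply: measurable_funM; first by apply: measurable_funM; [exact: measurable_cst|exact: mrad1].
exact: (measurableT_comp (measurable_powR (-1)) (mbe b)).
Qed.

Let near0 b w : 0 < b -> 0 <= near_ker b w.
Proof. by move=> b0; apply: poisson_ge0; apply: le_trans (ltW c0) _; exact: be_ge. Qed.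

Let far0 w : 0 <= far_ker w.
Proof. by apply: poisson_ge0; rewrite mulr_ge0// ltW. Qed.

Let fwt0 b w : 0 < b -> 0 <= far_wt b w.
Proof. move=> b0; apply: divr_ge0; first by rewrite mulr_ge0// ltW.
exact: le_trans (ltW c0) (be_ge w.1 b0). Qed.

Let l2n : L2r (fun x => `|g x|).
Proof.
split; first by apply: measurableT_comp => //; exact: (L1_mf lg).
apply: le_lt_trans l2g.2; apply: le_n2; [|exact: (L1_mf lg)|by move=> x; rewrite normr_id].
by apply: measurableT_comp => //; exact: (L1_mf lg).
Qed.

Let n2n : n2 (fun x => `|g x|) = n2 g.
Proof. by apply: eq_integral => x _; rewrite real_normK ?num_real. Qed.

Let near_form b : 0 < b -> (dbl (fun w => gg w * near_ker b w)%R <= (8 * pi)%:E * n2 g)%E.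
Proof.
move=> b0; rewrite -n2n.
have mb : mf (fun x => b + eps x) by apply: measurable_funD; [exact: measurable_cst|exact: meps].
exact: (quadratic_form (L1_norm lg) l2n (fun x => normr_ge0 (g x)) mb c0 (fun x => be_ge x b0)).
Qed.

Let far_form : (dbl (fun w => gg w * far_ker w)%R <= (8 * pi)%:E * n2 g)%E.
Proof.
rewrite -n2n.
have mb : mf (fun x => 4 * rad x) by apply: measurable_funM; [exact: measurable_cst|exact: mrad].
have hb x : 4 * (D * c `^ (1 - 2 * s)) <= 4 * rad x by rewrite ler_pM2l.
exact: (quadratic_form (L1_norm lg) l2n (fun x => normr_ge0 (g x)) mb rc0 hb).
Qed.

(** The b / 2 in each factor adds up to b in the kernel. The near part is estimated at once. The far
    part stays a double integral: its weight 8 rad / (b + eps) is bounded independently of [c] only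
    after summation over b = 2^-k, whereas its kernel does not involve b. *)
Lemma energy_le b : 0 < b ->
  (n2 (gam g sg (fun x => eps x + b / 2)%R) <=
   (2 * (64 * pi))%:E * n2 g + dbl (fun w => 2 * (far_wt b w * (gg w * far_ker w)))%R)%E.
Proof.
move=> b0.
have mrh : mf (fun x => eps x + b / 2) by apply: measurable_funD; [|exact: measurable_cst].
have hrh x : c <= eps x + b / 2 by rewrite (le_trans (heps x))// lerDl divr_ge0// ltW.
have lG := L2r_gam lg msg mrh c0 hrh.
rewrite (n2_fin lG).
pose K (w : R * R) := poisson (b + eps w.1 + eps w.2) (sg w.1 - sg w.2).
have hb (w : R * R) : c <= b + eps w.1 + eps w.2 by rewrite (le_trans (be_ge w.1 b0))// lerDl ltW.
have mK : mf K.
  apply: (@measurable_poisson2 _ (fun w => b + eps w.1 + eps w.2) _ c) => //.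
  - by apply: measurable_funD; [exact: mbe|exact: (measurableT_comp meps m2)].
  - by apply: measurable_funB; [exact: (measurableT_comp msg m1)|exact: (measurableT_comp msg m2)].
have K0 w : 0 <= K w by apply: poisson_ge0; apply: le_trans (ltW c0) _.
have hK w : 0 <= K w <= 2 / c.
  rewrite K0 /=; apply: (le_trans (poisson_le _ (lt_le_trans c0 (hb w)))).
  by rewrite ler_pM2l// lef_pV2 ?posrE// (lt_le_trans c0).
have -> : \int[mu]_x (gam g sg (fun x => eps x + b / 2) x ^+ 2) = \int[mu]_x (g x * \int[mu]_y (g y * K (x, y))).
  rewrite (bilinear lg lg msg msg mrh mrh c0 hrh (fun x => le_trans (ltW c0) (hrh x))).
  apply: eq_Rintegral => x _; congr (_ * _); apply: eq_Rintegral => y _; congr (_ * poisson _ _).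
  by rewrite /=; field.
apply: (le_trans (bilinear_le lg lg mK hK)); rewrite -/(dbl (fun w => `|g w.1| * `|g w.2| * K w)).
have sk0 w := shift_ker_ge0 w b0.
have skE w : gg w * shift_ker b w = 8 * (gg w * near_ker b w) + far_wt b w * (gg w * far_ker w).
  by rewrite /shift_ker /near_ker /far_wt /far_ker; ring.
have mn : mf (fun w => gg w * near_ker b w) by apply: measurable_funM; [exact: mgg|exact: mnear].
have mfa : mf (fun w => gg w * far_ker w) by apply: measurable_funM; [exact: mgg|exact: mfar].
have n0 w : 0 <= gg w * near_ker b w by rewrite mulr_ge0 ?gg0 ?near0.
have f0 w : 0 <= gg w * far_ker w by rewrite mulr_ge0 ?gg0 ?far0.
have mfw : mf (fun w => far_wt b w * (gg w * far_ker w)) by apply: measurable_funM; [exact: mfwt|].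
have fw0 w : 0 <= far_wt b w * (gg w * far_ker w) by rewrite mulr_ge0 ?fwt0.
have mn8 : mf (fun w => 8 * (gg w * near_ker b w)) by apply: measurable_funM; [exact: measurable_cst|].
have n80 w : 0 <= 8 * (gg w * near_ker b w) by rewrite mulr_ge0.
have msk : mf (fun w => gg w * shift_ker b w).
  have -> : (fun w => gg w * shift_ker b w) = (fun w => 8 * (gg w * near_ker b w) + far_wt b w * (gg w * far_ker w)) by apply/funext => w; exact: skE.
  exact: measurable_funD.
have s0' w : 0 <= gg w * shift_ker b w by rewrite mulr_ge0.
have msk2 : mf (fun w => gg (w.2, w.1) * shift_ker b (w.2, w.1)).
  by apply: (measurableT_comp msk); exact: measurable_swap.
apply: (@le_trans _ _ (dbl (fun w => gg w * shift_ker b w + gg (w.2, w.1) * shift_ker b (w.2, w.1))%R)).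
  apply: le_dbl.
  - by apply: measurable_funM; [exact: mgg|].
  - exact: measurable_funD.
  - by move=> w; rewrite mulr_ge0.
  - move=> [x y] /=; have := ler_wpM2l (gg0 (x, y)) (shift_kernel_le x y b0).
    by rewrite mulrDr /gg /= [`|g y| * _]mulrC.
rewrite (dblD msk msk2 s0' (fun w => s0' (w.2, w.1))) (dbl_swap msk s0').
have -> : dbl (fun w => gg w * shift_ker b w) = (8%:E * dbl (fun w => gg w * near_ker b w)%R + dbl (fun w => far_wt b w * (gg w * far_ker w))%R)%E.
  rewrite -(dblZ mn n0 (ler0n R 8)) -(dblD mn8 mfw n80 fw0); congr dbl; apply/funext => w; exact: skE.
rewrite (dblZ mfw fw0 (ler0n R 2)).
have nf := near_form b0.
have d0 : (0 <= dbl (fun w => far_wt b w * (gg w * far_ker w))%R)%E by exact: dbl_ge0.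
set X := dbl _ in nf *; set Y := dbl _ in d0 *.
apply: (@le_trans _ _ (((64 * pi)%:E * n2 g + Y) + ((64 * pi)%:E * n2 g + Y))%E).
  have h : (8%:E * X <= (64 * pi)%:E * n2 g)%E.
    apply: (@le_trans _ _ (8%:E * ((8 * pi)%:E * n2 g))%E); first by apply: lee_wpmul2l.
    by rewrite muleA -EFinM mulrA; have -> : 8 * 8 = 64 :> R by ring.
  by apply: leeD; apply: leeD2r.
rewrite addeACA; apply: leeD.
  by rewrite -ge0_muleDl ?lee_fin ?mulr_ge0 ?pi_ge0// -EFinD; have -> : 64 * pi + 64 * pi = 2 * (64 * pi) :> R by ring.
have -> : 2 = 1 + 1 :> R by ring.
by rewrite EFinD ge0_muleDl ?lee_fin// mul1e.
Qed.

(** Near part: the constant of [energy_le] times the sum of the geometric series in [quart s]. Far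
    part: 2 for the two orders of the variables, the bound of [scale_sum], and the 8 pi of
    [quadratic_form]. *)
Definition energy_cst : R := 2 * (64 * pi) * (1 - quart s)^-1 + 2 * (8 * D * minsum_cst (1 - 2 * s)) * (8 * pi).

Lemma energy_sum n :
  (\sum_(0 <= k < n) (quart s ^+ k)%:E * n2 (gam g sg (fun x => (eps x + 2 ^- k / 2)%R)) <= energy_cst%:E * n2 g)%E.
Proof.
have [q0 q1] := quart_bounds s0.
have qk k : 0 <= quart s ^+ k by rewrite exprn_ge0// ltW.
have b0 k : 0 < 2 ^- k :> R by rewrite invr_gt0 exprn_gt0.
have mfa : mf (fun w => gg w * far_ker w) by apply: measurable_funM; [exact: mgg|exact: mfar].
have f0 w : 0 <= gg w * far_ker w by rewrite mulr_ge0 ?gg0 ?far0.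
have mfw k : mf (fun w => 2 * (far_wt (2 ^- k) w * (gg w * far_ker w))).
  by apply: measurable_funM; [exact: measurable_cst|apply: measurable_funM; [exact: mfwt|]].
have fw0 k w : 0 <= 2 * (far_wt (2 ^- k) w * (gg w * far_ker w)) := mulr_ge0 (ler0n R 2) (mulr_ge0 (fwt0 w (b0 k)) (f0 w)).
have mqk k : mf (fun w => quart s ^+ k * (2 * (far_wt (2 ^- k) w * (gg w * far_ker w)))).
  by apply: measurable_funM; [exact: measurable_cst|].
have qk0 k w : 0 <= quart s ^+ k * (2 * (far_wt (2 ^- k) w * (gg w * far_ker w))) by rewrite mulr_ge0.
set N := n2 g.
have N0 : (0 <= N)%E by exact: n2_ge0.
apply: (@le_trans _ _ (\sum_(0 <= k < n) ((quart s ^+ k)%:E * ((2 * (64 * pi))%:E * N) +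
   dbl (fun w => quart s ^+ k * (2 * (far_wt (2 ^- k) w * (gg w * far_ker w))))%R))%E).
  apply: lee_sum => k _; rewrite dblZ// -ge0_muleDr; [|by rewrite mule_ge0// lee_fin !mulr_ge0// pi_ge0|exact: dbl_ge0].
  by apply: lee_wpmul2l; [rewrite lee_fin|exact: energy_le].
rewrite big_split /= -dbl_sum// /energy_cst EFinD ge0_muleDl; last 2 first.
- by rewrite lee_fin !mulr_ge0 ?pi_ge0// invr_ge0 subr_ge0 ltW.
- have [ts0 ts1] := twice_lt1 s0 s1.
  have h : 0 <= minsum_cst (1 - 2 * s) by apply: minsum_cst_ge0; rewrite ?subr_gt0// ltrBlDr ltrDl.
  by rewrite lee_fin !mulr_ge0 ?pi_ge0// ltW.
apply: leeD.
  rewrite -ge0_sume_distrl; last by move=> k _; rewrite lee_fin.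
  rewrite sumEFin [leRHS](_ : _ = ((1 - quart s)^-1)%:E * ((2 * (64 * pi))%:E * N))%E; last by rewrite muleA -EFinM mulrC.
  by apply: lee_wpmul2r; [rewrite mule_ge0// lee_fin !mulr_ge0// pi_ge0|rewrite lee_fin geo_sum].
(* The far kernel is common to all k, so the weights are summed pointwise before a single use of
   [quadratic_form]. *)
apply: (@le_trans _ _ (dbl (fun w => 2 * (8 * D * minsum_cst (1 - 2 * s)) * (gg w * far_ker w)))).
  apply: le_dbl.
  - exact: measurable_sum.
  - by apply: measurable_funM; [exact: measurable_cst|].
  - by move=> w; exact: sumr_ge0.
  - move=> w; have h := scale_sum n s0 s1 D0 (eps0 w.1).
    have -> : \sum_(0 <= k < n) quart s ^+ k * (2 * (far_wt (2 ^- k) w * (gg w * far_ker w))) =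
      2 * (\sum_(0 <= k < n) quart s ^+ k * far_wt (2 ^- k) w) * (gg w * far_ker w).
      by rewrite big_distrr /= big_distrl /=; apply: eq_bigr => k _; ring.
    by apply: ler_wpM2r => //; rewrite ler_pM2l.
have c1 : 0 <= 2 * (8 * D * minsum_cst (1 - 2 * s)).
  have [ts0 ts1] := twice_lt1 s0 s1.
  have h : 0 <= minsum_cst (1 - 2 * s) by apply: minsum_cst_ge0; rewrite ?subr_gt0// ltrBlDr ltrDl.
  by rewrite !mulr_ge0// ltW.
rewrite (dblZ mfa f0 c1).
have -> : ((2 * (8 * D * minsum_cst (1 - 2 * s)) * (8 * pi))%:E * N = (2 * (8 * D * minsum_cst (1 - 2 * s)))%:E * ((8 * pi)%:E * N))%E.
  by rewrite muleA -EFinM.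
by apply: lee_wpmul2l; [rewrite lee_fin|exact: far_form].
Qed.

End energy.

(** The displacement and the damping may vary with x, which admits an index n chosen as a function
    of x. *)
Definition lowV h tau eps x : R := \int[mu]_xi (h xi * (cas ((x + tau x) * xi) * dexp (eps x) xi)).

Definition n2w s h : \bar R := (\int[mu]_xi (h xi ^+ 2 * wt s xi)%:E)%E.

Lemma L2r_dexp (c : R) : 0 < c -> L2r (dexp c).
Proof.
move=> c0; split; first exact: measurable_dexp.
have c2 : 0 < c + c by rewrite addr_gt0.
have -> : n2 (dexp c) = (\int[mu]_x (dexp (c + c) x)%:E)%E.
  by apply: eq_integral => x _; rewrite expr2 dexpD.
by rewrite int_dexp// ltry.
Qed.

Lemma measurable_lowV h tau eps : mf h -> mf tau -> mf eps -> mf (lowV h tau eps).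
Proof.
move=> mh mt me; have mc := @measurable_cas R.
have f1 : mf (fun w : R * R => w.1) := measurable_fst.
have f2 : mf (fun w : R * R => w.2) := measurable_snd.
have ms : mf (fun w : R * R => w.1 + tau w.1).
  by apply: measurable_funD; [exact: f1|exact: (measurableT_comp mt f1)].
apply: (measurable_Rint2 (F := fun w => h w.2 * (cas ((w.1 + tau w.1) * w.2) * dexp (eps w.1) w.2))).
apply: measurable_funM; first exact: (measurableT_comp mh f2).
apply: measurable_funM; first by apply: (measurableT_comp mc); exact: measurable_funM.
rewrite /dexp; apply: measurableT_comp => //; apply: measurableT_comp => //.
apply: measurable_funM; first exact: (measurableT_comp me f1).
exact: (measurableT_comp _ f2).
Qed.

Lemma low_ker_le h (e c a xi : R) : c <= e ->
  `|h xi * (cas (a * xi) * dexp e xi)| <= 2 * `|h xi * dexp c xi|.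
Proof.
move=> hc; have := cas_dexp_le (a * xi) xi hc; move: (cas _ * _) => k hk.
rewrite [`|h xi * k|]normrM [`|h xi * dexp c xi|]normrM (ger0_norm (dexp_ge0 c xi)).
have -> : 2 * (`|h xi| * dexp c xi) = `|h xi| * (2 * dexp c xi) by ring.
by rewrite ler_wpM2l.
Qed.

Lemma L1_low_ker h (e c a : R) : L2r h -> 0 < c -> c <= e -> L1 (fun xi => h xi * (cas (a * xi) * dexp e xi)).
Proof.
move=> lh c0 hc; have l1 := L2rM lh (L2r_dexp c0).
have mk : mf (fun xi => h xi * (cas (a * xi) * dexp e xi)).
  apply: measurable_funM; first exact: lh.1.
  apply: measurable_funM; last exact: measurable_dexp.
  by apply: (measurableT_comp (@measurable_cas R)); apply: measurable_funM; [exact: measurable_cst|exact: measurable_id].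
by apply: (le_L1 mk (L1Z 2 (L1_norm l1))) => xi; exact: low_ker_le.
Qed.

Lemma lowV_le h tau eps (c : R) x : L2r h -> 0 < c -> c <= eps x ->
  `|lowV h tau eps x| <= 2 * \int[mu]_xi `|h xi * dexp c xi|.
Proof.
move=> lh c0 hc; have l1 := L2rM lh (L2r_dexp c0).
have lk := L1_low_ker (x + tau x) lh c0 hc.
apply: le_trans (le_normr_Rintegral measurableT lk) _; rewrite -(RintZ _ (L1_norm l1)).
by apply: le_Rintegral; [exact: measurableT|exact: (L1_norm lk)|exact: (L1Z 2 (L1_norm l1))|move=> xi _; exact: low_ker_le].
Qed.

Lemma amgm_wt (A a b w : R) : 0 < A -> 0 < w -> `|a * b| <= A / 2 * (a ^+ 2 * w) + (2 * A)^-1 * (b ^+ 2 / w).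
Proof.
move=> A0 w0; have Aw : 0 < A * w by rewrite mulr_gt0.
have -> : A / 2 * (a ^+ 2 * w) + (2 * A)^-1 * (b ^+ 2 / w) = (2 * (A * w))^-1 * ((A * w * a) ^+ 2 + b ^+ 2).
  by field; rewrite !gt_eqF.
rewrite ler_pdivlMl ?mulr_gt0//; move: (A * w) Aw => v v0.
have [h|h] := leP 0 (a * b).
  rewrite (ger0_norm h); have -> : (v * a) ^+ 2 + b ^+ 2 = 2 * v * (a * b) + (v * a - b) ^+ 2 by ring.
  by rewrite lerDl sqr_ge0.
rewrite (ltr0_norm h); have -> : (v * a) ^+ 2 + b ^+ 2 = 2 * v * - (a * b) + (v * a + b) ^+ 2 by ring.
by rewrite lerDl sqr_ge0.
Qed.

Lemma shuffle4 (a E q d : R) : a * (E * (q * d)) = E * (q * (a * d)).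
Proof. by ring. Qed.

Lemma low_duality h g tau eps (c : R) : L2r h -> L1 g -> mf tau -> mf eps -> 0 < c -> (forall x, c <= eps x) ->
  \int[mu]_x (g x * lowV h tau eps x) = \int[mu]_xi (h xi * gam g (fun x => x + tau x) eps xi).
Proof.
move=> lh lg mt me c0 hc; have l1 := L2rM lh (L2r_dexp c0); have mg := L1_mf lg; have mh := lh.1.
have ms : mf (fun x : R => x + tau x) by apply: measurable_funD; [exact: measurable_id|exact: mt].
have mk := measurable_gam_ker mg ms me.
pose F (w : R * R) := h w.1 * (g w.2 * (cas ((w.2 + tau w.2) * w.1) * dexp (eps w.2) w.1)).
have mF : mf F by apply: measurable_funM; [exact: (measurableT_comp mh measurable_fst)|exact: mk].
have bF xi x : `|F (xi, x)| <= (2 * `|h xi * dexp c xi|) * `|g x|.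
  rewrite /F /= normrM [`|g x * _|]normrM [`|h xi * dexp c xi|]normrM (ger0_norm (dexp_ge0 c xi)).
  have := cas_dexp_le ((x + tau x) * xi) xi (hc x); move: (cas _ * _) => k hk.
  have -> : 2 * (`|h xi| * dexp c xi) * `|g x| = `|h xi| * (`|g x| * (2 * dexp c xi)) by ring.
  by rewrite ler_wpM2l// ler_wpM2l.
have sw := Rfubini mF (L1Z 2 (L1_norm l1)) (L1_norm lg) bF.
transitivity (\int[mu]_xi \int[mu]_x F (xi, x)).
  rewrite sw; apply: eq_Rintegral => x _.
  have lk := L1_low_ker (x + tau x) lh c0 (hc x).
  by rewrite /lowV -(RintZ _ lk); apply: eq_Rintegral => xi _; rewrite /F /= mulrCA.
by apply: eq_Rintegral => xi _; exact: (RintZ (h xi) (L1_gam_ker xi lg ms me hc)).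
Qed.

(** Each of the two copies of [gam] absorbs one factor exp(-b |xi| / 2), which merely raises its
    damping rate. *)
Lemma gam_scale (g sg rh : R -> R) (b xi : R) : L1 g -> mf sg -> mf rh -> (forall x, 0 <= rh x) -> 
  gam g sg rh xi ^+ 2 * dexp b xi = gam g sg (fun x => rh x + b / 2) xi ^+ 2.
Proof.
move=> lg ms mr r0.
have -> : gam g sg (fun x => rh x + b / 2) xi = dexp (b / 2) xi * gam g sg rh xi.
  rewrite /gam -(RintZ _ (L1_gam_ker xi lg ms mr r0)); apply: eq_Rintegral => x _.
  by rewrite -dexpD; ring.
have -> : dexp b xi = dexp (b / 2) xi * dexp (b / 2) xi by rewrite dexpD -splitr.
by rewrite -expr2 -exprMn mulrC.
Qed.

(** By [wt_inv_le] the inverse weight is at most e^2 times the sum over k of 4^(-sk) exp(-2^-k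
    |xi|), and [gam_scale] turns each term into one of [energy_sum]. *)
Lemma energy_wt s D (c : R) g tau eps : 0 < s -> s < 1 / 2 -> 0 < D -> 0 < c -> L1 g -> L2r g -> mf tau -> mf eps ->
  (forall x, c <= eps x) -> (forall x, `|tau x| <= D * eps x `^ (1 - 2 * s)) ->
  (\int[mu]_xi (gam g (fun x => x + tau x)%R eps xi ^+ 2 / wt s xi)%:E <= (expR 2 * energy_cst s D)%:E * n2 g)%E.
Proof.
move=> s0 s1 D0 c0 lg l2g mt me hc ht.
have ms : mf (fun x : R => x + tau x) by apply: measurable_funD; [exact: measurable_id|exact: mt].
have e0 x : 0 <= eps x := le_trans (ltW c0) (hc x).
have [q0 q1] := quart_bounds s0.
have qk k : 0 <= quart s ^+ k by rewrite exprn_ge0// ltW.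
set G := gam g (fun x => x + tau x) eps.
have mG : mf G by exact: (measurable_gam (L1_mf lg) ms me).
pose u k xi := quart s ^+ k * gam g (fun x => x + tau x) (fun x => eps x + 2 ^- k / 2) xi ^+ 2.
have uE k xi : u k xi = quart s ^+ k * (G xi ^+ 2 * dexp (2 ^- k) xi).
  by rewrite (gam_scale (2 ^- k) xi lg ms me e0).
have mb k : mf (fun x => eps x + 2 ^- k / 2) by apply: measurable_funD; [exact: me|exact: measurable_cst].
have mgk k : mf (gam g (fun x => x + tau x) (fun x => eps x + 2 ^- k / 2)) := measurable_gam (L1_mf lg) ms (mb k).
have msq k : mf (fun xi => gam g (fun x => x + tau x) (fun x => eps x + 2 ^- k / 2) xi ^+ 2) := measurable_funX 2 (mgk k).
have mu_ k : mf (u k) by apply: measurable_funM; [exact: measurable_cst|exact: msq].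
have u0 k xi : 0 <= u k xi by rewrite mulr_ge0// sqr_ge0.
have mw : mf (fun xi => (wt s xi)^-1).
  have -> : (fun xi => (wt s xi)^-1) = (fun xi => wt s xi `^ (-1)).
    by apply/funext => xi; rewrite powR_inv1// wt_ge0.
  exact: (measurableT_comp (measurable_powR (-1)) (@measurable_wt R s)).
have mS : mf (fun xi => \sum_(0 <= k <oo) (u k xi)%:E)%E.
  apply: (@ge0_emeasurable_sum _ _ _ setT (fun k xi => (u k xi)%:E) xpredT).
  - by move=> k x _ _; rewrite lee_fin.
  - by move=> k _; exact: emf.
have E0 : 0 <= expR 2 :> R := expR_ge0 2.
apply: (@le_trans _ _ (\int[mu]_xi ((expR 2)%:E * (\sum_(0 <= k <oo) (u k xi)%:E)))%E).
  apply: ge0_le_integral; first exact: measurableT.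
  - by move=> xi _; rewrite lee_fin divr_ge0 ?sqr_ge0 ?wt_ge0.
  - by apply: emf; apply: measurable_funM; [exact: (measurable_funX 2 mG)|exact: mw].
  - exact: measurable_funeM.
  - move=> xi _; have [k hk] := wt_inv_le xi s0.
    apply: (@le_trans _ _ ((expR 2)%:E * (u k xi)%:E)%E).
      have -> : ((expR 2)%:E * (u k xi)%:E)%E = (expR 2 * u k xi)%:E by [].
      rewrite lee_fin uE; apply: (le_trans (ler_wpM2l (sqr_ge0 (G xi)) hk)).
      by rewrite le_eqVlt; apply/orP; left; apply/eqP; exact: shuffle4.
    apply: lee_wpmul2l; first by rewrite lee_fin.
    apply: (@le_trans _ _ (\sum_(0 <= i < k.+1) (u i xi)%:E)%E).
      by rewrite big_nat_recr//= leeDr// sume_ge0// => i _; rewrite lee_fin.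
    by apply: nneseries_lim_ge => i _ _; rewrite lee_fin.
rewrite ge0_integralZl; [|exact: measurableT|exact: mS|by move=> xi _; rewrite nneseries_ge0// => k _ _; rewrite lee_fin|by rewrite lee_fin].
rewrite EFinM -muleA; apply: lee_wpmul2l; first by rewrite lee_fin.
rewrite integral_nneseries; [|exact: measurableT|by move=> k; exact: emf|by move=> k xi _; rewrite lee_fin].
apply: lime_le.
  by apply: is_cvg_nneseries => k _ _; apply: int_ge0 => xi.
apply: nearW => n.
apply: le_trans (energy_sum s0 s1 D0 c0 lg l2g mt me hc ht n).
apply: lee_sum => k _; rewrite /u intZ; [exact: lexx|exact: msq|by move=> xi; rewrite sqr_ge0|exact: qk].
Qed.

Lemma energy_cst_gt0 s D : 0 < s -> s < 1 / 2 -> 0 < D -> 0 < energy_cst s D.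
Proof.
move=> s0 s1 D0; have [q0 q1] := quart_bounds s0; have [ts0 ts1] := twice_lt1 s0 s1.
have h : 0 <= minsum_cst (1 - 2 * s) by apply: minsum_cst_ge0; rewrite ?subr_gt0// ltrBlDr ltrDl.
have p0 := pi_gt0 R.
rewrite /energy_cst ltr_pwDl//.
  by rewrite !mulr_gt0// invr_gt0 subr_gt0.
by rewrite !mulr_ge0// ltW.
Qed.

(* Duality: with psi the cut-off of lowV and Gam its transform,
   |psi|^2 = <h, Gam> <= (A/2) |h|^2_wt + |Gam|^2_(1/wt) / (2A), and the last term is
   at most |psi|^2 / 2 by [energy_wt]. *)
Lemma low_bound s D (c : R) h tau eps L : 0 < s -> s < 1 / 2 -> 0 < D -> 0 < c -> L2r h -> mf tau -> mf eps ->
  (forall x, c <= eps x) -> (forall x, `|tau x| <= D * eps x `^ (1 - 2 * s)) ->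
  (n2 (cut L (lowV h tau eps)) <= (expR 2 * energy_cst s D)%:E * n2w s h)%E.
Proof.
move=> s0 s1 D0 c0 lh mt me hc ht.
set V := lowV h tau eps; set A := expR 2 * energy_cst s D.
have A0 : 0 < A by rewrite mulr_gt0 ?expR_gt0// energy_cst_gt0.
have mV : mf V := measurable_lowV lh.1 mt me.
set M := 2 * \int[mu]_xi `|h xi * dexp c xi|.
have bV x : `|V x| <= M by exact: lowV_le.
have M0 : 0 <= M := le_trans (normr_ge0 _) (bV 0).
have li := L2r_indic (measurable_itv `[- L%:R, L%:R]) (itvN_fin (- L%:R) L%:R : (mu _ < +oo)%E).
set g := cut L V.
have mg : mf g by exact: measurable_cut.
have l2g : L2r g.
  apply: (le_L2r mg (L2rZ M li)) => x; rewrite /g /cut normrM [`|M * _|]normrM ler_wpM2r// (le_trans (bV x))//.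
  exact: ler_norm.
have lii : L1 (\1_(itvN L) : R -> R).
  have := L2rM li li; congr L1; apply/funext => x; rewrite indicE.
  by case: (_ \in _); rewrite ?mulr1 ?mulr0.
have lg : L1 g.
  apply: (le_L1 mg (L1Z M lii)) => x; rewrite /g /cut normrM.
  have /andP[i0 i1] := indic01 (itvN L) x.
  by rewrite [`|\1_ _ x|]ger0_norm// ler_wpM2r.
have ms : mf (fun x : R => x + tau x) by apply: measurable_funD; [exact: measurable_id|exact: mt].
set G := gam g (fun x => x + tau x) eps.
have mG : mf G by exact: (measurable_gam (L1_mf lg) ms me).
have lG : L2r G by exact: L2r_gam lg ms me c0 hc.
have lhG := L2rM lh lG.
have gE : n2 g = (\int[mu]_xi (h xi * G xi))%:E.
  rewrite (n2_fin l2g) -(low_duality lh lg mt me c0 hc); congr EFin.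
  apply: eq_Rintegral => x _; rewrite -/V /g /cut indicE.
  by case: (_ \in _); rewrite ?mulr1 ?mulr0 ?expr0n ?mul0r.
have ew := energy_wt s0 s1 D0 c0 lg l2g mt me hc ht.
have mw : mf (fun xi => (wt s xi)^-1).
  have -> : (fun xi => (wt s xi)^-1) = (fun xi => wt s xi `^ (-1)).
    by apply/funext => xi; rewrite powR_inv1// wt_ge0.
  exact: (measurableT_comp (measurable_powR (-1)) (@measurable_wt R s)).
have w0 xi : 0 < wt s xi by exact: lt_le_trans ltr01 (wt_ge1 xi (ltW s0)).
have m1 : mf (fun xi => h xi ^+ 2 * wt s xi).
  by apply: measurable_funM; [exact: (measurable_funX 2 lh.1)|exact: measurable_wt].
have m2 : mf (fun xi => G xi ^+ 2 / wt s xi) by apply: measurable_funM; [exact: (measurable_funX 2 mG)|exact: mw].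
have p1 xi : 0 <= h xi ^+ 2 * wt s xi by rewrite mulr_ge0 ?sqr_ge0// ltW.
have p2 xi : 0 <= G xi ^+ 2 / wt s xi by rewrite divr_ge0 ?sqr_ge0// ltW.
have A2 : 0 <= A / 2 by rewrite divr_ge0// ltW.
have Ai : 0 <= (2 * A)^-1 by rewrite invr_ge0 mulr_ge0// ltW.
have key : (n2 g <= (A / 2)%:E * n2w s h + (2 * A)^-1%:E * (A%:E * n2 g))%E.
  rewrite {1}gE -(L1_int lhG).
  apply: (@le_trans _ _ (\int[mu]_xi ((A / 2) * (h xi ^+ 2 * wt s xi) + (2 * A)^-1 * (G xi ^+ 2 / wt s xi))%:E)%E).
    apply: (@le_trans _ _ (\int[mu]_xi `|h xi * G xi|%:E)%E).
      apply: le_integral; [exact: measurableT|exact: lhG|exact: (L1_norm lhG)|].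
      by move=> x _; rewrite lee_fin ler_norm.
    apply: le_int.
    - exact: (L1_mf (L1_norm lhG)).
    - by apply: measurable_funD; apply: measurable_funM; [exact: measurable_cst|exact: m1|exact: measurable_cst|exact: m2].
    - by move=> x; exact: normr_ge0.
    - by move=> xi; exact: amgm_wt.
  rewrite intD; [|by apply: measurable_funM; [exact: measurable_cst|exact: m1]|by apply: measurable_funM; [exact: measurable_cst|exact: m2]|by move=> xi; rewrite mulr_ge0|by move=> xi; rewrite mulr_ge0].
  rewrite (intZ m1 p1 A2) (intZ m2 p2 Ai); apply: leeD => //.
  by apply: lee_wpmul2l; [rewrite lee_fin|exact: ew].
move: key; rewrite gE; set a := Rintegral _ _ _.
have : (0 <= n2w s h)%E by exact: int_ge0.
case: (n2w s h) => [b| |]//; last by move=> _ _; rewrite gt0_muley ?lte_fin// leey.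
rewrite -!EFinM -EFinD !lee_fin => b0.
have -> : (2 * A)^-1 * (A * a) = a / 2 by field; rewrite gt_eqF.
have -> : A / 2 * b = (A * b) / 2 by ring.
lra.
Qed.

End low_frequency.

(** * The maximal estimate *)

Section low_maximal.
Context {R : realType}.
Notation mu := (@lebesgue_measure R).
Notation mf := (measurable_fun setT).
Implicit Types (h : R -> R) (s D : R) (ta ep : nat -> R).

(** Induction on N: the new candidate replaces the current one exactly where it is strictly larger,
    a measurable condition. Only finitely many rates occur, so the damping keeps a positive lower
    bound. *)
Lemma selector h ta ep s D N : L2r h -> (forall n, 0 < ep n) -> (forall n, `|ta n| <= D * ep n `^ (1 - 2 * s)) ->
  exists (T E : R -> R) (c : R), [/\ mf T, mf E, 0 < c, (forall x, c <= E x) & (forall x, `|T x| <= D * E x `^ (1 - 2 * s))] /\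
    forall x n, (n <= N)%N -> `|lowV h (fun=> ta n) (fun=> ep n) x| <= `|lowV h T E x|.
Proof.
move=> lh e0 ht; elim: N => [|N [T [E [c [[mT mE c0 hc hT] hN]]]]].
  exists (fun=> ta 0%N), (fun=> ep 0%N), (ep 0%N); split.
    by split => //; exact: measurable_cst.
  by move=> x n; rewrite leqn0 => /eqP ->.
have mc1 : mf (fun _ : R => ta N.+1) := measurable_cst _.
have mc2 : mf (fun _ : R => ep N.+1) := measurable_cst _.
pose b x := `|lowV h T E x| < `|lowV h (fun=> ta N.+1) (fun=> ep N.+1) x|.
have mb : mf b.
  by apply: measurable_fun_ltr; apply: measurableT_comp => //; exact: (measurable_lowV lh.1).
pose T' x := if b x then ta N.+1 else T x; pose E' x := if b x then ep N.+1 else E x.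
exists T', E', (Num.min c (ep N.+1)); split.
  split.
  - exact: measurable_fun_ifT.
  - exact: measurable_fun_ifT.
  - by rewrite lt_min c0 e0.
  - by move=> x; rewrite /E'; case: ifP => _; rewrite ge_min ?lexx ?hc ?orbT.
  - by move=> x; rewrite /T' /E'; case: ifP.
have EV x : lowV h T' E' x = if b x then lowV h (fun=> ta N.+1) (fun=> ep N.+1) x else lowV h T E x.
  by rewrite /lowV /T' /E'; case: (b x).
move=> x n; rewrite EV leq_eqVlt ltnS => /orP[/eqP ->|nN].
  by case: ifPn => [_|]; [exact: lexx|rewrite /b -leNgt].
by case: ifPn => [bx|_]; [apply: le_trans (hN x n nN) (ltW bx)|exact: hN].
Qed.

Lemma limn_einf_ge (u : nat -> \bar R) (l : \bar R) : (\forall n \near \oo, l <= u n)%E -> (l <= limn_einf u)%E.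
Proof.
move=> [N _ hN]; rewrite limn_einf_lim; apply: lime_ge; first exact: is_cvg_einfs.
exists N => // n /= Nn; apply: le_ereal_inf_tmp => _ [k /= nk <-]; apply: hN => /=; exact: leq_trans nk.
Qed.

Lemma measurable_sup (u : nat -> R -> R) : (forall n, mf (u n)) ->
  mf (fun x => ereal_sup (range (fun n => (u n x)%:E))).
Proof.
move=> m.
have -> : (fun x => ereal_sup (range (fun n => (u n x)%:E))) = (fun x => esups (fun n => (u n x)%:E) 0%N).
  apply/funext => x; congr ereal_sup; apply/seteqP; split => y.
    by move=> [n _ <-]; exists n.
  by move=> [n _ <-]; exists n.
by apply: (@measurable_fun_esups _ _ _ setT (fun n x => (u n x)%:E)) => n; exact: emf.
Qed.

Lemma measurable_limn_einf (u : nat -> R -> R) : (forall n, mf (u n)) ->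
  mf (fun x => limn_einf (fun n => (u n x)%:E)).
Proof.
move=> m.
have -> : (fun x => limn_einf (fun n => (u n x)%:E)) = (fun x => - limn_esup (fun n => - (u n x)%:E))%E.
  by apply/funext => x; rewrite -limn_einfN; congr limn_einf; apply/funext => n /=; rewrite opprK.
apply: measurableT_comp => //; apply: (@measurable_fun_limn_esup _ _ _ setT (fun n x => (- (u n x)%:E)%E)) => n.
by apply: measurableT_comp => //; exact: emf.
Qed.

Definition lowM h ta ep x : \bar R :=
  ereal_sup (range (fun n => (lowV h (fun=> ta n) (fun=> ep n) x ^+ 2)%:E)).

Lemma lowM_ge h ta ep n x : ((lowV h (fun=> ta n) (fun=> ep n) x ^+ 2)%:E <= lowM h ta ep x)%E.
Proof. by apply: ereal_sup_ubound; exists n. Qed.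

Lemma lowM_ge0 h ta ep x : (0 <= lowM h ta ep x)%E.
Proof. by apply: le_trans (lowM_ge h ta ep 0 x); rewrite lee_fin sqr_ge0. Qed.

Lemma measurable_lowM h ta ep : mf h -> mf (lowM h ta ep).
Proof.
move=> mh; apply: (@measurable_sup (fun n x => lowV h (fun=> ta n) (fun=> ep n) x ^+ 2)) => n.
by apply: measurable_funX; apply: measurable_lowV => //; exact: measurable_cst.
Qed.

(** The constant in [low_bound] depends neither on the selector, nor on its lower bound [c], nor on
    the cut-off, so Fatou's lemma passes from finitely many indices to all. *)
Lemma low_maximal h ta ep s D : 0 < s -> s < 1 / 2 -> 0 < D -> L2r h ->
  (forall n, 0 < ep n) -> (forall n, `|ta n| <= D * ep n `^ (1 - 2 * s)) ->
  (\int[mu]_x lowM h ta ep x <= (expR 2 * energy_cst s D)%:E * n2w s h)%E.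
Proof.
move=> s0 s1 D0 lh e0 ht.
have /choice[T hT] : forall N, exists T : R -> R, exists (E : R -> R) (c : R), [/\ mf T, mf E, 0 < c, (forall x, c <= E x) & (forall x, `|T x| <= D * E x `^ (1 - 2 * s))] /\
    forall x n, (n <= N)%N -> `|lowV h (fun=> ta n) (fun=> ep n) x| <= `|lowV h T E x|.
  by move=> N; exact: selector.
have {hT}/choice[E hE] := hT.
have {hE}/choice[c hc] := hE.
pose V N := cut N (lowV h (T N) (E N)).
have mV N : mf (V N).
  by have [[mT mE _ _ _] _] := hc N; apply: measurable_cut; exact: (measurable_lowV lh.1).
have bV N : (n2 (V N) <= (expR 2 * energy_cst s D)%:E * n2w s h)%E.
  have [[mT mE c0 hcE hTE] _] := hc N; exact: (low_bound N s0 s1 D0 c0 lh mT mE hcE hTE).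
have mV2 N : mf (fun x => V N x ^+ 2) := measurable_funX 2 (mV N).
apply: (@le_trans _ _ (\int[mu]_x limn_einf (fun N => (V N x ^+ 2)%:E))%E).
  apply: ge0_le_integral; first exact: measurableT.
  - by move=> x _; exact: lowM_ge0.
  - exact: measurable_lowM lh.1.
  - exact: measurable_limn_einf.
  - move=> x _; apply: ge_ereal_sup => _ [n _ <-]; apply: limn_einf_ge.
    have [N0 _ hN0] := cut_eq (lowV h (fun=> ta n) (fun=> ep n)) x.
    (* [cut_eq] only compares values: either x lies in [-N, N] or the value is 0, and in the second
       case there is nothing to bound. *)
    have hx N : (N0 <= N)%N -> \1_(itvN N) x = 1 :> R \/ lowV h (fun=> ta n) (fun=> ep n) x = 0.
      move=> /hN0; rewrite /= /cut => /eqP; rewrite -subr_eq0 -[X in _ - X]mulr1 -mulrBr mulf_eq0.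
      by move=> /orP[/eqP ->|/eqP/subr0_eq ->]; [right|left].
    exists (maxn N0 n) => // N /=; rewrite geq_max => /andP[h1 h2].
    have [_ hN] := hc N; rewrite lee_fin.
    have [h3|->] := hx N h1; last by rewrite expr0n sqr_ge0.
    rewrite /V /cut h3 mulr1 -[leLHS]real_normK ?num_real// -[leRHS]real_normK ?num_real//.
    by rewrite lerXn2r ?nnegrE//; exact: hN.
apply: le_trans (@fatou _ _ _ mu setT measurableT (fun N x => (V N x ^+ 2)%:E) _ _) _.
- by move=> N; apply: emf.
- by move=> N x _; rewrite lee_fin sqr_ge0.
rewrite limn_einf_lim; apply: lime_le; first exact: is_cvg_einfs.
apply: nearW => N; apply: le_trans (bV N).
by apply: ereal_inf_lbound; exists N => //=.
Qed.

End low_maximal.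

(** * Summability of the damping errors *)

Section high_frequency.
Context {R : realType}.
Implicit Types (s x X : R).

(** Each term is at most 4 X^2 (1 / (X + n) - 1 / (X + n + 1)), and these telescope to at most 4 X^2
    / X. *)
Lemma telescope_sq X m : 0 <= X -> \sum_(0 <= n < m) (2 * X / (X + n.+1%:R)) ^+ 2 <= 4 * X.
Proof.
move=> Xge0; have [->|Xn] := eqVneq X 0.
  have e n : (2 * 0 / (0 + n.+1%:R)) ^+ 2 = 0 :> R by rewrite mulr0 mul0r expr0n.
  by under eq_bigr do rewrite e; rewrite big1_eq mulr0.
have X0 : 0 < X by rewrite lt_neqAle eq_sym Xn.
have p (n : nat) : 0 < X + n%:R by rewrite ltr_pwDl.
have : \sum_(0 <= n < m) (2 * X / (X + n.+1%:R)) ^+ 2 <= 4 * X ^+ 2 * (X^-1 - (X + m%:R)^-1).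
  elim: m => [|m ih]; first by rewrite big_nil addr0 subrr mulr0.
  rewrite big_nat_recr//=; apply: (le_trans (lerD ih (lexx _))).
  have pm := p m; have pm1 := p m.+1.
  rewrite -subr_ge0.
  have -> : 4 * X ^+ 2 * (X^-1 - (X + m.+1%:R)^-1) - (4 * X ^+ 2 * (X^-1 - (X + m%:R)^-1) + (2 * X / (X + m.+1%:R)) ^+ 2) =
     4 * X ^+ 2 / ((X + m%:R) * (X + m.+1%:R) ^+ 2).
    rewrite -natr1 in pm1 *; field; rewrite !gt_eqF//.
  by rewrite divr_ge0 ?mulr_ge0 ?sqr_ge0 ?(ltW pm) ?(ltW pm1).
move=> /le_trans; apply.
apply: (@le_trans _ _ (4 * X ^+ 2 * X^-1)).
  rewrite ler_wpM2l ?mulr_ge0 ?sqr_ge0// gerBl invr_ge0 ltW//.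
by rewrite le_eqVlt; apply/orP; left; apply/eqP; field; rewrite gt_eqF.
Qed.

(** The e_n of the overview. By [scale_kappa] its power 1 - 2s has the decay of t_n. *)
Definition scale s (n : nat) : R := n.+1%:R `^ (- (2 * s)^-1).

Lemma scale_gt0 s n : 0 < scale s n. Proof. by rewrite powR_gt0// ltr0n. Qed.

Lemma scale_kappa s n : 0 < s -> scale s n `^ (1 - 2 * s) = n.+1%:R `^ (- kappa s).
Proof.
by move=> s0; rewrite -powRrM; congr (_ `^ _); rewrite /kappa; field; rewrite gt_eqF.
Qed.

(** With X = |x|^(2s), e_n |x| = (X / (n+1))^(1/(2s)), which is at most X / (n+1) if X < n+1, since
    1/(2s) > 1. If X >= n+1, the right-hand side is at least 1. *)
Lemma high_le s n x : 0 < s -> s < 1 / 2 ->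
  1 - dexp (scale s n) x <= 2 * (`|x| `^ (2 * s)) / (`|x| `^ (2 * s) + n.+1%:R).
Proof.
move=> s0 s1; have [ts0 ts1] := twice_lt1 s0 s1.
set X := `|x| `^ (2 * s); have X0 : 0 <= X by exact: powR_ge0.
have n0 : 0 < n.+1%:R :> R by rewrite ltr0n.
have d0 : 0 < X + n.+1%:R by rewrite ltr_wpDl.
rewrite ler_pdivlMr//.
have [h|h] := leP n.+1%:R X.
  by have := dexp_ge0 (scale s n) x; nra.
set y := scale s n * `|x|.
have yE : y = (X / n.+1%:R) `^ (2 * s)^-1.
  rewrite powRM ?invr_ge0 ?(ltW n0)// /X -powRrM divff ?gt_eqF// powRr1// mulrC /y /scale.
  by congr (_ * _); rewrite -(powR_inv1 (ltW n0)) -powRrM mulN1r.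
have z1 : X / n.+1%:R <= 1 by rewrite ler_pdivrMr// mul1r ltW.
have z0 : 0 <= X / n.+1%:R by rewrite divr_ge0// ltW.
have yz : y <= X / n.+1%:R.
  rewrite yE; move: z0; rewrite le_eqVlt => /orP[/eqP <-|z0'].
    by rewrite powR0// invr_neq0// gt_eqF.
  rewrite -[leRHS](powRr1 (ltW z0')); apply: ger_powR; first by rewrite z0' z1.
  by rewrite invf_ge1// ltW.
have hd : 1 - dexp (scale s n) x <= y.
  by rewrite /dexp -/y; have := expR_ge1Dx (- y); lra.
have yn : y * n.+1%:R <= X by rewrite -ler_pdivlMr.
have : y <= 1 := le_trans yz z1.
have y0 : 0 <= y by rewrite mulr_ge0// ltW// scale_gt0.
have hd0 := dexp_le1 x (ltW (scale_gt0 s n)).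
have hh : (1 - dexp (scale s n) x) * (X + n.+1%:R) <= y * (X + n.+1%:R) by rewrite ler_pM2r.
nra.
Qed.

Lemma high_sum s x m : 0 < s -> s < 1 / 2 ->
  \sum_(0 <= n < m) (1 - dexp (scale s n) x) ^+ 2 <= 4 * wt s x.
Proof.
move=> s0 s1; have X0 : 0 <= `|x| `^ (2 * s) by exact: powR_ge0.
apply: (@le_trans _ _ (4 * (`|x| `^ (2 * s)))).
  apply: le_trans (telescope_sq m X0); apply: ler_sum => n _.
  have h1 := high_le n x s0 s1; have hd0 := dexp_le1 x (ltW (scale_gt0 s n)).
  by rewrite lerXn2r ?nnegrE ?subr_ge0// (le_trans _ h1)// subr_ge0.
rewrite ler_pM2l// powRrM powR_mulrn//; apply: ge0_ler_powR; rewrite ?nnegrE ?sqr_ge0 ?addr_ge0//.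
  exact: ltW.
by rewrite lerDr.
Qed.

End high_frequency.

(** * Reduction of the damped wave to real cas integrals *)

Section strong_maximal.
Context {R : realType}.
Notation mu := (@lebesgue_measure R).
Notation mf := (measurable_fun setT).
Implicit Types (p q : R -> R) (s D : R) (t ep : nat -> R) (f phi : R -> R[i]).

(** On either half-line |xi| is linear, so there exp(i t |xi|) acts as a translation by t or by
    -t. *)
Definition half (b : bool) (y : R) : R := \1_(if b then `[0, +oo[%classic else ~` `[0, +oo[%classic) y.

Lemma half_sign b y : half b y = if (0 <= y) == b then 1 else 0.
Proof.
rewrite /half indicE; case: b.
  have [h|h] := leP 0 y; first by rewrite mem_set//= in_itv /= h.
  by rewrite memNset//= in_itv /= andbT; apply/negP; rewrite -ltNge.
have [h|h] := leP 0 y; first by rewrite memNset//= in_itv /= h; exact.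
by rewrite mem_set//= in_itv /= andbT; apply/negP; rewrite -ltNge.
Qed.

Lemma measurable_half b : mf (half b).
Proof. by case: b; apply: measurable_indic => //; apply: measurableC. Qed.

Lemma half01 b y : 0 <= half b y <= 1.
Proof. by rewrite half_sign; case: ifP; rewrite ?lexx ?ler01. Qed.

Lemma L2r_half b p : L2r p -> L2r (fun y => half b y * p y).
Proof.
move=> lp; apply: (le_L2r _ lp); first by apply: measurable_funM; [exact: measurable_half|exact: lp.1].
by move=> y; have /andP[h0 h1] := half01 b y; rewrite normrM ger0_norm// ler_piMl.
Qed.

Definition wave b p q := fun y => ev (fun y => half b y * p y) y - od (fun y => half b y * q y) y.

Lemma L2r_wave b p q : L2r p -> L2r q -> L2r (wave b p q).
Proof. by move=> lp lq; apply: L2rB; [apply: L2r_ev; exact: L2r_half|apply: L2r_od; exact: L2r_half]. Qed.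

(** Integration against cas is the cosine transform on even functions and the sine transform on odd
    ones. *)
Lemma Rint_wave p q z : L1 p -> L1 q ->
  \int[mu]_y (p y * cos (z * y) - q y * sin (z * y)) = \int[mu]_y ((ev p y - od q y) * cas (z * y)).
Proof.
move=> lp lq.
have lpo := L1_leb_preserving leb_preserving_opp lp; have lqo := L1_leb_preserving leb_preserving_opp lq.
have eE : hart1 (ev p) = ev (hart1 p).
  have -> : ev p = (fun x => 2^-1 * (p x + p (- x))) by apply/funext => x; rewrite /ev mulrC.
  by rewrite (hart1Z _ (L1D lp lpo)) (hart1D lp lpo) (hart1_opp lp); apply/funext => x; rewrite /ev mulrC.
have oE : hart1 (od q) = od (hart1 q).
  have -> : od q = (fun x => 2^-1 * (q x - q (- x))) by apply/funext => x; rewrite /od mulrC.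
  by rewrite (hart1Z _ (L1B lq lqo)) (hart1B lq lqo) (hart1_opp lq); apply/funext => x; rewrite /od mulrC.
have lev : L1 (ev p).
  by have := L1Z 2^-1 (L1D lp lpo); congr L1; apply/funext => x; rewrite /ev mulrC.
have lod : L1 (od q).
  by have := L1Z 2^-1 (L1B lq lqo); congr L1; apply/funext => x; rewrite /od mulrC.
have -> : \int[mu]_y ((ev p y - od q y) * cas (z * y)) = hart1 (fun y => ev p y - od q y) z by [].
rewrite (hart1B lev lod) eE oE -(Rint_cos z lp) -(Rint_sin z lq) RintegralB//.
- exact: L1_cos.
- exact: L1_sin.
Qed.

Lemma ev_dexp p e y : ev (fun y => p y * dexp e y) y = ev p y * dexp e y.
Proof. by rewrite /ev /dexp normrN; ring. Qed.

Lemma od_dexp p e y : od (fun y => p y * dexp e y) y = od p y * dexp e y.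
Proof. by rewrite /od /dexp normrN; ring. Qed.

Lemma half_wave b p q (a e x : R) : L2r p -> L2r q -> 0 < e ->
  \int[mu]_y (half b y * p y * dexp e y * cos ((x + a) * y) - half b y * q y * dexp e y * sin ((x + a) * y)) =
  lowV (wave b p q) (fun=> a) (fun=> e) x.
Proof.
move=> lp lq e0; have ld := L2r_dexp e0.
have l1 := L2rM (L2r_half b lp) ld; have l2 := L2rM (L2r_half b lq) ld.
rewrite (Rint_wave (x + a) l1 l2); apply: eq_Rintegral => y _.
by rewrite ev_dexp od_dexp /wave -mulrBl -mulrA [dexp e y * _]mulrC.
Qed.

Lemma wave_split (p q : R) (a e x y : R) :
  cos (x * y + a * `|y|) * (dexp e y * p) - sin (x * y + a * `|y|) * (dexp e y * q) =
  (half true y * p * dexp e y * cos ((x + a) * y) - half true y * q * dexp e y * sin ((x + a) * y)) +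
  (half false y * p * dexp e y * cos ((x - a) * y) - half false y * q * dexp e y * sin ((x - a) * y)).
Proof.
rewrite !half_sign; have [h|h] := leP 0 y => /=.
  by rewrite ger0_norm// -mulrDl; ring.
by rewrite ltr0_norm// mulrN -mulNr -mulrDl; ring.
Qed.

Lemma Rint_wave_split p q (a e x : R) : L2r p -> L2r q -> 0 < e ->
  \int[mu]_y (cos (x * y + a * `|y|) * (dexp e y * p y) - sin (x * y + a * `|y|) * (dexp e y * q y)) =
  lowV (wave true p q) (fun=> a) (fun=> e) x + lowV (wave false p q) (fun=> - a) (fun=> e) x.
Proof.
move=> lp lq e0; have ld := L2r_dexp e0.
rewrite -!half_wave// -RintegralD//; last 2 first.
- have l1 := L2rM (L2r_half true lp) ld; have l2 := L2rM (L2r_half true lq) ld.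
  exact: (L1B (L1_cos (x + a) l1) (L1_sin (x + a) l2)).
- have l1 := L2rM (L2r_half false lp) ld; have l2 := L2rM (L2r_half false lq) ld.
  exact: (L1B (L1_cos (x - a) l1) (L1_sin (x - a) l2)).
by apply: eq_Rintegral => y _; exact: wave_split.
Qed.

Lemma n2w_ge0 s p : (0 <= n2w s p)%E.
Proof. by apply: int_ge0 => x; rewrite mulr_ge0 ?sqr_ge0 ?wt_ge0. Qed.

Lemma mf_n2w s p : mf p -> mf (fun x => p x ^+ 2 * wt s x).
Proof. by move=> mp; apply: measurable_funM; [exact: measurable_funX|exact: measurable_wt]. Qed.

Lemma n2w_opp s p : mf p -> n2w s (fun x => p (- x)) = n2w s p.
Proof.
move=> mp; rewrite /n2w -(int_leb_preserving leb_preserving_opp (mf_n2w s mp)).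
  by apply: eq_integral => x _; rewrite /wt normrN.
by move=> x; rewrite mulr_ge0 ?sqr_ge0 ?wt_ge0.
Qed.

(** Cauchy-Schwarz for four terms with coefficients 1/2 or -1/2, together with the invariance of the
    weight under reflection. *)
Lemma n2w_wave s b p q : L2r p -> L2r q -> (n2w s (wave b p q) <= 2%:E * (n2w s p + n2w s q))%E.
Proof.
move=> lp lq; have mh := measurable_half b; have mp := lp.1; have mq := lq.1.
have mpo : mf (fun x : R => p (- x)) := measurableT_comp mp (leb_preserving_opp).1.
have mqo : mf (fun x : R => q (- x)) := measurableT_comp mq (leb_preserving_opp).1.
have p0 (u : R -> R) x : 0 <= u x ^+ 2 * wt s x by rewrite mulr_ge0 ?sqr_ge0 ?wt_ge0.
apply: (@le_trans _ _ (\int[mu]_x ((p x ^+ 2 * wt s x + p (- x) ^+ 2 * wt s x) + (q x ^+ 2 * wt s x + q (- x) ^+ 2 * wt s x))%:E)%E).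
  apply: le_int.
  - exact: mf_n2w (L2r_wave b lp lq).1.
  - by apply: measurable_funD; apply: measurable_funD; [exact: (mf_n2w s mp)|exact: (mf_n2w s mpo)|exact: (mf_n2w s mq)|exact: (mf_n2w s mqo)].
  - by move=> x; exact: p0.
  - move=> x; rewrite -!mulrDl ler_wpM2r ?wt_ge0// /wave /ev /od.
    have /andP[a0 a1] := half01 b x; have /andP[b0 b1] := half01 b (- x).
    have sq (h u : R) : 0 <= h -> h <= 1 -> (h * u) ^+ 2 <= u ^+ 2.
      by move=> h0 h1; rewrite exprMn ler_piMl ?sqr_ge0// expr_le1.
    have := sq _ (p x) a0 a1; have := sq _ (p (- x)) b0 b1; have := sq _ (q x) a0 a1; have := sq _ (q (- x)) b0 b1.
    move: (half b x * p x) (half b (- x) * p (- x)) (half b x * q x) (half b (- x) * q (- x)) => u1 u2 u3 u4 h1 h2 h3 h4.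
    apply: (@le_trans _ _ ((u1 ^+ 2 + u2 ^+ 2) + (u3 ^+ 2 + u4 ^+ 2))); last by apply: lerD; apply: lerD.
    have := sqr_ge0 (u1 - u2); have := sqr_ge0 (u3 + u4); have := sqr_ge0 (u1 + u2 + u3 - u4); nra.
have i1 := mf_n2w s mp; have i2 := mf_n2w s mpo; have i3 := mf_n2w s mq; have i4 := mf_n2w s mqo.
rewrite intD; [|exact: measurable_funD|exact: measurable_funD|
  by move=> x; exact: addr_ge0 (p0 p x) (p0 (fun x => p (- x)) x)|by move=> x; exact: addr_ge0 (p0 q x) (p0 (fun x => q (- x)) x)].
rewrite (intD i1 i2 (p0 p) (p0 (fun x => p (- x)))) (intD i3 i4 (p0 q) (p0 (fun x => q (- x)))).
rewrite -!/(n2w s _) (n2w_opp s mp) (n2w_opp s mq).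
have -> : 2 = 1 + 1 :> R by ring.
have a := n2w_ge0 s p; have b' := n2w_ge0 s q.
rewrite EFinD ge0_muleDl ?lee_fin// mul1e.
by rewrite addeACA.
Qed.

Lemma W_n2w s phi : mf (re phi) -> mf (im phi) -> W s phi = (n2w s (re phi) + n2w s (im phi))%E.
Proof.
move=> m1 m2; rewrite /W /n2w -intD; [|exact: mf_n2w|exact: mf_n2w| |]; first last.
- by move=> x; rewrite mulr_ge0 ?sqr_ge0 ?wt_ge0.
- by move=> x; rewrite mulr_ge0 ?sqr_ge0 ?wt_ge0.
by apply: eq_integral => x _; rewrite normc_sq mulrC mulrDl.
Qed.

Definition damp (e : R) phi : R -> R[i] := fun y => (dexp e y)%:C%C * phi y.

Lemma re_damp e phi y : re (damp e phi) y = dexp e y * re phi y.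
Proof. exact: reZ. Qed.

Lemma im_damp e phi y : im (damp e phi) y = dexp e y * im phi y.
Proof. exact: imZ. Qed.

Lemma L2r_damp (e : R) p : 0 < e -> L2r p -> L2r (fun y => dexp e y * p y).
Proof.
move=> e0 lp; apply: (le_L2r _ lp).
  by apply: measurable_funM; [exact: measurable_dexp|exact: lp.1].
by move=> y; rewrite normrM (ger0_norm (dexp_ge0 _ _)) ler_piMl// dexp_le1// ltW.
Qed.

Lemma L2_damp e phi : 0 < e -> L2 phi -> L2 (damp e phi).
Proof.
move=> e0 l; apply/L2P; split.
  have -> : re (damp e phi) = (fun y => dexp e y * re phi y) by apply/funext => y; exact: re_damp.
  exact: L2r_damp (L2_re l).
have -> : im (damp e phi) = (fun y => dexp e y * im phi y) by apply/funext => y; exact: im_damp.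
exact: L2r_damp (L2_im l).
Qed.

Lemma L1_damp e phi : 0 < e -> L2 phi -> L1 (re (damp e phi)) /\ L1 (im (damp e phi)).
Proof.
move=> e0 l; have ld := L2r_dexp e0.
have -> : re (damp e phi) = (fun y => dexp e y * re phi y) by apply/funext => y; exact: re_damp.
have -> : im (damp e phi) = (fun y => dexp e y * im phi y) by apply/funext => y; exact: im_damp.
by split; [exact: (L2rM ld (L2_re l))|exact: (L2rM ld (L2_im l))].
Qed.

(** Real and imaginary part, each split at frequency 0, give four integrals of type [lowV]; the
    imaginary part is the real part for the pair (im, - re). The factor (2 pi)^-2 <= 1/2 absorbs the
    2 in (u + v)^2 <= 2 u^2 + 2 v^2. *)
Lemma U_damp_sq (a e x : R) phi : L2 phi -> 0 < e ->
  Normc.normc (U a (damp e phi) x) ^+ 2 <=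
  (lowV (wave true (re phi) (im phi)) (fun=> a) (fun=> e) x ^+ 2 +
   lowV (wave false (re phi) (im phi)) (fun=> - a) (fun=> e) x ^+ 2) +
  (lowV (wave true (im phi) (fun y => - re phi y)) (fun=> a) (fun=> e) x ^+ 2 +
   lowV (wave false (im phi) (fun y => - re phi y)) (fun=> - a) (fun=> e) x ^+ 2).
Proof.
move=> l e0; have lr := L2_re l; have li := L2_im l.
have [l1 l2] := L1_damp e0 l.
have lrN : L2r (fun y => - re phi y).
  by have := L2rZ (-1) lr; congr L2r; apply/funext => y; rewrite mulN1r.
have lcs (u v : R -> R) : L1 u -> L1 v ->
    L1 (fun y => cos (x * y + a * `|y|) * u y - sin (x * y + a * `|y|) * v y).
  move=> lu lv; have mn : mf (fun y : R => x * y + a * `|y|) by mfun.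
  apply: L1B.
    have := L1_bdd lu (measurableT_comp (continuous_measurable_fun (@continuous_cos R)) mn) (fun y => cos_max _).
    by congr L1; apply/funext => y; exact: mulrC.
  have := L1_bdd lv (measurableT_comp (continuous_measurable_fun (@continuous_sin R)) mn) (fun y => sin_max _).
  by congr L1; apply/funext => y; exact: mulrC.
have ld := L2r_dexp e0.
have reE : complex.Re (U a (damp e phi) x) = (2 * pi)^-1 *
  (lowV (wave true (re phi) (im phi)) (fun=> a) (fun=> e) x + lowV (wave false (re phi) (im phi)) (fun=> - a) (fun=> e) x).
  rewrite U_re -(Rint_wave_split a x lr li e0) -RintZ; last exact: (lcs _ _ (L2rM ld lr) (L2rM ld li)).
  by apply: eq_Rintegral => y _; rewrite re_damp im_damp.
have imE : complex.Im (U a (damp e phi) x) = (2 * pi)^-1 *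
  (lowV (wave true (im phi) (fun y => - re phi y)) (fun=> a) (fun=> e) x + lowV (wave false (im phi) (fun y => - re phi y)) (fun=> - a) (fun=> e) x).
  rewrite U_im -(Rint_wave_split a x li lrN e0) -RintZ; last exact: (lcs _ _ (L2rM ld li) (L2rM ld lrN)).
  by apply: eq_Rintegral => y _; rewrite re_damp im_damp !mulrN opprK.
rewrite normc_sq reE imE; set u1 := lowV _ _ _ _; set u2 := lowV _ _ _ _; set u3 := lowV _ _ _ _; set u4 := lowV _ _ _ _.
have c1 : 0 <= (2 * pi)^-1 :> R by rewrite invr_ge0 mulr_ge0// pi_ge0.
have c2 : (2 * pi)^-1 <= 2^-1 :> R.
  by rewrite lef_pV2 ?posrE ?mulr_gt0 ?pi_gt0// ler_peMr//; have := pi_ge2 R; lra.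
move: (2 * pi)^-1 c1 c2 => c c1 c2.
have cc : c ^+ 2 <= 2^-1 by nra.
have sq (u v : R) : (c * (u + v)) ^+ 2 <= u ^+ 2 + v ^+ 2.
  rewrite exprMn; apply: (@le_trans _ _ (2^-1 * (u + v) ^+ 2)); first by rewrite ler_wpM2r ?sqr_ge0.
  by have := sqr_ge0 (u - v); lra.
by apply: lerD.
Qed.

End strong_maximal.

(** * From decay of the times to the strong maximal inequality *)

Section decay_to_strong.
Context {R : realType}.
Notation mu := (@lebesgue_measure R).
Notation mf := (measurable_fun setT).
Implicit Types (s D : R) (t : nat -> R) (f phi : R -> R[i]).

Definition rest s t f n : R -> R[i] := fun x => S1 f (t n) x - U (t n) (damp (scale s n) (fourier f)) x.

Lemma rest_mult (a e xi : R) f :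
  Normc.normc (S1mult f a xi - mult1 a (damp e (fourier f)) xi) ^+ 2 =
  ((2 * pi)^-1) ^+ 2 * ((1 - dexp e xi) ^+ 2 * Normc.normc (fourier f xi) ^+ 2).
Proof.
have -> : S1mult f a xi - mult1 a (damp e (fourier f)) xi =
    ((2 * pi)^-1)%:C%C * (cexpi (a * `|xi|) * ((1 - dexp e xi)%:C%C * fourier f xi)).
  by rewrite /S1mult /mult1 /damp; apply/complex_eqP; rewrite !(reB, imB, reZ, imZ, reM, imM); split; ring.
have sqZ (c : R) (z : R[i]) : Normc.normc (c%:C%C * z) ^+ 2 = c ^+ 2 * Normc.normc z ^+ 2.
  by rewrite !normc_sq reZ imZ; ring.
by rewrite sqZ normc_cexp sqZ.
Qed.

Lemma mf_rest s t f n : mf (re (rest s t f n)) /\ mf (im (rest s t f n)).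
Proof.
have e0 := scale_gt0 s n; have l := L2_fourier f.
have [l1 l2] := L1_damp e0 l; have [lu _] := ft_U (t n) l1 l2 (L2_damp e0 l).
have [ls _] := S1_spec f (t n).
have lr := L2B ls lu; exact: (conj (L2_re lr).1 (L2_im lr).1).
Qed.

(** The multiplier of the remainder is 1 - exp(-e_n |xi|) up to a unimodular factor and 1 / (2 pi);
    the constants combine to 8 pi (2 pi)^-2 = 2 / pi <= 1. *)
Lemma L2norm_rest s t f n :
  (L2norm_sq (rest s t f n) <= \int[mu]_xi ((1 - dexp (scale s n) xi) ^+ 2 * Normc.normc (fourier f xi) ^+ 2)%:E)%E.
Proof.
have e0 := scale_gt0 s n; have l := L2_fourier f; have ld := L2_damp e0 l.
have [l1 l2] := L1_damp e0 l.
have ls := L2_S1mult f (t n); have lm := L2_mult1 (t n) ld.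
have h := ftB ls lm (S1_spec f (t n)) (ft_U (t n) l1 l2 ld).
apply: (le_trans (ft_bound (L2B ls lm) h)).
have mn := measurable_normc_sq (L2_re l).1 (L2_im l).1.
have m1 : mf (fun xi => (1 - dexp (scale s n) xi) ^+ 2 * Normc.normc (fourier f xi) ^+ 2).
  apply: measurable_funM; last exact: mn.
  by apply: measurable_funX; apply: measurable_funB; [exact: measurable_cst|exact: measurable_dexp].
have p1 xi : 0 <= (1 - dexp (scale s n) xi) ^+ 2 * Normc.normc (fourier f xi) ^+ 2.
  by apply: mulr_ge0; exact: sqr_ge0.
have -> : L2norm_sq (fun x => S1mult f (t n) x - mult1 (t n) (damp (scale s n) (fourier f)) x) =
  ((((2 * pi)^-1) ^+ 2)%:E * \int[mu]_xi ((1 - dexp (scale s n) xi) ^+ 2 * Normc.normc (fourier f xi) ^+ 2)%:E)%E.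
  rewrite -intZ//; last exact: sqr_ge0.
  by apply: eq_integral => xi _; rewrite rest_mult.
have i0 : (0 <= \int[mu]_xi ((1 - dexp (scale s n) xi) ^+ 2 * Normc.normc (fourier f xi) ^+ 2)%:E)%E by exact: int_ge0.
rewrite muleA -EFinM -[leRHS]mul1e; apply: lee_wpmul2r => //; rewrite lee_fin.
have key (p : R) : 2 <= p -> 8 * p * ((2 * p)^-1) ^+ 2 <= 1.
  move=> p2; have p0 : 0 < p by apply: lt_le_trans p2.
  have -> : 8 * p * ((2 * p)^-1) ^+ 2 = 2 / p by field; rewrite gt_eqF.
  by rewrite ler_pdivrMr// mul1r.
exact: key (pi_ge2 R).
Qed.

Lemma ereal_sup_sq (u : nat -> R) (G : \bar R) : (forall n, 0 <= u n) -> (forall n, (u n ^+ 2)%:E <= G)%E ->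
  (ereal_sup (range (fun n => (u n)%:E)) ^+ 2 <= G)%E.
Proof.
move=> u0 h.
have S0 : (0 <= ereal_sup (range (fun n => (u n)%:E)))%E.
  by apply: (@le_trans _ _ (u 0%N)%:E); [rewrite lee_fin|apply: ereal_sup_ubound; exists 0%N].
case: G h => [g| |] h; last 2 first.
- exact: leey.
- by have := h 0%N; rewrite leeNy_eq.
have g0 : 0 <= g by have := h 0%N; rewrite lee_fin; apply: le_trans; exact: sqr_ge0.
have : (ereal_sup (range (fun n => (u n)%:E)) <= (Num.sqrt g)%:E)%E.
  apply: ge_ereal_sup => _ [n _ <-]; rewrite lee_fin -(@ger0_norm _ (u n))// -sqrtr_sqr ler_sqrt//.
  by have := h n; rewrite lee_fin.
case: (ereal_sup _) S0 => [r| |]//; rewrite !lee_fin => r0 hr.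
rewrite -[leRHS](sqr_sqrtr g0) expr2.
by apply: ler_pM.
Qed.

(** The supremum of the remainders is dominated by their square sum. Integrated, this becomes a sum
    of multipliers, bounded by [high_sum] with 4 times the Sobolev weight. *)
Lemma sum_rest s t f : 0 < s -> s < 1 / 2 ->
  (\int[mu]_x (\sum_(0 <= n <oo) (Normc.normc (rest s t f n x) ^+ 2)%:E) <= 4%:E * W s (fourier f))%E.
Proof.
move=> s0 s1; have l := L2_fourier f.
have mn := measurable_normc_sq (L2_re l).1 (L2_im l).1.
have mr n : mf (fun x => Normc.normc (rest s t f n x) ^+ 2).
  by have [m1 m2] := mf_rest s t f n; exact: measurable_normc_sq.
have md n : mf (fun xi => (1 - dexp (scale s n) xi) ^+ 2 * Normc.normc (fourier f xi) ^+ 2).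
  apply: measurable_funM; last exact: mn.
  by apply: measurable_funX; apply: measurable_funB; [exact: measurable_cst|exact: measurable_dexp].
have p1 n xi : 0 <= (1 - dexp (scale s n) xi) ^+ 2 * Normc.normc (fourier f xi) ^+ 2.
  by apply: mulr_ge0; exact: sqr_ge0.
rewrite integral_nneseries; [|exact: measurableT|by move=> n; exact: emf|by move=> n x _; rewrite lee_fin sqr_ge0].
apply: lime_le.
  by apply: is_cvg_nneseries => n _ _; apply: int_ge0 => x; exact: sqr_ge0.
apply: nearW => m.
apply: (@le_trans _ _ (\sum_(0 <= n < m) \int[mu]_xi ((1 - dexp (scale s n) xi) ^+ 2 * Normc.normc (fourier f xi) ^+ 2)%:E)%E).
  by apply: lee_sum => n _; exact: L2norm_rest.
rewrite -(int_sum _ md p1).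
have mw : mf (fun xi => wt s xi * Normc.normc (fourier f xi) ^+ 2).
  by apply: measurable_funM; [exact: measurable_wt|exact: mn].
have pw xi : 0 <= wt s xi * Normc.normc (fourier f xi) ^+ 2 by apply: mulr_ge0; [exact: wt_ge0|exact: sqr_ge0].
rewrite /W -intZ//; apply: le_int.
- exact: measurable_sum.
- by apply: measurable_funM; [exact: measurable_cst|exact: mw].
- by move=> xi; exact: sumr_ge0.
- move=> xi; rewrite -big_distrl /= mulrA; apply: ler_wpM2r; [exact: sqr_ge0|exact: high_sum].
Qed.

(** With A the constant of [low_maximal], 16 A is 2 from (u + r)^2 <= 2 u^2 + 2 r^2, times four wave
    pieces, times 2 for their weighted norms in [n2w_wave]. The 8 is 2 times the 4 of [sum_rest]. *)
Lemma maximal_le s D t f : 0 < s -> s < 1 / 2 -> 0 < D -> (forall n, 0 <= t n) ->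
  (forall n, t n <= D * n.+1%:R `^ (- kappa s)) ->
  (\int[mu]_x (maximalS1 t f x ^+ 2) <= (16 * (expR 2 * energy_cst s D) + 8)%:E * W s (fourier f))%E.
Proof.
move=> s0 s1 D0 tp ht; have l := L2_fourier f; have lr := L2_re l; have li := L2_im l.
have e0 := scale_gt0 s.
set phi := fourier f in l lr li *.
have lrN : L2r (fun y => - re phi y).
  by have := L2rZ (-1) lr; congr L2r; apply/funext => y; rewrite mulN1r.
have ht1 n : `|t n| <= D * scale s n `^ (1 - 2 * s) by rewrite ger0_norm// scale_kappa.
have ht2 n : `|- t n| <= D * scale s n `^ (1 - 2 * s) by rewrite normrN.
set A := expR 2 * energy_cst s D.
have A0 : 0 <= A by rewrite mulr_ge0 ?expR_ge0// ltW// energy_cst_gt0.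
pose tm n := - t n.
pose h1 := wave true (re phi) (im phi); pose h2 := wave false (re phi) (im phi).
pose h3 := wave true (im phi) (fun y => - re phi y); pose h4 := wave false (im phi) (fun y => - re phi y).
have l1 : L2r h1 by exact: L2r_wave. have l2 : L2r h2 by exact: L2r_wave.
have l3 : L2r h3 by exact: L2r_wave. have l4 : L2r h4 by exact: L2r_wave.
have WE := W_n2w s lr.1 li.1; set w := W s phi in WE *.
have eN : n2w s (fun y => - re phi y) = n2w s (re phi) by apply: eq_integral => y _; rewrite sqrrN.
have w1 : (n2w s h1 <= 2%:E * w)%E by rewrite WE; exact: n2w_wave.
have w2 : (n2w s h2 <= 2%:E * w)%E by rewrite WE; exact: n2w_wave.
have w3 : (n2w s h3 <= 2%:E * w)%E by rewrite WE addeC -eN; exact: n2w_wave.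
have w4 : (n2w s h4 <= 2%:E * w)%E by rewrite WE addeC -eN; exact: n2w_wave.
have wb (h : R -> R) ta : L2r h -> (forall n, `|ta n| <= D * scale s n `^ (1 - 2 * s)) -> (n2w s h <= 2%:E * w)%E ->
    (\int[mu]_x lowM h ta (scale s) x <= (2 * A)%:E * w)%E.
  move=> lh hta hw; apply: le_trans (low_maximal s0 s1 D0 lh e0 hta) _.
  have -> : ((2 * A)%:E * w = A%:E * (2%:E * w))%E by rewrite muleA -EFinM mulrC.
  by apply: lee_wpmul2l; [rewrite lee_fin|].
pose M1 := lowM h1 t (scale s); pose M2 := lowM h2 tm (scale s).
pose M3 := lowM h3 t (scale s); pose M4 := lowM h4 tm (scale s).
have m1 : mf M1 := measurable_lowM t (scale s) l1.1. have m2 : mf M2 := measurable_lowM tm (scale s) l2.1.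
have m3 : mf M3 := measurable_lowM t (scale s) l3.1. have m4 : mf M4 := measurable_lowM tm (scale s) l4.1.
have M10 x : (0 <= M1 x)%E := lowM_ge0 _ _ _ _. have M20 x : (0 <= M2 x)%E := lowM_ge0 _ _ _ _.
have M30 x : (0 <= M3 x)%E := lowM_ge0 _ _ _ _. have M40 x : (0 <= M4 x)%E := lowM_ge0 _ _ _ _.
pose Q x := (\sum_(0 <= n <oo) (Normc.normc (rest s t f n x) ^+ 2)%:E)%E.
have Q0 x : (0 <= Q x)%E by apply: nneseries_ge0 => n _ _; rewrite lee_fin sqr_ge0.
have mQ : mf Q.
  apply: (@ge0_emeasurable_sum _ _ _ setT (fun n x => (Normc.normc (rest s t f n x) ^+ 2)%:E) xpredT).
  - by move=> n x _ _; rewrite lee_fin sqr_ge0.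
  - by move=> n _; apply: emf; have [r1 r2] := mf_rest s t f n; exact: measurable_normc_sq.
have w0 : (0 <= w)%E by exact: W_ge0.
pose S x := ((M1 x + M2 x) + (M3 x + M4 x))%E.
have S0 x : (0 <= S x)%E by rewrite !adde_ge0.
have mS : mf S.
  by apply: emeasurable_funD; apply: emeasurable_funD; [exact: m1|exact: m2|exact: m3|exact: m4].
apply: (@le_trans _ _ (\int[mu]_x (2%:E * S x + 2%:E * Q x))%E).
  apply: ge0_le_integral; first exact: measurableT.
  - by move=> x _; apply: expe_ge0; exact: maximalS1_ge0.
  - have := measurable_maximalS1 t f => mm.
    have -> : (fun x => maximalS1 t f x ^+ 2)%E = (fun x => maximalS1 t f x * maximalS1 t f x)%E by apply/funext => x; rewrite expe2.
    exact: emeasurable_funM.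
  - by apply: emeasurable_funD; apply: measurable_funeM.
  - move=> x _; apply: ereal_sup_sq => n; first exact: normc_ge0.
    set u := U (t n) (damp (scale s n) phi) x; set r := rest s t f n x.
    have Ee : S1 f (t n) x = u + r by rewrite /r /rest /u addrC subrK.
    have hsq : Normc.normc (S1 f (t n) x) ^+ 2 <= 2 * Normc.normc u ^+ 2 + 2 * Normc.normc r ^+ 2.
      rewrite Ee; have := normc_tri u r; have := normc_ge0 (u + r); have := normc_ge0 u; have := normc_ge0 r.
      move: (Normc.normc (u + r)) (Normc.normc u) (Normc.normc r) => a b c c0 b0 a0 abc.
      have h : a ^+ 2 <= (b + c) ^+ 2 by rewrite lerXn2r ?nnegrE ?addr_ge0.
      by apply: (le_trans h); have := sqr_ge0 (b - c); lra.
    apply: (@le_trans _ _ (2 * Normc.normc u ^+ 2 + 2 * Normc.normc r ^+ 2)%:E); first by rewrite lee_fin.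
    rewrite EFinD; apply: leeD; rewrite EFinM; apply: lee_wpmul2l => //.
      have hU := U_damp_sq (t n) x l (e0 n); rewrite -lee_fin in hU; apply: (le_trans hU).
      by rewrite !EFinD; apply: leeD; apply: leeD; exact: lowM_ge.
    apply: (@le_trans _ _ (\sum_(0 <= i < n.+1) (Normc.normc (rest s t f i x) ^+ 2)%:E)%E).
      by rewrite big_nat_recr//= leeDr// sume_ge0// => i _; rewrite lee_fin sqr_ge0.
    by apply: nneseries_lim_ge => i _ _; rewrite lee_fin sqr_ge0.
rewrite ge0_integralD; [|exact: measurableT|by move=> x _; rewrite mule_ge0|by apply: measurable_funeM|by move=> x _; rewrite mule_ge0|by apply: measurable_funeM].
rewrite ge0_integralZl; [|exact: measurableT|exact: mS|by move=> x _|by []].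
rewrite ge0_integralZl; [|exact: measurableT|exact: mQ|by move=> x _|by []].
have iQ := sum_rest t f s0 s1.
have iS : (\int[mu]_x S x <= (8 * A)%:E * w)%E.
  have mm12 : mf (fun x => M1 x + M2 x)%E by exact: emeasurable_funD.
  have mm34 : mf (fun x => M3 x + M4 x)%E by exact: emeasurable_funD.
  rewrite ge0_integralD; [|exact: measurableT|by move=> x _; rewrite adde_ge0|exact: mm12|by move=> x _; rewrite adde_ge0|exact: mm34].
  rewrite ge0_integralD; [|exact: measurableT|by move=> x _|exact: m1|by move=> x _|exact: m2].
  rewrite ge0_integralD; [|exact: measurableT|by move=> x _|exact: m3|by move=> x _|exact: m4].
  have b1 := wb h1 t l1 ht1 w1; have b2 := wb h2 tm l2 ht2 w2.
  have b3 := wb h3 t l3 ht1 w3; have b4 := wb h4 tm l4 ht2 w4.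
  apply: (le_trans (leeD (leeD b1 b2) (leeD b3 b4))).
  have A2 : (0 <= (2 * A)%:E)%E by rewrite lee_fin mulr_ge0.
  rewrite -!ge0_muleDl ?adde_ge0// -!EFinD.
  by have -> : 2 * A + 2 * A + (2 * A + 2 * A) = 8 * A by ring.
apply: (@le_trans _ _ (2%:E * ((8 * A)%:E * w) + 2%:E * (4%:E * w))%E).
  by apply: leeD; apply: lee_wpmul2l.
have -> : (2%:E * ((8 * A)%:E * w) = (16 * A)%:E * w)%E by rewrite muleA -EFinM; congr (_%:E * _)%E; ring.
have -> : (2%:E * (4%:E * w) = 8%:E * w)%E by rewrite muleA -EFinM; congr (_%:E * _)%E; ring.
have -> : (16 * A + 8)%:E = ((16 * A)%:E + 8%:E)%E by [].
by rewrite [leRHS]ge0_muleDl; [exact: lexx|rewrite lee_fin mulr_ge0|rewrite lee_fin].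
Qed.

Lemma decay_strong s D t : 0 < s -> s < 1 / 2 -> 0 < D -> (forall n, 0 <= t n) ->
  (forall n, t n <= D * n.+1%:R `^ (- kappa s)) ->
  exists C1 : R, forall f : R -> R[i], Hs s f ->
    ('N[mu]_2[maximalS1 t f] <= C1%:E * Hnorm s f)%E.
Proof.
move=> s0 s1 D0 tp ht; set C := 16 * (expR 2 * energy_cst s D) + 8.
have C0 : 0 <= C by rewrite addr_ge0// !mulr_ge0 ?expR_ge0// ltW// energy_cst_gt0.
exists (Num.sqrt C) => f [lf hf].
have := maximal_le f s0 s1 D0 tp ht; rewrite -/C -Lnorm2_sq; last exact: maximalS1_ge0.
rewrite -Hnorm_sq; have := Hnorm_ge0 s f; move: hf.
have : (0 <= 'N[mu]_2[maximalS1 t f])%E by exact: Lnorm_ge0.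
case: (Hnorm s f) => [h| |]// + _; case: ('N[mu]_2[maximalS1 t f])%E => [m| |]//.
  rewrite !expe2 -!EFinM !lee_fin -!expr2 => m0 h0 hm.
  rewrite -[leLHS](@ger0_norm _ m)// -sqrtr_sqr -[leRHS](@ger0_norm _ (Num.sqrt C * h)) ?mulr_ge0 ?sqrtr_ge0//.
  by rewrite -[leRHS]sqrtr_sqr ler_wsqrtr// exprMn sqr_sqrtr.
Qed.

End decay_to_strong.

Theorem theorem1p3 (R : realType) (s : R) (t : nat -> R)
  (hs0 : 0 < s) (hs1 : s < 1 / 2)
  (ht : nonincreasing_seq t)
  (ht0 : t n @[n --> \oo] --> (0 : R))
  (hdt : nonincreasing_seq (fun n => t n - t n.+1)) :
  [<-> weak_ell (2 * s / (1 - 2 * s)) t;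
       exists C1 : R, forall f : R -> R[i], Hs s f ->
         ('N[lebesgue_measure]_2[maximalS1 t f] <= C1%:E * Hnorm s f)%E;
       exists C2 : R, forall f : R -> R[i], Hs s f ->
         forall B : set R, measurable B ->
         (forall x y, B x -> B y -> `|x - y| <= 1) ->
         forall alpha : R, 0 < alpha ->
         (lebesgue_measure [set x | B x /\ (alpha%:E < maximalS1 t f x)%E]
            <= (C2 * alpha ^- 2)%:E * Hnorm s f ^+ 2)%E;
       forall f : R -> R[i], Hs s f ->
         {ae lebesgue_measure, forall x : R,
            Normc.normc (S1 f (t n) x - f x) @[n --> \oo] --> (0 : R)}].
Proof.
have hs2 : s < 1 / 2 by [].
have tp := nonincreasing_cvg0_ge0 ht ht0.
tfae.
- move=> /(weak_ell_decay hs0 hs1 ht tp)[D [D0 hD]].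
  exact: decay_strong hs0 hs1 D0 tp hD.
- by move=> [C1]; exact: strong_weak.
- by move=> [C2 h]; exact: weak_conv (ltW hs0) ht0 h.
- move=> h; have [K hK] := gap_growth hs0 hs1 ht ht0 hdt h.
  have [D [D0 hD]] := gap_growth_decay hs0 hs1 ht ht0 hdt hK.
  exact: decay_weak_ell hs0 hs1 ht tp D0 hD.
Qed.
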